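(* Let $S$ be a connected graph of order at least $3$. Then the following statement holds: ''every $2$-connected claw-o-heavy graph $G$ of order $n\geq 10$ that is $S$-c-heavy is hamiltonian'' if and only if $S\in\{P_4,P_5,P_6,Z_1,Z_2,Z_3,B,N,W\}$.
   Context: All graphs are finite, simple and undirected. For a graph $G$ on $n=|V(G)|$ vertices, a vertex $v$ is heavy if $d_G(v)\geq n/2$; a pair $\{u,v\}$ of vertices is a heavy pair if $uv\notin E(G)$ and $d_G(u)+d_G(v)\geq n$. The claw is $K_{1,3}$. $G$ is claw-o-heavy if every induced subgraph of $G$ isomorphic to $K_{1,3}$ contains a heavy pair of $G$. For a graph $S$, $G$ is $S$-c-heavy if for every induced subgraph $G'$ of $G$ isomorphic to $S$ and every maximal clique $C$ of $G'$, every component of $G'-C$ with at least two vertices contains a vertex that is heavy in $G$. $P_i$ is the path on $i$ vertices. $Z_i$ ($i\geq1$) is obtained by identifying a vertex of a triangle $C_3$ with an end-vertex of a path $P_{i+1}$. $B_{i,j}$ is obtained by identifying two vertices of a triangle with the origins of a $P_{i+1}$ and a $P_{j+1}$ respectively; $B=B_{1,1}$ (bull), $W=B_{1,2}$ (wounded). $N$ (net) is obtained from a triangle by attaching one pendant edge to each of its three vertices. *)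

(* Defs.v *)
From mathcomp Require Import all_boot.

Set Implicit Arguments.
Unset Strict Implicit.
Unset Printing Implicit Defensive.

Record sgraph := SGraph {
  vertex :> finType;
  edge : rel vertex;
  edge_sym : symmetric edge;
  edge_irrefl : irreflexive edge }.

Arguments edge {s} x y.

Definition isomorphic (G H : sgraph) : Prop :=
  exists f : G -> H, bijective f /\ forall x y, edge (f x) (f y) = edge x y.

Section Induced.
Variables (G : sgraph) (A : {set G}).

Definition induced_edge : rel {x : G | x \in A} := relpre val (@edge G).

Lemma induced_sym : symmetric induced_edge.
Proof. by move=> x y; apply: edge_sym. Qed.

Lemma induced_irrefl : irreflexive induced_edge.
Proof. by move=> x; apply: edge_irrefl. Qed.

Definition induced : sgraph := SGraph induced_sym induced_irrefl.

End Induced.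

Section GraphNotions.
Variable G : sgraph.
Implicit Types (A C D X : {set G}) (u v : G).

Definition deg v : nat := #|[set u | edge v u]|.

(* d(v) >= n/2, with n/2 not rounded down *)
Definition heavy v : bool := #|G| <= (deg v).*2.

Definition heavy_pair u v : bool :=
  [&& u != v, ~~ edge u v & #|G| <= deg u + deg v].

Definition clique C : bool :=
  [forall u in C, forall v in C, (u != v) ==> edge u v].

(* Maximality is for inclusion, among the cliques of G[A] only. *)
Definition maximal_clique_of A C : bool :=
  maxset (fun D => (D \subset A) && clique D) C.

(* For u, v in A: u and v are joined by a path of G[A]. *)
Definition connect_in A : rel G := connect [rel u v in A | edge u v].

Definition connected A : Prop := {in A &, forall u v, connect_in A u v}.

(* The components of G[A], as vertex sets. *)
Definition components A : {set {set G}} :=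
  equivalence_partition (connect_in A) A.

Definition kconnected (k : nat) : Prop :=
  k < #|G| /\ forall X, #|X| < k -> connected (~: X).

Definition hamiltonian : Prop :=
  exists s : seq G, [/\ 2 < size s, ucycle edge s & s =i [set: G]].

End GraphNotions.

Definition complete_bipartite_edge (m n : nat) : rel ('I_m + 'I_n) :=
  fun x y => match x, y with
             | inl _, inr _ | inr _, inl _ => true
             | _, _ => false
             end.

Lemma complete_bipartite_sym m n : symmetric (@complete_bipartite_edge m n).
Proof. by case=> x [] y. Qed.

Lemma complete_bipartite_irrefl m n :
  irreflexive (@complete_bipartite_edge m n).
Proof. by case. Qed.

Definition complete_bipartite (m n : nat) : sgraph :=
  SGraph (@complete_bipartite_sym m n) (@complete_bipartite_irrefl m n).

Definition claw : sgraph := complete_bipartite 1 3.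

Definition consecutive : rel nat := fun a b => (a.+1 == b) || (b.+1 == a).

Lemma consecutive_sym : symmetric consecutive.
Proof. by move=> a b; rewrite /consecutive orbC. Qed.

Lemma consecutive_irrefl : irreflexive consecutive.
Proof. by move=> a; rewrite /consecutive orbb gtn_eqF. Qed.

Definition path_edge (i : nat) : rel 'I_i := fun a b => consecutive a b.

Lemma path_sym i : symmetric (@path_edge i).
Proof. by move=> a b; apply: consecutive_sym. Qed.

Lemma path_irrefl i : irreflexive (@path_edge i).
Proof. by move=> a; apply: consecutive_irrefl. Qed.

Definition path_graph (i : nat) : sgraph :=
  SGraph (@path_sym i) (@path_irrefl i).

Section Net.
Variables i j k : nat.

(* A triangle with the origins of a P_{i+1}, a P_{j+1} and a P_{k+1}
   identified with its three vertices. Tagged t a is the a-th vertex of the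
   path attached at t; its 0-th vertex is the triangle vertex t itself, so
   a length 0 attaches nothing. *)
Definition net_length (t : 'I_3) : nat := tnth [tuple i; j; k] t.

Definition net_vertex : finType := {t : 'I_3 & 'I_(net_length t).+1}.

Definition net_edge : rel net_vertex := fun x y =>
  if tag x == tag y then consecutive (tagged x) (tagged y)
  else (tagged x == 0 :> nat) && (tagged y == 0 :> nat).

Lemma net_sym : symmetric net_edge.
Proof.
by move=> x y; rewrite /net_edge eq_sym consecutive_sym [in X in if _ then _ else X]andbC.
Qed.

Lemma net_irrefl : irreflexive net_edge.
Proof. by move=> x; rewrite /net_edge eqxx consecutive_irrefl. Qed.

Definition gen_net : sgraph := SGraph net_sym net_irrefl.

End Net.

Definition Z_graph (i : nat) : sgraph := gen_net i 0 0.
Definition B_graph (i j : nat) : sgraph := gen_net i j 0.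
Definition bull : sgraph := B_graph 1 1.
Definition wounded : sgraph := B_graph 1 2.
Definition net : sgraph := gen_net 1 1 1.

Definition claw_o_heavy (G : sgraph) : Prop :=
  forall A : {set G}, isomorphic (induced A) claw ->
  exists u v, [/\ u \in A, v \in A & heavy_pair u v].

(* The heavy vertices required are heavy in G, not in G[A]. *)
Definition c_heavy (S G : sgraph) : Prop :=
  forall A : {set G}, isomorphic (induced A) S ->
  forall C : {set G}, maximal_clique_of A C ->
  forall D : {set G}, D \in components (A :\: C) -> 1 < #|D| ->
  exists2 v, v \in D & heavy v.

(* Main.v *)
Require Import Defs.
From mathcomp Require Import all_boot zify.

Set Implicit Arguments.
Unset Strict Implicit.
Unset Printing Implicit Defensive.

(** For sufficiency, complete the neighbourhood of a vertex x whenever it is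
    connected by edges, by heavy pairs and by detours through vertices that form
    a heavy pair with x.  These steps preserve claw-o-heaviness and do not make a
    nonhamiltonian graph hamiltonian, and a closed graph is claw-free, every
    edge lies in exactly one of its maximal cliques and every vertex in at most
    two of them.  A nonhamiltonian 2-connected closed graph contains, as in
    Brousek's theorem on claw-free graphs, two disjoint maximal cliques A and B
    joined by three pairwise separated connectors, each a long induced path or
    an edge lying in a triangle.  One of A, B contains at most one heavy vertex
    and no pair of degree sum above n + 1, which allows the completion steps to be undone one by
    one while the last vertices of the connectors stay pairwise adjacent.  In
    the original graph this leaves a net, a wounded or a Z_3 whose heavy
    vertices are too few for S-c-heaviness; for Z_3 the closed graph may also be
    so small that a Hamilton cycle can be written down, using n >= 10.  An
    induced P_6 with two light vertices at one end is undone directly.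

    For necessity, three 2-connected claw-free nonhamiltonian graphs on ten
    vertices have no common connected induced subgraph of order at least 4
    other than the nine graphs, and every graph is P_3-c-heavy and C_3-c-heavy. *)

(** * Completion at a vertex *)

(** c-heaviness speaks of induced subgraphs of the given graph, and completion steps destroy and
    create these, whereas claw-freeness and the two cliques exist only in the closed graph. So the
    connectors have to be transported back. The obstacle is heavy pairs: a claw of an intermediate
    graph is contradictory only if no two of its leaves form one. Pairs nonadjacent in the closed
    graph are harmless, since a closed graph has no heavy pair. A pair inside the chosen clique that
    is adjacent in the closed graph but not in the intermediate one lacks at least one neighbour at
    each end, so the bound n + 1 on its degree sum drops to n - 1. One clique satisfies the bound by
    counting: a pair of A above it forces |A| >= |B| + 2.

    The contradictions for net, wounded and Z_3 have one form. Heavy vertices of a closed graph are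
    pairwise adjacent, so two vertices nonadjacent there are never both heavy, while c-heaviness
    asks for heavy vertices in two places that are nonadjacent. For Z_3 the cliques shrink until the
    connectors have nine vertices in all, and the last step starts from a tenth. *)

Section Rel.
Variable V : finType.
Implicit Types (g f : rel V) (u v w x y : V) (p q s : seq V).

Definition nb g v : {set V} := [set u | g v u].
Definition dg g v := #|nb g v|.

(** Relative to a set [X] because the structural induction for closed graphs runs over vertex
    subsets. *)
Definition ham_on g (X : {set V}) := exists s, [/\ 2 < size s, ucycle g s & s =i X].

Definition simple_rel g := symmetric g /\ irreflexive g.

(** The heavy pairs of the theorem, for a relation on a fixed vertex type: all graphs between the
    original one and its closure live on [V]. *)
Definition ore_pair g u v := [&& u != v, ~~ g u v & #|V| <= dg g u + dg g v].

Definition add_edge g u v : rel V :=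
  fun a b => [|| g a b, (a == u) && (b == v) | (a == v) && (b == u)].

Lemma ore_pairC g u v : symmetric g -> ore_pair g u v = ore_pair g v u.
Proof. by move=> gs; rewrite /ore_pair eq_sym gs addnC. Qed.

Lemma add_edge_simple g u v : simple_rel g -> u != v -> simple_rel (add_edge g u v).
Proof.
case=> gs gi uv; split=> [a b|a]; rewrite /add_edge.
  by rewrite gs; case: (a == u); case: (b == v); case: (a == v); case: (b == u); rewrite ?orbT ?orbF.
rewrite gi /=; apply/negbTE; rewrite negb_or.
by apply/andP; split; apply/negP=> /andP[/eqP-> /eqP e]; move: uv; rewrite e eqxx.
Qed.

Lemma ham_onP g X : ham_on g X <->
  exists x p, [/\ 1 < size p, path g x p, uniq (x :: p), g (last x p) x & x :: p =i X].
Proof.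
split=> [[[|x p] [] //]|[x [p [sz pp up cl e]]]].
  rewrite ltnS /ucycle => sz /andP[] /=; rewrite rcons_path => /andP[pp cl] up e.
  by exists x, p.
by exists (x :: p); split=> //; rewrite /ucycle /= rcons_path pp cl.
Qed.

(** A Hamilton cycle is a tuple of length [#|X|] with decidable properties, so the arguments by
    contradiction in [ham_on_complete] and [ham_or_st] stay constructive. *)
Lemma ham_on_NNE g X : ~ ~ ham_on g X -> ham_on g X.
Proof.
pose b := [exists t : #|X|.-tuple V, [&& 2 < size t, ucycleb g t & [set z in t] == X]].
have bP : b -> ham_on g X.
  case/existsP=> t /and3P[h1 h2 /eqP h3]; exists t; split=> // z.
  by have /setP/(_ z) := h3; rewrite inE.
move=> nn; have [/bP//|nb] := boolP b; case: nn => -[s [sz /andP[cs us] e]].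
have ss : size s == #|X| by rewrite -(card_uniqP us); apply/eqP/eq_card=> z; rewrite e.
move/negP: nb; apply; apply/existsP; exists (Tuple ss).
rewrite /= sz /ucycleb cs us /=; apply/eqP/setP=> z; by rewrite inE -e.
Qed.

Lemma ham_on_rot g X x : ham_on g X -> x \in X ->
  exists p, [/\ 1 < size p, path g x p, uniq (x :: p), g (last x p) x & x :: p =i X].
Proof.
case=> s [sz /andP[cs us] e] xX; have xs : x \in s by rewrite e.
case: (rot_to xs) => i p rp; exists p.
have : cycle g (x :: p) by rewrite -rp rot_cycle.
have : size (x :: p) = size s by rewrite -rp size_rot.
have up : uniq (x :: p) by rewrite -rp rot_uniq.
rewrite /= rcons_path => + /andP[].
move=> szp pp cl; split => //.
- by move: sz; rewrite -szp.
- by move=> z; rewrite -rp mem_rot e.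
Qed.

Lemma sub_ham_on g f X : subrel g f -> ham_on g X -> ham_on f X.
Proof.
move=> sub /ham_onP[x [p [? pp ? cl ?]]]; apply/ham_onP; exists x, p; split=> //.
  exact: sub_path pp.
exact: sub.
Qed.

Lemma path_rev g x p : symmetric g -> path g x p ->
  path g (last x p) (rev (belast x p)).
Proof. by move=> gs pp; rewrite rev_path (eq_path (e' := g)) // => a b /=; rewrite gs. Qed.

(* The crossing argument of Ore: on the cycle, the successors of the
   neighbours of v and the neighbours of u must overlap. *)
Lemma ore_cross g u p v : simple_rel g -> path g u p -> uniq (u :: p) ->
  last u p = v -> u :: p =i [set: V] -> #|V| <= dg g u + dg g v ->
  1 < size p -> ham_on g [set: V].
Proof.
move=> [gs gi] pp up lp all sm sz.
set s := u :: p.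
pose nx := next s.
have nxi : injective nx by apply: can_inj (prev_next up).
pose X := [set y | g u (nx y)]; pose Y := [set y | g v y].
have nxv : nx v = u.
  by rewrite /nx -lp next_nth mem_last index_last // {1}/s nth_default.
have cX : #|X| = dg g u.
  rewrite /dg /nb -(card_imset X nxi); apply: eq_card=> z; rewrite inE.
  apply/imsetP/idP=> [[y]|gz]; first by rewrite inE => h ->.
  exists (prev s z); first by rewrite inE /nx next_prev.
  by rewrite /nx next_prev.
have vX : v \notin X by rewrite inE nxv gi.
have vY : v \notin Y by rewrite inE gi.
(* [v] lies in neither set: its cyclic successor is [u], which is the last vertex's wrap-around, and
   [g] has no loops. Disjoint sets would therefore bound the degree sum by [#|V| - 1]. *)
have : X :&: Y != set0.
  apply/negP => /eqP e0.
  have h1 := cardsUI X Y; rewrite e0 cards0 addn0 cX in h1.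
  have : X :|: Y \subset ~: [set v].
    apply/subsetP=> z; rewrite in_setC1; apply: contraL => /eqP->.
    by rewrite inE negb_or vX vY.
  move/subset_leq_card; rewrite cardsC1 h1 => h2.
  have : 0 < #|V| by apply/card_gt0P; exists u.
  have := h2; rewrite -/(dg g v); move: sm; rewrite /dg /nb /Y; lia.
case/set0Pn=> y; rewrite !inE => /andP[h1 h2].
have ys : y \in s by rewrite all inE.
have yv : y != v by apply: contraL h2 => /eqP->; rewrite gi.
have [p1 [p2 es]] : exists p1 p2, s = p1 ++ y :: p2.
  by case/splitPr: ys => p1 p2; exists p1, p2.
case: p2 es => [|z p2] es.
  by move: yv; rewrite -lp -[last u p](last_cons u u) -/s es last_cat /= eqxx.
have ny : nx y = z.
  rewrite /nx next_nth ys; rewrite {1}/s.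
  have -> : nth u p (index y s) = nth u s (index y s).+1 by [].
  have ui : uniq s := up.
  move: ui; rewrite es => ui.
  have -> : index y (p1 ++ y :: z :: p2) = size p1.
    rewrite index_cat; move: ui; rewrite cat_uniq => /and3P[_ /hasPn h _].
    have /negbTE-> : y \notin p1 by apply: h; rewrite inE eqxx.
    by rewrite /= eqxx addn0.
  by rewrite nth_cat ltnNge leqnSn /= subSnn.
rewrite ny in h1.
apply/ham_onP.
have hs : exists p1', p1 ++ [:: y] = u :: p1'.
  by case: p1 es => [|b p1] /=; rewrite /s => -[-> _]; [exists [::] | exists (p1 ++ [:: y])].
case: hs => p1' e1.
have ep : p = p1' ++ z :: p2.
  by move: es; rewrite /s -cat_rcons -cats1 e1 => -[].
have un : uniq (u :: p1' ++ rev (z :: p2)).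
  rewrite (perm_uniq (s2 := u :: p)) // ep perm_cons perm_cat2l.
  by apply/permPl/perm_rev.
(* The cycle runs from [u] to [y], jumps to [v], returns along the path to [z] and closes at [u]. *)
exists u, (p1' ++ rev (z :: p2)).
have l1 : last u p1' = y.
  by have := congr1 (last u) e1; rewrite last_cat /= => <-.
have lv : last z p2 = v by rewrite -lp ep last_cat.
move: pp; rewrite ep cat_path l1 => /andP[pp1] /= /andP[gyz pp2].
split.
- by move: sz; rewrite ep !size_cat size_rev.
- rewrite cat_path pp1 l1 /=.
  have : path g v (rev (belast z p2)) by rewrite -lv; exact: path_rev.
  rewrite -lv [z :: p2]lastI rev_rcons /= => ->.
  by rewrite andbT lv gs.
- exact: un.
- by rewrite last_cat rev_cons last_rcons gs.
- move=> t; rewrite -all /s ep !inE !mem_cat mem_rev.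
  by [].
Qed.

(** A Hamilton cycle through the new edge, opened there, is a Hamilton path of [g] between [u] and
    [v], to which the crossing argument applies. The path is reversed when the cycle leaves [u]
    along the new edge. *)
Lemma bondy_chvatal g u v : simple_rel g -> ore_pair g u v ->
  ham_on (add_edge g u v) [set: V] -> ham_on g [set: V].
Proof.
move=> sg /and3P[uv nguv sm] hh; have [gs gi] := sg.
have [p [sz pp up cl e]] := ham_on_rot hh (in_setT u).
case: (boolP (path g u p && g (last u p) u)) => [/andP[pp' cl']|bad].
  by apply/ham_onP; exists u, p.
have gu a b : add_edge g u v a b -> a != u -> b != u -> g a b.
  rewrite /add_edge => /or3P[//|/andP[/eqP-> _]|/andP[_ /eqP->]]; by rewrite eqxx.
(* only the two edges of the cycle at u can be the new one *)
have pgen a q : path (add_edge g u v) a q -> a != u -> u \notin q -> path g a q.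
  elim: q a => //= b q IH a /andP[h1 h2] au; rewrite inE negb_or eq_sym => /andP[bu uq].
  by rewrite (gu _ _ h1 au bu) IH.
case: p => [//|b p] in sz pp up cl e bad *.
move: up pp; rewrite /= inE negb_or => /andP[/andP[ub uvp] up] /andP[ab pp].
rewrite eq_sym in ub.
have pg := pgen _ _ pp ub uvp.
have lu : last b p != u.
  by apply/eqP=> h; have := mem_last b p; rewrite h inE (negbTE uvp) orbF eq_sym (negbTE ub).
have new a : add_edge g u v u a -> ~~ g u a -> a = v.
  by rewrite /add_edge => /or3P[->//|/andP[_ /eqP]//|/andP[/eqP h]]; move: uv; rewrite h eqxx.
case: (boolP (g u b)) => gub.
  have gl : ~~ g u (last b p).
    by apply: contra bad => h; rewrite /= gub pg gs h.
  have el : last b p = v.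
    apply: new gl; rewrite (add_edge_simple sg uv).1; exact: cl.
  apply: (@ore_cross g u (b :: p) v) => //=; first by rewrite gub.
  by rewrite inE negb_or eq_sym ub uvp.
have eb := new _ ab gub.
have gl : g (last b p) u.
  have : add_edge g u v u (last b p) by rewrite (add_edge_simple sg uv).1.
  case/or3P=> [|/andP[_ /eqP h]|/andP[/eqP h]]; first by rewrite gs.
    case: p => [|c p] in sz h up {cl e bad pp uvp pg lu} *; first by [].
    by move: up => /=; rewrite -eb in h; rewrite -h /= mem_last.
  by move: uv; rewrite h eqxx.
apply: (@ore_cross g u (rev (b :: p)) v) => //.
- rewrite [b :: p]lastI rev_rcons /= gs gl /=; exact: path_rev.
- by rewrite /= mem_rev rev_uniq inE negb_or eq_sym ub uvp.
- by rewrite rev_cons last_rcons.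
- by move=> t; rewrite !inE mem_rev -[_ || _]/(t \in u :: b :: p) e inE.
- by rewrite size_rev.
Qed.

End Rel.

(** Permutations between concatenations and reversals are proved by counting occurrences on both
    sides. *)
Ltac perm_cat := let t := fresh in apply/permP=> t; rewrite /= ?(count_cat, count_rev, =^~ cats1) /= ?(count_cat, count_rev, =^~ cats1) /= ?count_cat /=; clear; lia.

(** * Completing an eligible vertex creates no Hamilton cycle *)

Section Closure.
Variable V : finType.
Implicit Types (g f h : rel V) (u v w x y : V) (p q s : seq V).

Lemma nb_sub g f v : subrel g f -> nb g v \subset nb f v.
Proof. by move=> sub; apply/subsetP=> u; rewrite !inE; apply: sub. Qed.

Lemma dg_sub g f v : subrel g f -> dg g v <= dg f v.
Proof. by move=> sub; apply/subset_leq_card/nb_sub. Qed.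

(** [bondy_chvatal] is applied once for each extra edge of [f]; degree sums only grow as edges are
    added, so a pair that is large in [g] stays large in every intermediate graph. *)
Lemma hamr_heavy g f : simple_rel g -> simple_rel f -> subrel g f ->
  (forall a b, f a b -> g a b \/ #|V| <= dg g a + dg g b) ->
  ham_on f [set: V] -> ham_on g [set: V].
Proof.
move=> + sf; move En : #|[set p : V * V | f p.1 p.2 && ~~ g p.1 p.2]| => n.
elim/ltn_ind: n g En => n IH g En sg sub new hf.
case: (pickP (fun p : V * V => f p.1 p.2 && ~~ g p.1 p.2)) => [[a b] /= /andP[fab ngab]|no]; last first.
  apply: sub_ham_on hf => a b fab; apply/negPn/negP=> ng.
  by have := no (a, b); rewrite /= fab ng.
have ab : a != b by apply: contraTneq fab => ->; rewrite sf.2.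
have hab : ore_pair g a b.
  by rewrite /ore_pair ab ngab; case: (new a b fab) => // h; rewrite h in ngab.
apply: (bondy_chvatal sg hab).
have sub2 : subrel g (add_edge g a b) by move=> c d h; rewrite /add_edge h.
apply: (IH _ _ (add_edge g a b) erefl) => //.
- rewrite -En; apply: proper_card; apply/properP; split.
    apply/subsetP=> -[c d]; rewrite !inE /= => /andP[-> /=].
    by rewrite /add_edge negb_or => /andP[].
  by exists (a, b); rewrite !inE /= fab //= /add_edge !eqxx orbT.
- exact: add_edge_simple.
- move=> c d; rewrite /add_edge => /or3P[/sub//|/andP[/eqP-> /eqP->]//|/andP[/eqP-> /eqP->]].
  by rewrite sf.1.
- move=> c d /new[h|h]; [left; exact: sub2|right].
  by apply: leq_trans h _; apply: leq_add; apply: dg_sub.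
Qed.

Definition claw_heavy g := forall c u v w, g c u -> g c v -> g c w ->
  u != v -> u != w -> v != w -> ~~ g u v -> ~~ g u w -> ~~ g v w ->
  [|| ore_pair g u v, ore_pair g u w | ore_pair g v w].

(** Ryjacek's closure of claw-free graphs counts only the edges [g a b] inside the neighbourhood of
    [x]; the two other links adapt it to graphs whose claws contain heavy pairs. *)
Definition detour_rel g x : rel V := fun a b => [&& g x a, g x b &
  [|| g a b, ore_pair g a b | [exists y, [&& ore_pair g x y, g y a & g y b]]]].

Definition eligible g x := forall a b, g x a -> g x b -> connect (detour_rel g x) a b.

Definition complete_at g x : rel V := fun a b => g a b || [&& a != b, g x a & g x b].

Lemma complete_at_sub g x : subrel g (complete_at g x).
Proof. by move=> a b h; rewrite /complete_at h. Qed.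

Lemma complete_at_simple g x : simple_rel g -> simple_rel (complete_at g x).
Proof.
case=> gs gi; split=> [a b|a]; last by rewrite /complete_at gi eqxx.
by rewrite /complete_at gs eq_sym [g x a && _]andbC.
Qed.

Lemma last_rev' d s : last d (rev s) = head d s.
Proof. by case: s => //= a s; rewrite rev_cons last_rcons. Qed.
Lemma head_rev' d s : head d (rev s) = last d s.
Proof. by case/lastP: s => //= s a; rewrite rev_rcons last_rcons. Qed.

Lemma sorted_cat' g d p q : sorted g p -> sorted g q ->
  (p != [::] -> q != [::] -> g (last d p) (head d q)) -> sorted g (p ++ q).
Proof.
case: p => [//|a p] /= pp; case: q => [|b q] /= pq h; first by rewrite cats0.
by rewrite cat_path pp /= h.
Qed.

Lemma sorted_rev' g s : symmetric g -> sorted g s -> sorted g (rev s).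
Proof. by move=> gs ss; rewrite rev_sorted (eq_sorted (e' := g)) // => a b /=; rewrite gs. Qed.

Lemma ham_onS g d s0 s : uniq s0 -> s0 =i [set: V] -> sorted g s -> 2 < size s ->
  g (last d s) (head d s) -> perm_eq s s0 -> ham_on g [set: V].
Proof.
move=> u0 e0 ss sz cl pe; apply/ham_onP; case: s => [//|x p] /= in ss sz cl pe *.
exists x, p; split=> //; first by rewrite -[_ && _]/(uniq (x :: p)) (perm_uniq pe).
by move=> t; rewrite (perm_mem pe).
Qed.

Section Core.
Variables (g f : rel V) (x : V).
Hypotheses (sg : simple_rel g) (sf : simple_rel f) (cg : claw_heavy g).
Hypotheses (gf : subrel g f) (fc : subrel f (complete_at g x)).
(** Heavy pairs of [g] may be used as edges when cycles are rerouted: by [hamr_heavy] a Hamilton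
    cycle of [E] gives one of [f]. *)
Let E : rel V := fun a b => f a b || ore_pair g a b.
Hypothesis nh : ~ ham_on E [set: V].

Lemma E_sym : symmetric E.
Proof. by move=> a b; rewrite /E sf.1 ore_pairC //; case: sg. Qed.

Lemma fE : subrel f E. Proof. by move=> a b h; rewrite /E h. Qed.
Lemma gE : subrel g E. Proof. by move=> a b /gf; apply: fE. Qed.

Lemma fx y : f x y -> g x y.
Proof. by move/fc; rewrite /complete_at sg.2 /= andbF orbF. Qed.

(** The cycle is [x A B], and its missing edge [u v] lies where [A] meets [B]. Every rerouting would
    be a Hamilton cycle of [E], which excludes many pairs. The claw at [x] on [u], [v] and the first
    vertex of [A] then forces [u] to be joined to that first vertex, so [A] closes into a cycle;
    cutting this cycle at [w] excludes enough pairs to produce a claw at [w] without heavy pair. *)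
Lemma core_A u v w A B :
  last x A = u -> head x B = v -> B != [::] -> sorted f (x :: A) -> sorted f B ->
  f (last x B) x -> uniq (x :: A ++ B) -> x :: A ++ B =i [set: V] ->
  g x u -> g x v -> E w u -> E w v ->
  g x w \/ [&& ore_pair g x w, g w u & g w v] -> w \in A -> False.
Proof.
have [gs gi] := sg; have Es := E_sym.
move=> lA hB B0 sxA sB clB un all xu xv wu wv hw wA.
have A0 : A != [::] by case: (A) wA.
set a1 := head x A; set bl := last x B.
have xa1 : g x a1 by apply: fx; move: sxA; rewrite /a1; case: (A) A0 => //= a A' _ /andP[].
have xbl : g x bl by apply: fx; rewrite sf.1.
have sA : sorted E A by apply: sub_sorted fE _ _; move: sxA; case: (A) => //= a A' /andP[].
have {}sB : sorted E B by apply: sub_sorted sB; exact: fE.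
have szT s : perm_eq s (x :: A ++ B) -> 2 < size s.
  move/perm_size->; rewrite /= size_cat; case: (A) A0 => //; case: (B) B0 => //=.
  by move=> *; rewrite addnS.
have ham s : sorted E s -> E (last x s) (head x s) -> perm_eq s (x :: A ++ B) -> False.
  move=> ss cs pe; apply: nh; apply: (@ham_onS _ x (x :: A ++ B) s) => //; exact: szT.
have nuv : ~~ E u v.
  apply/negP=> h; apply: (ham (x :: A ++ B)) => //.
    rewrite -cat_cons; apply: (@sorted_cat' _ x) => //; first exact: sub_sorted fE _ sxA.
    by rewrite /= lA hB.
  by rewrite /= last_cat; move: (B0) clB; case: (B) => //= b B' _ /fE.
have na1v : ~~ E a1 v.
  apply/negP=> h; apply: (ham (x :: rev A ++ B)); last by perm_cat.
    rewrite -cat_cons; apply: (@sorted_cat' _ x) => //.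
      rewrite -[x :: rev A]/([:: x] ++ rev A); apply: (@sorted_cat' _ x) => //; first exact: sorted_rev'.
      by move=> _ _; rewrite head_rev' lA /=; exact: gE.
    by move=> _ _; rewrite /= last_rev' hB.
  by rewrite /= last_cat; move: (B0) clB; case: (B) => //= b B' _ /fE.
have nubl : ~~ E u bl.
  apply/negP=> h; apply: (ham (x :: A ++ rev B)); last by perm_cat.
    rewrite -cat_cons; apply: (@sorted_cat' _ x) => //; first exact: sub_sorted fE _ sxA.
      exact: sorted_rev'.
    by move=> _ _; rewrite /= lA head_rev'.
  by rewrite /= last_cat last_rev'; move: (B0) hB; case: (B) => //= b B' _ ->; rewrite Es; exact: gE.
have gne a b : ~~ E a b -> ~~ g a b by apply: contra; exact: gE.
have hne a b : ~~ E a b -> ~~ ore_pair g a b by apply: contra => h; rewrite /E h orbT.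
have uA : u \in A by rewrite -lA; case: (A) A0 => //= a A' _; exact: mem_last.
have vB : v \in B by rewrite -hB; case: (B) B0 => //= b B' _; rewrite inE eqxx.
have a1A : a1 \in A by rewrite /a1; case: (A) A0 => //= b B' _; rewrite inE eqxx.
move: (un); rewrite /= mem_cat negb_or cat_uniq => /andP[/andP[xA xB] /and3P[uqA dAB uqB]].
have neAB a b : a \in A -> b \in B -> a != b.
  by move=> aA bB; apply: contraNneq dAB => e; apply/hasP; exists b => //; rewrite -e.
have neA a : a \in A -> x != a by move=> aA; apply: contraNneq xA => ->.
have wnu : w != u.
  case/orP: wu => [h|/and3P[]//]; by apply: contraTneq h => ->; rewrite sf.2.
have wna1 : w != a1 by apply: contraNneq na1v => <-.
have ua1 : u != a1.
  apply/eqP => e; move: wA wnu lA e; rewrite /a1; case/lastP: (A) uqA => // A' a.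
  rewrite last_rcons; case: A' => [|c A'] /=; first by rewrite inE => _ /eqP-> /eqP + e; rewrite e.
  by case/andP=> h _ _ _ ea eu; rewrite ea -eu mem_rcons inE eqxx in h.
have Eua1 : E u a1.
  apply/negPn/negP=> nua1.
  have := cg xu xv xa1 (neAB _ _ uA vB) ua1.
  rewrite [v == a1]eq_sym neAB // => /(_ isT (gne _ _ nuv) (gne _ _ nua1)).
  rewrite gs => /(_ (gne _ _ na1v)); rewrite (negbTE (hne _ _ nuv)) (negbTE (hne _ _ nua1)).
  by rewrite ore_pairC // (negbTE (hne _ _ na1v)).
case/splitPr: wA lA sxA sA uqA @a1 xa1 na1v a1A wna1 ua1 Eua1 ham nuv nubl uA neAB neA xA A0 all un szT dAB.
move=> A1 A2 lA sxA sA uqA a1 xa1 na1v a1A wna1 ua1 Eua1 ham nuv nubl uA neAB neA xA A0 all un szT dAB.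
case: A2 lA sxA sA uqA @a1 xa1 na1v a1A wna1 ua1 Eua1 ham nuv nubl uA neAB neA xA A0 all un szT dAB.
  by rewrite cats1 last_rcons => e; rewrite e eqxx in wnu.
move=> wp A2.
case/lastP: A1 => [|A1 wm]; first by move=> _ _ _ _ /= _ _ _ /eqP.
move=> lA sxA sA uqA a1 xa1 na1v a1A wna1 ua1 Eua1 ham nuv nubl uA neAB neA xA A0 all un szT dAB.
set L := rcons A1 wm; set R := wp :: A2.
have a1E : a1 = head x L by rewrite /a1 /L; case: (A1).
have uE : u = last x R by rewrite -lA last_cat.
have sL : sorted E L.
  by move: sA; rewrite -/L; case: (L) => //= c L'; rewrite cat_path => /andP[].
have sR : sorted E R.
  move: sA; rewrite -cat_rcons; case: (rcons _ w) => //= c L'.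
  by rewrite cat_path => /andP[_] /= /andP[].
have [fmw fwp] : f wm w /\ f w wp.
  move: sxA; rewrite /= -cats1 -catA cat_path => /andP[_] /=.
  by case/and4P=> _ -> ->.
have nil1 : L != [::] by rewrite /L; case: (A1).
have lL : last x L = wm by rewrite last_rcons.
have wmA : wm \in L ++ w :: R by rewrite mem_cat mem_rcons inE eqxx.
have wpA : wp \in L ++ w :: R by rewrite mem_cat !inE eqxx !orbT.
have wA' : w \in L ++ w :: R by rewrite mem_cat !inE eqxx !orbT.
have Eb : E bl x by exact: fE.
have lastB a s : last a (s ++ B) = bl.
  by rewrite last_cat /bl; case: (B) B0.
(* As [u] and [a1] are joined, all of [A] can be traversed from [w] to either of its two neighbours
   [wm] and [wp]. *)
have sW1 : sorted E (w :: R ++ L).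
  rewrite -cat_cons; apply: (@sorted_cat' _ x) => //.
    by rewrite /= fE.
  by move=> _ _; rewrite /= -a1E -[last wp A2]/(last x R) -uE.
have sW2 : sorted E (w :: rev L ++ rev R).
  rewrite -cat_cons; apply: (@sorted_cat' _ x); last first.
  - have hd d : head d L = a1 by rewrite a1E; move: nil1; case: (L).
    by move=> _ _; rewrite head_rev' -uE /= last_rev' hd Es.
  - exact: sorted_rev'.
  rewrite -[w :: rev L]/([:: w] ++ rev L); apply: (@sorted_cat' _ x) => //; first exact: sorted_rev'.
  by move=> _ _; rewrite head_rev' lL /= fE // sf.1.
have lW1 : last x (w :: R ++ L) = wm by rewrite -cat_cons last_cat; move: nil1 lL; case: (L).
have lW2 : last x (w :: rev L ++ rev R) = wp.
  by rewrite -cat_cons last_cat -[RHS]/(head x R) -last_rev'; case/lastP: (rev R) (size_rev R) => //= s a _; rewrite !last_rcons.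
have nc1 : ~~ E x wm.
  apply/negP=> h; apply: (ham (x :: rev (w :: R ++ L) ++ B)); last by rewrite /L /R; perm_cat.
    rewrite -cat_cons; apply: (@sorted_cat' _ x) => //.
      rewrite -[x :: rev _]/([:: x] ++ rev _); apply: (@sorted_cat' _ x) => //; first exact: sorted_rev'.
      by move=> _ _; rewrite head_rev' lW1.
    by move=> _ _; rewrite -[x :: _]/([:: x] ++ _) last_cat last_rev' hB.
  by rewrite -cat_cons lastB.
have nc2 : ~~ E x wp.
  apply/negP=> h; apply: (ham (x :: rev (w :: rev L ++ rev R) ++ B)); last by rewrite /L /R; perm_cat.
    rewrite -cat_cons; apply: (@sorted_cat' _ x) => //.
      rewrite -[x :: rev _]/([:: x] ++ rev _); apply: (@sorted_cat' _ x) => //; first exact: sorted_rev'.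
      by move=> _ _; rewrite head_rev' lW2.
    by move=> _ _; rewrite -[x :: _]/([:: x] ++ _) last_cat last_rev' hB.
  by rewrite -cat_cons lastB.
have nc3 : ~~ E wm wp.
  apply/negP=> h; apply: (ham ((x :: L) ++ R ++ w :: B)); last by rewrite /L /R; perm_cat.
    apply: (@sorted_cat' _ x) => //.
    - by rewrite /=; move: sxA => /=; rewrite -/L cat_path => /andP[/(sub_path fE)].
    - apply: (@sorted_cat' _ x) => //; last by rewrite -uE /= Es.
      rewrite -[w :: B]/([:: w] ++ B); apply: (@sorted_cat' _ x) => //.
      by rewrite hB.
    - by move=> _ _; rewrite -[x :: L]/([:: x] ++ L) last_cat; move: nil1 lL; case: (L) => //= c L' _ ->.
  by rewrite !catA -cat_rcons lastB.
have wmwp : wm != wp.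
  apply: contraTneq uqA => e; rewrite e cat_uniq; apply/negP=> /and3P[_ /hasPn/(_ wp) + _].
  by rewrite !inE eqxx orbT mem_rcons inE eqxx => /(_ isT).
(* An edge of [f] outside [g] has both ends in the neighbourhood of [x]. *)
have ff a b : f a b -> ~~ E x b -> g a b.
  move/fc; rewrite /complete_at => /orP[//|/and3P[_ _ h]] /negP[]; exact: gE.
have gwm : g w wm by apply: ff nc1; rewrite sf.1.
have gwp : g w wp by apply: ff nc2.
(* If [x w] is an edge, the claw at [w] has the leaves [wm], [wp], [x]; if it is a heavy pair, the
   third leaf is [v]. *)
case: hw => [xw|/and3P[hxw gwu gwv]].
  have := cg gwm gwp; rewrite gs in xw; move/(_ x xw wmwp).
  rewrite ![_ == x]eq_sym (negbTE (neA _ wmA)) (negbTE (neA _ wpA)) => /(_ isT isT (gne _ _ nc3)).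
  rewrite ![g _ x]gs => /(_ (gne _ _ nc1) (gne _ _ nc2)).
  by rewrite ![ore_pair g _ x]ore_pairC // (negbTE (hne _ _ nc1)) (negbTE (hne _ _ nc2)) (negbTE (hne _ _ nc3)).
have Exw : E x w by rewrite /E hxw orbT.
have nc4 : ~~ E wm v.
  apply/negP=> h; apply: (ham (x :: (w :: R ++ L) ++ B)); last by rewrite /L /R; perm_cat.
    rewrite -[x :: _]/([:: x] ++ _); apply: (@sorted_cat' _ x) => //.
    by apply: (@sorted_cat' _ x) => //; rewrite lW1 hB.
  by rewrite -[x :: _]cat_cons lastB.
have nc5 : ~~ E wp v.
  apply/negP=> h; apply: (ham (x :: (w :: rev L ++ rev R) ++ B)); last by rewrite /L /R; perm_cat.
    rewrite -[x :: _]/([:: x] ++ _); apply: (@sorted_cat' _ x) => //.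
    by apply: (@sorted_cat' _ x) => //; rewrite lW2 hB.
  by rewrite -[x :: _]cat_cons lastB.
have := cg gwm gwp gwv wmwp (neAB _ _ wmA vB) (neAB _ _ wpA vB).
move/(_ (gne _ _ nc3) (gne _ _ nc4) (gne _ _ nc5)).
by rewrite (negbTE (hne _ _ nc3)) (negbTE (hne _ _ nc4)) (negbTE (hne _ _ nc5)).
Qed.

(** Reversing the cycle exchanges [A] with [B] and [u] with [v], which reduces the position of [w]
    to [core_A]. *)
Lemma core_AB u v w A B :
  last x A = u -> head x B = v -> A != [::] -> B != [::] -> sorted f (x :: A) -> sorted f B ->
  f (last x B) x -> uniq (x :: A ++ B) -> x :: A ++ B =i [set: V] ->
  g x u -> g x v -> E w u -> E w v ->
  g x w \/ [&& ore_pair g x w, g w u & g w v] -> False.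
Proof.
have [gs gi] := sg.
move=> lA hB A0 B0 sxA sB clB un all xu xv wu wv hw.
have : w \in x :: A ++ B by rewrite all inE.
rewrite inE mem_cat => /or3P[/eqP e|wA|wB].
- by case: hw; rewrite e ?gi // => /and3P[/and3P[]]; rewrite eqxx.
- exact: (core_A lA hB B0 sxA sB clB un all xu xv wu wv hw wA).
apply: (@core_A v u w (rev B) (rev A)) => //.
- by rewrite last_rev'.
- by rewrite head_rev'.
- by rewrite -size_eq0 size_rev size_eq0.
- rewrite -[x :: _]/([:: x] ++ _); apply: (@sorted_cat' _ x) => //.
    by apply: sorted_rev' => //; case: sf.
  by move=> _ _; rewrite head_rev' /= sf.1.
- apply: sorted_rev'; first by case: sf.
  by move: sxA => /=; case: (A) => //= a A' /andP[].
- rewrite last_rev' sf.1; by move: A0 sxA; case: (A) => //= a A' _ /andP[].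
- rewrite (perm_uniq (s2 := x :: A ++ B)) //; perm_cat.
- move=> t; rewrite -all; apply: perm_mem; perm_cat.
- by case: hw => [|/and3P[-> -> ->]]; [left|right].
- by rewrite mem_rev.
Qed.

Lemma core u v w : g x u -> g x v -> u != v -> ~~ f u v -> E w u -> E w v ->
  g x w \/ [&& ore_pair g x w, g w u & g w v] -> ~ ham_on (add_edge f u v) [set: V].
Proof.
have [gs gi] := sg.
move=> xu xv uv nfuv wu wv hw hh.
have xu' : x != u by apply: contraTneq xu => ->; rewrite gi.
have xv' : x != v by apply: contraTneq xv => ->; rewrite gi.
have [p [sz pp up clp e]] := ham_on_rot hh (in_setT x).
have adx a : add_edge f u v x a -> f x a.
  by rewrite /add_edge (negbTE xu') (negbTE xv') orbF.
have adx' a : add_edge f u v a x -> f a x.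
  by rewrite /add_edge ![x == _]eq_sym in xu' xv' *; rewrite (negbTE xu') (negbTE xv') !andbF !orbF.
have clx := adx' _ clp.
have key q a : path (add_edge f u v) a q -> uniq (a :: q) -> path f a q \/
  exists A B, [/\ q = A ++ B, B != [::], path f a A, sorted f B &
   (last a A = u /\ head a B = v) \/ (last a A = v /\ head a B = u)].
  elim: q a => [|b q IH] a /=; first by left.
  case/andP=> ab pq /andP[aq uq]; case: (boolP (f a b)) => fab.
    have [fp|[A [B [-> B0 pA sB hAB]]]] := IH b pq uq; first by left.
    by right; exists (b :: A), B; rewrite /= ?fab; split => //; case: (B) B0 hAB.
  right; exists [::], (b :: q); split=> //=; last first.
    by case/or3P: ab => [h|/andP[/eqP-> /eqP->]|/andP[/eqP-> /eqP->]]; [rewrite h in fab|left|right].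
  have abq : a \notin b :: q by [].
  have hab : (a = u /\ b = v) \/ (a = v /\ b = u).
    by case/or3P: ab => [h|/andP[/eqP-> /eqP->]|/andP[/eqP-> /eqP->]]; [rewrite h in fab|left|right].
  have {}IH c r : path (add_edge f u v) c r -> a \notin c :: r -> path f c r.
    elim: r c => //= d r IHr c /andP[cd pr]; rewrite inE negb_or => /andP[ac adr].
    rewrite IHr // andbT; case/or3P: cd => // /andP[/eqP ec /eqP ed]; move: ac adr;
    rewrite ec ed inE negb_or; case: hab => -[-> _]; rewrite eqxx ?andbF //.
  exact: IH.
have [fp|[A [B [ep B0 pA sB hAB]]]] := key p x pp up.
  by apply: nh; apply: (sub_ham_on fE); apply/ham_onP; exists x, p.
have lB : last x B = last x p by rewrite ep last_cat; case: (B) B0.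
have A0 : A != [::].
  apply/eqP=> eA; move: hAB; rewrite eA /=.
  by case=> -[ex _]; [move: xu'|move: xv']; rewrite ex eqxx.
rewrite -lB in clx; rewrite ep in up e.
case: hAB => -[lA hB].
  exact: (@core_AB u v w A B).
apply: (@core_AB v u w A B) => //.
by case: hw => [|/and3P[-> -> ->]]; [left|right].
Qed.

End Core.

(** The edges of the completion are removed one at a time, so the claim is proved for every [f]
    between [g] and its completion. Along a walk of [detour_rel] there is always a pair nonadjacent
    in [f] that is heavy or has a common neighbour of the kind required by [core]. *)
Lemma ham_on_complete g x : simple_rel g -> claw_heavy g -> eligible g x -> ham_on (complete_at g x) [set: V] -> ham_on g [set: V].
Proof.
move=> sg cg eg; have [gs gi] := sg.
suff H n f : #|[set p : V * V | complete_at g x p.1 p.2 && ~~ f p.1 p.2]| = n ->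
   simple_rel f -> subrel g f -> subrel f (complete_at g x) -> ham_on (complete_at g x) [set: V] -> ham_on f [set: V].
  by apply: (H _ g erefl sg) => //; exact: complete_at_sub.
elim/ltn_ind: n f => n IH f En sf gf fc hh.
pose E : rel V := fun a b => f a b || ore_pair g a b.
have EH : ham_on E [set: V] -> ham_on f [set: V].
  apply: hamr_heavy => //.
  - by split=> a; rewrite /E ?sf.2 /ore_pair ?eqxx // => b; rewrite sf.1 eq_sym gs addnC.
  - by move=> a b h; rewrite /E h.
  move=> a b /orP[h|/and3P[_ _ h]]; [by left|right].
  by apply: leq_trans h _; apply: leq_add; apply: dg_sub.
have step u v : g x u -> g x v -> u != v -> ~~ f u v ->
    ham_on (add_edge f u v) [set: V] .
  move=> xu xv uv nf; have cuv : complete_at g x u v by rewrite /complete_at uv xu xv orbT.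
  have sc := complete_at_simple x sg.
  apply: (IH _ _ (add_edge f u v) erefl) => //.
  - rewrite -En; apply: proper_card; apply/properP; split.
      apply/subsetP=> -[c d]; rewrite !inE /= => /andP[-> /=].
      by rewrite /add_edge negb_or => /andP[].
    by exists (u, v); rewrite !inE /= cuv //= /add_edge !eqxx orbT.
  - exact: add_edge_simple.
  - by move=> c d h; rewrite /add_edge gf.
  - move=> c d; rewrite /add_edge => /or3P[/fc//|/andP[/eqP-> /eqP->]//|/andP[/eqP-> /eqP->]].
    by rewrite sc.1.
case: (pickP (fun p : V * V => [&& g x p.1, g x p.2, p.1 != p.2 & ~~ f p.1 p.2])) =>
  [[u v] /= /and4P[xu xv uv nf]|no]; last first.
  apply: sub_ham_on hh => a b; rewrite /complete_at => /orP[/gf//|/and3P[ab xa xb]].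
  by have := no (a, b); rewrite /= xa xb ab => /negbFE.
have [u' [v' [xu' xv' uv' nf' hw]]] : exists u' v', [/\ g x u', g x v', u' != v', ~~ f u' v' &
   ore_pair g u' v' \/ exists w, [/\ E w u', E w v' & g x w \/ [&& ore_pair g x w, g w u' & g w v']]].
  have /connectP[p] := eg u v xu xv.
  elim: p u xu uv nf => [|b p IHp] u xu uv nf /=; first by move=> _ e; rewrite e eqxx in uv.
  case/andP=> ub pp lv.
  move/and3P: ub => [_ xb ub].
  have [ebv|bv] := eqVneq b v.
    rewrite ebv in ub; exists u, v; split=> //.
    case/or3P: ub => [/gf h|h|/existsP[y /and3P[h1 h2 h3]]]; first by rewrite h in nf.
      by left.
    by right; exists y; rewrite /E !(gf _ _ h2) !(gf _ _ h3); split=> //; right; rewrite h1 h2.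
  (* While [b] and [v] are nonadjacent the shorter walk from [b] will do. Otherwise [b] is a common
     neighbour of [u] and [v], or [u] and [b] are the wanted pair. *)
  case: (boolP (f b v)) => fbv; last exact: (IHp b).
  have [eub|nub] := eqVneq u b; first by move: nf; rewrite eub fbv.
  case: (boolP (f u b)) => fub.
    exists u, v; split=> //; right; exists b; split; [| |by left]; by rewrite /E ?fbv // sf.1 fub.
  exists u, b; split=> //.
  case/or3P: ub => [/gf h|h|/existsP[y /and3P[h1 h2 h3]]]; first by rewrite h in fub.
    by left.
  by right; exists y; rewrite /E !(gf _ _ h2) !(gf _ _ h3); split=> //; right; rewrite h1 h2.
have hst := step u' v' xu' xv' uv' nf'.
case: hw => [hp'|[w [w1 w2 w3]]].
  apply: (bondy_chvatal sf _ hst); rewrite /ore_pair uv' nf'.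
  by move/and3P: hp' => [_ _ h]; apply: leq_trans h _; apply: leq_add; apply: dg_sub.
apply: EH; apply: ham_on_NNE => nh.
exact: (core sg sf cg gf fc nh xu' xv' uv' nf' w1 w2 w3 hst).
Qed.

End Closure.

(** * Existence of the closure *)

Section Closed.
Variable V : finType.
Implicit Types (g f h : rel V) (u v w x y : V) (s : seq V) (K : {set V}).

(** [a] is joined to every other neighbour of [x], and [x] itself makes up for [a]. *)
Lemma dg_complete g x a : simple_rel g -> g x a -> dg g x <= dg (complete_at g x) a.
Proof.
move=> [gs gi] xa; rewrite /dg (cardsD1 a) inE xa.
have xN : x \notin nb g x :\ a by rewrite !inE gi andbF.
rewrite -[_ + _]/(true + _) -xN -cardsU1; apply: subset_leq_card.
apply/subsetP=> z; rewrite !inE => /orP[/eqP->|/andP[za xz]]; rewrite /complete_at.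
  by rewrite gs xa.
by rewrite eq_sym za xa xz !orbT.
Qed.

Lemma ore_pair_complete g x u v : subrel g (complete_at g x) -> ore_pair g u v -> ~~ complete_at g x u v -> ore_pair (complete_at g x) u v.
Proof.
move=> sub /and3P[uv _ d] n; rewrite /ore_pair uv n; apply: leq_trans d _.
by apply: leq_add; apply: dg_sub.
Qed.

(** In a claw with a new edge [c u] the other two leaves are not neighbours of [x], so replacing [u]
    by [x] gives a claw of [g]. A heavy pair of that claw containing [x] passes to [u] by
    [dg_complete]. *)
Lemma claw_heavy_complete g x : simple_rel g -> claw_heavy g -> claw_heavy (complete_at g x).
Proof.
move=> sg cg; have [gs gi] := sg; have [cs ci] := complete_at_simple x sg.
have sub := @complete_at_sub V g x.
have H c u v w : ~~ g c u -> complete_at g x c u -> complete_at g x c v -> complete_at g x c w ->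
    u != v -> u != w -> v != w -> ~~ complete_at g x u v -> ~~ complete_at g x u w -> ~~ complete_at g x v w ->
    [|| ore_pair (complete_at g x) u v, ore_pair (complete_at g x) u w | ore_pair (complete_at g x) v w].
  move=> ncu; rewrite {1}/complete_at (negbTE ncu) /= => /and3P[cu xc xu].
  move=> cv cw uv uw vw nuv nuw nvw.
  have out a : u != a -> ~~ complete_at g x u a -> ~~ g x a && (x != a).
    move=> ua; rewrite /complete_at ua xu negb_or /= => /andP[h1 h2]; rewrite h2.
    by apply: contraNneq h1 => <-; rewrite gs.
  have /andP[nxv xv] := out v uv nuv; have /andP[nxw xw] := out w uw nuw.
  have gcv : g c v by move: cv; rewrite /complete_at (negbTE nxv) !andbF orbF.
  have gcw : g c w by move: cw; rewrite /complete_at (negbTE nxw) !andbF orbF.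
  rewrite gs in xc.
  have ngvw : ~~ g v w by apply: contra nvw; exact: sub.
  have lift a : u != a -> ~~ complete_at g x u a -> ore_pair g x a -> ore_pair (complete_at g x) u a.
    move=> ua nua /and3P[_ _ d]; rewrite /ore_pair ua nua; apply: leq_trans d _.
    by apply: leq_add; [exact: dg_complete | exact: dg_sub].
  case/or3P: (cg c x v w xc gcv gcw xv xw vw nxv nxw ngvw) => h.
  - by rewrite lift.
  - by rewrite (lift w) ?orbT.
  - by rewrite (ore_pair_complete sub h nvw) !orbT.
move=> c u v w cu cv cw uv uw vw nuv nuw nvw.
case: (boolP (g c u)) => gcu; last exact: (H c u v w).
case: (boolP (g c v)) => gcv; last first.
  have := H c v u w gcv cv cu cw; rewrite eq_sym uv cs; move/(_ isT vw uw nuv nvw nuw).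
  by rewrite ore_pairC // => /or3P[] ->; rewrite ?orbT.
case: (boolP (g c w)) => gcw; last first.
  have := H c w u v gcw cw cu cv; rewrite ![w == _]eq_sym ![complete_at g x w _]cs.
  move/(_ uw vw uv nuw nvw nuv).
  by rewrite ![ore_pair _ w _]ore_pairC // => /or3P[] ->; rewrite ?orbT.
have ng a b : ~~ complete_at g x a b -> ~~ g a b by apply: contra; exact: sub.
case/or3P: (cg c u v w gcu gcv gcw uv uw vw (ng _ _ nuv) (ng _ _ nuw) (ng _ _ nvw)) => h.
- by rewrite (ore_pair_complete sub h nuv).
- by rewrite (ore_pair_complete sub h nuw) orbT.
- by rewrite (ore_pair_complete sub h nvw) !orbT.
Qed.

Inductive completes_to : rel V -> rel V -> Prop :=
| ext0 g : completes_to g g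
| extS g x h : eligible g x -> completes_to (complete_at g x) h -> completes_to g h.

Lemma completes_to_simple g h : completes_to g h -> simple_rel g -> simple_rel h.
Proof. by elim=> // {h}g' x h _ _ IH sg; apply/IH/complete_at_simple. Qed.

Lemma completes_to_claw_heavy g h : completes_to g h -> simple_rel g -> claw_heavy g -> claw_heavy h.
Proof. by elim=> // {h}g' x h _ _ IH sg cg; apply: IH; [exact: complete_at_simple|exact: claw_heavy_complete]. Qed.

Lemma completes_to_sub g h : completes_to g h -> subrel g h.
Proof. by elim=> [{h}g' a b //|{h}g' x h _ _ IH a b ab]; apply/IH/complete_at_sub. Qed.

Lemma completes_to_ham g h : completes_to g h -> simple_rel g -> claw_heavy g -> ham_on h [set: V] -> ham_on g [set: V].
Proof.
elim=> // {h}g' x h el _ IH sg cg hh; apply: (ham_on_complete sg cg el); apply: IH => //.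
  exact: complete_at_simple.
exact: claw_heavy_complete.
Qed.

Definition closed h := forall x, eligible h x -> forall a b, h x a -> h x b -> a != b -> h a b.

Lemma closure_ex g : simple_rel g -> exists2 h, completes_to g h & closed h.
Proof.
move En : #|[set p : V * V | ~~ g p.1 p.2]| => n.
elim/ltn_ind: n g En => n IH g En sg.
pose eb x := [forall a, forall b, g x a ==> g x b ==> connect (detour_rel g x) a b].
have eP x : eb x -> eligible g x.
  by move=> /forallP h a b xa xb; have /forallP/(_ b) := h a; rewrite xa xb.
have eP' x : eligible g x -> eb x.
  by move=> h; apply/forallP=> a; apply/forallP=> b; apply/implyP=> xa; apply/implyP; exact: h.
case: (pickP (fun p : V * (V * V) => [&& eb p.1, g p.1 p.2.1, g p.1 p.2.2, p.2.1 != p.2.2 & ~~ g p.2.1 p.2.2])).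
  move=> [x [a b]] /= /and5P[/eP el xa xb ab nab].
  have [|h eh ch] := IH _ _ (complete_at g x) erefl (complete_at_simple x sg); last by exists h => //; exact: extS el eh.
  rewrite -En; apply: proper_card; apply/properP; split.
    by apply/subsetP=> -[c d]; rewrite !inE /= /complete_at negb_or => /andP[].
  by exists (a, b); rewrite !inE /= ?nab // /complete_at ab xa xb orbT.
move=> no; exists g; first exact: ext0.
move=> x /eP' el a b xa xb ab; have := no (x, (a, b)); rewrite /= el xa xb ab /=.
by move/negbFE.
Qed.

(** Inclusion-exclusion: the union of the two neighbourhoods misses [u], [v] and [O]. *)
Lemma ore_pair_common g u v (O : {set V}) : simple_rel g -> u != v -> ~~ g u v ->
  #|V| <= dg g u + dg g v ->
  (forall o, o \in O -> [/\ o != u, o != v, ~~ g u o & ~~ g v o]) ->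
  2 + #|O| <= #|nb g u :&: nb g v|.
Proof.
move=> [gs gi] uv nuv d hO.
have := cardsUI (nb g u) (nb g v); rewrite -/(dg g u) -/(dg g v) => e.
have : #|(nb g u :|: nb g v) :|: ([set u; v] :|: O)| <= #|V| by apply: max_card.
have d1 : (nb g u :|: nb g v) :&: ([set u; v] :|: O) = set0.
  apply/setP=> z; rewrite !inE; apply/negbTE/negP.
  case/andP=> hz /orP[/orP[]/eqP ez|zO].
  - by move: hz; rewrite ez gi gs (negbTE nuv).
  - by move: hz; rewrite ez gi (negbTE nuv).
  - by have [_ _ /negbTE h1 /negbTE h2] := hO _ zO; rewrite h1 h2 in hz.
have d2 : [set u; v] :&: O = set0.
  apply/setP=> z; rewrite !inE; apply/negbTE/negP; case/andP=> hz zO.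
  by have [/negbTE h1 /negbTE h2 _ _] := hO _ zO; rewrite h1 h2 in hz.
rewrite (cardsU (_ :|: _)) d1 cards0 subn0 (cardsU [set u; v] O) d2 cards0 subn0 cards2 uv.
move: e d; lia.
Qed.

Lemma ore_pair_common2 g u v c : simple_rel g -> ore_pair g u v -> exists w, [/\ g u w, g v w & w != c].
Proof.
move=> sg /and3P[uv nuv d].
have := @ore_pair_common g u v set0 sg uv nuv d; rewrite cards0 => h.
have {h} : 2 <= #|nb g u :&: nb g v| by apply: h => o; rewrite inE.
rewrite (cardsD1 c) => h.
have : 0 < #|(nb g u :&: nb g v) :\ c| by move: h; case: (c \in _) => /=; lia.
by case/card_gt0P=> w; rewrite !inE => /and3P[h1 h2 h3]; exists w.
Qed.

Lemma detour_rel_sym g x : symmetric g -> symmetric (detour_rel g x).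
Proof.
move=> gs a b; rewrite /detour_rel (gs a b) (ore_pairC a b gs).
have -> : [exists y, [&& ore_pair g x y, g y a & g y b]] = [exists y, [&& ore_pair g x y, g y b & g y a]].
  by apply: eq_existsb => y; rewrite [g y a && _]andbC.
by case: (g x a); case: (g x b).
Qed.

(** * Closed graphs *)

Section ClosedFacts.
Variable g : rel V.
Hypotheses (sg : simple_rel g) (cg : claw_heavy g) (clg : closed g).
Let gs := sg.1.
Let gi := sg.2.

Lemma closed_nohp u v : ore_pair g u v = false.
Proof.
apply/negP=> huv; have /and3P[uv nuv d] := huv.
pose W := nb g u :&: nb g v.
pose O := [set o | [&& o != u, o != v, ~~ g u o & ~~ g v o]].
have cW : 2 + #|O| <= #|W|.
  by apply: ore_pair_common => // o; rewrite inE => /and4P.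
have bw w : w \in W -> exists b, (g w b && ~~ connect (detour_rel g w) u b).
  rewrite !inE => /andP[uw vw].
  case: (pickP (fun b => g w b && ~~ connect (detour_rel g w) u b)) => [b hb|no]; first by exists b.
  have cs : connect_sym (detour_rel g w) by apply: sym_connect_sym; exact: detour_rel_sym.
  have el : eligible g w.
    move=> a b wa wb; have := no a; rewrite wa /= => /negbFE ca'; have := no b; rewrite wb /= => /negbFE cb'.
    by rewrite cs in ca'; exact: connect_trans ca' cb'.
  by rewrite gs in uw; rewrite gs in vw; rewrite (clg el uw vw uv) in nuv.
pose f w := odflt u [pick b | g w b && ~~ connect (detour_rel g w) u b].
have fP w : w \in W -> g w (f w) && ~~ connect (detour_rel g w) u (f w).
  by move=> /bw [b hb]; rewrite /f; case: pickP => // /(_ b); rewrite hb.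
have fO w : w \in W -> f w \in O.
  move=> wW; have /andP[h1 h2] := fP w wW; move: wW; rewrite !inE => /andP[uw vw].
  rewrite gs in uw; rewrite gs in vw.
  have uv' : detour_rel g w u v by rewrite /detour_rel uw vw huv !orbT.
  apply/and4P; split.
  - by apply: contraNneq h2 => ->; exact: connect0.
  - by apply: contraNneq h2 => ->; exact: connect1.
  - by apply: contra h2 => h; apply: connect1; rewrite /detour_rel uw h1 h.
  - apply: contra h2 => h; apply: connect_trans (connect1 uv') _.
    by apply: connect1; rewrite /detour_rel vw h1 h.
have : ~~ dinjectiveb f W.
  apply/negP=> /dinjectiveP inj.
  have : #|f @: W| <= #|O| by apply/subset_leq_card/subsetP=> b /imsetP[w wW ->]; exact: fO.
  by rewrite (card_in_imset inj); move: cW; lia.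
case/dinjectivePn=> w wW [w']; rewrite !inE => /andP[w'w uvw'] ef.
have w'W : w' \in W by rewrite !inE.
have /andP[h1 h2] := fP w wW; have /andP[h1' _] := fP w' w'W.
rewrite -ef in h1'; move: wW; rewrite !inE => /andP[uw vw].
case/andP: uvw' => uw' vw'.
have gwu : g w u by rewrite gs.
case: (boolP (g w w')) => ww'.
  case/negP: h2; apply: (@connect_trans _ _ w'); apply: connect1.
    by rewrite /detour_rel gwu ww' uw'.
  by rewrite /detour_rel ww' h1 h1'.
case: (boolP (ore_pair g w w')) => hww'.
  case/negP: h2; apply: connect1; rewrite /detour_rel gwu h1 /=; apply/or3P; apply: Or33.
  by apply/existsP; exists w'; rewrite hww' h1' gs uw'.
have cs : connect_sym (detour_rel g u) by apply: sym_connect_sym; exact: detour_rel_sym.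
have cww : connect (detour_rel g u) w w'.
  apply: connect1; rewrite /detour_rel uw uw' /=; apply/or3P; apply: Or33.
  by apply/existsP; exists v; rewrite huv vw vw'.
have all c : g u c -> connect (detour_rel g u) w c.
  move=> uc; have [->|cw] := eqVneq c w; first exact: connect0.
  have [->|cw'] := eqVneq c w' => //.
  have ww'ne : w != w' by rewrite eq_sym.
  have one : detour_rel g u w c || detour_rel g u w' c.
    rewrite /detour_rel uw uw' uc /=; apply/negPn/negP; rewrite negb_or.
    case/andP; rewrite negb_or => /andP[n1]; rewrite negb_or => /andP[n2 _].
    rewrite negb_or => /andP[n3]; rewrite negb_or => /andP[n4 _].
    have := cg uw uw' uc ww'ne; rewrite ![_ == c]eq_sym => /(_ cw cw' ww' n1 n3).
    by rewrite (negbTE hww') (negbTE n2) (negbTE n4).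
  case/orP: one => h; first exact: connect1.
  by apply: connect_trans cww _; exact: connect1.
have el : eligible g u.
  by move=> a b ua ub; apply: connect_trans (all b ub); rewrite cs; exact: all.
by move: ww'; rewrite (clg el uw uw') // eq_sym.
Qed.

Lemma closed_clawfree c u v w : g c u -> g c v -> g c w ->
  u != v -> u != w -> v != w -> [|| g u v, g u w | g v w].
Proof.
move=> cu cv cw uv uw vw; apply/negPn/negP; rewrite !negb_or => /and3P[h1 h2 h3].
by have := cg cu cv cw uv uw vw h1 h2 h3; rewrite !closed_nohp.
Qed.

(** With [a] and [c] nonadjacent, claw-freeness joins every other neighbour of [x] to [a] or [c];
    since [b] links these two, [x] is eligible. *)
Lemma closed_diamondfree x a b c : g x a -> g x b -> g x c -> g a b -> g b c ->
  a != c -> g a c.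
Proof.
move=> xa xb xc ab bc ac; apply/negPn/negP=> nac.
have cs : connect_sym (detour_rel g x) by apply: sym_connect_sym; exact: detour_rel_sym.
have rxg p q : g x p -> g x q -> g p q -> connect (detour_rel g x) p q.
  by move=> h1 h2 h3; apply: connect1; rewrite /detour_rel h1 h2 h3.
have cac : connect (detour_rel g x) a c by apply: connect_trans (rxg a b xa xb ab) _; exact: rxg.
have all d : g x d -> connect (detour_rel g x) a d.
  move=> xd; have [->|da] := eqVneq d a; first exact: connect0.
  have [->|dc] := eqVneq d c => //.
  have := closed_clawfree xd xa xc da dc ac; rewrite (negbTE nac) orbF.
  case/orP=> h; first by apply: rxg => //; rewrite gs.
  by apply: connect_trans cac _; apply: rxg => //; rewrite gs.
have el : eligible g x.
  by move=> p q xp xq; apply: connect_trans (all q xq); rewrite cs; exact: all.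
by rewrite (clg el xa xc ac) in nac.
Qed.

End ClosedFacts.

(* K is a clique of size at least 2 and a vertex outside K has at most
   one neighbour in K; in a closed graph these are the maximal cliques. *)
Definition closed_clique h K := [/\ 1 < #|K|, forall u v, u \in K -> v \in K -> u != v -> h u v &
  forall w u v, w \notin K -> u \in K -> v \in K -> h w u -> h w v -> u = v].

(** In a closed graph, the maximal clique containing the edge [u v]; see [mc_kq]. *)
Definition edge_clique h u v : {set V} := [set w | [|| w == u, w == v | h w u && h w v]].

Lemma mc_in h K w u v : closed_clique h K -> u \in K -> v \in K -> u != v -> h w u -> h w v -> w \in K.
Proof.
move=> [_ _ h3] uK vK uv wu wv; apply/negPn/negP=> wK.
by rewrite (h3 w u v) ?eqxx in uv.
Qed.

Lemma mc_kqE h K u v : simple_rel h -> closed_clique h K -> u \in K -> v \in K -> u != v -> K = edge_clique h u v.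
Proof.
move=> sh mK uK vK uv; apply/setP=> w; rewrite inE; apply/idP/idP.
  move=> wK; have [->//|wu] := eqVneq w u; have [->//|wv] := eqVneq w v => /=.
  by case: mK => _ hK _; rewrite !hK.
case/or3P=> [/eqP->//|/eqP->//|/andP[]]; exact: (mc_in mK).
Qed.

Lemma mc_eq h K K' u v : simple_rel h -> closed_clique h K -> closed_clique h K' -> u \in K -> v \in K ->
  u \in K' -> v \in K' -> u != v -> K = K'.
Proof. by move=> sh m m' *; rewrite (mc_kqE sh m (u := u) (v := v)) // (mc_kqE sh m' (u := u) (v := v)). Qed.

Lemma mc_kq h u v : simple_rel h -> claw_heavy h -> closed h -> h u v -> closed_clique h (edge_clique h u v).
Proof.
move=> sh ch clh huv; have [hs hi] := sh.
have uv : u != v by apply: contraTneq huv => ->; rewrite hi.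
have df := closed_diamondfree sh ch clh.
have cli a b : a \in edge_clique h u v -> b \in edge_clique h u v -> a != b -> h a b.
  rewrite !inE => /or3P[/eqP->|/eqP->|/andP[au av]] /or3P[/eqP->|/eqP->|/andP[bu bv]] ab //.
  - by rewrite eqxx in ab.
  - by rewrite hs.
  - by rewrite hs.
  - by rewrite eqxx in ab.
  - by rewrite hs.
  - by apply: (df u a v b) => //; rewrite hs.
split=> //.
  have <- : #|[set u; v]| = 2 by rewrite cards2 uv.
  by apply/subset_leq_card/subsetP=> z; rewrite !inE => /orP[]->; rewrite ?orbT.
move=> w p q wK pK qK wp wq; apply/eqP/negPn/negP=> pq; case/negP: (wK).
have all r : r \in edge_clique h u v -> h w r.
  move=> rK; have [->//|rp] := eqVneq r p; have [->//|rq] := eqVneq r q.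
  apply: (df p w q r) => //; rewrite ?(hs p w) //.
  - exact: cli.
  - by apply: cli; rewrite // eq_sym.
  - by apply: cli; rewrite // eq_sym.
  - by apply: contraNneq wK => ->.
by rewrite inE !all ?orbT // inE eqxx ?orbT.
Qed.

(** Further vertices [p] and [q] of the two cliques are nonadjacent, so a neighbour of [v] in
    neither clique would complete a claw at [v]. *)
Lemma mc_nb2 h K K' v w : simple_rel h -> claw_heavy h -> closed h -> closed_clique h K -> closed_clique h K' -> K <> K' ->
  v \in K -> v \in K' -> h v w -> w \in K \/ w \in K'.
Proof.
move=> sh ch clh mK mK' ne vK vK' vw; have [hs hi] := sh.
have oth L : closed_clique h L -> v \in L -> exists2 p, p \in L & p != v.
  case=> c _ _ vL; have : 0 < #|L :\ v| by move: c; rewrite (cardsD1 v) vL; lia.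
  by case/card_gt0P=> p; rewrite !inE => /andP[h1 h2]; exists p.
have [p pK pv] := oth K mK vK; have [q qK qv] := oth K' mK' vK'.
have adj L a : closed_clique h L -> v \in L -> a \in L -> a != v -> h v a.
  by move=> [_ c _] vL aL av; apply: c => //; rewrite eq_sym.
have vp := adj _ _ mK vK pK pv; have vq := adj _ _ mK' vK' qK qv.
have [->|wp] := eqVneq w p; first by left.
have [->|wq] := eqVneq w q; first by right.
have pq : p != q.
  apply/negP=> /eqP e; apply: ne; apply: (mc_eq sh mK mK' pK vK) => //; by rewrite e.
have npq : ~~ h p q.
  apply/negP=> hpq; apply: ne; have qK2 : q \in K.
    by apply: (mc_in mK vK pK); rewrite ?(eq_sym v) // hs.
  by apply: (mc_eq sh mK mK' qK2 vK).
have := closed_clawfree sh ch clh vw vp vq wp wq pq; rewrite (negbTE npq) orbF => /orP[] hw.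
  by left; apply: (mc_in mK vK pK); rewrite ?(eq_sym v) // hs.
by right; apply: (mc_in mK' vK' qK); rewrite ?(eq_sym v) // hs.
Qed.

(** A completed vertex becomes simplicial and remains so in the closure ([simplicial_completes_to]);
    undoing its completion step relies on this. *)
Definition simplicial h x := forall y z, h x y -> h x z -> y != z -> h y z.

Lemma simplicial_complete g x : simple_rel g -> simplicial (complete_at g x) x.
Proof.
move=> [gs gi] y z; rewrite /complete_at gi /= !andbF !orbF => -> -> ->; by rewrite orbT.
Qed.

(** If [x] is adjacent to the completed vertex [y], its neighbours other than [y] are already
    neighbours of [y] and become pairwise adjacent with the rest. *)
Lemma simplicial_step g x y : simple_rel g -> simplicial g x -> simplicial (complete_at g y) x.
Proof.
move=> sg sx; have [gs gi] := sg => a b; rewrite {1 2}/complete_at.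
case: (boolP (g y x)) => yx /=; last first.
  by rewrite !andbF !orbF => xa xb ab; apply: complete_at_sub; exact: sx.
have all c : g x c || (x != c) && g y c -> c = y \/ g y c.
  case/orP=> [xc|/andP[_]]; last by right.
  have [->|cy] := eqVneq c y; first by left.
  by right; rewrite gs; apply: sx => //; rewrite gs.
move=> xa xb ab; have [ea|ya] := all a xa; have [eb|yb] := all b xb.
- by rewrite ea eb eqxx in ab.
- by rewrite ea; apply: complete_at_sub.
- by rewrite eb gs in ya *; apply: complete_at_sub.
- by rewrite /complete_at ab ya yb orbT.
Qed.

Lemma simplicial_completes_to g h x : completes_to g h -> simple_rel g -> simplicial g x -> simplicial h x.
Proof.
by elim=> // {h}g' y h _ _ IH sg sx; apply: IH; [exact: complete_at_simple|exact: simplicial_step].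
Qed.

(* The graph induced on a maximal clique of the closure has no cutvertex:
   no completion step can join the two sides of a cutvertex. *)
Lemma mc_2con g h K c (S1 S2 : {set V}) : completes_to g h -> simple_rel g -> closed_clique h K ->
  S1 \subset K -> S2 \subset K -> S1 != set0 -> S2 != set0 ->
  (forall k, k \in K -> [|| k \in S1, k \in S2 | k == c]) ->
  ~ (forall a b, a \in S1 -> b \in S2 -> a != b /\ ~~ g a b).
Proof.
move=> e sg mK s1 s2 n1 n2 cov; elim: e sg mK => [{h}g' sg [_ cK _]|{h}g' x h el ex IH sg mK] sep.
  case/set0Pn: n1 => a a1; case/set0Pn: n2 => b b2; have [ab /negP[]] := sep a b a1 b2.
  by apply: cK => //; [exact: (subsetP s1)|exact: (subsetP s2)].
have [gs gi] := sg; have [cs ci] := complete_at_simple x sg.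
apply: (IH (complete_at_simple x sg) mK) => a b a1 b2.
have [ab nab] := sep a b a1 b2; split=> //; apply/negP; rewrite /complete_at (negbTE nab) ab /=.
case/andP=> xa xb.
have gh p q : g' p q -> h p q by move=> h1; apply: (completes_to_sub ex); exact: complete_at_sub.
have aK := subsetP s1 _ a1; have bK := subsetP s2 _ b2.
have xK : x \in K by apply: (mc_in mK aK bK ab); exact: gh.
have S12 p q : p \in S1 -> q \in S2 -> g' p q -> False.
  by move=> h1 h2 h3; have [_ /negP] := sep p q h1 h2.
have xc : x = c.
  case/or3P: (cov x xK) => [h1|h1|/eqP//]; first by case: (S12 x b).
  by case: (S12 a x) => //; rewrite gs.
have inv p q : p \in S1 -> detour_rel g' x p q -> q \in S1.
  move=> p1 /and3P[xp xq hpq].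
  have pK := subsetP s1 _ p1.
  have qK : q \in K.
    have [->//|qa] := eqVneq q a.
    have xa' : x != a by apply: contraTneq xa => ->; rewrite gi.
    apply: (mc_in mK xK aK xa'); first by apply: gh; rewrite gs.
    by apply: (completes_to_sub ex); rewrite /complete_at qa xa xq orbT.
  case/or3P: (cov q qK) => [//|q2|/eqP qc]; last by rewrite qc xc gi in xq.
  have [pq npq] := sep p q p1 q2; exfalso.
  have mid r : g' p r -> g' q r -> r != c -> False.
    move=> pr qr rc; have rK : r \in K.
      by apply: (mc_in mK pK qK pq); apply: gh; rewrite gs.
    case/or3P: (cov r rK) => [r1|r2|]; last by rewrite (negbTE rc).
      by apply: (S12 r q r1 q2); rewrite gs.
    exact: (S12 p r).
  case/or3P: hpq => [h1|h1|/existsP[y /and3P[/and3P[xy _ _] yp yq]]].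
  - by rewrite h1 in npq.
  - by have [r [h2 h3 h4]] := ore_pair_common2 c sg h1; exact: (mid r).
  - by apply: (mid y); rewrite ?(gs _ y) // eq_sym -xc.
have cab := el a b xa xb.
have cS1 : {in S1, forall p q, connect (detour_rel g' x) p q -> q \in S1}.
  move=> p p1 q /connectP[s]; elim: s p p1 => [|r s IHs] p p1 /=; first by move=> _ ->.
  by case/andP=> pr ps lq; apply: (IHs r) => //; exact: inv pr.
by have [] := sep b b (cS1 a a1 b cab) b2; rewrite eqxx.
Qed.

Section Mc2.
Variables (g h : rel V) (K : {set V}).
Hypotheses (e : completes_to g h) (sg : simple_rel g) (mK : closed_clique h K) (K3 : 2 < #|K|).

(** Otherwise [c] would separate [v] from the rest of [K]. *)
Lemma mc_nb v c : v \in K -> v != c -> exists w, [/\ w \in K, w != c, w != v & g v w].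
Proof.
move=> vK vc; case: (pickP (fun w => [&& w \in K, w != c, w != v & g v w])) => [w /and4P|no]; first by exists w.
case: (@mc_2con g h K c [set v] (K :\ v :\ c)) => //.
- by rewrite sub1set.
- by apply/subsetP=> z; rewrite !inE => /and3P[].
- by apply/set0Pn; exists v; rewrite inE.
- rewrite -card_gt0; have := cardsD1 v K; have := cardsD1 c (K :\ v).
  by case: (c \in _); case: (v \in _) => /=; move: K3; lia.
- by move=> k kK; rewrite !inE kK andbT; case: (k == v) => //=; case: (k == c).
move=> a b; rewrite !inE => /eqP-> /and3P[bc bv bK]; split; first by rewrite eq_sym.
by apply/negP=> vb; have := no b; rewrite bK bc bv vb.
Qed.

(** [c] would separate a further vertex of [K] from [a] and [b]. *)
Lemma mc_pair a b c : a \in K -> b \in K -> c != a -> c != b ->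
  (forall w, w \in K -> g a w -> w = b \/ w = c) ->
  (forall w, w \in K -> g b w -> w = a \/ w = c) ->
  forall k, k \in K -> [\/ k = a, k = b | k = c].
Proof.
move=> aK bK ca cb ha hb k kK.
have [->|ka] := eqVneq k a; first by constructor 1.
have [->|kb] := eqVneq k b; first by constructor 2.
have [->|kc] := eqVneq k c; first by constructor 3.
exfalso; apply: (@mc_2con g h K c [set a; b] (K :\ a :\ b :\ c)) => //.
- by apply/subsetP=> z; rewrite !inE => /orP[]/eqP->.
- by apply/subsetP=> z; rewrite !inE => /and4P[].
- by apply/set0Pn; exists a; rewrite !inE eqxx.
- by apply/set0Pn; exists k; rewrite !inE ka kb kc.
- by move=> z zK; rewrite !inE zK andbT; case: (z == a); case: (z == b); case: (z == c).
move=> p q; rewrite !inE => /orP[]/eqP-> /and4P[qc qb qa qK]; rewrite eq_sym; split=> //; apply/negP=> pq.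
  by case: (ha q qK pq) => e1; move: qb qc; rewrite e1 eqxx.
by case: (hb q qK pq) => e1; move: qa qc; rewrite e1 eqxx.
Qed.

End Mc2.

End Closed.

(** * Induced paths and holes *)

Section IPath.
Variables (V : finType) (g : rel V).
Hypotheses (gs : symmetric g) (gi : irreflexive g).
Implicit Types (u v w x y z : V) (p q s : seq V) (X Y Z K : {set V}).

Definition link x s := [&& x \notin s, all (fun z => ~~ g x z) (behead s) &
  if s is y :: _ then g x y else true].

Fixpoint induced_path s := if s is x :: s' then link x s' && induced_path s' else true.

Lemma lnkP x y s : link x (y :: s) -> forall z, z \in y :: s -> x != z /\ (g x z -> z = y).
Proof.
case/and3P=> h1 /allP h2 h3 z zs; split; first by apply: contraNneq h1 => ->.
by move: zs; rewrite inE => /orP[/eqP//|/h2 /negbTE ->].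
Qed.

Lemma lnkI x y s : uniq (y :: s) -> g x y -> (forall z, z \in y :: s -> x != z /\ (g x z -> z = y)) ->
  link x (y :: s).
Proof.
move=> /= /andP[ys us] xy h; rewrite /link xy andbT; apply/andP; split.
  by apply/negP=> xs; have [] := h x xs; rewrite eqxx.
apply/allP=> z zs; apply/negP=> xz; have [_ /(_ xz) e] := h z (mem_behead zs).
by rewrite -e zs in ys.
Qed.

Lemma ipath_uniq s : induced_path s -> uniq s.
Proof. by elim: s => //= x s IH /andP[/and3P[-> _ _] /IH]. Qed.

Lemma ipath_sorted s : induced_path s -> sorted g s.
Proof.
elim: s => //= x [|y s] IH //= /andP[/and3P[_ _ ->] h] /=; exact: IH.
Qed.

Lemma ipath_cat d p q : induced_path p -> induced_path q -> p != [::] -> q != [::] ->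
  g (last d p) (head d q) ->
  (forall x y, x \in p -> y \in q -> x != y /\ (g x y -> x = last d p /\ y = head d q)) ->
  induced_path (p ++ q).
Proof.
elim: p => // x p IH /= /andP[lx ip] iq _ q0 lk sep.
case: p IH lx ip lk sep => [|y p] IH lx ip lk sep.
  rewrite /= iq andbT; case: q iq q0 lk sep {IH} => // z q iq _ /= lk sep.
  apply: lnkI => //; first exact: ipath_uniq iq.
  by move=> t tq; have [h1 h2] := sep x t (mem_head _ _) tq; split=> // /h2[].
have IHq : induced_path ((y :: p) ++ q).
  apply: IH => // a b ap bq; have [h1 h2] := sep a b (mem_behead (s := x :: _) ap) bq; split=> //.
rewrite [induced_path _]/= -/induced_path; apply/andP; split=> //.
have /andP[/and3P[xn _ _] up] : link x (y :: p) && uniq (y :: p) by rewrite lx ipath_uniq.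
rewrite cat_cons; apply: lnkI; first by rewrite -cat_cons; exact: ipath_uniq.
  by case/and3P: lx.
move=> z; rewrite -cat_cons mem_cat => /orP[zp|zq]; first exact: lnkP lx z zp.
have [h1 h2] := sep x z (mem_head _ _) zq; split=> // /h2[e _].
by case/negP: xn; rewrite e /= mem_last.
Qed.

Lemma ipath_catl p q : induced_path (p ++ q) -> induced_path p.
Proof.
elim: p => //= x p IH /andP[/and3P[h1 h2 h3] /IH ->]; rewrite andbT.
move: h1; rewrite mem_cat negb_or => /andP[h1 _].
case: p {IH} h1 h2 h3 => [//|y p] h1 /=; rewrite all_cat => /andP[h2 _] h3.
by rewrite /link h1 /= h2.
Qed.

Lemma ipath_catr p q : induced_path (p ++ q) -> induced_path q.
Proof. by elim: p => //= x p IH /andP[_ /IH]. Qed.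

Lemma ipath_sep d p q x y : induced_path (p ++ q) -> x \in p -> y \in q ->
  x != y /\ (g x y -> x = last d p /\ y = head d q).
Proof.
elim: p => // a p IH /=; case/andP=> lk ip; rewrite inE => /orP[/eqP->|xp] yq; last first.
  have [h1 h2] := IH ip xp yq; split=> // /h2[-> ->]; by case: p xp {IH h1 h2 lk ip}.
case: p lk ip {IH} => [|b p] lk ip /=.
  case: q yq lk ip => // c q yq lk ip; have [h1 h2] := lnkP lk yq; by split=> // /h2.
have yq' : y \in b :: (p ++ q) by rewrite inE mem_cat yq !orbT.
have [h1 h2] := lnkP lk yq'; split=> // /h2 e.
have := ipath_uniq ip; rewrite cat_uniq => /and3P[_ /hasPn/(_ _ yq)].
by rewrite e inE eqxx.
Qed.

Lemma ipath_lnk d p q : induced_path (p ++ q) -> p != [::] -> q != [::] -> g (last d p) (head d q).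
Proof.
move/ipath_sorted; case: p => //= x p; rewrite cat_path => /andP[_] + _.
by case: q => //= y q /andP[].
Qed.

Lemma ipath_rev p : induced_path p -> induced_path (rev p).
Proof.
elim: p => // x p IH; case: p IH => [|y p] IH // ip.
have ip' : induced_path (y :: p) by case/andP: ip.
rewrite rev_cons -cats1; apply: (@ipath_cat x) => //; first exact: IH.
- by rewrite -size_eq0 size_rev.
- rewrite last_rev' /= gs; by case/andP: ip => /and3P[].
move=> a b; rewrite mem_rev => ap; rewrite inE => /eqP->; rewrite eq_sym.
have [h1 h2] := lnkP (proj1 (andP ip)) ap; split=> //; rewrite gs => /h2 ->.
by rewrite last_rev'.
Qed.

Lemma ipath_consec p a b : induced_path p -> a \in p -> b \in p -> g a b ->
  exists p1 p2, p = p1 ++ a :: b :: p2 \/ p = p1 ++ b :: a :: p2.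
Proof.
elim: p => // x p IH /= /andP[lk ip]; rewrite !inE => /orP[/eqP ea|ap] /orP[/eqP eb|bp] ab.
- by rewrite ea eb gi in ab.
- case: p bp lk {IH ip} => // y p bp lk; have [_ h] := lnkP lk bp.
  by exists [::], p; left; rewrite /= -ea (h _) // -ea.
- case: p ap lk {IH ip} => // y p ap lk; have [_ h] := lnkP lk ap.
  by exists [::], p; right; rewrite /= -eb (h _) // -eb gs.
have [p1 [p2 [->|->]]] := IH ip ap bp ab; exists (x :: p1), p2; [by left|by right].
Qed.

Definition inX Y : rel V := [rel a b | [&& a \in Y, b \in Y & g a b]].

Lemma inX_sym Y : symmetric (inX Y).
Proof. by move=> a b; rewrite /inX /= [g a b]gs; case: (a \in Y); case: (b \in Y). Qed.

Lemma split_lasthas (P : pred V) s : has P s -> exists s1 z s2, [/\ s = s1 ++ z :: s2, P z & ~~ has P s2].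
Proof.
elim: s => //= x s IH; case: (boolP (has P s)) => [/IH [s1 [z [s2 [-> Pz n]]]] _|n].
  by exists (x :: s1), z, s2.
by rewrite orbF => Px; exists [::], x, s.
Qed.

(** A vertex [u] is put in front of an induced path by cutting the path at the last neighbour of
    [u], or at [u] itself if it occurs there. *)
Lemma ipath_ex Y u v : connect (inX Y) u v -> u \in Y ->
  exists s, [/\ induced_path (u :: s), last u s = v & {subset u :: s <= Y}].
Proof.
case/connectP=> p; elim: p u => [|w p IH] u /=.
  by move=> _ -> uY; exists [::]; split=> // z; rewrite inE => /eqP->.
case/andP=> /and3P[uY wY uw] pp lv _; have [s [is_ ls sub]] := IH w pp lv wY.
case: (boolP (u \in w :: s)) => us.
  have [s1 [s2 es]] : exists s1 s2, w :: s = s1 ++ u :: s2 by case/splitPr: us => a b; exists a, b.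
  have iu : induced_path (u :: s2) by apply: (@ipath_catr s1); rewrite -es.
  exists s2; split; first exact: iu.
  - by rewrite -ls -[last w s](last_cons w w) es last_cat.
  - by move=> z zs; apply: sub; rewrite es mem_cat zs orbT.
have hs : has (g u) (w :: s) by rewrite /= uw.
have [s1 [z [s2 [es uz n]]]] := split_lasthas hs.
have iz : induced_path (z :: s2) by apply: (@ipath_catr s1); rewrite -es.
have subz t : t \in z :: s2 -> t \in w :: s by move=> h; rewrite es mem_cat h orbT.
exists (z :: s2); split.
- rewrite [induced_path _]/= -/induced_path -[_ && induced_path s2]/(induced_path (z :: s2)) iz andbT.
  apply: lnkI => //; first exact: ipath_uniq.
  move=> t tz; split; first by apply: contraNneq us => ->; exact: subz.
  move=> ut; move: tz; rewrite inE => /orP[/eqP//|ts].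
  by case/negP: n; apply/hasP; exists t.
- by rewrite -ls -[last w s](last_cons w w) es last_cat.
- by move=> t; rewrite inE => /orP[/eqP->//|/subz]; exact: sub.
Qed.

(* tri p q: p and q are induced paths, adjacent only through their two heads
   and through their two ends; together they bound a hole. *)
Definition tri p q := [/\ induced_path p, induced_path q, 1 < size p, 1 < size q &
  forall d, [/\ g (head d p) (head d q), g (last d p) (last d q) &
  forall x y, x \in p -> y \in q -> x != y /\
    (g x y -> (x = head d p /\ y = head d q) \/ (x = last d p /\ y = last d q))]].

Lemma tri_sym p q : tri p q -> tri q p.
Proof.
case=> ip iq sp sq h; split=> // d; have [h1 h2 h3] := h d; rewrite !(gs _ (_ d p)); split=> // x y xq yp.
by have [h4 h5] := h3 y x yp xq; rewrite eq_sym gs; split=> // /h5[[]|[]]; [left|right].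
Qed.

(** An induced cycle of length at least four, opened at [x]; [hole_rot] reopens it at any other
    vertex. *)
Definition hole x p := [/\ 2 < size p, induced_path p, x \notin p, g x (head x p) &
  g x (last x p) /\ forall z, z \in p -> g x z -> z = head x p \/ z = last x p].

Lemma head_in d p : p != [::] -> head d p \in p.
Proof. by case: p => //= a p _; rewrite inE eqxx. Qed.
Lemma last_in d p : p != [::] -> last d p \in p.
Proof. by case: p => //= a p _; rewrite mem_last. Qed.

Lemma hole_tri a p q : tri (a :: p) q -> hole a (p ++ rev q).
Proof.
case=> ip iq sp sq h; have [h1 h2 h3] := h a.
have p0 : p != [::] by case: (p) sp.
have q0 : q != [::] by case: (q) sq.
have rq0 : rev q != [::] by rewrite -size_eq0 size_rev size_eq0.
have lp : last a (a :: p) = last a p by [].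
have hd : head a (p ++ rev q) = head a p by case: (p) p0.
have ls : last a (p ++ rev q) = head a q.
  by rewrite last_cat; move: rq0 (last_rev' a q); case: (rev q).
split.
- by rewrite size_cat size_rev; move: sp sq => /=; lia.
- apply: (@ipath_cat a) => //; first by case/andP: ip.
  + exact: ipath_rev.
  + by rewrite head_rev' -lp.
  move=> x y xp; rewrite mem_rev => yq.
  have [h4 h5] := h3 x y (mem_behead (s := a :: p) xp) yq; split=> // /h5[[ex _]|[-> ->]].
    by have /andP[] := ipath_uniq ip; rewrite -[X in X \notin _]/(head a (a :: p)) -ex xp.
  by rewrite head_rev'.
- rewrite mem_cat mem_rev negb_or; apply/andP; split; first by have /andP[] := ipath_uniq ip.
  by apply/negP=> aq; have [] := h3 a a (mem_head _ _) aq; rewrite eqxx.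
- rewrite hd; case: (p) p0 ip => //= b p' _ /andP[/and3P[_ _ h4] _]; exact: h4.
split; first by rewrite ls.
move=> z; rewrite mem_cat mem_rev hd ls => /orP[zp|zq] az.
  left; case: (p) zp ip => // b p' zp /andP[lk _]; by have [_ /(_ az)] := lnkP lk zp.
have [_ /(_ az) [[_ ->]|[ea _]]] := h3 a z (mem_head _ _) zq; first by right.
have /andP[+ _] := ipath_uniq ip; rewrite {1}ea lp => /negP[]; exact: last_in.
Qed.

Lemma hole_rot1 x y p : hole x (y :: p) -> hole y (rcons p x).
Proof.
case=> sz ip xp xy [xl hx]; rewrite /= in sz xy xl.
have p0 : p != [::] by case: (p) sz.
have up := ipath_uniq ip; have /andP[lk ip'] := ip.
have lp : last x (y :: p) = last x p by case: (p) p0.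
split.
- by rewrite size_rcons.
- rewrite -cats1; apply: (@ipath_cat x) => //.
    by rewrite /= gs; move: xl; case: (p) p0.
  move=> a b ap; rewrite inE => /eqP->; split.
    by apply: contraNneq xp => <-; rewrite inE ap orbT.
  rewrite gs => xa; have [ea|->] := hx a (mem_behead (s := y :: p) ap) xa; last by rewrite lp.
  by move: up; rewrite /= -[y]/(head x (y :: p)) -ea ap.
- rewrite mem_rcons inE negb_or; move: up => /= /andP[-> _]; rewrite andbT.
  by apply: contraNneq xp => ->; rewrite inE eqxx.
- case: (p) p0 lk => //= b p' _ /and3P[_ _ h]; exact: h.
rewrite last_rcons; split; first by rewrite gs.
move=> z; rewrite mem_rcons inE => /orP[/eqP->|zp] yz; first by right.
left; case: (p) zp lk => // b p' zp lk; by have [_ /(_ yz)] := lnkP lk zp.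
Qed.

Lemma hole_rot x p y : hole x p -> y \in x :: p ->
  exists p', hole y p' /\ y :: p' =i x :: p.
Proof.
have [n] := ubnP (index y (x :: p)); elim: n x p => // n IH x p.
case: p => [|z p]; first by move=> _ [].
rewrite /=; have [->|nxy] := eqVneq x y; first by move=> _ hh _; exists (z :: p).
rewrite ltnS => lt hh; rewrite inE eq_sym (negbTE nxy) /= => yp.
have h1 := hole_rot1 hh.
have [||p' [hp' e]] := IH z (rcons p x) _ h1.
- apply: leq_ltn_trans _ lt; rewrite -cats1 -cat_cons index_cat yp /=; case: eqP => //.
- by rewrite -cats1 -cat_cons mem_cat yp.
exists p'; split=> // t; rewrite e !inE mem_rcons !inE.
by case: (t == x); case: (t == z); rewrite ?orbT.
Qed.

Lemma hole_rev x p : hole x p -> hole x (rev p).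
Proof.
case=> sz ip xp xy [xl hx]; split; rewrite ?size_rev ?mem_rev ?head_rev' ?last_rev' //; first exact: ipath_rev.
split=> // z; rewrite mem_rev => zp xz; have [] := hx z zp xz; by [right|left].
Qed.

Lemma hole_size_split x p : hole x p -> exists y q z, p = y :: rcons q z /\ q != [::].
Proof.
case=> sz _ _ _ _; case: p sz => // y p; case/lastP: p => // q z; case: q => // a q _.
by exists y, (a :: q), z.
Qed.

Lemma hole_ends x p : hole x p -> ~~ g (head x p) (last x p) /\ head x p != last x p.
Proof.
move=> hh; have [y [q [z [e q0]]]] := hole_size_split hh.
have [_ ip _ _ _] := hh; rewrite e /= last_rcons.
rewrite e -cats1 -cat_cons in ip.
have [h1 h2] := @ipath_sep x _ _ y z ip (mem_head _ _) (mem_head _ _).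
split=> //; apply/negP=> /h2 [e1 _]; have := ipath_uniq (ipath_catl ip).
by rewrite /= {1}e1 /= last_in.
Qed.

End IPath.

(** * Inserting the neighbours of a hole into it *)

Section Fill.
Variables (V : finType) (g : rel V).
Hypotheses (sg : simple_rel g) (cg : claw_heavy g) (clg : closed g).
Let gs := sg.1.
Let gi := sg.2.
Implicit Types (u v w x y z : V) (p q s : seq V) (X Y Z K : {set V}).

Lemma clique_path K x s : (forall a b, a \in K -> b \in K -> a != b -> g a b) ->
  uniq (x :: s) -> {subset x :: s <= K} -> path g x s.
Proof.
move=> cK; elim: s x => //= y s IH x /and3P[]; rewrite inE negb_or => /andP[xy xs] ys us sub.
rewrite cK ?sub ?inE ?eqxx ?orbT //=; apply: IH; first by rewrite /= ys.
by move=> t ts; apply: sub; rewrite inE ts orbT.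
Qed.

Lemma clique_sorted K s : (forall a b, a \in K -> b \in K -> a != b -> g a b) ->
  uniq s -> {subset s <= K} -> sorted g s.
Proof. by case: s => //= x s *; exact: (@clique_path K). Qed.

(** Each vertex of [Z] is placed in the first edge of the path whose clique contains it; vertices
    assigned to the same edge are inserted together, as they lie in a common clique with its
    ends. *)
Lemma fill p x Z : path g x p -> uniq (x :: p) ->
  (forall z, z \in Z -> z \notin x :: p) ->
  (forall z, z \in Z -> exists p1 a b p2, x :: p = p1 ++ a :: b :: p2 /\ z \in edge_clique g a b) ->
  exists q, [/\ path g x q, last x q = last x p, uniq (x :: q) &
    forall t, (t \in x :: q) = (t \in x :: p) || (t \in Z)].
Proof.
elim: p x Z => [|y p IH] x Z.
  move=> _ _ _ hZ; exists [::]; split=> // t; case: (boolP (t \in Z)) => tZ; last by rewrite orbF.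
  by have [p1 [a [b [p2 []]]]] := hZ t tZ; case: p1 => // ? [].
move=> /= /andP[xy py] /andP[xnp /andP[ynp up]] nZ hZ.
pose Z1 := [set z in Z | z \in edge_clique g x y]; pose Z2 := Z :\: Z1.
have nZ2 z : z \in Z2 -> z \notin y :: p.
  by rewrite inE => /andP[_ /nZ]; rewrite inE negb_or => /andP[].
have [|z zZ2|q [pq lq uq eq]] := IH y Z2 py _ nZ2; first by rewrite /= ynp.
  have /setDP[zZ zn1] := zZ2; have [p1 [a [b [p2 [e zk]]]]] := hZ z zZ.
  case: p1 e => [|c p1] /= [e1 e2]; last by exists p1, a, b, p2.
  by move: zn1; rewrite inE zZ /= e1 e2 => /negP[]; move: e2; case: (p2) => *.
have mK := mc_kq sg cg clg xy; have [_ cK _] := mK.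
have u1 : uniq (x :: enum Z1).
  rewrite /= enum_uniq andbT mem_enum inE; apply/negP=> /andP[/nZ + _].
  by rewrite inE eqxx.
exists (enum Z1 ++ y :: q).
have mem t : (t \in x :: enum Z1 ++ y :: q) = (t \in [:: x, y & p]) || (t \in Z).
  rewrite inE mem_cat mem_enum eq /Z2 in_setD /Z1 in_set; move: (t \in edge_clique g x y) => b.
  by rewrite !in_cons; case: (t \in Z); case: b; case: (t == x); case: (t == y); case: (t \in p).
have yK : y \in edge_clique g x y by rewrite inE eqxx orbT.
have xK : x \in edge_clique g x y by rewrite inE eqxx.
have subK : {subset x :: enum Z1 <= edge_clique g x y}.
  by move=> t; rewrite inE => /orP[/eqP->//|]; rewrite mem_enum inE => /andP[].
split=> //.
- rewrite cat_path (clique_path cK u1 subK) /= pq andbT.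
  apply: cK => //; first by apply: subK; exact: mem_last.
  apply/negP=> /eqP e; have := mem_last x (enum Z1); rewrite e inE mem_enum inE => /orP[/eqP e1|].
    by rewrite e1 gi in xy.
  by case/andP=> /nZ; rewrite !inE eqxx orbT.
- by rewrite last_cat /= lq.
have yqn t : t \in enum Z1 -> t \notin y :: q.
  rewrite mem_enum eq => tZ; rewrite in_setD tZ orbF; apply/negP=> tp.
  by move: tZ; rewrite in_set => /andP[/nZ]; rewrite in_cons tp orbT.
rewrite cat_uniq enum_uniq uq andbT; apply/andP; split; last by apply/hasPn=> t ty; apply/negP=> /yqn; rewrite ty.
have xZ : x \notin Z by apply/negP=> /nZ; rewrite mem_head.
by rewrite mem_cat mem_enum eq in_setD in_set (negbTE xZ) (negbTE xnp).
Qed.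

Definition NS X s := [set w in X | (w \in s) || has (g w) s].

(** The two neighbours of [x] on the hole are nonadjacent, so any other neighbour of [x] is joined
    to one of them by claw-freeness. *)
Lemma hole_nb x p w : hole g x p -> g w x ->
  [\/ w = head x p, w = last x p, g w (head x p) | g w (last x p)].
Proof.
move=> hh wx; have [h1 h2] := hole_ends hh; have [_ _ _ xh [xl _]] := hh.
have [->|n1] := eqVneq w (head x p); first by constructor 1.
have [->|n2] := eqVneq w (last x p); first by constructor 2.
rewrite gs in wx; have := closed_clawfree sg cg clg wx xh xl n1 n2 h2.
by rewrite (negbTE h1) orbF => /orP[]; [constructor 3|constructor 4].
Qed.

(* Each vertex of N[hole] outside the hole lies in the maximal clique of an
   edge of the hole and can be inserted there. *)
Lemma hole_ham X x p : hole g x p -> {subset x :: p <= X} -> NS X (x :: p) = X -> ham_on g X.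
Proof.
move=> hh sub eNS; have [sz ip xp xh [xl hx]] := hh.
pose l := last x p; pose Z := X :\: [set t in x :: p].
(* [Z2] goes into the closing edge [l x] of the cycle, [Z1] into the path [x p]. *)
pose Z2 := [set z in Z | z \in edge_clique g l x]; pose Z1 := Z :\: Z2.
have p0 : p != [::] by case: (p) sz.
have ux : uniq (x :: p) by rewrite /= xp (ipath_uniq ip).
have px : path g x p.
  by have := ipath_sorted ip; case: (p) p0 xh => //= a p' _ -> .
have ndj z : z \in Z -> z \notin x :: p by rewrite !inE => /andP[].
have glx : g l x by rewrite gs.
have [q [pq lq uq eq]] : exists q, [/\ path g x q, last x q = last x p, uniq (x :: q) &
    forall t, (t \in x :: q) = (t \in x :: p) || (t \in Z1)].
  apply: fill => // [z /setDP[zZ _]|z /setDP[zZ zn2]]; first exact: ndj.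
  have zX : z \in X by move: zZ; rewrite inE => /andP[].
  have znp := ndj z zZ.
  have : z \in NS X (x :: p) by rewrite eNS.
  rewrite inE zX (negbTE znp) => /hasP[v vs zv].
  have [a [b [as_ bs_ ab [za zb]]]] : exists a b, [/\ a \in x :: p, b \in x :: p, g a b & g z a /\ g z b].
    have [p' [hh' e']] := hole_rot gs hh vs; have [sz' _ _ vh' [vl' _]] := hh'.
    have p'0 : p' != [::] by case: (p') sz'.
    have hin : head v p' \in x :: p by rewrite -e' inE head_in ?orbT.
    have lin : last v p' \in x :: p by rewrite -e' inE last_in ?orbT.
    case: (hole_nb hh' zv) => [e|e|e|e].
    - by rewrite e hin in znp.
    - by rewrite e lin in znp.
    - by exists v, (head v p').
    - by exists v, (last v p').
  have zk c e : g z c -> g z e -> z \in edge_clique g c e by move=> h1 h2; rewrite inE h1 h2 !orbT.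
  have main c : c \in p -> g x c -> g z c -> g z x ->
    exists p1 a0 b0 p2, x :: p = p1 ++ a0 :: b0 :: p2 /\ z \in edge_clique g a0 b0.
    move=> cp xc zc zx; have [ec|ec] := hx c cp xc.
      exists [::], x, c, (behead p); split; last exact: zk.
      by rewrite /= ec; case: (p) p0.
    by move: zn2; rewrite inE zZ zk // /l -ec.
  move: as_ bs_; rewrite !inE => /orP[/eqP ea|ap] /orP[/eqP eb|bp].
  - by rewrite ea eb gi in ab.
  - by apply: (main b) => //; rewrite -ea.
  - by apply: (main a) => //; rewrite -eb // gs.
  have [p1 [p2 [e|e]]] := ipath_consec gs gi ip ap bp ab.
    by exists (x :: p1), a, b, p2; split; [rewrite e|exact: zk].
  by exists (x :: p1), b, a, p2; split; [rewrite e|exact: zk].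
have mK := mc_kq sg cg clg glx; have [_ cK _] := mK.
have lK : l \in edge_clique g l x by rewrite inE eqxx.
have xK : x \in edge_clique g l x by rewrite inE eqxx orbT.
have Z2s t : t \in enum Z2 -> [/\ t \in Z, t \notin x :: p & t \in edge_clique g l x].
  by rewrite mem_enum inE => /andP[h1 h2]; split=> //; exact: ndj.
have lin : l \in x :: p by rewrite inE last_in ?orbT.
have u2 : uniq (l :: enum Z2).
  by rewrite /= enum_uniq andbT; apply/negP=> /Z2s[_]; rewrite lin.
have p2 : path g l (enum Z2).
  by apply: (clique_path cK u2) => t; rewrite inE => /orP[/eqP->//|/Z2s[]].
apply/ham_onP; exists x, (q ++ enum Z2).
have mem t : t \in x :: q ++ enum Z2 = (t \in X).
  rewrite -cat_cons mem_cat eq mem_enum; have := sub t.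
  rewrite /Z1 in_setD /Z2 in_set; move: (t \in edge_clique g l x) => b; rewrite !inE.
  case: (t == x); case: (t \in p) => //=; rewrite ?orbT; try by move/(_ isT)->.
  by move=> _; case: (t \in X); case: b.
have unn : uniq (x :: q ++ enum Z2).
  rewrite -cat_cons cat_uniq uq enum_uniq andbT; apply/hasPn=> t /Z2s [h1 h2 h3].
  by rewrite eq (negbTE h2) /Z1 in_setD /Z2 in_set h1 h3.
split=> //.
- have : {subset p <= q ++ enum Z2}.
    move=> t tp; have tx : t != x by apply: contraNneq xp => <-.
    have := mem t; rewrite inE (negbTE tx) /= => ->; apply: sub; by rewrite inE tp orbT.
  by move/(uniq_leq_size (ipath_uniq ip)) => h; apply: leq_trans h; exact: ltnW.
- by rewrite cat_path pq lq.
- rewrite last_cat lq -/l; apply: cK => //.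
    by have := mem_last l (enum Z2); rewrite inE => /orP[/eqP->//|/Z2s[]].
  apply/negP=> /eqP e; have := mem_last l (enum Z2); rewrite e inE => /orP[/eqP e1|/Z2s[_]].
    by rewrite e1 gi in glx.
  by rewrite inE eqxx.
Qed.

End Fill.

(** * Paths between cliques, 2-connected vertex sets and holes *)

Section Paths.
Variables (V : finType) (g : rel V).
Hypothesis sg : simple_rel g.
Let gs := sg.1.
Let gi := sg.2.
Implicit Types (u v w x y z : V) (p q s t : seq V) (X Y Z K G : {set V}).

Definition clique_path_in K K' s :=
  [/\ s != [::], sorted g s, uniq s & forall d, head d s \in K /\ last d s \in K'].

Lemma pth_cat K1 K K3 s t : (forall a b, a \in K -> b \in K -> a != b -> g a b) ->
  clique_path_in K1 K s -> clique_path_in K K3 t -> (forall z, z \in s -> z \notin t) -> clique_path_in K1 K3 (s ++ t).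
Proof.
case: s => [|x s] cK [//= _ ps us hs]; case: t => [|y t] [//= _ pt ut ht] dj.
have [xK lsK] := hs x; have [yK ltK] := ht y; rewrite /= in xK lsK yK ltK; split=> //.
- rewrite /= cat_path ps /= pt andbT; apply: cK => //.
  by apply/negP=> /eqP e; have := dj _ (mem_last x s); rewrite e inE eqxx.
- rewrite -cat_cons cat_uniq; apply/and3P; split=> //; apply/hasPn=> z zt; apply/negP=> zs.
  by have := dj z zs; rewrite zt.
- by move=> d; rewrite /= last_cat.
Qed.

Lemma pth_rev K K' s : clique_path_in K K' s -> clique_path_in K' K (rev s).
Proof.
case=> s0 ps us hs; split; rewrite ?rev_uniq //; first by rewrite -size_eq0 size_rev size_eq0.
  by rewrite sorted_rev' //.
by move=> d; rewrite head_rev' last_rev'; have [] := hs d.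
Qed.

Lemma pth1 K K' x : x \in K -> x \in K' -> clique_path_in K K' [:: x].
Proof. by []. Qed.

Lemma pth_ham K s X : (forall a b, a \in K -> b \in K -> a != b -> g a b) ->
  clique_path_in K K s -> 2 < size s -> s =i X -> ham_on g X.
Proof.
move=> cK; case: s => // x s [_ ps us hs] sz e; apply/ham_onP; exists x, s; split=> //.
have [xK lK] := hs x; apply: cK => //=; apply/negP=> /eqP e1.
by case: s sz us e1 {ps hs e xK lK} => //= y s _ /andP[+ _] e2; rewrite -e2 mem_last.
Qed.

Definition biconnected X := 2 < #|X| /\
  forall r u v, u \in X :\ r -> v \in X :\ r -> connect (inX g (X :\ r)) u v.

Lemma inX_cs Y : connect_sym (inX g Y).
Proof. by apply: sym_connect_sym; exact: inX_sym. Qed.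

Lemma connect_mono Y Y' u v : Y \subset Y' -> connect (inX g Y) u v -> connect (inX g Y') u v.
Proof.
move=> /subsetP sub; apply: connect_sub => a b /and3P[aY bY ab]; apply: connect1.
by rewrite /inX /= !sub.
Qed.

Lemma connect_clique Y K u v : (forall a b, a \in K -> b \in K -> a != b -> g a b) ->
  u \in K -> v \in K -> u \in Y -> v \in Y -> connect (inX g Y) u v.
Proof.
move=> cK uK vK uY vY; have [->|n] := eqVneq u v; first exact: connect0.
by apply: connect1; rewrite /inX /= uY vY cK.
Qed.

Lemma gate_path Y Y1 G p u : Y1 \subset Y -> path (inX g Y) u p -> last u p \in Y1 -> u \in Y ->
  (forall x y, x \in Y :\: Y1 -> y \in Y1 -> g x y -> y \in G) ->
  (forall a b, a \in G :&: Y1 -> b \in G :&: Y1 -> connect (inX g Y1) a b) ->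
  exists c, [/\ connect (inX g Y1) c (last u p), c \in Y1 & if u \in Y1 then c = u else c \in G].
Proof.
move=> sub pp lY uY gate gc; elim: p u pp lY uY => [|w p IH] u /=.
  by move=> _ uY1 _; exists u; rewrite connect0 uY1.
case/andP=> /and3P[uY wY uw] pw lY _; have [c [cl c1]] := IH w pw lY wY.
case: (boolP (w \in Y1)) => w1 hc; case: (boolP (u \in Y1)) => u1.
- exists u; split=> //; rewrite hc in cl; apply: connect_trans cl; apply: connect1.
  by rewrite /inX /= u1 w1.
- exists w; rewrite hc in cl; split=> //.
  by apply: (gate u) => //; rewrite inE u1.
- exists u; split=> //; apply: connect_trans cl; apply: gc; rewrite inE ?hc ?u1 ?andbT //.
  by apply: (gate w); rewrite ?inE ?w1 // gs.
- by exists c.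
Qed.

(** A walk of [X] that leaves [X1] comes back through [G], so it can be replaced by walks inside
    [X1] between vertices of [G]. Only these gates have to stay connected when [r] is deleted. *)
Lemma bic_gate X X1 G : biconnected X -> X1 \subset X -> 2 < #|X1| ->
  (forall x y, x \in X :\: X1 -> y \in X1 -> g x y -> y \in G) ->
  (forall r u v, u \in G :&: (X1 :\ r) -> v \in G :&: (X1 :\ r) -> connect (inX g (X1 :\ r)) u v) ->
  biconnected X1.
Proof.
move=> [_ bX] sub c1 gate gc; split=> // r u v ur vr.
have sr : X1 :\ r \subset X :\ r by exact: setSD.
have := bX r u v (subsetP sr _ ur) (subsetP sr _ vr) => /connectP[p pp ev].
have := @gate_path _ _ G _ _ sr pp; rewrite -ev ur => -[] //.
- exact: (subsetP sr).
- move=> x y; rewrite !inE => /andP[h1 /andP[h2 h3]] /andP[h4 h5]; apply: gate => //.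
  by rewrite inE h3 andbT; apply: contra h1 => ->; rewrite h2.
- by move=> a b; rewrite !in_setI => /andP[h1 h2] /andP[h3 h4]; apply: gc; rewrite in_setI ?h1 ?h3.
by move=> c [cl _ e]; rewrite -e.
Qed.

Definition comp Y x := [set w in Y | connect (inX g Y) x w].

Lemma comp_conn Y x u v : u \in comp Y x -> v \in comp Y x -> connect (inX g (comp Y x)) u v.
Proof.
suff H w : w \in Y -> connect (inX g Y) x w -> connect (inX g (comp Y x)) x w.
  rewrite !inE => /andP[uY xu] /andP[vY xv]; apply: (@connect_trans _ _ x); last exact: H.
  by rewrite inX_cs; exact: H.
move=> wY /connectP[p pp ->]; move: (connect0 (inX g Y) x); set a0 := (X in connect _ x X -> _).
suff H a : connect (inX g Y) x a -> path (inX g Y) a p -> connect (inX g (comp Y x)) a (last a p).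
  by move=> xa; exact: H.
elim: p {pp a0} a => [|y p IH] a /= xa; first by rewrite connect0.
case/andP=> /and3P[aY bY ab] pp.
have xy : connect (inX g Y) x y by apply: connect_trans xa _; apply: connect1; rewrite /inX /= aY bY.
apply: connect_trans (IH y xy pp); apply: connect1; by rewrite /inX /= !inE aY bY xa xy.
Qed.

Lemma path_conn p x Y : path g x p -> {subset x :: p <= Y} ->
  forall u v, u \in x :: p -> v \in x :: p -> connect (inX g Y) u v.
Proof.
move=> pp sub; suff H w : w \in x :: p -> connect (inX g Y) x w.
  by move=> u v up vp; apply: (@connect_trans _ _ x); [rewrite inX_cs|]; exact: H.
elim: p x pp sub => [|y p IH] x /=; first by move=> _ _; rewrite inE => /eqP->.
case/andP=> xy pp sub; rewrite inE => /orP[/eqP->//|wp].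
apply: connect_trans (IH y pp _ wp); last by move=> t tp; apply: sub; rewrite inE tp orbT.
by apply: connect1; rewrite /inX /= !sub ?inE ?eqxx ?orbT.
Qed.

Lemma hole_path x p : hole g x p -> path g x p.
Proof. by case=> sz /ipath_sorted; case: p sz => //= a p _ -> _ ->. Qed.

Lemma hole_uniq x p : hole g x p -> uniq (x :: p).
Proof. by case=> _ /ipath_uniq /= -> ->. Qed.

Lemma hole_conn x p r Y u v : hole g x p -> {subset [predD1 x :: p & r] <= Y} ->
  u \in x :: p -> v \in x :: p -> u != r -> v != r -> connect (inX g Y) u v.
Proof.
move=> hh sub up vp ur vr.
case: (boolP (r \in x :: p)) => rp.
  have [p' [hh' e]] := hole_rot gs hh rp; move: up vp; rewrite -!e !inE (negbTE ur) (negbTE vr) /= => up vp.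
  have := hole_path hh'; have := hole_uniq hh'.
  case: p' up vp e {hh'} => // y p' up vp e /andP[rn _] /= /andP[_ pp].
  apply: path_conn pp _ _ _ up vp => t tp; apply: sub.
  rewrite inE /= -e in_cons tp orbT andbT.
  by apply: contraTneq tp => ->.
apply: path_conn (hole_path hh) _ _ _ up vp => t tp; apply: sub; rewrite inE /= tp andbT.
by apply: contraNneq rp => <-.
Qed.

Lemma hole_tf x p a b c : hole g x p -> a \in x :: p -> b \in x :: p -> c \in x :: p ->
  g a b -> g a c -> b != c -> ~~ g b c.
Proof.
move=> hh ap bp cp ab ac bc; have [p' [hh' e]] := hole_rot gs hh ap.
have [h1 h2] := hole_ends hh'; have [_ _ _ _ [_ hx]] := hh'.
have ina z : z \in x :: p -> g a z -> z = head a p' \/ z = last a p'.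
  by rewrite -e inE => /orP[/eqP->|]; [rewrite gi|exact: hx].
case: (ina b bp ab) (ina c cp ac) => [eb|eb] [ec|ec]; rewrite eb ec ?eqxx // in bc *.
by rewrite gs.
Qed.

Hypotheses (cg : claw_heavy g) (clg : closed g).

Lemma hole_edge x p w v : hole g x p -> w \notin x :: p -> v \in x :: p -> g w v ->
  exists v', [/\ v' \in x :: p, g v v' & g w v'].
Proof.
move=> hh wp vp wv; have [p' [hh' e]] := hole_rot gs hh vp; have [sz _ _ vh [vl _]] := hh'.
have p0 : p' != [::] by case: (p') sz.
have hin : head v p' \in x :: p by rewrite -e inE head_in ?orbT.
have lin : last v p' \in x :: p by rewrite -e inE last_in ?orbT.
case: (hole_nb sg cg clg hh' wv) => h.
- by rewrite h hin in wp.
- by rewrite h lin in wp.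
- by exists (head v p').
- by exists (last v p').
Qed.

(** Two neighbours of [w] on the hole are adjacent, as [u] would complete a claw at [w] otherwise,
    and a hole contains no triangle. *)
Lemma hole_nb_only x p w u v v' z : hole g x p -> g w u -> (forall z, z \in x :: p -> ~~ g u z /\ u != z) ->
  v \in x :: p -> v' \in x :: p -> g v v' -> g w v -> g w v' -> z \in x :: p -> g w z ->
  z = v \/ z = v'.
Proof.
move=> hh wu un vp vp' vv wv wv' zp wz.
have [->|zv] := eqVneq z v; first by left.
have [->|zv'] := eqVneq z v'; first by right.
have ad y : y \in x :: p -> g w y -> z != y -> g z y.
  move=> yp wy zy; have [n1 n2] := un z zp; have [n3 n4] := un y yp.
  have := closed_clawfree sg cg clg wu wz wy n2 n4 zy.
  by rewrite (negbTE n1) (negbTE n3).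
have vv' : v != v' by apply: contraTneq vv => ->; rewrite gi.
by have := hole_tf hh zp vp vp' (ad v vp wv zv) (ad v' vp' wv' zv') vv'; rewrite vv.
Qed.

(** If [X] is not a clique, some [x] in it lies in two maximal cliques [Ka] and [Ky]. On an induced
    path between them that avoids [x], the stretch from the last vertex in [Ka] to the next vertex
    in [Ky] closes up with [x] to a hole. *)
Lemma bic_hole X : biconnected X -> (exists x p, hole g x p /\ {subset x :: p <= X}) \/ ham_on g X.
Proof.
move=> [cX bX].
have [cl|] := boolP [forall a in X, forall b in X, (a != b) ==> g a b].
  right; have cK a b : a \in X -> b \in X -> a != b -> g a b.
    by move=> aX bX'; move/forall_inP: cl => /(_ a aX) /forall_inP/(_ b bX') /implyP.
  apply: (@pth_ham X (enum X)) => //; last by move=> z; rewrite mem_enum.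
    split.
    - by rewrite -size_eq0 -cardE; lia.
    - by apply: (@clique_sorted _ _ X) => //; [exact: enum_uniq|move=> z; rewrite mem_enum].
    - exact: enum_uniq.
    have e0 : enum X != [::] by rewrite -size_eq0 -cardE; lia.
    by move=> d; rewrite -!(mem_enum X) head_in ?last_in.
  by rewrite -cardE.
rewrite negb_forall_in => /exists_inP[a aX]; rewrite negb_forall_in => /exists_inP[b bX'].
rewrite negb_imply => /andP[ab nab]; left.
have [r rX [ra rb]] : exists2 r, r \in X & r != a /\ r != b.
  have : 0 < #|X :\ a :\ b|.
    by move: cX; rewrite (cardsD1 a) aX (cardsD1 b (X :\ a)) !inE eq_sym ab bX'; lia.
  by case/card_gt0P=> r; rewrite !inE => /and3P[h1 h2 h3]; exists r.
have [|s [is_ ls ss]] := @ipath_ex _ g X a b _ aX.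
  have := bX r a b; rewrite !inE eq_sym ra eq_sym rb aX bX' => /(_ isT isT).
  by apply: connect_mono; exact: subsetDl.
have [x [y [xX yX [xa xy]]]] : exists x y, [/\ x \in X, y \in X, g x a /\ g x y & ~~ g a y /\ a != y].
  case: s is_ ls ss => [|x [|y s]] /= is_ ls ss; first by rewrite ls eqxx in ab.
    by case/andP: is_ => /and3P[_ _]; rewrite ls (negbTE nab).
  case/and3P: is_ => lk lk2 _; exists x, y; split.
  - by apply: ss; rewrite !inE eqxx orbT.
  - by apply: ss; rewrite !inE eqxx !orbT.
  - by split; [rewrite gs; case/and3P: lk|case/and3P: lk2].
  case/and3P: lk; rewrite !inE !negb_or => /and3P[_ h _] /andP[n _] _; by split.
move=> [nay ay]; have axn : a != x by apply: contraTneq xa => ->; rewrite gi.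
have yxn : y != x by apply: contraTneq xy => ->; rewrite gi.
pose Ka := edge_clique g x a; pose Ky := edge_clique g x y.
have mA : closed_clique g Ka by exact: mc_kq. have mY : closed_clique g Ky by exact: mc_kq.
have aA : a \in Ka by rewrite inE eqxx orbT. have yY : y \in Ky by rewrite inE eqxx orbT.
have xA : x \in Ka by rewrite inE eqxx. have xY : x \in Ky by rewrite inE eqxx.
have ne : Ka <> Ky.
  move=> e; have [_ cK _] := mA; by move: (nay); rewrite cK // e.
have sep u v : u \in Ka -> v \in Ky -> u != x -> v != x -> u != v /\ ~~ g u v.
  move=> uA vY ux vx; have uv : u != v.
    by apply/negP=> /eqP e; apply: ne; apply: (mc_eq sg mA mY uA xA) => //; rewrite e.
  split=> //; apply/negP=> gv; apply: ne; apply: (mc_eq sg mA mY uA xA) => //.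
  apply: (mc_in mY vY xY vx gv); by case: mA => _ cK _; exact: cK.
have aXx : a \in X :\ x by rewrite !inE axn.
have yXx : y \in X :\ x by rewrite !inE yxn.
have [s' [is' ls' ss']] := ipath_ex (bX x a y aXx yXx) aXx.
have [s1 [z [s2 [es zA n2]]]] : exists s1 z s2, [/\ a :: s' = s1 ++ z :: s2, z \in Ka & ~~ has (mem Ka) s2].
  by apply: split_lasthas; rewrite /= aA.
have zx : z \in X :\ x by apply: ss'; rewrite es mem_cat inE eqxx orbT.
have yA : y \notin Ka by apply/negP=> yA; have [] := sep y y yA yY yxn yxn; rewrite eqxx.
have l2 : last z s2 = y by rewrite -ls' -[last a s'](last_cons a a) es last_cat.
have ys2 : y \in s2 by case: (s2) l2 => [/= e|t s2' <- /=]; [rewrite -e zA in yA|exact: mem_last].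
have [t1 [w [t2 [et wY nt]]]] : exists t1 w t2, [/\ rev s2 = t1 ++ w :: t2, w \in Ky & ~~ has (mem Ky) t2].
  by apply: split_lasthas; rewrite has_rev; apply/hasP; exists y.
have es2 : s2 = rcons (rev t2) w ++ rev t1.
  by rewrite -[s2]revK et rev_cat rev_cons.
have iz : induced_path g (z :: rcons (rev t2) w).
  by apply: (@ipath_catl _ _ _ (rev t1)); rewrite cat_cons -es2; apply: (@ipath_catr _ _ s1); rewrite -es.
have inXx (t : V) : t \in z :: rcons (rev t2) w -> t \in X :\ x.
  move=> h; apply: ss'; rewrite es mem_cat es2; apply/orP; right; rewrite -cat_cons mem_cat h //.
have wx : w \in X :\ x by apply: inXx; rewrite inE mem_rcons inE eqxx orbT.
have zxn : z != x by case/setD1P: zx.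
have wxn : w != x by case/setD1P: wx.
have [zw nzw] := sep z w zA wY zxn wxn.
have xz : g x z by case: mA => _ cK _; apply: cK; rewrite // eq_sym.
have xw : g x w by case: mY => _ cK _; apply: cK; rewrite // eq_sym.
exists x, (z :: rcons (rev t2) w); split; last first.
  by move=> t; rewrite inE => /orP[/eqP->//|/inXx/setD1P[]].
split=> //.
- rewrite /= size_rcons size_rev; case: t2 {et nt es2 inXx wx} iz => //= /andP[/and3P[_ _ h] _].
  by rewrite h in nzw.
- by apply/negP=> /inXx; rewrite !inE eqxx.
split; first by rewrite /= last_rcons.
move=> t; rewrite /= last_rcons inE mem_rcons inE => /or3P[/eqP->|/eqP->|tt] xt; [by left|by right|].
case: (mc_nb2 sg cg clg mA mY ne xA xY xt) => tK.
  by case/hasP: n2; exists t => //; rewrite es2 mem_cat mem_rcons inE tt orbT.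
by case/hasP: nt; exists t => //; rewrite -mem_rev.
Qed.

End Paths.

Lemma dj_of (T : eqType) (L s t rest : seq T) : uniq L -> perm_eq L ((s ++ t) ++ rest) ->
  forall z, z \in s -> z \notin t.
Proof.
move=> uL pe z zs; move: uL; rewrite (perm_uniq pe) !cat_uniq => /and3P[/and3P[_ h _] _ _].
by apply: contra h => zt; apply/hasP; exists z.
Qed.

(** * Two cliques and three connectors *)

Section Good.
Variables (V : finType) (g : rel V).
Hypotheses (sg : simple_rel g) (cg : claw_heavy g) (clg : closed g).
Let gs := sg.1.
Let gi := sg.2.
Implicit Types (u v w x y z : V) (p q s t : seq V) (X Y Z K E F A B L : {set V}).

(* A connector (p, e): an induced path p, together with a common neighbour e
   of its two vertices when p is a single edge. *)
Definition conn := (seq V * seq V)%type.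
Implicit Type k : conn.
Definition conn_vertices k := k.1 ++ k.2.

Definition conn_sep k k' := forall d x y, x \in conn_vertices k -> y \in conn_vertices k' -> x != y /\
  (g x y -> (x = head d k.1 /\ y = head d k'.1) \/ (x = last d k.1 /\ y = last d k'.1)).

Definition conn_valid A B k := [/\ induced_path g k.1, 1 < size k.1,
  forall d, head d k.1 \in A /\ last d k.1 \in B &
  if k.2 is c :: s then [/\ s = [::], size k.1 = 2 & forall z, z \in k.1 -> g c z] else 2 < size k.1].

(** Relative to [X] for the sake of the induction: [A] and [B] are maximal cliques of the whole
    graph but have to be disjoint only inside [X]. *)
Definition three_connectors X := exists A B k1 k2 k3, [/\ closed_clique g A, closed_clique g B,
  forall w, w \in X -> w \in A -> w \notin B,
  [/\ conn_valid A B k1, conn_valid A B k2 & conn_valid A B k3] &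
  [/\ conn_sep k1 k2, conn_sep k1 k3, conn_sep k2 k3 & {subset conn_vertices k1 ++ conn_vertices k2 ++ conn_vertices k3 <= X}]].

Lemma cvalid_in A B k : conn_valid A B k -> forall d, head d k.1 \in conn_vertices k /\ last d k.1 \in conn_vertices k.
Proof.
case=> _ sz _ _ d; have k0 : k.1 != [::] by case: (k.1) sz.
by rewrite !mem_cat head_in ?last_in.
Qed.

Lemma mc_three M K K' a b c : closed_clique g M -> closed_clique g K -> closed_clique g K' ->
  a \in M -> b \in M -> c \in M -> a != b -> a != c -> b != c ->
  a \in K \/ a \in K' -> b \in K \/ b \in K' -> c \in K \/ c \in K' -> M = K \/ M = K'.
Proof.
move=> mM mK mK' aM bM cM ab ac bc.
have E L x y : closed_clique g L -> x \in M -> y \in M -> x \in L -> y \in L -> x != y -> M = L.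
  by move=> mL *; apply: (mc_eq sg mM mL (u := x) (v := y)).
move=> [ha|ha] [hb|hb] [hc|hc]; first [by left; apply: (E _ a b)|by left; apply: (E _ a c)
 |by left; apply: (E _ b c)|by right; apply: (E _ a b)|by right; apply: (E _ a c)|by right; apply: (E _ b c)].
Qed.

(** Only the disjointness of [A] and [B] in [X] is at stake. A common vertex outside [X1] is
    adjacent to the three connector ends in each of the two cliques, so these ends are gates and
    each clique is [K] or [K'] by [mc_three]; but [h] lies in both of these. *)
Lemma good_lift X X1 K K' h : X1 \subset X -> closed_clique g K -> closed_clique g K' -> h \in K -> h \in K' -> h \in X1 ->
  (forall x y, x \in X :\: X1 -> y \in X1 -> g x y -> y \in K :|: K') -> three_connectors X1 -> three_connectors X.
Proof.
move=> /subsetP sub mK mK' hK hK' h1 gate [A [B [k1 [k2 [k3 [mA mB dj [c1 c2 c3] [s12 s13 s23 sb]]]]]]].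
exists A, B, k1, k2, k3; split=> //; last by split=> // z /sb/sub.
move=> w wX wA; apply/negP=> wB.
case: (boolP (w \in X1)) => [w1|w1]; first by have := dj w w1 wA; rewrite wB.
have inv z : z \in conn_vertices k1 -> z \in X1 by move=> zk; apply: sb; rewrite mem_cat zk.
have inv2 z : z \in conn_vertices k2 -> z \in X1 by move=> zk; apply: sb; rewrite mem_cat (mem_cat z (conn_vertices k2)) zk orbT.
have inv3 z : z \in conn_vertices k3 -> z \in X1 by move=> zk; apply: sb; rewrite mem_cat (mem_cat z (conn_vertices k2)) zk !orbT.
have [ha1 hb1] := cvalid_in c1 w; have [ha2 hb2] := cvalid_in c2 w; have [ha3 hb3] := cvalid_in c3 w.
have [_ _ /(_ w)[A1 B1] _] := c1; have [_ _ /(_ w)[A2 B2] _] := c2; have [_ _ /(_ w)[A3 B3] _] := c3.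
have inG M z : closed_clique g M -> w \in M -> z \in M -> z \in X1 -> z \in K \/ z \in K'.
  case=> _ cM _ wM zM z1; have := gate w z; rewrite !inE w1 wX z1 => /(_ isT isT) H.
  apply/orP; apply: H; apply: cM => //; by apply: contraNneq w1 => ->.
have [a12 _] := s12 w _ _ ha1 ha2; have [a13 _] := s13 w _ _ ha1 ha3; have [a23 _] := s23 w _ _ ha2 ha3.
have [b12 _] := s12 w _ _ hb1 hb2; have [b13 _] := s13 w _ _ hb1 hb3; have [b23 _] := s23 w _ _ hb2 hb3.
have EA : A = K \/ A = K'.
  by apply: (mc_three mA mK mK' A1 A2 A3) => //; apply: (inG A) => //; auto.
have EB : B = K \/ B = K'.
  by apply: (mc_three mB mK mK' B1 B2 B3) => //; apply: (inG B) => //; auto.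
have nAB : A <> B by move=> e; have := dj _ (inv _ ha1) A1; rewrite -e A1.
have := dj h h1; case: EA EB => -> [] e; rewrite ?e ?hK ?hK' // in nAB *; by move=> /(_ isT).
Qed.

Lemma pth_ham' K s X : closed_clique g K -> clique_path_in g K K s -> s =i X -> 2 < #|X| -> ham_on g X.
Proof.
move=> [_ cK _] ps e c; apply: (pth_ham cK ps _ e); case: ps => _ _ us _.
by rewrite -(card_uniqP us) (eq_card e).
Qed.

Section Step.
Variable X : {set V}.
Hypotheses (bX : biconnected g X)
  (IH : forall Y, #|Y| < #|X| -> biconnected g Y -> ham_on g Y \/ three_connectors Y).

(** [d] stands in for the other half: [d |: E] is 2-connected, and deleting [d] from one of its
    Hamilton cycles leaves a path through [E] with both ends in [K]. *)
Lemma half_i K E d : closed_clique g K -> (forall x y, x \in X :\: E -> y \in E -> g x y -> x \in K /\ y \in K) ->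
  E \subset X -> d \in X :\: E -> d \in K -> 1 < #|E| -> 1 < #|X :\: E| ->
  three_connectors X \/ exists s, clique_path_in g K K s /\ s =i E.
Proof.
move=> mK cross sE dE dK cE cE'; have [_ cK _] := mK; have /setDP[dX dnE] := dE.
pose X1 := d |: E; have sX1 : X1 \subset X by rewrite subUset sub1set dX.
have c1 : #|X1| = #|E|.+1 by rewrite cardsU1 dnE.
have lt : #|X1| < #|X|.
  by move: cE'; rewrite cardsD (setIidPr sE) c1; lia.
have gate x y : x \in X :\: X1 -> y \in X1 -> g x y -> y \in K :|: K.
  rewrite !inE negb_or => /andP[/andP[_ h1] h2] /orP[/eqP->|h3] xy; first by rewrite dK.
  by have [|_ ->] // := cross x y _ h3 xy; rewrite inE h1.
case: (IH lt).
- apply: (bic_gate sg bX sX1 _ gate); first by rewrite c1.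
  move=> r u v; rewrite setUid !in_setI => /andP[uK u1] /andP[vK v1].
  exact: (connect_clique cK).
- move=> hX1; have [[|y p] [sz pp up cl e]] := ham_on_rot hX1 (setU11 _ _) => //; right; exists (y :: p).
  have ein z : z \in y :: p -> z \in E.
    move=> zp; have := e z; rewrite in_cons zp orbT !inE; case: eqP => // e1 _.
    by move: up; rewrite cons_uniq -e1 zp.
  move: pp => /= /andP[dy pp]; split.
    split=> // [|d0]; first by case/andP: up.
    have [_ yK] := cross d y dE (ein y (mem_head _ _)) dy.
    have [|_ lK] := cross d (last y p) dE (ein _ (mem_last _ _)); first by rewrite gs.
    by split.
  move=> z; have := e z; rewrite !inE; case: eqP => [->|//]; rewrite (negbTE dnE) => _.
  by apply/negP=> dp; move: up; rewrite cons_uniq inE dp.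
by move=> gX; left; apply: (good_lift sX1 mK mK dK dK (setU11 _ _) gate gX).
Qed.

Lemma case_i K E d v : closed_clique g K -> (forall x y, x \in X :\: E -> y \in E -> g x y -> x \in K /\ y \in K) ->
  E \subset X -> d \in E -> d \in K -> v \in X :\: E -> v \in K ->
  1 < #|E| -> 1 < #|X :\: E| -> ham_on g X \/ three_connectors X.
Proof.
move=> mK cross sE dE dK vE vK cE cE'; have [_ cK _] := mK.
have eE : X :\: (X :\: E) = E by rewrite setDDr setDv set0U; apply/setIidPr.
case: (half_i mK cross sE vE vK cE cE') => [gX|[s [ps es]]]; first by right.
have [||||||gX|[t [pt et]]] := @half_i K (X :\: E) d mK; rewrite ?eE ?subsetDl //; last 2 first.
- by right.
- left; apply: (@pth_ham' K (s ++ t)) => //; last by case: bX.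
    apply: (pth_cat cK ps pt) => z; rewrite es et inE => ->; by [].
  move=> z; rewrite mem_cat es et inE; case: (boolP (z \in E)) => // /(subsetP sE) ->; by [].
by move=> x y xE yE; rewrite gs => yx; have [] := cross y x yE xE yx.
Qed.

Definition opth K s := s = [::] \/ clique_path_in g K K s.

Lemma opth_catl K K' s t : closed_clique g K -> opth K s -> clique_path_in g K K' t -> (forall z, z \in s -> z \notin t) -> clique_path_in g K K' (s ++ t).
Proof. by move=> [_ cK _] [->//|ps] pt dj; exact: (pth_cat cK ps pt dj). Qed.

Lemma opth_catr K K' s t : closed_clique g K -> clique_path_in g K' K s -> opth K t -> (forall z, z \in s -> z \notin t) -> clique_path_in g K' K (s ++ t).
Proof. by move=> [_ cK _] ps [->|pt] dj; rewrite ?cats0 //; exact: (pth_cat cK ps pt dj). Qed.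

(** * Vertex sets split by two cliques with a common vertex *)

Section Two.
Variables (K K' E F : {set V}) (h d d' e e' : V).
Hypotheses (mK : closed_clique g K) (mK' : closed_clique g K') (ne : K <> K') (hK : h \in K) (hK' : h \in K')
  (hE : h \notin E) (hF : h \notin F) (dEF : forall z, z \in E -> z \notin F)
  (eX : forall z, z \in X = [|| z == h, z \in E | z \in F])
  (cross : forall x y, x \in F -> y \in E -> g x y -> (x \in K /\ y \in K) \/ (x \in K' /\ y \in K'))
  (dE : d \in E) (dK : d \in K) (dE' : d' \in E) (dK' : d' \in K')
  (eF : e \in F) (eK : e \in K) (eF' : e' \in F) (eK' : e' \in K').

Lemma KK_h z : z \in K -> z \in K' -> z = h.
Proof. by move=> zK zK'; apply/eqP; apply/negPn/negP=> n; apply: ne; exact: (mc_eq sg mK mK' zK hK). Qed.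

(** When a vertex other than [h] is deleted, [h] joins the gates in [K] and [K']; when [h] is
    deleted, the connection inside [D] does. *)
Lemma two_bic X1 (D : {set V}) a a' : X1 \subset X -> h \in X1 -> 2 < #|X1| ->
  (forall x y, x \in X :\: X1 -> y \in X1 -> g x y -> y \in K :|: K') ->
  a \in K -> a' \in K' -> a \in D -> a' \in D -> D \subset X1 :\ h -> connect (inX g D) a a' -> biconnected g X1.
Proof.
move=> sX1 h1 c1 gate aK aK' aD aD' sD cD; apply: (bic_gate sg bX sX1 c1 gate).
have [_ cK _] := mK; have [_ cK' _] := mK'; have /subsetP sD' := sD.
have toh r u : r != h -> u \in (K :|: K') :&: (X1 :\ r) -> connect (inX g (X1 :\ r)) u h.
  move=> rh; rewrite inE in_setU => /andP[/orP[uK|uK] u1].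
    by apply: (connect_clique cK) => //; rewrite !inE eq_sym rh.
  by apply: (connect_clique cK') => //; rewrite !inE eq_sym rh.
have toa u : u \in (K :|: K') :&: (X1 :\ h) -> connect (inX g (X1 :\ h)) u a'.
  rewrite inE in_setU => /andP[/orP[uK|uK] u1]; last by apply: (connect_clique cK') => //; exact: sD'.
  apply: connect_trans (connect_mono sD cD); apply: (connect_clique cK) => //; exact: sD'.
move=> r u v uG vG; have [er|rh] := eqVneq r h.
  by rewrite er in uG vG *; apply: connect_trans (toa u uG) _; rewrite inX_cs //; exact: toa.
by apply: connect_trans (toh r u rh uG) _; rewrite inX_cs //; exact: toh.
Qed.

Lemma nb_h z : g h z -> z \in K \/ z \in K'.
Proof. exact: (mc_nb2 sg cg clg mK mK' ne hK hK'). Qed.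

Lemma eh_ : e != h. Proof. by apply: contraNneq hF => <-. Qed.
Lemma eh' : e' != h. Proof. by apply: contraNneq hF => <-. Qed.
Lemma dh : d != h. Proof. by apply: contraNneq hE => <-. Qed.

(** The side [F] is replaced by its two representatives [e] and [e'], and [f] witnesses that the
    vertex set shrinks. Removing [h], [e], [e'] cuts a Hamilton cycle into three pieces, which
    recombine to one or two paths from [K] to [K']. *)
Lemma two_ab f : connect (inX g E) d d' -> f \in F -> f != e -> f != e' ->
  three_connectors X \/ exists s t, [/\ clique_path_in g K K' s, t = [::] \/ clique_path_in g K K' t, uniq (s ++ t) & s ++ t =i E].
Proof.
move=> cE fF fe fe'; pose X1 := h |: (e |: (e' |: E)).
have in1 z : (z \in X1) = [|| z == h, z == e, z == e' | z \in E] by rewrite !inE.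
have eE : e \notin E by apply: contraL eF; exact: dEF.
have eE' : e' \notin E by apply: contraL eF'; exact: dEF.
have ee' : e != e' by apply: contraNneq eh_ => e0; apply/eqP; apply: KK_h => //; rewrite e0.
have enK' : e \notin K' by apply: contra eh_ => h1; apply/eqP; exact: KK_h.
have enK : e' \notin K by apply: contra eh' => h1; apply/eqP; exact: KK_h.
have sX1 : X1 \subset X.
  by apply/subsetP=> z; rewrite in1 eX => /or4P[/eqP->|/eqP->|/eqP->|->]; rewrite ?eqxx ?eF ?eF' ?orbT.
have lt : #|X1| < #|X|.
  apply: proper_card; apply/properP; split=> //; exists f; first by rewrite eX fF !orbT.
  rewrite in1 (negbTE fe) (negbTE fe') /= negb_or; apply/andP; split.
    by apply: contraNneq hF => <-.
  by apply: contraL fF; exact: dEF.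
have gate x y : x \in X :\: X1 -> y \in X1 -> g x y -> y \in K :|: K'.
  rewrite inE in1 eX in1 inE !negb_or => /andP[/and4P[n1 n2 n3 n4]].
  rewrite (negbTE n1) (negbTE n4) /= => xF /or4P[/eqP->|/eqP->|/eqP->|yE] xy; rewrite ?hK ?eK ?eK' ?orbT //.
  by case: (cross xF yE xy) => -[_ ->]; rewrite ?orbT.
have c1 : 2 < #|X1|.
  by rewrite !cardsU1 !inE !negb_or eE' eE hE ![h == _]eq_sym eh_ eh' ee'.
case: (IH lt).
- apply: (two_bic sX1 (setU11 _ _) c1 gate dK dK' dE dE' _ cE).
  apply/subsetP=> z zE; rewrite !inE zE !orbT andbT; by apply: contraNneq hE => <-.
- move=> hX1; have [p0 [_ pp0 up0 cl0 e0]] := ham_on_rot hX1 (setU11 _ _); right.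
  suff H p p1 p2 p3 : path g h (rcons p h) -> uniq (h :: p) -> h :: p =i X1 ->
    p = p1 ++ e :: p2 ++ e' :: p3 ->
    exists s t, [/\ clique_path_in g K K' s, t = [::] \/ clique_path_in g K K' t, uniq (s ++ t) & s ++ t =i E].
    have pr0 : path g h (rcons p0 h) by rewrite rcons_path pp0.
    have ep0 : e \in p0 by have := e0 e; rewrite inE (negbTE eh_) in1 eqxx orbT /= => ->.
    have ep0' : e' \in p0 by have := e0 e'; rewrite inE (negbTE eh') in1 eqxx !orbT /= => ->.
    case/splitPr: ep0 pr0 up0 e0 ep0' {pp0 cl0} => q1 q2 pr0 up0 e0.
    rewrite mem_cat inE eq_sym (negbTE ee') /= => /orP[] eq.
      case/splitPr: eq pr0 up0 e0 => r1 r2 pr0 up0 e0.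
      set p1 := (X in path g h (rcons X h)) in pr0.
      apply: (H (rev p1) (rev q2) (rev r2) (rev r1)).
      - by have := path_rev gs pr0; rewrite last_rcons belast_rcons rev_cons.
      - by move: up0; rewrite /= mem_rev rev_uniq.
      - by move=> z; rewrite -e0 !inE mem_rev.
      - by rewrite /p1 !(rev_cat, rev_cons) -?cats1 /= -!catA.
    case/splitPr: eq pr0 up0 e0 => r1 r2 pr0 up0 e0.
    by apply: (H _ q1 r1 r2 pr0 up0 e0).
  move=> pp up ein ep.
  have uL : uniq (h :: e :: e' :: p1 ++ p2 ++ p3).
    have : uniq (h :: p1 ++ e :: p2 ++ e' :: p3) by rewrite -ep.
    by congr is_true; apply: perm_uniq; perm_cat.
  have uu : uniq (p1 ++ p2 ++ p3) by case/and4P: uL.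
  have mz z : z \in p1 ++ p2 ++ p3 = (z \in E).
    have : (z \in h :: e :: e' :: p1 ++ p2 ++ p3) = (z \in X1).
      rewrite -ein ep; apply: perm_mem; perm_cat.
    rewrite in1 !in_cons; case: eqP => [->|_].
      by rewrite (negbTE hE); case/andP: uL; rewrite !in_cons !negb_or => /and3P[_ _ /negbTE].
    case: eqP => [->|_].
      by rewrite (negbTE eE); case/and3P: uL => _; rewrite !in_cons !negb_or => /andP[_ /negbTE].
    case: eqP => [->|_] //.
    by rewrite (negbTE eE'); case/and4P: uL => _ _ /negbTE.
  have cE1 z : z \in E -> g z e -> z \in K.
    by move=> zE ze; case: (cross eF zE _) => [|[]//|[]]; [rewrite gs|rewrite (negbTE enK')].
  have cE2 z : z \in E -> g z e' -> z \in K'.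
    by move=> zE ze; case: (cross eF' zE _) => [|[]|[]//]; [rewrite gs|rewrite (negbTE enK)].
  have m1 z : z \in p1 -> z \in E by rewrite -mz mem_cat => ->.
  have m2 z : z \in p2 -> z \in E by rewrite -mz !mem_cat => ->; rewrite orbT.
  have m3 z : z \in p3 -> z \in E by rewrite -mz !mem_cat => ->; rewrite !orbT.
  (* A piece beginning at a neighbour of [h] starts in [K] or in [K']; which of the two decides how
     the pieces recombine. *)
  have piece q L : path g h q -> uniq q -> (forall d0, q != [::] -> last d0 q \in L) ->
    [\/ q = [::], clique_path_in g K L q | clique_path_in g K' L q].
    case: q => [|y q]; first by constructor 1.
    move=> /= /andP[hy py] uq /(_ h isT) lq; case: (nb_h hy) => yK; [constructor 2|constructor 3]; by split.
  move: pp; rewrite ep rcons_cat rcons_cons rcons_cat rcons_cons cat_path /= cat_path /= => /and5P[pp1 l1e pp2 l2e pp3].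
  move: (uu); rewrite !cat_uniq => /and3P[u1 _ /and3P[u2 _ u3]].
  have h1 : opth K p1 \/ clique_path_in g K' K p1.
    case: (@piece p1 K pp1 u1) => [d0 p10|->|h1|h1]; [|by left; left|by left; right|by right].
    apply: cE1; first by apply: m1; rewrite last_in.
    by case: (p1) p10 l1e.
  have h3 : opth K' p3 \/ clique_path_in g K' K p3.
    have pp3' : path g h (rev p3).
      move/path_sorted: pp3 => /(sorted_rev' gs); by rewrite rev_rcons.
    have u3' : uniq (rev p3) by rewrite rev_uniq.
    case: (@piece (rev p3) K' pp3' u3') => [d0 p30|e3|h3|h3].
    - have p31 : p3 != [::] by rewrite -size_eq0 -size_rev size_eq0.
      rewrite last_rev'; apply: cE2; first by apply: m3; rewrite head_in.
      by rewrite gs; case: (p3) p31 pp3 => //= a ? _ /andP[].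
    - by left; left; rewrite -[p3]revK e3.
    - by right; rewrite -[p3]revK; exact: pth_rev.
    - by left; right; rewrite -[p3]revK; exact: pth_rev.
  have h2 : clique_path_in g K K' p2.
    have ne' : ~~ g e e'.
      apply/negP=> eee; have [_ cK _] := mK; case/negP: enK.
      case: (mK') => _ _ /(_ e h e' enK' hK' eK') H; move: (eh').
      by rewrite -H ?eqxx // cK ?eh_.
    have p20 : p2 != [::] by case: (p2) l2e => //= ee; rewrite ee in ne'.
    split=> //; first exact: path_sorted pp2.
    move=> d0; split.
      apply: cE1; first by apply: m2; rewrite head_in.
      by rewrite gs; case: (p2) p20 pp2 => //= a ? _ /andP[].
    apply: cE2; first by apply: m2; rewrite last_in.
    by case: (p2) p20 l2e.
  have fin s t : clique_path_in g K K' s -> t = [::] \/ clique_path_in g K K' t -> perm_eq (s ++ t) (p1 ++ p2 ++ p3) ->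
    exists s t, [/\ clique_path_in g K K' s, t = [::] \/ clique_path_in g K K' t, uniq (s ++ t) & s ++ t =i E].
    move=> ps pt pe; exists s, t; split=> //; first by rewrite (perm_uniq pe).
    by move=> z; rewrite (perm_mem pe) mz.
  case: h1 h3 => h1 [] h3.
  - apply: (fin (p1 ++ p2 ++ p3) [::]); [|by left|by perm_cat].
    apply: opth_catl => //; last by apply: (dj_of (rest := [::]) uu); perm_cat.
    apply: opth_catr => //; apply: (dj_of (rest := p1) uu); perm_cat.
  - apply: (fin (p1 ++ p2) (rev p3)); [|by right; exact: pth_rev|by perm_cat].
    apply: opth_catl => //; apply: (dj_of (rest := p3) uu); perm_cat.
  - apply: (fin (p2 ++ p3) (rev p1)); [|by right; exact: pth_rev|by perm_cat].
    apply: opth_catr => //; apply: (dj_of (rest := p1) uu); perm_cat.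
  - apply: (fin ((rev p1 ++ p3) ++ p2) [::]); [|by left|by perm_cat].
    apply: opth_catl => //; last by apply: (dj_of (rest := [::]) uu); perm_cat.
    right; have [_ cK' _] := mK'; apply: (pth_cat cK' (pth_rev sg h1) h3).
    by apply: (dj_of (rest := p2) uu); perm_cat.
by move=> gX; left; apply: (good_lift sX1 mK mK' hK hK' (setU11 _ _) gate gX).
Qed.

(** Here [E] shrinks to the single vertex [d], so the pieces next to [d] end in [K]. This asymmetry
    with [two_ab] is what lets the two covers be joined in [case_iii]. *)
Lemma two_aa : connect (inX g F) e e' ->
  three_connectors X \/ (exists q, clique_path_in g K K q /\ q =i F) \/
  exists q q', [/\ clique_path_in g K K' q, opth K q', uniq (q ++ q') & q ++ q' =i F].
Proof.
move=> cF; pose X1 := h |: (d |: F).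
have in1 z : (z \in X1) = [|| z == h, z == d | z \in F] by rewrite !inE.
have dF : d \notin F by exact: dEF.
have dnK' : d \notin K' by apply: contra dh => h1; apply/eqP; exact: KK_h.
have dd' : d' != d by apply: contraNneq dnK' => <-.
have sX1 : X1 \subset X.
  by apply/subsetP=> z; rewrite in1 eX => /or3P[/eqP->|/eqP->|->]; rewrite ?eqxx ?dE ?orbT.
have lt : #|X1| < #|X|.
  apply: proper_card; apply/properP; split=> //; exists d'; first by rewrite eX dE' !orbT.
  by rewrite in1 (negbTE dd') (negbTE (dEF dE')) !orbF; apply: contraNneq hE => <-.
have gate x y : x \in X :\: X1 -> y \in X1 -> g x y -> y \in K :|: K'.
  rewrite inE in1 eX in1 inE !negb_or => /andP[/and3P[n1 n2 n3]].
  rewrite (negbTE n1) (negbTE n3) /= orbF => xE /or3P[/eqP->|/eqP->|yF] xy; rewrite ?hK ?dK ?orbT //.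
  by rewrite gs in xy; case: (cross yF xE xy) => -[-> _]; rewrite ?orbT.
have ee' : e != e' by apply: contraNneq eh_ => e0; apply/eqP; apply: KK_h => //; rewrite e0.
have c1 : 2 < #|X1|.
  have : 0 < #|F| by apply/card_gt0P; exists e.
  by rewrite !cardsU1 !inE !negb_or dF hF [h == _]eq_sym dh.
case: (IH lt).
- apply: (two_bic sX1 (setU11 _ _) c1 gate eK eK' eF eF' _ cF).
  apply/subsetP=> z zF; rewrite !inE zF !orbT andbT; by apply: contraNneq hF => <-.
- move=> hX1; have [p [_ pp up cl ein]] := ham_on_rot hX1 (setU11 _ _); right.
  have dp : d \in p by have := ein d; rewrite inE (negbTE dh) in1 eqxx orbT /= => ->.
  have {cl} pp : path g h (rcons p h) by rewrite rcons_path pp.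
  case/splitPr: dp pp up ein => p1 p2 pp up ein.
  have uL : uniq (h :: d :: p1 ++ p2) by move: up; congr is_true; apply: perm_uniq; perm_cat.
  have uu : uniq (p1 ++ p2) by case/and3P: uL.
  have mz z : z \in p1 ++ p2 = (z \in F).
    have : (z \in h :: d :: p1 ++ p2) = (z \in X1) by rewrite -ein; apply: perm_mem; perm_cat.
    rewrite in1 !in_cons; case: eqP => [->|_].
      by rewrite (negbTE hF); case/andP: uL; rewrite !in_cons !negb_or => /andP[_ /negbTE].
    by case: eqP => [->|_] //; rewrite (negbTE dF); case/and3P: uL => _ /negbTE.
  have cE1 z : z \in F -> g z d -> z \in K.
    by move=> zF zd; case: (cross zF dE zd) => [[]//|[]]; rewrite (negbTE dnK').
  have m1 z : z \in p1 -> z \in F by rewrite -mz mem_cat => ->.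
  have m2 z : z \in p2 -> z \in F by rewrite -mz !mem_cat => ->; rewrite orbT.
  have piece q : path g h q -> uniq q -> (forall d0, q != [::] -> last d0 q \in K) -> opth K q \/ clique_path_in g K' K q.
    case: q => [|y q]; first by left; left.
    move=> /= /andP[hy py] uq /(_ h isT) lq; case: (nb_h hy) => yK; [left; right|right]; by split.
  move: pp; rewrite rcons_cat rcons_cons cat_path /= => /and3P[pp1 l1e pp2].
  move: (uu); rewrite !cat_uniq => /and3P[u1 _ u2].
  have h1 : opth K p1 \/ clique_path_in g K' K p1.
    apply: piece => // d0 p10; apply: cE1; first by apply: m1; rewrite last_in.
    by case: (p1) p10 l1e.
  have h2 : opth K (rev p2) \/ clique_path_in g K' K (rev p2).
    apply: piece; last 1 first.
    - move=> d0 p20; have p21 : p2 != [::] by rewrite -size_eq0 -size_rev size_eq0.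
      rewrite last_rev'; apply: cE1; first by apply: m2; rewrite head_in.
      by rewrite gs; case: (p2) p21 pp2 => //= a ? _ /andP[].
    - move/path_sorted: pp2 => /(sorted_rev' gs); by rewrite rev_rcons.
    - by rewrite rev_uniq.
  have orev s : opth K s -> opth K (rev s) by case=> [->|]; [left|right; exact: pth_rev].
  case: h1 h2 => h1 [] h2.
  - left; exists (p1 ++ p2); split; last exact: mz.
    have h2' := orev _ h2; rewrite revK in h2'.
    have p0 : p1 ++ p2 != [::] by apply: contraTneq eF => e0; rewrite -mz e0.
    case: h1 p0 => [->|h1] p0; last by apply: opth_catr => //; apply: (dj_of (rest := [::]) uu); perm_cat.
    by case: h2' p0 => [->|].
  - right; exists p2, p1; split=> //; first by rewrite -[p2]revK; exact: pth_rev.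
      by rewrite uniq_catC.
    by move=> z; rewrite -mz !mem_cat orbC.
  - right; exists (rev p1), (rev p2); split=> //; first exact: pth_rev.
      by move: uu; congr is_true; apply: perm_uniq; perm_cat.
    by move=> z; rewrite -mz !mem_cat !mem_rev.
  left; exists (p2 ++ p1); split; last by move=> z; rewrite -mz !mem_cat orbC.
  have [_ cK' _] := mK'; apply: (pth_cat cK' _ h1).
    by rewrite -[p2]revK; exact: pth_rev.
  by apply: (dj_of (rest := [::]) uu); perm_cat.
by move=> gX; left; apply: (good_lift sX1 mK mK' hK hK' (setU11 _ _) gate gX).
Qed.

(** [h] serves as a one-vertex path between any of the cliques [K] and [K']. In each of the four
    combinations of the covers of [E] and [F] the pieces can be ordered so that consecutive ends,
    and the first and last, share a clique. *)
Lemma case_iii f : connect (inX g E) d d' -> connect (inX g F) e e' -> f \in F -> f != e -> f != e' ->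
  ham_on g X \/ three_connectors X.
Proof.
move=> cE cF fF fe fe'; have [cX _] := bX; have [_ cK _] := mK; have [_ cK' _] := mK'.
have hh A B : h \in A -> h \in B -> clique_path_in g A B [:: h] by exact: pth1.
case: (two_ab cE fF fe fe') => [|[s [t [ps pt ust est]]]]; first by right.
have fin L (q : seq V) r : uniq (h :: (s ++ t) ++ q) -> q =i F -> closed_clique g L -> clique_path_in g L L r ->
  perm_eq r (h :: (s ++ t) ++ q) -> ham_on g X \/ three_connectors X.
  move=> _ eq mL pr pe; left; apply: (pth_ham' mL pr) => // z.
  by rewrite (perm_mem pe) inE mem_cat est eq eX.
have uni q : uniq q -> q =i F -> uniq (h :: (s ++ t) ++ q).
  move=> uq eq; rewrite cons_uniq cat_uniq ust uq andbT mem_cat est eq negb_or hE hF /=.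
  by apply/hasPn=> z; rewrite eq est => zF; apply: contraL zF; exact: dEF.
case: (two_aa cF) => [|[[q [pq eq]]|[q [q' [pq pq' uq eq]]]]]; first by right.
  have uL := uni q (let: And4 _ _ u _ := pq in u) eq.
  case: pt => [et|pt].
    rewrite et cats0 in uL; apply: (fin K q ((s ++ [:: h]) ++ q)) => //; rewrite ?et ?cats0 //; last by perm_cat.
    apply: (pth_cat cK _ pq); last by apply: (dj_of (rest := [::]) uL); perm_cat.
    by apply: (pth_cat cK' ps (hh _ _ hK' hK)); apply: (dj_of (rest := q) uL); perm_cat.
  apply: (fin K q (((s ++ rev t) ++ [:: h]) ++ q)) => //; last by perm_cat.
  apply: (pth_cat cK _ pq); last by apply: (dj_of (rest := [::]) uL); perm_cat.
  apply: (pth_cat cK _ (hh _ _ hK hK)); last by apply: (dj_of (rest := q) uL); perm_cat.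
  by apply: (pth_cat cK' ps (pth_rev sg pt)); apply: (dj_of (rest := h :: q) uL); perm_cat.
have uL := uni _ uq eq.
case: pt => [et|pt].
  rewrite et cats0 in uL; apply: (fin K (q ++ q') (((s ++ rev q) ++ [:: h]) ++ q')) => //; rewrite ?et ?cats0 //; last by perm_cat.
  apply: opth_catr => //; last by apply: (dj_of (rest := [::]) uL); perm_cat.
  apply: (pth_cat cK _ (hh _ _ hK hK)); last by apply: (dj_of (rest := q') uL); perm_cat.
  by apply: (pth_cat cK' ps (pth_rev sg pq)); apply: (dj_of (rest := h :: q') uL); perm_cat.
apply: (fin K (q ++ q') ((((s ++ rev t) ++ q) ++ [:: h]) ++ q')) => //; last by perm_cat.
apply: opth_catr => //; last by apply: (dj_of (rest := [::]) uL); perm_cat.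
apply: (pth_cat cK' _ (hh _ _ hK' hK)); last by apply: (dj_of (rest := q') uL); perm_cat.
apply: (pth_cat cK _ pq); last by apply: (dj_of (rest := h :: q') uL); perm_cat.
by apply: (pth_cat cK' ps (pth_rev sg pt)); apply: (dj_of (rest := h :: q ++ q') uL); perm_cat.
Qed.

End Two.
End Step.
End Good.

(** * A hole with maximal neighbourhood yields a Hamilton cycle or three connectors *)

Section Hole.
Variables (V : finType) (g : rel V).
Hypotheses (sg : simple_rel g) (cg : claw_heavy g) (clg : closed g).
Let gs := sg.1.
Let gi := sg.2.
Implicit Types (u v w x y z d f : V) (p q s t : seq V) (X Y Z K E F A B L : {set V}).

Lemma edge_cliqueC u v : edge_clique g u v = edge_clique g v u.
Proof. by apply/setP=> z; rewrite !inE andbC; case: (z == u); case: (z == v). Qed.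

Lemma csep_tri p q e e' : tri g p q ->
  (forall f z, f \in e -> z \in q -> f != z /\ ~~ g f z) ->
  (forall f z, f \in e' -> z \in p -> f != z /\ ~~ g f z) ->
  (forall f f', f \in e -> f' \in e' -> f != f' /\ ~~ g f f') -> conn_sep g (p, e) (q, e').
Proof.
move=> [_ _ _ _ h] h1 h2 h3 d x y; have [_ _ hd] := h d.
rewrite !mem_cat /= => /orP[xp|xe] /orP[yq|ye].
- exact: hd.
- by have [] := h2 y x ye xp; rewrite eq_sym gs => -> /negbTE ->.
- by have [-> /negbTE ->] := h1 x y xe yq.
- by have [-> /negbTE ->] := h3 x y xe ye.
Qed.

Lemma NSP X t z : reflect (z \in X /\ (z \in t \/ exists2 a, a \in t & g z a)) (z \in NS g X t).
Proof.
rewrite inE; apply: (iffP andP) => -[zX h]; split=> //.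
  by case/orP: h => [|/hasP]; [left|right].
by apply/orP; case: h => [|h]; [left|right; apply/hasP].
Qed.

Lemma NS_eq X s t : s =i t -> NS g X s = NS g X t.
Proof.
by move=> e; apply/setP=> w; rewrite !inE e (eq_has_r e).
Qed.

Lemma hole_arcs v p1 w1 w2 p2 : hole g v (p1 ++ w1 :: w2 :: p2) -> p1 != [::] ->
  tri g (rcons p1 w1) (v :: rcons (rev p2) w2).
Proof.
set p' := p1 ++ _ => hh p10; have [sz ip vp vh [vl hx]] := hh.
have ep : p' = rcons p1 w1 ++ (w2 :: p2) by rewrite -cats1 -catA.
have i2 : induced_path g (w2 :: p2) by apply: (@ipath_catr _ _ (rcons p1 w1)); rewrite -ep.
have i1 : induced_path g (rcons p1 w1) by apply: (@ipath_catl _ _ _ (w2 :: p2)); rewrite -ep.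
have up := ipath_uniq ip.
have hd d : head d p' = head d p1 by rewrite /p'; case: (p1) p10.
have lt d : last d p' = last w2 p2 by rewrite /p' last_cat.
have lin : last w2 p2 \in w2 :: p2 by exact: mem_last.
have vnp z : z \in w2 :: p2 -> z \in p' by rewrite ep mem_cat => ->; rewrite orbT.
have vnp1 z : z \in rcons p1 w1 -> z \in p' by rewrite ep mem_cat => ->.
have d12 z : z \in rcons p1 w1 -> z \notin w2 :: p2.
  apply: (@dj_of _ p' _ _ [::]) => //; rewrite cats0 -ep //.
have hin d : head d p1 \in rcons p1 w1 by rewrite mem_rcons inE head_in ?orbT.
have eb : v :: rcons (rev p2) w2 = rev (rcons (w2 :: p2) v) by rewrite rev_rcons rev_cons.
split=> //.
- rewrite eb; apply: ipath_rev => //; rewrite -cats1; apply: (@ipath_cat _ _ v) => //.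
    by rewrite /= gs; move: vl; rewrite lt.
  move=> a b ap; rewrite inE => /eqP->; split; first by apply: contraNneq vp => <-; exact: vnp.
  rewrite gs => va; case: (hx a (vnp a ap) va) => e; last by rewrite e !lt.
  by have := d12 a; rewrite e hd hin -hd -e ap => /(_ isT).
- by rewrite size_rcons; case: (p1) p10.
- by rewrite /= size_rcons.
move=> d; split.
- by rewrite /= gs; move: vh; rewrite hd; case: (p1) p10.
- rewrite last_rcons /= last_rcons; have := ipath_sorted ip.
  by rewrite /p'; case: (p1) p10 => //= a ? _; rewrite cat_path /= => /and3P[_ _ /andP[]].
move=> x y xp; rewrite in_cons => /orP[/eqP->|].
  split; first by apply: contraNneq vp => <-; exact: vnp1.
  rewrite gs => vx; left; split=> //; case: (hx x (vnp1 x xp) vx) => ex.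
    by rewrite ex hd; case: (p1) p10.
  by have := d12 x xp; rewrite ex lt lin.
rewrite mem_rcons inE mem_rev -in_cons => yq.
rewrite ep in ip; have [h1 h2] := @ipath_sep _ _ v _ _ x y ip xp yq; split=> // /h2[-> ->].
by right; rewrite !last_rcons /= last_rcons.
Qed.

Section Step.
Variable X : {set V}.
Hypotheses (bX : biconnected g X)
  (IH : forall Y, #|Y| < #|X| -> biconnected g Y -> ham_on g Y \/ three_connectors g Y).
Let goal := ham_on g X \/ three_connectors g X.
Variables (x0 : V) (p0 : seq V).
Let s := x0 :: p0.
Hypotheses (hh : hole g x0 p0) (sX : {subset s <= X})
  (bigger : forall y q, hole g y q -> {subset y :: q <= X} -> #|NS g X s| < #|NS g X (y :: q)| -> goal).
Variable u0 : V.
Hypothesis u0P : u0 \in X :\: NS g X s.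

(** The hole [s] has as large a closed neighbourhood as possible, which is what [bigger] expresses.
    [U] is a component of the vertices beyond that neighbourhood, and [Nn] are its attachments. *)
Let U := comp g (X :\: NS g X s) u0.
Let Nn := [set d in NS g X s | [exists u, (u \in U) && g d u]].

Lemma U_s u : u \in U -> u \in X /\ forall z, z \in s -> ~~ g u z /\ u != z.
Proof.
rewrite inE => /andP[/setDP[uX un] _]; split=> // z zs; split.
  by apply: contra un => uz; apply/NSP; split=> //; right; exists z.
by apply: contraNneq un => ->; apply/NSP; split; [exact: sX|left].
Qed.

Lemma U_nNS u : u \in U -> u \notin NS g X s.
Proof. by rewrite inE => /andP[/setDP[]]. Qed.

Lemma U_out w u : w \in X -> u \in U -> g w u -> w \in U \/ w \in Nn.
Proof.
move=> wX uU wu; case: (boolP (w \in NS g X s)) => wN.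
  by right; rewrite inE wN; apply/existsP; exists u; rewrite uU.
left; have wY : w \in X :\: NS g X s by apply/setDP.
have mU z : z \in U = (z \in X :\: NS g X s) && connect (inX g (X :\: NS g X s)) u0 z by rewrite in_set.
move: uU; rewrite !mU => /andP[uY cu]; rewrite wY /=; apply: connect_trans cu _; apply: connect1.
by rewrite /inX /= gs wu wY uY.
Qed.

(** An attachment sees just one edge [v v'] of the hole and belongs to its clique; the later case
    distinction is about how the cliques of different attachments meet. *)
Definition Nd d v v' := [/\ v \in s, v' \in s, g v v' & g d v /\ g d v'] /\
  [/\ d \in X, d \notin s, exists2 u, u \in U & g d u & forall z, z \in s -> g d z -> z = v \/ z = v'].

Lemma NdC d v v' : Nd d v v' -> Nd d v' v.
Proof.
case=> -[h1 h2 h3 [h4 h5]] [h6 h7 h8 h9]; split; split=> //; first by rewrite gs.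
by move=> z zs /(h9 z zs)[]; [right|left].
Qed.

Lemma Nn_Nd d : d \in Nn -> exists v v', Nd d v v'.
Proof.
rewrite inE => /andP[dN /existsP[u /andP[uU du]]]; have [uX us] := U_s uU.
have /NSP[dX dN'] := dN; have ds : d \notin s.
  by apply/negP=> /us[]; rewrite gs du.
case: dN' => [|[v conn_vertices dv]]; first by rewrite (negbTE ds).
have [v' [vs' vv dv']] := hole_edge sg cg clg hh ds conn_vertices dv.
exists v, v'; split; split=> //; first by exists u.
by move=> z zs dz; apply: (hole_nb_only sg cg clg hh du us conn_vertices vs' vv dv dv' zs dz).
Qed.

Lemma Nd_Nn d v v' : Nd d v v' -> d \in Nn.
Proof.
case=> -[h1 h2 h3 [h4 h5]] [h6 h7 [u h8 h8'] h9]; rewrite inE; apply/andP; split.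
  by apply/NSP; split=> //; right; exists v.
by apply/existsP; exists u; rewrite h8.
Qed.

Lemma Nd_K d v v' : Nd d v v' -> [/\ v \in edge_clique g v v', v' \in edge_clique g v v', d \in edge_clique g v v', v != v' & closed_clique g (edge_clique g v v')].
Proof.
case=> -[h1 h2 h3 [h4 h5]] _; have vv : v != v' by apply: contraTneq h3 => ->; rewrite gi.
by rewrite !inE !eqxx h4 h5 ?orbT; split=> //; exact: mc_kq.
Qed.

(** Otherwise [d] would be the centre of a claw with leaves [u], [x] and [v]. *)
Lemma Nd_cross d v v' x : Nd d v v' -> x \in X -> x \notin U -> x \notin Nn -> g x d -> x \in edge_clique g v v'.
Proof.
move=> nd xX xU xN xd; have [[h1 h2 h3 [h4 h5]] [h6 h7 [u uU du] h9]] := nd.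
have [vK vK' dK vv mK] := Nd_K nd; apply/negPn/negP=> xK.
have [uX us] := U_s uU; have [uv uv'] := us v h1.
have dv : d != v by apply: contraNneq h7 => ->.
have xv : ~~ g x v.
  apply/negP=> xv; have [_ _ H] := mK; by move: dv; rewrite (H x d v) ?eqxx.
have ux : u != x by apply: contraNneq xU => <-.
have xv' : x != v by apply: contraNneq xK => ->.
have dx : g d x by rewrite gs.
have := closed_clawfree sg cg clg du dx h4 ux uv' xv'.
rewrite (negbTE uv) (negbTE xv) !orbF gs => xu.
by case: (U_out xX uU xu) => H; [rewrite H in xU|rewrite H in xN].
Qed.

(** A single attachment would be a cutvertex between [U] and the hole. *)
Lemma Nn_other r : r \notin U -> exists2 d, d \in Nn & d != r.
Proof.
move=> rU; have [/exists_inP[d dN dr]|] := boolP [exists d in Nn, d != r]; first by exists d.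
rewrite negb_exists_in => /forall_inP H.
have u0U : u0 \in U by rewrite inE u0P connect0.
have [z zs zr] : exists2 z, z \in s & z != r.
  have [sz _ _ xh _] := hh; have [er|] := eqVneq x0 r; last by exists x0 => //; rewrite mem_head.
  exists (head x0 p0); first by rewrite inE head_in ?orbT //; case: (p0) sz.
  by apply: contraTneq xh => ->; rewrite er gi.
have [_ /(_ r u0 z) c] := bX; have u0r : u0 != r by apply: contraNneq rU => <-.
have := c; rewrite !inE u0r zr (sX zs); have [-> _] := U_s u0U; move/(_ isT isT).
case/connectP=> q; elim: q u0 u0U {c u0r H} (H) => [|y q IHq] a aU H /=.
  by move=> _ e; have [_ /(_ z zs)[_]] := U_s aU; rewrite e eqxx.
case/andP=> /and3P[aX yX ay] pq lq; apply: (IHq y _ H pq lq).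
case/setD1P: yX => yr yX; case: (U_out (w := y) (u := a) yX aU) => //; first by rewrite gs.
by move/H; rewrite negbK (negbTE yr).
Qed.

Lemma big y q u : hole g y q -> {subset y :: q <= X} -> NS g X s \subset NS g X (y :: q) ->
  u \in U -> u \in NS g X (y :: q) -> goal.
Proof.
move=> hy sub subN uU uN; apply: (bigger hy sub); apply: proper_card; apply/properP; split=> //.
by exists u => //; exact: U_nNS.
Qed.

(** A neighbour of the hole is adjacent to both ends of one of its edges, so a set [t] that meets
    every edge of the hole catches it. *)
Lemma NS_sub t : (forall z, z \in s -> z \in NS g X t) ->
  (forall a b, a \in s -> b \in s -> g a b -> a \in t \/ b \in t) -> NS g X s \subset NS g X t.
Proof.
move=> h1 h2; apply/subsetP=> z zN; case: (boolP (z \in s)) => [/h1//|zs].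
case/NSP: zN => zX []; first by rewrite (negbTE zs).
case=> a as_ za.
have [b [bs ab zb]] := hole_edge sg cg clg hh zs as_ za.
by apply/NSP; split=> //; right; case: (h2 a b as_ bs ab) => h; [exists a|exists b].
Qed.

Section Arcs.
Variables (d d' u : V) (r : seq V).
Hypotheses (rd : forall z, z \in r -> [\/ z \in U, z = d | z = d']) (hr : forall z, head z r = d)
  (lr : forall z, last z r = d') (uU : u \in U) (du : g d u) (dX : d \in X) (dX' : d' \in X).

(** The two arcs of the hole and the path [r] through [U] form a theta: any two of them bound a
    hole. *)
Definition arcs (a b : seq V) := [/\ s =i a ++ b, tri g a b, tri g a r & tri g b r].

Lemma rX z : z \in r -> z \in X.
Proof. by case/rd => [/U_s[]//|->|->]. Qed.

Lemma hole_br a b : arcs a b -> exists y q, hole g y q /\ y :: q =i b ++ r.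
Proof.
case=> _ _ _ tbr; have [_ _ sb _ _] := tbr; case: b sb tbr => // y b _ tbr.
exists y, (b ++ rev r); split; first exact: hole_tri.
by move=> z; rewrite !inE !mem_cat mem_rev.
Qed.

Definition wit (a b : seq V) f := [/\ f \in X, f \in NS g X s, f \notin s, forall z, z \in a -> g f z &
  forall z, z \in b ++ r -> f != z /\ ~~ g f z].

(** The hole on [b] and [r] sees [u], so by maximality it misses some [f] in the neighbourhood of
    [s], and [f] can be attached only at the two vertices of [a]. It becomes the triangle vertex of
    the connector [a]. *)
Lemma wit_ex a b : arcs a b -> size a = 2 -> goal \/ exists f, wit a b f.
Proof.
move=> ab sa; have [es tab tar tbr] := ab; have [y [q [hy ey]]] := hole_br ab.
have [_ _ sa' sb hd] := tab.
have a_e : exists a1 a2, a = [:: a1; a2] by case: (a) sa => [|a1 [|a2 []]] // _; exists a1, a2.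
case: a_e => a1 [a2 ea]; have [_ _ _ sr _] := tar.
have b0 : b != [::] by case: (b) sb.
have r0 : r != [::] by case: (r) sr.
have sub : {subset y :: q <= X}.
  move=> z; rewrite ey mem_cat => /orP[zb|/rX//]; by apply: sX; rewrite es mem_cat zb orbT.
have [h1 h2 h3] := hd u.
have uN : u \in NS g X (y :: q).
  have [uX _] := U_s uU; rewrite (NS_eq _ ey); apply/NSP; split=> //; right.
  by exists d; [rewrite mem_cat -(hr u) head_in ?orbT|rewrite gs].
case: (boolP (NS g X s \subset NS g X (y :: q))) => [sub'|]; first by left; exact: (big hy sub sub' uU uN).
case/subsetPn=> f fN fn; right; exists f.
have fX : f \in X by case/NSP: fN.
have fbr z : z \in b ++ r -> f != z /\ ~~ g f z.
  move=> zb; rewrite (NS_eq _ ey) in fn; split.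
    by apply: contraNneq fn => ->; apply/NSP; split; [apply: sub; rewrite ey|left].
  by apply: contra fn => fz; apply/NSP; split=> //; right; exists z.
have a1n : a1 \in NS g X (y :: q).
  rewrite (NS_eq _ ey); apply/NSP; split; first by apply: sX; rewrite es ea mem_head.
  right.
  exists (head u b); first by rewrite mem_cat head_in.
  by move: h1; rewrite ea.
have a2n : a2 \in NS g X (y :: q).
  rewrite (NS_eq _ ey); apply/NSP; split; first by apply: sX; rewrite es ea !inE eqxx orbT.
  right.
  exists (last u b); first by rewrite mem_cat last_in.
  by move: h2; rewrite ea.
have fs : f \notin s.
  rewrite es mem_cat ea !inE -orbA; apply/negP=> /or3P[/eqP e|/eqP e|fb]; try by rewrite e ?a1n ?a2n in fn.
  by have [] := fbr f _; rewrite ?mem_cat ?fb ?eqxx.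
have ina z : z \in s -> g f z -> z = a1 \/ z = a2.
  rewrite es mem_cat ea !inE -orbA => /or3P[/eqP|/eqP|zb] fz; [by left|by right|].
  by have [|_] := fbr z; rewrite ?mem_cat ?zb ?fz.
have /NSP[_ []] := fN; first by rewrite (negbTE fs).
case=> z zs fz.
have [z' [zs' zz fz']] := hole_edge sg cg clg hh fs zs fz.
split=> // t; rewrite ea !inE.
have nz : z != z' by apply: contraTneq zz => ->; rewrite gi.
have hs' : z' \in s by exact: zs'.
case: (ina z zs fz) => e1; case: (ina z' hs' fz') => e2; rewrite e1 e2 ?eqxx // in nz fz fz' *;
  by case/orP=> /eqP->.
Qed.

(* If the witness had a neighbour u in U, the detour d, u, f, a2 would give a
   larger hole. *)
Lemma wit_U a b f : arcs a b -> size a = 2 -> wit a b f -> g u f -> goal.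
Proof.
move=> [es tab tar tbr] sa [fX fN fs fa fbr] uf.
have [ia ib _ sb hab] := tab; have [_ ir _ sr har] := tar; have [_ _ _ _ hbr] := tbr.
have a_e : exists a1 a2, a = [:: a1; a2] by case: (a) sa => [|a1 [|a2 []]] // _; exists a1, a2.
case: a_e => a1 [a2 ea]; have [uX us] := U_s uU.
have [h1 h2 h3] := hab u; have [h4 h5 h6] := har u; have [h7 h8 h9] := hbr u.
have b0 : b != [::] by case: (b) sb.
have r0 : r != [::] by case: (r) sr.
have dr : d \in r by rewrite -(hr u) head_in.
have as_ z : z \in a -> z \in s by rewrite es mem_cat => ->.
have bs_ z : z \in b -> z \in s by rewrite es mem_cat => ->; rewrite orbT.
have a2a : a2 \in a by rewrite ea !inE eqxx orbT. have a1a : a1 \in a by rewrite ea mem_head.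
have a12 : a1 != a2 by move: (ipath_uniq ia); rewrite ea /= inE andbT.
have [fd nfd] : f != d /\ ~~ g f d by apply: fbr; rewrite mem_cat dr orbT.
have [ua2 ua2'] := us a2 (as_ _ a2a).
have [da2 nda2] : a2 != d /\ ~~ g a2 d.
  have [n1 n2] := h6 a2 d a2a dr; split=> //; apply/negP=> /n2[[e _]|[_ e]].
    by rewrite e ea eqxx in a12.
  have ur := ipath_uniq ir; move: sr ur e; rewrite -(hr u).
  by case: (r) => //= c [|c' r'] //= _ /andP[+ _] e; rewrite e mem_last.
have un : u != d by apply: contraTneq du => ->; rewrite gi.
have fu : f != u by apply: contraTneq uf => ->; rewrite gi.
have fa2 : g f a2 by exact: fa.
have fa2' : f != a2 by apply: contraTneq fa2 => ->; rewrite gi.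
have tn : tri g [:: d; u; f; a2] b.
  split=> //.
    rewrite /= /link /= !inE !negb_or du uf fa2 (eq_sym d u) (eq_sym d f) (eq_sym d a2) (eq_sym u f) un fd da2 fu ua2' fa2' [g d f]gs nfd.
    by rewrite [g d a2]gs nda2 ua2.
  move=> c; have [h1' h2' h3'] := hab c; split.
  - by rewrite /= -(hr c) gs; have [] := hbr c.
  - by move: h2'; rewrite ea.
  move=> x y; rewrite !inE => /or4P[]/eqP-> yb.
  - have [_ _ /(_ y d yb dr)[n1 n2]] := hbr c; rewrite eq_sym; split=> //; rewrite gs => /n2[[-> _]|[_ e]].
      by left.
    have ur := ipath_uniq ir; move: sr ur e; rewrite -(hr c).
    by case: (r) => //= b1 [|c' r'] //= _ /andP[+ _] e; rewrite e mem_last.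
  - by have [/negbTE-> ->] := us y (bs_ _ yb).
  - by have [|-> /negbTE->] := fbr y; rewrite ?mem_cat ?yb.
  have [n1 n2] := h3' a2 y a2a yb; split=> // /n2[[e _]|[_ ->]]; last by right.
  by rewrite e ea eqxx in a12.
have hn := hole_tri gs tn.
have en : d :: [:: u; f; a2] ++ rev b =i [:: d; u; f; a2] ++ b by move=> z; rewrite !(inE, mem_cat) mem_rev.
apply: (big hn _ _ uU).
- move=> z; rewrite en mem_cat !inE => /orP[/or4P[/eqP->|/eqP->|/eqP->|/eqP->]|/bs_/sX] //.
  by apply: sX; exact: as_.
- rewrite (NS_eq _ en); apply: NS_sub.
    move=> z zs; apply/NSP; split; first exact: sX.
    move: zs; rewrite es !mem_cat ea !inE -orbA.
    case/or3P=> [/eqP->|/eqP->|->]; rewrite ?eqxx ?orbT; try by left.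
    right; exists a2; first by rewrite !inE eqxx !orbT.
    by move: (ipath_sorted ia); rewrite ea /= andbT.
  move=> z z'; rewrite !es !mem_cat ea !inE -!orbA => /or3P[/eqP->|/eqP->|->]; rewrite ?eqxx ?orbT; try by left.
  by case/or3P=> [/eqP->|/eqP->|->]; rewrite ?gi ?eqxx ?orbT //; right.
by rewrite (NS_eq _ en); apply/NSP; split=> //; left; rewrite !inE eqxx orbT.
Qed.

(** Here the hole has four vertices. If [f] and [f'] are adjacent, the path [b1 f' f a2] closes with
    [r] to a hole whose neighbourhood covers that of [s] and also contains [u]. *)
Lemma wit_wit a b f f' : arcs a b -> arcs b a -> size a = 2 -> size b = 2 -> wit a b f -> wit b a f' -> g f f' -> goal.
Proof.
move=> [es tab tar tbr] _ sa sb [fX fN fs fa fbr] [fX' fN' fs' fa' fbr'] ff.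
have [ia ib _ _ hab] := tab; have [_ ir _ sr har] := tar; have [_ _ _ _ hbr] := tbr.
have a_e : exists a1 a2, a = [:: a1; a2] by case: (a) sa => [|a1 [|a2 []]] // _; exists a1, a2.
have b_e : exists b1 b2, b = [:: b1; b2] by case: (b) sb => [|b1 [|b2 []]] // _; exists b1, b2.
case: a_e b_e => a1 [a2 ea] [b1 [b2 eb]].
have [h1 h2 h3] := hab u; rewrite ea eb /= in h1 h2 h3.
have a12 : a1 != a2 by move: (ipath_uniq ia); rewrite ea /= inE andbT.
have b12 : b1 != b2 by move: (ipath_uniq ib); rewrite eb /= inE andbT.
have ga : g a1 a2 by move: (ipath_sorted ia); rewrite ea /= andbT.
have [||m1 m2] := h3 a2 b1; rewrite ?inE ?eqxx ?orbT //.
have n21 : ~~ g a2 b1 by apply/negP=> /m2[[e _]|[_ e]]; [rewrite e eqxx in a12|rewrite e eqxx in b12].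
have [||m3 m4] := h3 a1 b2; rewrite ?inE ?eqxx ?orbT //.
have n12 : ~~ g a1 b2 by apply/negP=> /m4[[_ e]|[e _]]; [rewrite e eqxx in b12|rewrite e eqxx in a12].
have [fb1 nfb1] : f != b1 /\ ~~ g f b1 by apply: fbr; rewrite mem_cat eb mem_head.
have [fa2 nfa2] : f' != a2 /\ ~~ g f' a2 by apply: fbr'; rewrite mem_cat ea !inE eqxx orbT.
have g1 : g f a2 by apply: fa; rewrite ea !inE eqxx orbT.
have g2 : g f' b1 by apply: fa'; rewrite eb mem_head.
have f'f : f' != f by apply: contraTneq ff => ->; rewrite gi.
have f'b1 : f' != b1 by apply: contraTneq g2 => ->; rewrite gi.
have fa2' : f != a2 by apply: contraTneq g1 => ->; rewrite gi.
have tn : tri g [:: b1; f'; f; a2] r.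
  split=> //.
    rewrite /= /link /= !inE !negb_or [g b1 f']gs g2 [g f' f]gs ff g1 (eq_sym b1 f') (eq_sym b1 f) (eq_sym b1 a2).
    by rewrite f'b1 fb1 m1 f'f fa2 fa2' [g b1 f]gs nfb1 [g b1 a2]gs n21 nfa2.
  move=> c; have [p1 p2 p3] := har c; have [q1 q2 q3] := hbr c; rewrite ea eb /= in p1 p2 p3 q1 q2 q3; split=> //.
  move=> x y; rewrite !inE => /or4P[]/eqP-> yr.
  - have [|p4 p5] := q3 b1 y _ yr; first by rewrite mem_head.
    by split=> // /p5[[_ ->]|[e _]]; [left|rewrite e eqxx in b12].
  - by have [|-> /negbTE->] := fbr' y; rewrite ?mem_cat ?yr ?orbT.
  - by have [|-> /negbTE->] := fbr y; rewrite ?mem_cat ?yr ?orbT.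
  have [|p4 p5] := p3 a2 y _ yr; first by rewrite !inE eqxx orbT.
  by split=> // /p5[[e _]|[_ ->]]; [rewrite e eqxx in a12|right].
have hn := hole_tri gs tn.
have en : b1 :: [:: f'; f; a2] ++ rev r =i [:: b1; f'; f; a2] ++ r by move=> z; rewrite !(inE, mem_cat) mem_rev.
have ein z : z \in s = [|| z == a1, z == a2, z == b1 | z == b2] by rewrite es mem_cat ea eb !inE -!orbA.
apply: (big hn _ _ uU).
- move=> z; rewrite en mem_cat !inE => /orP[/or4P[/eqP->|/eqP->|/eqP->|/eqP->]|/rX] //.
    by apply: sX; rewrite ein eqxx !orbT.
  by apply: sX; rewrite ein eqxx !orbT.
- rewrite (NS_eq _ en); apply: NS_sub.
    move=> z zs; apply/NSP; split; first exact: sX.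
    move: zs; rewrite ein !mem_cat !inE.
    case/or4P=> [/eqP->|/eqP->|/eqP->|/eqP->]; rewrite ?eqxx ?orbT; try by left.
      by right; exists b1; rewrite ?mem_cat ?inE ?eqxx.
    by right; exists a2; rewrite ?mem_cat ?inE ?eqxx ?orbT // gs.
  move=> z z'; rewrite !ein !mem_cat !inE => /or4P[]/eqP-> /or4P[]/eqP->; rewrite ?gi ?eqxx ?orbT //; try by [left|right].
    by rewrite (negbTE n12).
  by rewrite gs (negbTE n12).
rewrite (NS_eq _ en); apply/NSP; split; first by have [] := U_s uU.
right; exists d; last by rewrite gs.
by rewrite mem_cat -(hr u) head_in ?orbT //; case: (r) sr.
Qed.

End Arcs.

(** The connectors are the two arcs of the hole between the edges [v v'] and [w1 w2] and a path
    through [U] between the attachments. An arc with two vertices gets its triangle from [wit_ex]; a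
    path [d d'] gets it from [u], by claw-freeness at [d]. *)
Lemma case_ii d v v' d' w w' : Nd d v v' -> Nd d' w w' ->
  (forall z, z \in X -> z \in edge_clique g v v' -> z \notin edge_clique g w w') -> goal.
Proof.
move=> nd nd' dj; have [[conn_vertices vs' vv [dv dv']] [dX ds [u uU du] hd]] := nd.
have [vK vK' dK nvv mK] := Nd_K nd.
have [p' [hv ep ehd]] : exists p', [/\ hole g v p', v :: p' =i s & head v p' = v'].
  have [p' [hv ep]] := hole_rot gs hh conn_vertices; have [_ _ _ _ [_ hx]] := hv.
  have vp' : v' \in p' by have := ep v'; rewrite inE eq_sym (negbTE nvv) vs'.
  case: (hx v' vp' vv) => e; first by exists p'.
  exists (rev p'); split; first exact: hole_rev.
    by move=> z; rewrite -ep !inE mem_rev.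
  by rewrite head_rev'.
have [w1 [w2 [p1 [p2 [e12 nd1 dj1]]]]] : exists w1 w2 p1 p2, [/\ p' = p1 ++ w1 :: w2 :: p2, Nd d' w1 w2 &
    forall z, z \in X -> z \in edge_clique g v v' -> z \notin edge_clique g w1 w2].
  have [[ws ws' ww [dw dw']] _] := nd'; have [wK wK' _ _ _] := Nd_K nd'.
  have inp z : z \in s -> z \in edge_clique g w w' -> z \in p'.
    move=> zs zK; have := ep z; rewrite zs inE => /orP[/eqP e|//].
    by have := dj v (sX conn_vertices) vK; rewrite -e zK.
  have [_ ip _ _ _] := hv.
  have [q1 [q2 [e|e]]] := ipath_consec gs gi ip (inp w ws wK) (inp w' ws' wK') ww.
    by exists w, w', q1, q2.
  by exists w', w, q1, q2; rewrite [edge_clique g w' w]edge_cliqueC; split=> //; exact: NdC.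
have [[ws ws' ww [dw dw']] [dX' ds' [u' uU' du'] hd']] := nd1; have [wK wK' dK' nww mK'] := Nd_K nd1.
have nK z : z \in s -> z \in edge_clique g w1 w2 -> z != v /\ z != v'.
  move=> zs zK; split; apply: contraTneq zK => ->; exact: dj1 (sX _) _.
have p10 : p1 != [::].
  apply/negP=> /eqP e; move: ehd; rewrite e12 e /= => e'.
  by have [_] := nK w1 ws wK; rewrite e' eqxx.
have tab : tri g (rcons p1 w1) (v :: rcons (rev p2) w2) by apply: hole_arcs => //; rewrite -e12.
set a := rcons p1 w1 in tab *; set b := v :: _ in tab *.
have es : s =i a ++ b.
  move=> z; rewrite -ep e12; apply: perm_mem; rewrite /a /b; perm_cat.
have as_ z : z \in a -> z \in s by rewrite es mem_cat => ->.
have bs_ z : z \in b -> z \in s by rewrite es mem_cat => ->; rewrite orbT.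
have ua : uniq (a ++ b).
  have <- : uniq (v :: p') = uniq (a ++ b) by apply: perm_uniq; rewrite e12 /a /b; perm_cat.
  exact: hole_uniq hv.
have dab z : z \in a -> z \notin b by apply: (@dj_of _ _ _ _ [::] ua); rewrite cats0.
have dd' : d != d' by apply: contraTneq dK => ->; apply: contraTN dK' => h; exact: dj1.
pose Y := d |: (d' |: U).
have UY : U \subset Y by apply/subsetP=> z zU; rewrite !in_setU1 zU !orbT.
have cdd : connect (inX g Y) d d'.
  have dY : d \in Y by rewrite !inE eqxx. have dY' : d' \in Y by rewrite !inE eqxx orbT.
  apply: (@connect_trans _ _ u); first by apply: connect1; rewrite /inX /= dY (subsetP UY).
  apply: (@connect_trans _ _ u'); first by apply: connect_mono UY _; exact: comp_conn.
  by apply: connect1; rewrite /inX /= dY' (subsetP UY) // gs.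
have dY : d \in Y by rewrite !inE eqxx.
have [r' [ir lr' subr]] := ipath_ex cdd dY.
pose r := d :: r'.
have r'0 : r' != [::] by apply/negP=> /eqP e; rewrite e /= in lr'; rewrite lr' eqxx in dd'.
have rd z : z \in r -> [\/ z \in U, z = d | z = d'].
  by move/subr; rewrite !in_setU1 => /or3P[/eqP|/eqP|]; [constructor 2|constructor 3|constructor 1].
have hr z : head z r = d by [].
have lr z : last z r = d' by [].
have sr : 1 < size r by rewrite /r /=; case: (r') r'0.
have tr c c' q : induced_path g q -> 1 < size q -> {subset q <= s} -> (forall z, head z q = c) -> (forall z, last z q = c') ->
  g c d -> g c' d' -> (forall z, z \in q -> g d z -> z = c) -> (forall z, z \in q -> g d' z -> z = c') -> tri g q r.
  move=> iq sq subq hq lq cd cd' n1 n2; split=> // z; rewrite hq lq hr lr; split=> // x y xq yr.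
  have xs := subq x xq; case: (rd y yr) => [yU|->|->].
  - by have [_ /(_ x xs)[/negbTE n3]] := U_s yU; rewrite eq_sym gs n3.
  - split; first by apply: contraNneq ds => <-.
    by rewrite gs => /n1 ->; [left|].
  split; first by apply: contraNneq ds' => <-.
  by rewrite gs => /n2 ->; [right|].
have ha z : head z a = v'.
  by rewrite /a -ehd e12; case: (p1) p10.
have la z : last z a = w1 by rewrite last_rcons.
have lb z : last z b = w2 by rewrite /= last_rcons.
have [ia ib sa sb _] := tab.
have va' : v' \in a by rewrite -(ha v) head_in //; case: (a) sa.
have wa : w1 \in a by rewrite -(la v) last_in //; case: (a) sa.
have wb : w2 \in b by rewrite -(lb v) last_in.
have tar : tri g a r.
  apply: (tr v' w1) => //; try by rewrite gs.
    by move=> z za dz; case: (hd z (as_ z za) dz) => // e; have := dab z za; rewrite e mem_head.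
  by move=> z za dz; case: (hd' z (as_ z za) dz) => // e; have := dab z za; rewrite e wb.
have tbr : tri g b r.
  apply: (tr v w2) => //; try by rewrite gs.
    by move=> z zb dz; case: (hd z (bs_ z zb) dz) => // e; have := dab v' va'; rewrite -e zb.
  by move=> z zb dz; case: (hd' z (bs_ z zb) dz) => // e; have := dab w1 wa; rewrite -e zb.
have aab : arcs r a b by [].
have aba : arcs r b a by split=> //; [move=> z; rewrite es !mem_cat orbC|exact: tri_sym].
pose K := edge_clique g v v'; pose K' := edge_clique g w1 w2.
have cn q t : arcs r q t -> (forall z, head z q \in K /\ last z q \in K') ->
    goal \/ exists e, conn_valid g K K' (q, e) /\ forall f, f \in e -> size q = 2 /\ wit r q t f.
  move=> aqt hq; have [_ [iq _ sq _ _] _ _] := aqt.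
  have [sq2|sq2] := eqVneq (size q) 2; last first.
    right; exists [::]; split=> //; split=> //=; by rewrite ltn_neqAle eq_sym sq2.
  case: (wit_ex rd hr uU du dX dX' aqt sq2) => [|[f wf]]; first by left.
  right; exists [:: f]; split; last by move=> c; rewrite inE => /eqP->.
  by split=> //=; split=> //; case: wf.
case: (cn a b aab) => [z||[ea [cva wita]]]; rewrite ?ha ?la ?vK' ?wK //.
case: (cn b a aba) => [z||[eb [cvb witb]]]; rewrite ?lb ?vK ?wK' //.
have [er [cvr witr]] : exists e, conn_valid g K K' (r, e) /\ forall f, f \in e -> f \in U /\ g d f.
  case: (boolP (2 < size r)) => sr2; first by exists [::]; split=> //; split=> // z; rewrite /= lr'.
  have er' : r' = [:: d'].
    by move: sr2 lr' r'0; rewrite /r /=; case: (r') => [|c [|]] //= _ ->.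
  have gdd : g d d' by move: (ipath_sorted ir); rewrite er' /= andbT.
  exists [:: u]; split; last by move=> f; rewrite inE => /eqP->.
  split=> //=; first by move=> z; rewrite /= lr'.
  split=> //; first by rewrite er'.
  have [_ /(_ v conn_vertices)[nuv uv]] := U_s uU.
  have ud' : u != d' by apply: contraTneq uU => ->; apply: (contraL (@U_nNS d')); move: (Nd_Nn nd1); rewrite inE => /andP[->].
  have nd'v : ~~ g d' v.
    apply/negP=> h; case: (hd' v conn_vertices h) => e.
      by have [] := nK w1 ws wK; rewrite -e eqxx.
    by have [] := nK w2 ws' wK'; rewrite -e eqxx.
  have d'v : d' != v by apply: contraNneq ds' => ->.
  have := closed_clawfree sg cg clg du gdd dv ud' uv d'v.
  rewrite (negbTE nuv) (negbTE nd'v) !orbF => ud z; rewrite /r er' !inE => /orP[]/eqP-> //.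
  by rewrite gs.
have [/hasP[f fe /hasP[f' fe' ff]]|n1] := boolP (has (fun f => has (g f) eb) ea).
  have [s2 wf] := wita f fe; have [s2' wf'] := witb f' fe'.
  exact: (wit_wit rd hr uU du dX dX' aab aba s2 s2' wf wf' ff).
have [/hasP[f fe /hasP[f' fe' ff]]|n2] := boolP (has (fun f => has (g f) er) ea).
  have [s2 wf] := wita f fe; have [fU df] := witr f' fe'; rewrite gs in ff.
  exact: (wit_U hr fU df dX aab s2 wf ff).
have [/hasP[f fe /hasP[f' fe' ff]]|n3] := boolP (has (fun f => has (g f) er) eb).
  have [s2 wf] := witb f fe; have [fU df] := witr f' fe'; rewrite gs in ff.
  exact: (wit_U hr fU df dX aba s2 wf ff).
have nh e e' f f' : ~~ has (fun f => has (g f) e') e -> f \in e -> f' \in e' -> ~~ g f f'.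
  by move/hasPn=> h fe fe'; have /hasPn/(_ f' fe') := h f fe.
have neU f q t f' : wit r q t f -> f' \in U -> f != f'.
  by case=> _ fN _ _ _ fU; apply: contraTneq fN => ->; exact: U_nNS.
right; exists K, K', (a, ea), (b, eb), (r, er); split=> //.
split.
- apply: csep_tri => // f z fe => [zb|za|fe'].
  + by have [_ [_ _ _ _ h]] := wita f fe; apply: h; rewrite mem_cat zb.
  + by have [_ [_ _ _ _ h]] := witb f fe; apply: h; rewrite mem_cat za.
  split; last exact: nh n1 fe fe'.
  have [_ [_ _ _ h _]] := wita f fe; have [_ [_ _ _ _ h']] := witb z fe'.
  apply/negP=> /eqP e; have [|_] := h' v'; first by rewrite mem_cat va'.
  by rewrite -e h.
- apply: csep_tri => // f z fe => [zb|za|fe'].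
  + by have [_ [_ _ _ _ h]] := wita f fe; apply: h; rewrite mem_cat zb orbT.
  + have [fU _] := witr f fe; have [_ h] := U_s fU; have [] := h z (as_ z za); by [].
  split; last exact: nh n2 fe fe'.
  by have [_ wf] := wita f fe; have [fU _] := witr z fe'; exact: neU wf fU.
- apply: csep_tri => // f z fe => [zb|za|fe'].
  + by have [_ [_ _ _ _ h]] := witb f fe; apply: h; rewrite mem_cat zb orbT.
  + have [fU _] := witr f fe; have [_ h] := U_s fU; have [] := h z (bs_ z za); by [].
  split; last exact: nh n3 fe fe'.
  by have [_ wf] := witb f fe; have [fU _] := witr z fe'; exact: neU wf fU.
move=> z; rewrite mem_cat => /orP[|]; last rewrite mem_cat => /orP[]; rewrite mem_cat /= => /orP[h|h].
- exact: sX (as_ z h).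
- by have [_ []] := wita z h.
- exact: sX (bs_ z h).
- by have [_ []] := witb z h.
- by case: (rd z h) => [/U_s[]|->|->].
by have [/U_s[]] := witr z h.
Qed.

Lemma Nd_kq d a b v v' : Nd d a b -> v \in s -> v' \in s -> g v v' -> d \in edge_clique g v v' -> edge_clique g a b = edge_clique g v v'.
Proof.
case=> _ [_ ds _ h] conn_vertices vs' vv; rewrite inE => /or3P[/eqP e|/eqP e|/andP[dv dv']].
- by rewrite e conn_vertices in ds.
- by rewrite e vs' in ds.
have nv : v != v' by apply: contraTneq vv => ->; rewrite gi.
case: (h v conn_vertices dv) (h v' vs' dv') => e1 [] e2; rewrite e1 e2 ?eqxx // in nv *; exact: edge_cliqueC.
Qed.

(** All attachments in one clique is [case_i], two cliques disjoint in [X] is [case_ii], two cliques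
    through a common [h] is [case_iii]. A third clique meeting both of the latter would give a
    triangle with its edges in three different cliques, although a vertex with two neighbours in a
    maximal clique belongs to it. *)
Lemma step : goal.
Proof.
have x0s : x0 \in s by exact: mem_head.
have nU z : z \in s -> z \notin U by move=> zs; apply/negP=> zU; have [_ /(_ z zs)[_]] := U_s zU; rewrite eqxx.
have nN z : z \in s -> z \notin Nn.
  by move=> zs; apply/negP=> /Nn_Nd[a [b [_ [_]]]]; rewrite zs.
have [d dN _] := Nn_other (nU x0 x0s).
have [v [v' nd]] := Nn_Nd dN; have [[conn_vertices vs' vv [dv dv']] [dX ds [u uU du] hd]] := nd.
have [vK vK' dK nvv mK] := Nd_K nd; set K := edge_clique g v v' in vK vK' dK mK.
have NnU z : z \in Nn -> z \notin U.
  by rewrite inE => /andP[zN _]; apply: contraL zN; exact: U_nNS.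
have NnX z : z \in Nn -> z \in X by move/Nn_Nd=> [a [b [_ []]]].
pose E := U :|: Nn.
have nE z : z \in s -> z \notin E by move=> zs; rewrite in_setU negb_or nU ?nN.
have EX z : z \in E -> z \in X by rewrite in_setU => /orP[/U_s[]|/NnX].
have cr x y : x \in X -> x \notin E -> y \in E -> g x y -> exists a b, Nd y a b /\ x \in edge_clique g a b.
  rewrite in_setU negb_or => xX /andP[xU xN]; rewrite in_setU => /orP[yU|yN] xy.
    by case: (U_out xX yU xy) => h; [rewrite h in xU|rewrite h in xN].
  have [a [b ndy]] := Nn_Nd yN; exists a, b; split=> //; exact: (Nd_cross ndy xX xU xN xy).
have crK x y K0 (a b : V) : K0 = edge_clique g a b -> a \in s -> b \in s -> g a b -> x \in X -> x \notin E -> y \in E -> y \in K0 -> g x y -> x \in K0.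
  move=> -> as_ bs_ ab xX xE yE yK xy; have [a' [b' [ndy xk]]] := cr x y xX xE yE xy.
  by rewrite -(Nd_kq ndy as_ bs_ ab yK).
case: (boolP (Nn \subset K)) => [/subsetP sub|/subsetPn[d' dN' dnK']].
  have [d2 d2N d2d] := Nn_other (NnU d dN).
  apply: (@case_i V g sg X bX IH K E d v) => //.
  - move=> x y /setDP[xX xE] yE xy; have [a [b [ndy _]]] := cr x y xX xE yE xy.
    have yK : y \in K by apply: sub; exact: (Nd_Nn ndy).
    by split=> //; apply: (crK x y K v v').
  - by apply/subsetP.
  - by rewrite in_setU dN orbT.
  - by rewrite in_setD nE //=; exact: sX.
  - by apply/card_gt1P; exists d, d2; split; rewrite 1?eq_sym // in_setU ?dN ?d2N orbT.
  by apply/card_gt1P; exists v, v'; split; rewrite // in_setD nE //=; exact: sX.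
have [w [w' nd']] := Nn_Nd dN'; have [[ws ws' ww [dw dw']] [dX' ds' [u' uU' du'] hd']] := nd'.
have [wK wK' dK' nww mK'] := Nd_K nd'; set K' := edge_clique g w w' in wK wK' dK' mK'.
have ne : K <> K' by move=> e; rewrite -e in dK'; rewrite dK' in dnK'.
have [/exists_inP[h hX /andP[hK hK']]|] := boolP [exists h in X, (h \in K) && (h \in K')]; last first.
  rewrite negb_exists_in => /forall_inP H; apply: (case_ii nd nd') => z zX zK.
  by have := H z zX; rewrite [z \in K]zK.
case: (boolP (Nn \subset K :|: K')) => [/subsetP sub|/subsetPn[d2 d2N]]; last first.
  rewrite in_setU negb_or => /andP[d2K d2K']; have [y [y' nd2]] := Nn_Nd d2N.
  have [_ _ d2K2 _ mK2] := Nd_K nd2; set K2 := edge_clique g y y' in d2K2 mK2.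
  have [/exists_inP[h1 h1X /andP[h1K h1K2]]|] := boolP [exists h in X, (h \in K) && (h \in K2)]; last first.
    rewrite negb_exists_in => /forall_inP H; apply: (case_ii nd nd2) => z zX zK.
    by have := H z zX; rewrite [z \in K]zK.
  have [/exists_inP[h2 h2X /andP[h2K h2K2]]|] := boolP [exists h in X, (h \in K') && (h \in K2)]; last first.
    rewrite negb_exists_in => /forall_inP H; apply: (case_ii nd' nd2) => z zX zK.
    by have := H z zX; rewrite [z \in K']zK.
  exfalso; have hnK2 : h \notin K2.
    apply/negP=> hK2; have [_ cK2 _] := mK2.
    have hd2 : g h d2 by apply: cK2 => //; apply: contraNneq d2K => <-.
    by case: (mc_nb2 sg cg clg mK mK' ne hK hK' hd2) => e; [rewrite e in d2K|rewrite e in d2K'].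
  have h1h : h != h1 by apply: contraNneq hnK2 => ->.
  have h2h : h != h2 by apply: contraNneq hnK2 => ->.
  have h12 : h2 != h1 by apply/negP=> /eqP e; apply: ne; apply: (mc_eq sg mK mK' hK h1K) => //; rewrite -e.
  have [_ cK' _] := mK'; have [_ cK2 _] := mK2.
  have h2K0 : h2 \in K.
    by apply: (mc_in mK hK h1K h1h); [apply: cK' => //; rewrite eq_sym|apply: cK2].
  by apply: ne; apply: (mc_eq sg mK mK' hK h2K0).
have hE : h \notin E.
  rewrite in_setU; apply/negP=> /orP[hU|hN].
    have [_ us] := U_s hU; have [n1 n2] := us v conn_vertices.
    by move: hK; rewrite inE (negbTE n2) (negbTE n1) /= orbF; have [_] := us v' vs' => /negbTE->.
  have [a [b ndh]] := Nn_Nd hN; apply: ne.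
  by rewrite /K /K' -(Nd_kq ndh conn_vertices vs' vv hK) (Nd_kq ndh ws ws' ww hK').
pose F := (X :\: E) :\ h.
have mF z : z \in F = [&& z != h, z \notin E & z \in X] by rewrite in_setD1 in_setD.
have sF z : z \in s -> z != h -> z \in F by move=> zs zh; rewrite mF zh nE ?sX.
have [e [es_ eK eh]] : exists e, [/\ e \in s, e \in K & e != h].
  by have [evh|] := eqVneq v h; [exists v'; rewrite -evh eq_sym|exists v].
have [e' [es_' eK' eh']] : exists e', [/\ e' \in s, e' \in K' & e' != h].
  by have [evh|] := eqVneq w h; [exists w'; rewrite -evh eq_sym|exists w].
have [f fs fh] : exists2 f, f \in s & f \notin [:: h; e; e'].
  apply/hasP/negPn/negP=> /hasPn H; have [sz _ _ _ _] := hh.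
  have := @uniq_leq_size _ s [:: h; e; e'] (hole_uniq hh).
  rewrite /s /= leqNgt ltnS sz => Hs; suff: false by []; apply: Hs => z zs.
  by have := H z zs; rewrite negbK.
move: fh; rewrite !inE !negb_or => /and3P[fh fe fe'].
have dE : d \in E by rewrite in_setU dN orbT. have dE' : d' \in E by rewrite in_setU dN' orbT.
have cU : connect (inX g E) d d'.
  apply: (@connect_trans _ _ u); first by apply: connect1; rewrite /inX /= dE du in_setU uU.
  apply: (@connect_trans _ _ u'); last by apply: connect1; rewrite /inX /= dE' gs du' in_setU uU'.
  by apply: connect_mono (comp_conn sg uU uU'); exact: subsetUl.
have cF : connect (inX g F) e e'.
  by apply: (hole_conn sg hh _ es_ es_' eh eh') => z /= /andP[h1 h2]; exact: sF.
apply: (@case_iii V g sg cg clg X bX IH K K' E F h d d' e e') cU cF (sF f fs fh) fe fe' => //.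
- by rewrite mF eqxx.
- by move=> z zE; rewrite mF zE /= andbF.
- move=> z; rewrite mF; case: eqP => [->|_] /=; first by rewrite hX.
  by case: (boolP (z \in E)) => // /EX ->.
- move=> x y; rewrite mF => /and3P[xh xE xX] yE xy; have [a [b [ndy _]]] := cr x y xX xE yE xy.
  have := sub y (Nd_Nn ndy); rewrite in_setU => /orP[yK|yK]; [left|right]; split=> //.
    by apply: (crK x y K v v').
  by apply: (crK x y K' w w').
- exact: sF.
exact: sF.
Qed.

End Step.

(** Induction on the size of [X], and for fixed [X] on the number of vertices outside the
    neighbourhood of the hole. *)
Theorem closed_ham_or_good X : biconnected g X -> ham_on g X \/ three_connectors g X.
Proof.
have [n] := ubnP #|X|; elim: n X => // n IH X; rewrite ltnS => Xn bX.
have IH' Y : #|Y| < #|X| -> biconnected g Y -> ham_on g Y \/ three_connectors g Y.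
  by move=> lt; apply: IH; exact: leq_trans lt Xn.
case: (bic_hole sg cg clg bX) => [[x [p [hh sX]]]|]; last by left.
have [m] := ubnP (#|X| - #|NS g X (x :: p)|); elim: m x p hh sX => // m IHm x p hh sX.
rewrite ltnS => le; case: (boolP (NS g X (x :: p) == X)) => [/eqP e|ne].
  by left; exact: (hole_ham sg cg clg hh sX e).
have sub (t : seq V) : NS g X t \subset X by apply/subsetP=> z; rewrite inE => /andP[].
have [u uX un] : exists2 u, u \in X & u \notin NS g X (x :: p).
  by apply/subsetPn; apply: contra ne => h; rewrite eqEsubset sub.
apply: (@step X bX IH' x p hh sX _ u); last by rewrite in_setD un.
move=> y q hy sy lt; apply: (IHm y q hy sy).
have := subset_leq_card (sub (y :: q)); move: le lt; clear; lia.
Qed.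

End Hole.

(** * Undoing the completion steps *)

Section Heavy.
Variable V : finType.
Implicit Types (g f h : rel V) (u v w x y z : V) (p q s : seq V) (A B X K : {set V}).

Definition heavy_in g v := #|V| <= (dg g v).*2.

Lemma heavy_in_sub g f v : subrel g f -> heavy_in g v -> heavy_in f v.
Proof. by move=> sub; have := @dg_sub _ _ _ v sub; rewrite /heavy_in; lia. Qed.

(** Two nonadjacent heavy vertices form a heavy pair, and a closed graph has none. *)
Lemma heavy_in_adj h u v : simple_rel h -> claw_heavy h -> closed h -> heavy_in h u -> heavy_in h v -> u != v -> h u v.
Proof.
move=> sh ch clh hu hw uv; apply/negPn/negP=> n; have := closed_nohp sh ch clh u v.
by rewrite /ore_pair uv n; move: hu hw; rewrite /heavy_in; lia.
Qed.

Lemma bic_sub g h X : subrel g h -> biconnected g X -> biconnected h X.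
Proof.
move=> sub [cX bX]; split=> // r u v ur vr; apply: connect_sub (bX r u v ur vr) => a b /and3P[aX bX' ab].
by apply: connect1; rewrite /inX /= aX bX' sub.
Qed.

(* An induced path of the completed graph uses at most one new edge, in which
   the completed vertex x can be inserted. *)
Lemma ipath_cl f x p : simple_rel f -> induced_path (complete_at f x) p -> induced_path f p \/
  [/\ x \notin p & exists p1 p2, [/\ p = p1 ++ p2, p1 != [::], p2 != [::], induced_path f (p1 ++ x :: p2) &
    f x (last x p1) /\ f x (head x p2)]].
Proof.
move=> sf; have [fs fi] := sf; have [es ei] := complete_at_simple x sf.
have sub : subrel f (complete_at f x) by exact: complete_at_sub.
elim: p => [|a q IH]; first by left.
case: q IH => [|b q] IH; first by left.
move=> ip; have [lk iq] := andP ip; have lkE := lnkP lk; have /andP[aq uq] := ipath_uniq ip.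
have eab : complete_at f x a b by case/and3P: lk.
have xx u v : f x u -> f x v -> u != v -> complete_at f x u v by move=> xu xv uv; rewrite /complete_at uv xu xv orbT.
case: (IH iq) => [fq|[xq [p1 [p2 [e p10 p20 ip' [x1 x2]]]]]].
  case: (boolP (f a b)) => fab.
    left; rewrite -[induced_path f _]/(link f a (b :: q) && induced_path f (b :: q)) fq andbT.
    apply: lnkI; [exact: ipath_uniq fq|by []|].
    by move=> z /lkE[n1 n2]; split=> // /sub/n2.
  move: eab; rewrite /complete_at (negbTE fab) /= => /and3P[ab xa xb]; right.
  have xa' : x != a by apply: contraTneq xa => ->; rewrite fi.
  have nxz z : z \in b :: q -> f x z -> z = b.
    move=> zq xz; have [n1 n2] := lkE z zq; apply: n2; exact: xx.
  have xbq : x \notin b :: q.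
    apply/negP=> xq; have [n1 n2] := lkE x xq; have := n2 (sub _ _ _); rewrite fs => /(_ xa) e.
    by rewrite -e fi in xb.
  split; first by rewrite inE negb_or xa' xbq.
  exists [:: a], (b :: q); split=> //.
  have ixq : induced_path f (x :: b :: q).
    rewrite -[induced_path f _]/(link f x (b :: q) && induced_path f (b :: q)) fq andbT.
    apply: lnkI; [exact: ipath_uniq fq|by []|].
    move=> z zq; split; first by apply: contraNneq xbq => ->.
    exact: nxz.
  rewrite -[induced_path f _]/(link f a (x :: b :: q) && induced_path f (x :: b :: q)) ixq andbT.
  apply: lnkI; [exact: ipath_uniq ixq|by rewrite fs|].
  move=> z; rewrite in_cons => /orP[/eqP->|zq]; first by rewrite eq_sym.
  have [n1 n2] := lkE z zq; split=> // az; have zb := n2 (sub _ _ az).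
  by rewrite zb (negbTE fab) in az.
right.
have hin : head x p2 \in p2 by exact: head_in.
have lin : last x p1 \in p1 by exact: last_in.
have hb : head x p2 != b.
  have uq' : uniq (b :: q) by exact: (@ipath_uniq _ (complete_at f x)).
  apply: contraTneq uq' => hb; rewrite e cat_uniq; apply/negP=> /and3P[_ /negP nh _].
  apply: nh; apply/hasP; exists (head x p2) => //=; rewrite hb.
  by case: (p1) p10 e => //= c p1' _ [-> _]; rewrite inE eqxx.
have inq z : z \in p2 -> z \in b :: q by move=> zp; rewrite e mem_cat zp orbT.
have nax : ~~ f x a.
  apply/negP=> xa; have [n1 n2] := lkE _ (inq _ hin); case/eqP: hb; apply: n2; exact: xx.
have xa : x != a.
  apply: contraNneq hb => xa; have [_ n2] := lkE _ (inq _ hin).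
  by apply/eqP; apply: n2; apply: sub; rewrite -xa.
have fab : f a b.
  by move: eab; rewrite /complete_at (negbTE nax) /= andbF orbF.
split; first by rewrite inE negb_or xa xq.
exists (a :: p1), p2; split=> //; first by rewrite e.
  rewrite cat_cons -[induced_path f _]/(link f a (p1 ++ x :: p2) && induced_path f (p1 ++ x :: p2)) ip' andbT.
  case: (p1) p10 e ip' => // c p1' _ [<- e'] ip'; rewrite cat_cons in ip' *.
  apply: lnkI; [exact: ipath_uniq ip'|by []|].
  move=> z zin; have [->|zx] := eqVneq z x; first by rewrite eq_sym; split=> //; rewrite fs (negbTE nax).
  have zq' : z \in b :: q by move: zin; rewrite e' !(in_cons, mem_cat) (negbTE zx).
  by have [n1 n2] := lkE z zq'; split=> // /sub/n2.
split=> //; by case: (p1) p10 x1.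
Qed.

Definition P6bad f := exists v1 v2 p, [/\ induced_path f (v1 :: v2 :: p), size p = 4, ~~ heavy_in f v1 & ~~ heavy_in f v2].

(** If [x] enters between [v1] and [v2], it becomes the second vertex of the path and is light,
    because its degree is at most that of [v1] in the completion. The lengthened path is cut back to
    six vertices at the other end. *)
Lemma P6bad_cl f x : simple_rel f -> P6bad (complete_at f x) -> P6bad f.
Proof.
move=> sf [v1 [v2 [p [ip sp n1 n2]]]].
have nf v : ~~ heavy_in (complete_at f x) v -> ~~ heavy_in f v by apply: contra; apply: heavy_in_sub; exact: complete_at_sub.
case: (ipath_cl sf ip) => [ip'|[_ [p1 [p2 [e p10 p20 ip' [x1 x2]]]]]].
  by exists v1, v2, p; split=> //; exact: nf.
case: p1 p10 e ip' x1 => // a [|b p1] _; [case=> ea e ip' x1|case=> ea eb e ip' _].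
  exists v1, x, (v2 :: take 3 p); split; last 1 first.
  - apply: contra n1; rewrite ea /heavy_in => h; apply: leq_trans h _; rewrite leq_double; exact: dg_complete.
  - apply: (@ipath_catl _ _ _ (drop 3 p)); move: ip'; rewrite -e -ea.
    by rewrite -{1}(cat_take_drop 3 p).
  - by rewrite /= size_takel ?sp.
  - exact: nf.
exists v1, v2, (take 4 (p1 ++ x :: p2)); split; try exact: nf.
  by apply: (@ipath_catl _ _ _ (drop 4 (p1 ++ x :: p2))); rewrite /= cat_take_drop ea eb.
by move: sp; rewrite e !size_cat => sp; rewrite size_takel // size_cat /=; move: sp; clear; lia.
Qed.

Lemma P6bad_ext g h : completes_to g h -> simple_rel g -> P6bad h -> P6bad g.
Proof. by elim=> // {h}f x h _ _ IH sf bh; apply: (P6bad_cl sf (x := x)); apply: IH => //; exact: complete_at_simple. Qed.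

Definition conn_rev (k : conn V) : conn V := (rev k.1, k.2).

Lemma cvalid_rev h A B k : simple_rel h -> conn_valid h A B k -> conn_valid h B A (conn_rev k).
Proof.
move=> [hs hi] [ip sz ab e]; split=> /=; rewrite ?size_rev //; first exact: ipath_rev.
  by move=> d; rewrite head_rev' last_rev'; have [] := ab d.
by case: (k.2) e => // c s [-> sz' hc]; split=> // z; rewrite mem_rev; exact: hc.
Qed.

Lemma csep_sym h k k' : simple_rel h -> conn_sep h k k' -> conn_sep h k' k.
Proof.
move=> [hs hi] c d x y xk yk; have [n1 n2] := c d y x yk xk; rewrite eq_sym hs; split=> // /n2.
by case=> -[-> ->]; [left|right].
Qed.

Lemma csep_rev h k k' : simple_rel h -> conn_sep h k k' -> conn_sep h (conn_rev k) (conn_rev k').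
Proof.
move=> [hs hi] c d x y; rewrite !mem_cat /= !mem_rev -!mem_cat => xk yk.
by have [n1 n2] := c d x y xk yk; split=> // /n2[]; rewrite !head_rev' !last_rev'; [right|left].
Qed.

Lemma cv_near h A B k d : simple_rel h -> conn_valid h A B k ->
  exists z, [/\ z \in conn_vertices k, z != head d k.1, z != last d k.1 & h (head d k.1) z].
Proof.
move=> [hs hi] [ip sz _ e]; case: k ip sz e => [p [|c s]] /= ip sz.
  case: p ip {sz} => // a [//|m [//|b p]] ip _; exists m; rewrite /conn_vertices cats0 /=.
  have := ipath_uniq ip; have := ipath_sorted ip; rewrite /= !inE !negb_or -!andbA => /andP[am _].
  case/and5P=> am' _ _ mb /andP[mp _]; rewrite eqxx orbT am eq_sym am'; split=> //.
  by apply: contraTneq (mem_last b p) => <-; rewrite inE negb_or mb.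
case=> -> sz' hc; have p0 : p != [::] by case: (p) sz.
have hin : head d p \in p by exact: head_in. have lin : last d p \in p by exact: last_in.
exists c; split; first by rewrite mem_cat mem_head orbT.
- by apply: contraTneq (hc _ hin) => ->; rewrite hi.
- by apply: contraTneq (hc _ lin) => ->; rewrite hi.
by rewrite hs; exact: hc.
Qed.

(** The connector [k2] is prolonged at its head by the head of [k1] and a neighbour of it, and at
    its last vertex by the last vertex of [k3] and a neighbour of it. *)
Lemma good_P6 h : simple_rel h -> three_connectors h [set: V] -> exists v1 v2 p, induced_path h (v1 :: v2 :: p) /\ size p = 4.
Proof.
move=> sh; have [hs hi] := sh; case=> A [B [k1 [k2 [k3 [mA mB dj [c1 c2 c3] [s12 s13 s23 _]]]]]].
have [d _] : exists d : V, true by case: mA => /card_gt1P[x _]; exists x.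
have [z1 [z1k z1a z1b az1]] := cv_near d sh c1.
have [z3 [z3k z3b z3a bz3]] := cv_near d sh (cvalid_rev sh c3).
rewrite /= head_rev' last_rev' in z3b z3a bz3.
have z3k' : z3 \in conn_vertices k3 by move: z3k; rewrite !mem_cat /= mem_rev.
have [ha1 _] := cvalid_in c1 d; have [_ hb3] := cvalid_in c3 d.
have [_ _ /(_ d)[A1 B1] _] := c1; have [ip2 sz2 _ _] := c2; have [_ _ /(_ d)[A3 B3] _] := c3.
have ab1 : head d k1.1 != last d k1.1 by apply: contraTneq B1 => <-; exact: dj.
have ab3 : head d k3.1 != last d k3.1 by apply: contraTneq B3 => <-; exact: dj.
have k20 : k2.1 != [::] by case: (k2.1) sz2.
have in2 y : y \in k2.1 -> y \in conn_vertices k2 by rewrite mem_cat => ->.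
have s1 y : y \in [:: z1; head d k1.1] -> y \in conn_vertices k1 /\ y != last d k1.1.
  by rewrite !inE => /orP[]/eqP->.
have s3 y : y \in [:: last d k3.1; z3] -> y \in conn_vertices k3 /\ y != head d k3.1.
  by rewrite !inE => /orP[]/eqP->; rewrite // eq_sym.
have ipQ : induced_path h ([:: z1; head d k1.1] ++ k2.1 ++ [:: last d k3.1; z3]).
  apply: (@ipath_cat _ _ d) => //=.
  - by rewrite /link /= inE z1a hs az1.
  - apply: (@ipath_cat _ _ d) => //=.
    + by rewrite /link /= inE eq_sym z3b bz3.
    + have [|n1 n2] := s23 d (last d k2.1) (last d k3.1) _ hb3; first by apply: in2; exact: last_in.
      by case: mB => _ cB _; apply: cB => //; have [_ _ /(_ d)[]] := c2.
    move=> x y xp yq; have [yk ya] := s3 y yq; have [n1 n2] := s23 d x y (in2 x xp) yk.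
    split=> // /n2[[_ e]|[-> ->]] //; by rewrite e eqxx in ya.
  - by case: (k2.1) k20.
  - have -> : head d (k2.1 ++ [:: last d k3.1; z3]) = head d k2.1 by case: (k2.1) k20.
    have [|n1 _] := s12 d (head d k1.1) (head d k2.1) ha1; first by apply: in2; exact: head_in.
    by case: mA => _ cA _; apply: cA => //; have [_ _ /(_ d)[]] := c2.
  have -> : head d (k2.1 ++ [:: last d k3.1; z3]) = head d k2.1 by case: (k2.1) k20.
  move=> x y xp; rewrite mem_cat => yq; have [xk xb] := s1 x xp; case/orP: yq => yq.
    have [n1 n2] := s12 d x y xk (in2 y yq); split=> // /n2[[-> ->]|[e _]] //; by rewrite e eqxx in xb.
  have [yk ya] := s3 y yq; have [n1 n2] := s13 d x y xk yk.
  by split=> // /n2[[_ e]|[e _]]; [rewrite e eqxx in ya|rewrite e eqxx in xb].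
exists z1, (head d k1.1), (take 4 (k2.1 ++ [:: last d k3.1; z3])); split.
  by apply: (@ipath_catl _ _ _ (drop 4 (k2.1 ++ [:: last d k3.1; z3]))); rewrite /= cat_take_drop.
by rewrite size_takel // size_cat /=; move: sz2; clear; lia.
Qed.

(** Heavy vertices of the closed graph are pairwise adjacent, so at one end of the induced [P_6] the
    two outermost vertices are both light. *)
Lemma P6_ham g : simple_rel g -> claw_heavy g -> biconnected g [set: V] ->
  (forall v1 v2 v3 v4 v5 v6, induced_path g [:: v1; v2; v3; v4; v5; v6] -> heavy_in g v1 || heavy_in g v2) -> ham_on g [set: V].
Proof.
move=> sg cg bg H; have [h e clh] := closure_ex sg.
have sh := completes_to_simple e sg; have ch := completes_to_claw_heavy e sg cg.
case: (closed_ham_or_good sh ch clh (bic_sub (completes_to_sub e) bg)) => [hh|gh]; first exact: completes_to_ham e sg cg hh.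
have [u1 [u2 [q [iq sq]]]] := good_P6 sh gh.
have : P6bad h.
  case: q sq iq => // u3 [//|u4 [//|u5 [//|u6 [|//]]]] _ iq; set Q := [:: _, _ & _] in iq.
  have ir := ipath_rev sh.1 iq; have [_ hi] := sh.
  case: (boolP (heavy_in h u1 || heavy_in h u2)) => [h12|]; last first.
    by rewrite negb_or => /andP[n1 n2]; exists u1, u2, [:: u3; u4; u5; u6].
  have nn x y : x \in [:: u1; u2] -> y \in [:: u5; u6] -> heavy_in h x -> heavy_in h y -> False.
    move=> x1 y5 hx hy; have iq' : induced_path h ([:: u1; u2; u3] ++ [:: u4; u5; u6]) by [].
    have [||n1 n2] := @ipath_sep _ _ x _ _ x y iq'.
    - by move: x1; rewrite !inE => /orP[]->; rewrite ?orbT.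
    - by move: y5; rewrite !inE => /orP[]->; rewrite ?orbT.
    have [_ ey] := n2 (heavy_in_adj sh ch clh hx hy n1); move: (ipath_uniq iq); rewrite /= in ey.
    by rewrite /= !inE -ey !negb_or; move: y5; rewrite !inE => /orP[]/eqP->; rewrite !eqxx ?andbF.
  exists u6, u5, [:: u4; u3; u2; u1]; split=> //; apply/negP=> h6.
    by case/orP: h12 => h1; [apply: (nn u1 u6)|apply: (nn u2 u6)]; rewrite ?inE ?eqxx ?orbT.
  by case/orP: h12 => h1; [apply: (nn u1 u5)|apply: (nn u2 u5)]; rewrite ?inE ?eqxx ?orbT.
move/(P6bad_ext e sg) => [v1 [v2 [p [ip sp n1 n2]]]].
case: p sp ip => // v3 [//|v4 [//|v5 [//|v6 [|//]]]] _ /H.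
by rewrite (negbTE n1) (negbTE n2).
Qed.

End Heavy.

(** * Carrying the three connectors back to the original graph *)

Section Carry.
Variables (V : finType) (h : rel V).
Hypotheses (sh : simple_rel h) (ch : claw_heavy h) (clh : closed h).
Let hs := sh.1.
Let hi := sh.2.
Implicit Types (f g : rel V) (u v w x y z d : V) (p q s : seq V) (A B X K : {set V}) (k : conn V).

(** The bound is the one [nohp] needs: an edge inside [B] that is missing in [f] costs each of its
    ends a neighbour, so the degree sum in [f] falls below [#|V|]. *)
Definition clean B := forall u v, u \in B -> v \in B -> u != v -> dg h u + dg h v <= #|V|.+1.
Definition one_heavy B := forall u v, u \in B -> v \in B -> heavy_in h u -> heavy_in h v -> u = v.

(** The common neighbours of [u] and [v] lie in [A], and together the two have at most two
    neighbours in [B], as a vertex outside [B] has at most one there. So the degree sum is at most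
    [#|V| + #|A| - #|B|]. *)
Lemma dirty_card A B u v : closed_clique h A -> closed_clique h B -> (forall w, w \in A -> w \notin B) ->
  u \in A -> v \in A -> u != v -> #|V|.+1 < dg h u + dg h v -> #|B| + 2 <= #|A|.
Proof.
move=> mA mB dj uA vA uv; rewrite /dg -cardsUI => lt.
have h1 : #|nb h u :&: nb h v| + 2 <= #|A|.
  have sub : (nb h u :&: nb h v) \subset A :\ u :\ v.
    apply/subsetP=> w; rewrite !inE => /andP[uw vw]; apply/and3P; split.
    - by apply: contraTneq vw => ->; rewrite hi.
    - by apply: contraTneq uw => ->; rewrite hi.
    by apply: (mc_in mA uA vA uv); rewrite hs.
  have := subset_leq_card sub; have := cardsD1 u A; have := cardsD1 v (A :\ u).
  rewrite !inE uA vA eq_sym uv /=; clear; lia.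
have one w : w \in A -> #|nb h w :&: B| <= 1.
  move=> wA; apply/card_le1P=> a; rewrite inE => /andP[wa aB] b; rewrite inE [in RHS]inE.
  apply/andP/eqP=> [[wb bB]|->//]; have [_ _ H] := mB.
  by apply: (H w); rewrite ?dj // -1?[h w _]/(h w b); move: wa wb; rewrite !inE.
have h2 : #|(nb h u :|: nb h v) :&: B| <= 2.
  rewrite setIUl; apply: leq_trans (leq_card_setU _ _) _; exact: (leq_add (one u uA) (one v vA)).
have h3 : #|(nb h u :|: nb h v) :\: B| + #|B| <= #|V|.
  have := cardsUI ((nb h u :|: nb h v) :\: B) B.
  have -> : ((nb h u :|: nb h v) :\: B) :&: B = set0 by apply/setP=> z; rewrite !inE; case: (z \in B); rewrite ?andbF.
  by rewrite cards0 addn0 => <-; exact: max_card.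
have := cardsID B (nb h u :|: nb h v); move: lt h1 h2 h3; clear; lia.
Qed.

(** If one clique has two heavy vertices, the other has none, since a heavy vertex outside would be
    adjacent to both. If neither has two, [dirty_card] rules out that both fail to be clean. *)
Lemma orient A B : closed_clique h A -> closed_clique h B -> (forall w, w \in A -> w \notin B) ->
  (clean B /\ one_heavy B) \/ (clean A /\ one_heavy A).
Proof.
move=> mA mB dj; have dj' w : w \in B -> w \notin A by apply: contraL; exact: dj.
have two X (Y : {set V}) u1 u2 v : closed_clique h X -> (forall w, w \in Y -> w \notin X) -> u1 \in X -> u2 \in X -> heavy_in h u1 -> heavy_in h u2 ->
    u1 != u2 -> v \in Y -> ~~ heavy_in h v.
  move=> mX dYX u1X u2X hu1 hu2 u12 vY; apply/negP=> hvv; have [_ _ H] := mX.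
  have ne w : w \in X -> v != w by move=> wX; apply: contraTneq wX => <-; exact: dYX.
  by move: u12; rewrite (H v u1 u2) ?eqxx ?dYX // heavy_in_adj ?ne.
have none X : (forall v, v \in X -> ~~ heavy_in h v) -> clean X /\ one_heavy X.
  move=> nX; split=> [u v uX vX uv|u v uX _ hu]; last by have := nX u uX; rewrite hu.
  by have := nX u uX; have := nX v vX; rewrite /heavy_in; clear; lia.
pose fb X := [forall u in X, forall v in X, heavy_in h u ==> heavy_in h v ==> (u == v)].
have fbP X : fb X -> one_heavy X.
  move=> /forall_inP H u v uX vX hu hvv; have /forall_inP/(_ v vX) := H u uX.
  by rewrite hu hvv => /eqP.
have nfb X : ~~ fb X -> exists u1 u2, [/\ u1 \in X, u2 \in X, heavy_in h u1, heavy_in h u2 & u1 != u2].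
  rewrite negb_forall_in => /exists_inP[u uX]; rewrite negb_forall_in => /exists_inP[v vX].
  by rewrite !negb_imply => /and3P[h1 h2 h3]; exists u, v.
case: (boolP (fb A)) => [fA|/nfb[u1 [u2 [h1 h2 h3 h4 h5]]]]; last first.
  by left; apply: none => v; exact: (two A B u1 u2).
case: (boolP (fb B)) => [fB|/nfb[u1 [u2 [h1 h2 h3 h4 h5]]]]; last first.
  by right; apply: none => v; exact: (two B A u1 u2).
pose cb X := [forall u in X, forall v in X, (u != v) ==> (dg h u + dg h v <= #|V|.+1)].
have cbP X : cb X -> clean X.
  move=> /forall_inP H u v uX vX uv; have /forall_inP/(_ v vX) := H u uX; by rewrite uv.
have ncb X : ~~ cb X -> exists u1 u2, [/\ u1 \in X, u2 \in X, u1 != u2 & #|V|.+1 < dg h u1 + dg h u2].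
  rewrite negb_forall_in => /exists_inP[u uX]; rewrite negb_forall_in => /exists_inP[v vX].
  by rewrite negb_imply -ltnNge => /andP[h1 h2]; exists u, v.
case: (boolP (cb B)) => [cB|/ncb[v1 [v2 [a1 a2 a3 a4]]]]; first by left; split; [exact: cbP|exact: fbP].
case: (boolP (cb A)) => [cA|/ncb[u1 [u2 [b1 b2 b3 b4]]]]; first by right; split; [exact: cbP|exact: fbP].
have := dirty_card mB mA dj' a1 a2 a3 a4; have := dirty_card mA mB dj b1 b2 b3 b4; clear; lia.
Qed.

Variables (A B : {set V}).
Hypotheses (mA : closed_clique h A) (mB : closed_clique h B) (dj : forall w, w \in A -> w \notin B).
Let dj' w : w \in B -> w \notin A. Proof. by apply: contraL; exact: dj. Qed.

(* While the completion steps are undone, an edge a b of a connector that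
   disappears becomes a path, and one of the b's may be replaced by the
   completed vertex; the edges between the a's are allowed to disappear. *)
Definition valid f k := [/\ induced_path f k.1, 1 < size k.1, forall d, head d k.1 \in A /\ last d k.1 \in B,
  (if k.2 is c :: s then [/\ s = [::], size k.1 = 2 & forall z, z \in k.1 -> h c z] else 2 < size k.1) &
  (forall d z, z \in conn_vertices k -> z \in A -> z = head d k.1) /\
  (forall d z, z \in conn_vertices k -> z \in B ->
     z = last d k.1 \/ (2 < size k.1 /\ forall w, h (last d k.1) w -> w \in B))].

Definition sep f k k' := forall d x y, x \in conn_vertices k -> y \in conn_vertices k' -> [/\ x != y,
  h x y -> (x \in A /\ y \in A) \/ (x \in B /\ y \in B) &
  f x y -> (x = head d k.1 /\ y = head d k'.1) \/ (x = last d k.1 /\ y = last d k'.1)].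

Definition last_adjacent f k k' := forall d, f (last d k.1) (last d k'.1).

Definition three_conns f k1 k2 k3 := [/\ [/\ valid f k1, valid f k2 & valid f k3],
  [/\ sep f k1 k2, sep f k1 k3 & sep f k2 k3] & [/\ last_adjacent f k1 k2, last_adjacent f k1 k3 & last_adjacent f k2 k3]].

Lemma sep_sym f k k' : simple_rel f -> sep f k k' -> sep f k' k.
Proof.
move=> [fs _] s d x y xk yk; have [n1 n2 n3] := s d y x yk xk; split; first by rewrite eq_sym.
  by rewrite hs => /n2[][]; [left|right].
by rewrite fs => /n3[][]; [left|right].
Qed.

Lemma bb_sym f k k' : simple_rel f -> last_adjacent f k k' -> last_adjacent f k' k.
Proof. by move=> [fs _] b d; rewrite fs. Qed.

Lemma st_perm12 f k1 k2 k3 : simple_rel f -> three_conns f k1 k2 k3 -> three_conns f k2 k1 k3.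
Proof. by move=> sf [[v1 v2 v3] [s1 s2 s3] [b1 b2 b3]]; split; split=> //; [exact: sep_sym|exact: bb_sym]. Qed.

Lemma st_perm23 f k1 k2 k3 : simple_rel f -> three_conns f k1 k2 k3 -> three_conns f k1 k3 k2.
Proof. by move=> sf [[v1 v2 v3] [s1 s2 s3] [b1 b2 b3]]; split; split=> //; [exact: sep_sym|exact: bb_sym]. Qed.

Lemma val_in f k d : valid f k -> [/\ head d k.1 \in conn_vertices k, last d k.1 \in conn_vertices k, head d k.1 \in A & last d k.1 \in B].
Proof.
case=> _ sz /(_ d)[hA lB] _ _; have k0 : k.1 != [::] by case: (k.1) sz.
by rewrite !mem_cat head_in ?last_in.
Qed.

Lemma st_init k1 k2 k3 : [/\ conn_valid h A B k1, conn_valid h A B k2 & conn_valid h A B k3] ->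
  [/\ conn_sep h k1 k2, conn_sep h k1 k3 & conn_sep h k2 k3] -> three_conns h k1 k2 k3.
Proof.
move=> [c1 c2 c3] [s12 s13 s23].
have [_ cA _] := mA; have [_ cB _] := mB.
have V1 k k' : conn_valid h A B k -> conn_valid h A B k' -> conn_sep h k k' -> valid h k.
  move=> c c' s; have [ip sz hl e] := c; have [ip' sz' hl' _] := c'; split=> //; split=> d z zk zX.
    have [hA lB] := hl d; have [hA' lB'] := hl' d; have [hk lk] := cvalid_in c' d.
    have [n1 n2] := s d z _ zk hk; case: (n2 (cA _ _ zX hA' n1)) => -[-> //] e1.
    by move: hA'; rewrite e1 => /dj; rewrite lB'.
  left; have [hA lB] := hl d; have [hA' lB'] := hl' d; have [hk lk] := cvalid_in c' d.
  have [n1 n2] := s d z _ zk lk; case: (n2 (cB _ _ zX lB' n1)) => -[-> //] e1.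
  by move: hA'; rewrite -e1 => /dj; rewrite lB'.
have S1 k k' : conn_valid h A B k -> conn_valid h A B k' -> conn_sep h k k' -> sep h k k'.
  move=> c c' s d x y xk yk; have [n1 n2] := s d x y xk yk; split=> // /n2.
  have [_ _ /(_ d)[a1 b1] _] := c; have [_ _ /(_ d)[a2 b2] _] := c'.
  by case=> -[-> ->]; [left|right].
have B1 k k' : conn_valid h A B k -> conn_valid h A B k' -> conn_sep h k k' -> last_adjacent h k k'.
  move=> c c' s d; have [_ l1] := cvalid_in c d; have [_ l2] := cvalid_in c' d.
  have [_ _ /(_ d)[a1 b1] _] := c; have [_ _ /(_ d)[a2 b2] _] := c'.
  by have [n1 _] := s d _ _ l1 l2; exact: cB.
split; split; [exact: V1 s12|exact: V1 (csep_sym sh s12)|exact: V1 (csep_sym sh s13)|exact: S1|exact: S1|exact: S1|exact: B1|exact: B1|exact: B1].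
Qed.

Hypothesis clB : clean B.

(** A pair nonadjacent in [h] is excluded because [h] is closed, an edge of [h] inside [B] because
    [B] is clean. *)
Lemma nohp f u v : symmetric f -> subrel f h -> u != v -> ~~ f u v -> (h u v -> u \in B /\ v \in B) -> ~~ ore_pair f u v.
Proof.
move=> fs sub uv nf H; apply/negP=> /and3P[_ _ d].
have le w : dg f w <= dg h w by exact: dg_sub.
case: (boolP (h u v)) => [huv|nh]; last first.
  by have := closed_nohp sh ch clh u v; rewrite /ore_pair uv nh (leq_trans d) // leq_add.
have [uB vB] := H huv; have := clB uB vB uv.
have lt a b : h a b -> ~~ f a b -> dg f a < dg h a.
  move=> hab nab; apply: proper_card; apply/properP; split.
    by apply/subsetP=> z; rewrite !inE; exact: sub.
  by exists b; rewrite inE.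
have nf' : ~~ f v u by rewrite fs.
have hvu : h v u by rewrite hs.
by have := lt u v huv nf; have := lt v u hvu nf'; move: d; clear; lia.
Qed.

Section Step.
Variables (f : rel V) (x : V).
Hypotheses (sf : simple_rel f) (cf : claw_heavy f) (eh : subrel (complete_at f x) h) (sx : simplicial h x).
Let fs := sf.1.
Let fi := sf.2.
Let e := complete_at f x.
Let fe : subrel f e := @complete_at_sub V f x.
Let fh : subrel f h := fun u v H => eh (fe H).

Lemma exx u v : f x u -> f x v -> u != v -> e u v.
Proof. by move=> xu xv uv; rewrite /e /complete_at uv xu xv orbT. Qed.

Lemma sep_f k k' : sep e k k' -> sep f k k'.
Proof. by move=> s d u v uk vk; have [n1 n2 n3] := s d u v uk vk; split=> // /fe. Qed.

(** A simplicial vertex lies in a single maximal clique. *)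
Lemma nx_in K : closed_clique h K -> x \in K -> (exists2 b, b \in K & h x b) -> forall w, h x w -> w \in K.
Proof.
move=> mK xK [b bK xb] w xw; have [->//|wb] := eqVneq w b.
have [->//|wx] := eqVneq w x.
by apply: (mc_in mK xK bK _); rewrite 1?hs //; [apply: contraTneq xb => ->; rewrite hi|rewrite hs; apply: sx; rewrite // eq_sym].
Qed.

(** By [ipath_cl] at most one edge of the connector is lost, and [x] is inserted there; a triangle
    vertex is then dropped, as the path has three vertices. If [x] lies in [A] or [B], so do both
    ends of the lost edge. This is impossible for [A], and for [B] one of the ends is not the last
    vertex, so the exception in [valid] already held. *)
Lemma touch k : valid e k -> valid f k \/ exists p1 p2, [/\ k.1 = p1 ++ p2, p1 != [::], p2 != [::],
  x \notin k.1 & [/\ f x (last x p1), f x (head x p2) & valid f (p1 ++ x :: p2, [::])]].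
Proof.
move=> [ip sz hl ek [kA kB]]; case: (ipath_cl sf ip) => [ip'|[xk [p1 [p2 [ep p10 p20 ip' [x1 x2]]]]]].
  by left; split.
right; exists p1, p2; split=> //.
have lin : last x p1 \in k.1 by rewrite ep mem_cat last_in.
have hin : head x p2 \in k.1 by rewrite ep mem_cat head_in ?orbT.
have kv z : z \in k.1 -> z \in conn_vertices k by rewrite mem_cat => ->.
have lh : last x p1 != head x p2.
  by have := ipath_uniq ip; rewrite ep => u; apply/negP=> /eqP E; have := @dj_of _ _ p1 p2 [::] u _ _ (last_in x p10);
    rewrite cats0 E head_in // => /(_ (perm_refl _)).
have hd d : head d (p1 ++ x :: p2) = head d k.1 by rewrite ep; case: (p1) p10.
have ls d : last d (p1 ++ x :: p2) = last d k.1 by rewrite ep !last_cat /=; case: (p2) p20.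
have two K : closed_clique h K -> x \in K -> (exists2 b, b \in K & h x b) -> last x p1 \in K /\ head x p2 \in K.
  by move=> mK xK hb; split; apply: (nx_in mK xK hb); exact: fh.
have sz2 : 2 < size (p1 ++ x :: p2).
  by rewrite size_cat /= addnS ltnS; case: (p1) p10 => // a p1' _; case: (p2) p20 => // b p2' _; rewrite /= addnS addSn.
split=> //; split; [exact: ip'|exact: ltnW sz2|by move=> d; rewrite /= hd ls|exact: sz2|].
have mem z : z \in conn_vertices (p1 ++ x :: p2, [::]) -> z = x \/ z \in k.1.
  by rewrite /conn_vertices cats0 /= ep !mem_cat inE => /or3P[->|/eqP->|->]; [right|left|right; rewrite orbT].
have other K : closed_clique h K -> x \in K -> exists2 b, b \in K & h x b.
  case=> c cK _ xK; have : 0 < #|K :\ x| by move: c; rewrite (cardsD1 x) xK; clear; lia.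
  by case/card_gt0P=> b; rewrite !inE => /andP[bx bK]; exists b => //; apply: cK; rewrite // eq_sym.
split=> d z /mem[->|zk].
- move=> xA; have [l1 l2] := two A mA xA (other A mA xA).
  by case/eqP: lh; rewrite (kA d _ (kv _ lin) l1) (kA d _ (kv _ hin) l2).
- by rewrite hd; apply: kA; exact: kv.
- move=> xB; have [l1 l2] := two B mB xB (other B mB xB); right; split=> //.
  rewrite ls; case: (kB d _ (kv _ lin) l1) => [E1|[_ //]].
  by case: (kB d _ (kv _ hin) l2) => [E2|[_ //]]; rewrite E1 E2 eqxx in lh.
move=> zB; rewrite ls; case: (kB d z (kv z zk) zB) => [->|[s2 H]]; [by left|by right; split].
Qed.

(** If [x] were equal or adjacent to [y], both [u] and [v] would be adjacent to [y] in the
    completion, whereas [sep] lets [y] have only one neighbour in [k]. *)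
Lemma touch_sep k k' u v y : valid e k -> valid e k' -> sep e k k' -> u \in conn_vertices k -> v \in conn_vertices k -> u != v ->
  f x u -> f x v -> y \in conn_vertices k' -> [/\ x != y, ~~ f x y & h x y -> x \in B /\ y \in B].
Proof.
move=> vk vk' s uk vk1 uv xu xv yk; have [uy n2 n3] := s u u y uk yk; have [vy m2 m3] := s u v y vk1 yk.
have [_ _ hA lB] := val_in u vk'.
have no : e u y -> e v y -> False.
  move=> /n3[[u1 y1]|[u1 y1]] /m3[[v1 y2]|[v1 y2]]; first [by case/eqP: uv; rewrite v1|idtac].
    by move: hA; rewrite -y1 y2 => /dj; rewrite lB.
  by move: hA; rewrite -y2 y1 => /dj; rewrite lB.
split.
- by apply/eqP=> E; apply: no; rewrite -E; apply: fe; rewrite fs.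
- by apply/negP=> xy; apply: no; exact: exx.
move=> xy; have huy : h u y by apply: sx => //; exact: fh.
have hvy : h v y by apply: sx => //; exact: fh.
have [_ _ _ _ [kA _]] := vk.
case: (n2 huy) (m2 hvy) => -[uX yX] [] [vX yY].
- by case/eqP: uv; rewrite (kA u u uk uX) (kA u v vk1 vX).
- by have := dj yX; rewrite yY.
- by have := dj yY; rewrite yX.
by split=> //; apply: (mc_in mB uX vX uv); exact: fh.
Qed.

Lemma touch_no k k' u v : valid e k -> valid e k' -> sep e k k' -> u \in conn_vertices k -> v \in conn_vertices k -> u != v ->
  f x u -> f x v -> valid f k'.
Proof.
move=> vk vk' s uk vk1 uv xu xv; case: (touch vk') => // -[p1 [p2 [ep p10 p20 _ [x1 _ _]]]].
have lin : last x p1 \in conn_vertices k' by rewrite mem_cat ep mem_cat last_in.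
by have [_ /negP] := touch_sep vk vk' s uk vk1 uv xu xv lin.
Qed.

Lemma step_touched k1 k2 k3 p1 p2 : three_conns e k1 k2 k3 -> last_adjacent f k1 k2 -> last_adjacent f k1 k3 -> last_adjacent f k2 k3 ->
  [/\ k1.1 = p1 ++ p2, p1 != [::], p2 != [::],
  x \notin k1.1 & [/\ f x (last x p1), f x (head x p2) & valid f (p1 ++ x :: p2, [::])]] -> three_conns f (p1 ++ x :: p2, [::]) k2 k3.
Proof.
move=> [[v1 v2 v3] [s12 s13 s23] _] b12 b13 b23 [ep p10 p20 xk [x1 x2 vf]].
have [ip _ _ _ _] := v1.
have lin : last x p1 \in conn_vertices k1 by rewrite mem_cat ep mem_cat last_in.
have hin : head x p2 \in conn_vertices k1 by rewrite mem_cat ep mem_cat head_in ?orbT.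
have lh : last x p1 != head x p2.
  by have := ipath_uniq ip; rewrite ep => u; apply/negP=> /eqP E; have := @dj_of _ _ p1 p2 [::] u _ _ (last_in x p10);
    rewrite cats0 E head_in // => /(_ (perm_refl _)).
have hd d : head d (p1 ++ x :: p2) = head d k1.1 by rewrite ep; case: (p1) p10.
have ls d : last d (p1 ++ x :: p2) = last d k1.1 by rewrite ep !last_cat /=; case: (p2) p20.
have S k : valid e k -> sep e k1 k -> sep f (p1 ++ x :: p2, [::]) k.
  move=> vk s d a b; rewrite /= {1}/conn_vertices cats0 /= mem_cat in_cons orbCA => /orP[/eqP->|].
    move=> bk; have [n1 n2 n3] := touch_sep v1 vk s lin hin lh x1 x2 bk; split=> //; first by move/n3; right.
    by rewrite (negbTE n2).
  rewrite -mem_cat -ep => ak bk; have [|n1 n2 n3] := s d a b _ bk; first by rewrite mem_cat ak.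
  by rewrite hd ls; split=> // /fe.
split; split=> //.
- exact: (touch_no v1 v2 s12 lin hin lh).
- exact: (touch_no v1 v3 s13 lin hin lh).
- exact: S.
- exact: S.
- exact: sep_f.
- by move=> d; rewrite /= ls.
- by move=> d; rewrite /= ls.
Qed.

(** [x] is adjacent to all three last vertices, so it lies in [B] and can become the last vertex of
    [k3]. The old last vertex stays in [B] as an inner vertex; the exception in [valid] is made for
    it and holds because [x] is simplicial. *)
Lemma step_hub k1 k2 k3 d : three_conns e k1 k2 k3 -> f (last d k1.1) (last d k2.1) ->
  ~~ f (last d k1.1) (last d k3.1) -> ~~ f (last d k2.1) (last d k3.1) -> three_conns f k1 k2 (rcons k3.1 x, [::]).
Proof.
move=> [[v1 v2 v3] [s12 s13 s23] [b12 b13 b23]] n12 n13 n23.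
have [h1 l1 A1 B1] := val_in d v1; have [h2 l2 A2 B2] := val_in d v2; have [h3 l3 A3 B3] := val_in d v3.
have [x1 x3] : f x (last d k1.1) /\ f x (last d k3.1).
  by have := b13 d; rewrite /e /complete_at (negbTE n13) => /and3P[].
have [x2 _] : f x (last d k2.1) /\ f x (last d k3.1).
  by have := b23 d; rewrite /e /complete_at (negbTE n23) => /and3P[].
have [b12n _ _] := s12 d _ _ l1 l2; have [b13n _ _] := s13 d _ _ l1 l3.
have xB : x \in B by apply: (mc_in mB B1 B2 b12n); exact: fh.
have xA := dj' xB.
have nxB : forall w, h x w -> w \in B by apply: (nx_in mB xB); exists (last d k1.1) => //; exact: fh.
have nx k k' y : valid e k -> valid e k' -> sep e k k' -> f x (last d k'.1) -> y \in conn_vertices k -> f x y -> y = last d k.1.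
  move=> vk vk' s xl yk xy; have [_ l' A' B'] := val_in d vk'.
  have [n1 _ n3] := s d y _ yk l'; case: (n3 (exx xy xl n1)) => -[-> //] E.
  by rewrite E in B'; have [_ _ /dj] := val_in d vk'; rewrite B'.
have nin k k' : valid e k -> valid e k' -> sep e k k' -> f x (last d k'.1) -> f x (last d k.1) -> x \notin conn_vertices k.
  move=> vk vk' s xl' xl; apply/negP=> xk; have [_ l' A' B'] := val_in d vk'.
  have [n1 _ n3] := s d x _ xk l'; case: (n3 (fe xl')) => -[E1 E2].
    by rewrite E2 in B'; have := dj A'; rewrite B'.
  by rewrite -E1 fi in xl.
have es_ : simple_rel e by exact: complete_at_simple.
have s21 := sep_sym es_ s12; have s31 := sep_sym es_ s13; have s32 := sep_sym es_ s23.
have same k k' : valid e k -> valid e k' -> sep e k k' -> f x (last d k'.1) -> valid f k.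
  move=> vk vk' s xl; case: (touch vk) => // -[p1 [p2 [ep p10 p20 _ [y1 y2 _]]]].
  have [ip _ _ _ _] := vk.
  have lin : last x p1 \in conn_vertices k by rewrite mem_cat ep mem_cat last_in.
  have hin : head x p2 \in conn_vertices k by rewrite mem_cat ep mem_cat head_in ?orbT.
  have lh : last x p1 != head x p2.
    by have := ipath_uniq ip; rewrite ep => u; apply/negP=> /eqP E; have := @dj_of _ _ p1 p2 [::] u _ _ (last_in x p10);
      rewrite cats0 E head_in // => /(_ (perm_refl _)).
  by case/eqP: lh; rewrite (nx k k' _ vk vk' s xl lin y1) (nx k k' _ vk vk' s xl hin y2).
have x_1 := nin k1 k2 v1 v2 s12 x2 x1; have x_2 := nin k2 k1 v2 v1 s21 x1 x2; have x_3 := nin k3 k1 v3 v1 s31 x1 x3.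
have vf3 := same k3 k1 v3 v1 s31 x1.
have [ip3 sz3 hl3 _ [kA3 kB3]] := vf3; have k30 : k3.1 != [::] by case: (k3.1) sz3.
have in3 z : z \in k3.1 -> z \in conn_vertices k3 by rewrite mem_cat => ->.
have hd d' : head d' (rcons k3.1 x) = head d' k3.1 by case: (k3.1) k30.
have sz : 2 < size (rcons k3.1 x) by rewrite size_rcons; move: sz3; clear; lia.
have ml z : z \in conn_vertices (rcons k3.1 x, [::]) -> z = x \/ z \in k3.1.
  by rewrite /conn_vertices cats0 /= mem_rcons inE => /orP[/eqP|]; [left|right].
have dd' d' : last d' k3.1 = last d k3.1 by case: (k3.1) k30.
have S k : valid e k -> sep e k k3 -> sep e k3 k -> ~~ f (last d k.1) (last d k3.1) -> x \notin conn_vertices k ->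
    (forall y, y \in conn_vertices k -> f x y -> y = last d k.1) -> sep f k (rcons k3.1 x, [::]).
  move=> vk s _ nk xk nxk d' a b ak /ml[->|bk] /=; rewrite hd last_rcons.
    split; first by apply: contraNneq xk => <-.
      by rewrite hs => /nxB aB; right.
    rewrite fs => /(nxk a ak) ->; right; split=> //.
    by have [_ sk _ _ _] := vk; case: (k.1) sk.
  have [n1 n2 n3] := s d a b ak (in3 b bk); split=> // fab; have [[-> ->]|[E1 E2]] := n3 (fe fab).
    left; split; last by case: (k3.1) k30.
    by have [_ sk _ _ _] := vk; case: (k.1) sk.
  by rewrite -E1 -E2 fab in nk.
split; split.
- exact: same k1 k2 v1 v2 s12 x2.
- exact: same k2 k1 v2 v1 s21 x1.
- split=> //=.
  + rewrite -cats1; apply: (@ipath_cat _ _ d) => //=; first by rewrite fs.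
    move=> a b ak; rewrite inE => /eqP->; split; first by apply: contraNneq x_3 => <-; exact: in3.
    by rewrite fs => xa; split=> //; apply: (nx k3 k1 a v3 v1 s31 x1 (in3 a ak)).
  + by move: sz; clear; lia.
  + by move=> d'; rewrite hd last_rcons; have [] := hl3 d'.
  split=> d' z /ml[->|zk]; rewrite ?hd ?last_rcons.
  + by rewrite (negbTE xA).
  + by apply: kA3; exact: in3.
  + by left.
  by right.
- exact: sep_f.
- apply: S => // y yk; exact: nx k1 k2 y v1 v2 s12 x2 yk.
- apply: S => // y yk; exact: nx k2 k1 y v2 v1 s21 x1 yk.
- by move=> d'; have [_ q1 _ _ _] := v1; have [_ q2 _ _ _] := v2; move: n12; case: (k1.1) q1 => //; case: (k2.1) q2.
- by move=> d'; rewrite /= last_rcons fs; have [_ q1 _ _ _] := v1; move: x1; case: (k1.1) q1.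
by move=> d'; rewrite /= last_rcons fs; have [_ q1 _ _ _] := v2; move: x2; case: (k2.1) q1.
Qed.

Lemma before k d : valid e k -> exists m, [/\ m \in conn_vertices k, m != last d k.1 & e m (last d k.1)].
Proof.
case=> ip sz _ _ _; case: k ip sz => p c /=; case/lastP: p => // p b; case/lastP: p => // p m ip _.
exists m; rewrite last_rcons; rewrite -cats1 in ip *.
have mp : m \in rcons p m by rewrite mem_rcons mem_head.
have [mb _] := ipath_sep m ip mp (mem_head b [::]); split=> //; first by rewrite /conn_vertices /= !mem_cat mp.
by have := @ipath_lnk _ _ m _ _ ip; rewrite last_rcons; apply=> //; case: (p).
Qed.

(** If only the edge between [k1] and [k2] were lost, the last vertex of [k3] would be the centre of
    a claw whose third leaf is its predecessor [m]; if all three were lost, [x] would be a centre.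
    [nohp] excludes heavy pairs in both claws. *)
Lemma two_new k1 k2 k3 d : three_conns e k1 k2 k3 -> ~~ f (last d k1.1) (last d k2.1) ->
  (f (last d k1.1) (last d k3.1) && ~~ f (last d k2.1) (last d k3.1)) ||
  (f (last d k2.1) (last d k3.1) && ~~ f (last d k1.1) (last d k3.1)).
Proof.
move=> [[v1 v2 v3] [s12 s13 s23] [b12 b13 b23]] n12.
have [h1 l1 A1 B1] := val_in d v1; have [h2 l2 A2 B2] := val_in d v2; have [h3 l3 A3 B3] := val_in d v3.
have [b12n _ _] := s12 d _ _ l1 l2; have [b13n _ _] := s13 d _ _ l1 l3; have [b23n _ _] := s23 d _ _ l2 l3.
have [x1 x2] : f x (last d k1.1) /\ f x (last d k2.1).
  by have := b12 d; rewrite /e /complete_at (negbTE n12) => /and3P[].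
have [m [mk mb em]] := before d v3.
have sep3 k : valid e k -> sep e k k3 -> [/\ last d k.1 != m, ~~ e (last d k.1) m & h (last d k.1) m -> last d k.1 \in B /\ m \in B].
  move=> vk s; have [_ l A' B'] := val_in d vk; have [n1 n2 n3] := s d _ m l mk; split=> //.
    apply/negP=> /n3[[E _]|[_ E]]; last by rewrite E eqxx in mb.
    by have := dj' B'; rewrite E A'.
  by move/n2=> [[E _]|//]; have := dj' B'; rewrite E.
have [c1 c2 c3] := sep3 k1 v1 s13; have [c4 c5 c6] := sep3 k2 v2 s23.
case: (boolP (f (last d k1.1) (last d k3.1))) => f13; case: (boolP (f (last d k2.1) (last d k3.1))) => f23 //=; exfalso.
  have f3m : f (last d k3.1) m.
    have em' : e (last d k3.1) m by have [es _] := complete_at_simple x sf; rewrite -[e]/(complete_at f x) es.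
    apply/negPn/negP=> nf; move: em'; rewrite /e /complete_at (negbTE nf) /= => /and3P[_ _ xm].
    by case/negP: c2; apply: exx.
  have f31 : f (last d k3.1) (last d k1.1) by rewrite fs.
  have f32 : f (last d k3.1) (last d k2.1) by rewrite fs.
  have nf1 : ~~ f (last d k1.1) m by apply: contra c2; exact: fe.
  have nf2 : ~~ f (last d k2.1) m by apply: contra c5; exact: fe.
  have := cf f31 f32 f3m b12n c1 c4 n12 nf1 nf2.
  by rewrite !(negbTE (nohp fs fh _ _ _)).
have x3 : f x (last d k3.1) by have := b13 d; rewrite /e /complete_at (negbTE f13) => /and3P[].
have := cf x1 x2 x3 b12n b13n b23n n12 f13 f23.
by rewrite !(negbTE (nohp fs fh _ _ _)).
Qed.

(** If edges between last vertices are lost, exactly two of them are, and [step_hub] applies.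
    Otherwise at most one connector is touched. *)
Lemma step_st k1 k2 k3 : three_conns e k1 k2 k3 -> exists k1' k2' k3', three_conns f k1' k2' k3'.
Proof.
move=> S; have [[v1 v2 v3] _ _] := S; have se : simple_rel e by exact: complete_at_simple.
have [_ _ /(_ x)[_ _] _ _] := v1; set d := x.
have bbd k k' : valid e k -> valid e k' -> f (last d k.1) (last d k'.1) -> last_adjacent f k k'.
  by move=> [_ q1 _ _ _] [_ q2 _ _ _] H d'; move: H; case: (k.1) q1 => //; case: (k'.1) q2.
have C12 a b c : three_conns e a b c -> ~~ f (last d a.1) (last d b.1) -> exists k1' k2' k3', three_conns f k1' k2' k3'.
  move=> S' n; case/orP: (two_new S' n) => /andP[h1 h2].
    have S2 := st_perm23 se S'; rewrite fs in h2.
    by do 3 eexists; apply: (step_hub S2 h1 n) => //; rewrite fs.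
  have S2 := st_perm23 se (st_perm12 se S'); rewrite fs in n.
  by do 3 eexists; apply: (step_hub S2 h1 n) => //; rewrite fs.
case: (boolP (f (last d k1.1) (last d k2.1))) => f12; last exact: (C12 k1 k2 k3).
case: (boolP (f (last d k1.1) (last d k3.1))) => f13; last by apply: (C12 k1 k3 k2) => //; exact: st_perm23.
case: (boolP (f (last d k2.1) (last d k3.1))) => f23; last first.
  by apply: (C12 k2 k3 k1) => //; apply: st_perm23 => //; exact: st_perm12.
have b12 := bbd k1 k2 v1 v2 f12; have b13 := bbd k1 k3 v1 v3 f13; have b23 := bbd k2 k3 v2 v3 f23.
case: (touch v1) => [w1|[p1 [p2 H]]]; last by do 3 eexists; exact: (step_touched S b12 b13 b23 H).
case: (touch v2) => [w2|[p1 [p2 H]]].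
  case: (touch v3) => [w3|[p1 [p2 H]]].
    by exists k1, k2, k3; have [_ [s1 s2 s3] _] := S; split; split=> //; exact: sep_f.
  have S3 : three_conns e k3 k1 k2 by apply: st_perm12 => //; exact: st_perm23.
  by do 3 eexists; apply: (step_touched S3 _ _ b12 H); exact: bb_sym.
have S2 := st_perm12 se S.
by do 3 eexists; apply: (step_touched S2 _ b23 b13 H); exact: bb_sym.
Qed.

End Step.

Lemma carry g k1 k2 k3 : completes_to g h -> simple_rel g -> claw_heavy g -> three_conns h k1 k2 k3 -> exists k1' k2' k3', three_conns g k1' k2' k3'.
Proof.
move=> ex sg cg S.
suff H f h' : completes_to f h' -> h' = h -> simple_rel f -> claw_heavy f -> exists k1' k2' k3', three_conns f k1' k2' k3' by exact: (H g h).
elim=> [f' -> _ _|{h'}f' x h' el ex' IH eh sf cf]; first by exists k1, k2, k3.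
have [|k1' [k2' [k3' S']]] := IH eh (complete_at_simple x sf); first exact: claw_heavy_complete.
rewrite {}eh in ex'.
by apply: (step_st sf cf (completes_to_sub ex') _ S'); apply: simplicial_completes_to ex' (complete_at_simple x sf) _; exact: simplicial_complete.
Qed.

End Carry.

(** * Nets and woundeds *)

Section Far.
Variables (V : finType) (g h : rel V).
Hypotheses (sg : simple_rel g) (cg : claw_heavy g) (ex : completes_to g h) (clh : closed h).
Let gs := sg.1.
Let gi := sg.2.
Let sh := completes_to_simple ex sg.
Let ch := completes_to_claw_heavy ex sg cg.
Let hs := sh.1.
Let hi := sh.2.
Let gh : subrel g h := completes_to_sub ex.
Implicit Types (u v w x y z d : V) (p q s : seq V) (A B X K : {set V}) (k : conn V).

Definition nadj u v := u != v /\ ~~ g u v.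
(** The nonadjacency that contradicts c-heaviness: a pattern cannot occur if the places where it
    needs heavy vertices are far from each other. *)
Definition far u v := [/\ u != v, ~~ g u v & ~~ (heavy_in g u && heavy_in g v)].

Lemma farC u v : far u v -> far v u.
Proof. by case=> n1 n2 n3; split; rewrite 1?eq_sym 1?gs 1?andbC. Qed.

Lemma nadjC u v : nadj u v -> nadj v u.
Proof. by case=> n1 n2; split; rewrite 1?eq_sym 1?gs. Qed.

Lemma far_nadj u v : far u v -> nadj u v.
Proof. by case. Qed.

(** Vertices heavy in [g] stay heavy in [h], where heavy vertices are pairwise adjacent. *)
Lemma hfar u v : u != v -> ~~ h u v -> far u v.
Proof.
move=> uv nh; split=> //; first by apply: contra nh; exact: gh.
by apply: contra nh => /andP[hu hw]; apply: (heavy_in_adj sh ch clh) => //; apply: heavy_in_sub gh _.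
Qed.

Section Clique.
Variables (A B : {set V}) (a b : V).
Hypotheses (mA : closed_clique h A) (dj : forall w, w \in A -> w \notin B) (aA : a \in A) (bB : b \in B) (hab : h a b).

Lemma ab_neq : a != b. Proof. by apply: contraTneq hab => ->; rewrite hi. Qed.

Lemma mcK : closed_clique h (edge_clique h a b). Proof. exact: mc_kq. Qed.
Lemma aK : a \in edge_clique h a b. Proof. by rewrite inE eqxx. Qed.
Lemma bK : b \in edge_clique h a b. Proof. by rewrite inE eqxx orbT. Qed.

(** [y] lies outside [A], and [a] is its only neighbour there. *)
Lemma KA y w : y \in edge_clique h a b -> y != a -> w \in A -> w != a -> y != w /\ ~~ h y w.
Proof.
move=> yK ya wA wa; have [_ cK _] := mcK; have [_ _ HA] := mA.
have bA : b \notin A by apply: contraL bB => bA; exact: dj.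
have yA : y \notin A.
  apply/negP=> yA; have yb : y != b by apply: contraNneq bA => <-.
  by case/eqP: ya; apply: (HA b) => //; rewrite hs //; apply: cK; rewrite ?bK.
split; first by apply: contraNneq yA => ->.
by apply/negP=> yw; case/eqP: wa; apply: (HA y) => //; apply: cK; rewrite ?aK.
Qed.

Lemma K_out z y y' : z \notin edge_clique h a b -> y \in edge_clique h a b -> y' \in edge_clique h a b -> y != y' -> ~~ h y z \/ ~~ h y' z.
Proof.
move=> zK yK yK' yy; case: (boolP (h y z)) => yz; [right|by left].
by apply/negP=> yz'; have [_ _ H] := mcK; case/eqP: yy; apply: (H z) => //; rewrite hs.
Qed.

Lemma K_common t u v : u \in edge_clique h a b -> v \in edge_clique h a b -> u != v -> g u t -> g v t -> t \in edge_clique h a b.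
Proof. by move=> uK vK uv ut vt; apply: (mc_in mcK uK vK uv); rewrite hs; exact: gh. Qed.

End Clique.

Lemma KB A B a b y w : closed_clique h A -> closed_clique h B -> (forall w, w \in A -> w \notin B) -> a \in A -> b \in B -> h a b ->
  y \in edge_clique h a b -> y != b -> w \in B -> w != b -> y != w /\ ~~ h y w.
Proof.
move=> mA mB dj aA bB hab; rewrite edge_cliqueC; apply: (@KA B A b a) => //; last by rewrite hs.
by move=> z; apply: contraL; exact: dj.
Qed.

(* If z is another neighbour of a in K, the claw a; b, z, e with e in A makes
   b, z a heavy pair, which has a common neighbour too many. *)
Lemma pendant_dichotomy A B a b w : closed_clique h A -> closed_clique h B -> (forall w, w \in A -> w \notin B) -> a \in A -> b \in B -> g a b ->
  2 < #|A| -> 2 < #|edge_clique h a b| -> (forall z, z \in edge_clique h a b -> z != a -> g b z -> z = w) ->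
  forall z, z \in edge_clique h a b -> [\/ z = a, z = b | z = w].
Proof.
move=> mA mB dj aA bB gab A3 K3 one; have hab := gh gab.
have mK := mcK hab; have ab := ab_neq hab; have aK := aK a b; have bK := bK a b.
have bA : b \notin A by apply: contraL bB => bA; exact: dj.
have ba : b != a by rewrite eq_sym.
have [w' [wK wa wb bw]] := mc_nb ex sg mK K3 bK ba.
have ew : w' = w by exact: one.
rewrite {}ew in wK wa wb bw.
apply: (mc_pair ex sg mK aK bK wa wb) => z zK; last first.
  by have [->|za] := eqVneq z a; [left|right; exact: one].
move=> az; have [->|zb] := eqVneq z b; first by left.
have [->|zw] := eqVneq z w; first by right.
have za : z != a by apply: contraTneq az => ->; rewrite gi.
exfalso; have nbz : ~~ g b z by apply: contraNN zw => bz; apply/eqP; exact: one.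
have [e [eA _ ea ae]] := mc_nb ex sg mA A3 aA ab.
have [be nbe] : b != e /\ ~~ h b e by apply: (KA mA dj aA bB hab) => //; rewrite eq_sym.
have [ze nze] : z != e /\ ~~ h z e by exact: (KA mA dj aA bB hab).
have ngbe : ~~ g b e by apply: contra nbe; exact: gh.
have ngze : ~~ g z e by apply: contra nze; exact: gh.
have bz : b != z by rewrite eq_sym.
have hpn u v : ~~ h u v -> u != v -> ore_pair g u v = false.
  move=> nh uv; apply/negP=> /and3P[_ _ d]; have := closed_nohp sh ch clh u v.
  by rewrite /ore_pair uv nh (leq_trans d) // leq_add // dg_sub.
have := cg gab az ae bz be ze nbz ngbe ngze; rewrite !(hpn _ e) // !orbF => /and3P[_ _ dd].
have := @ore_pair_common _ g b z [set e] sg bz nbz dd; rewrite cards1 => H.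
have : 2 + 1 <= #|nb g b :&: nb g z|.
  by apply: H => o; rewrite inE => /eqP->; rewrite !(eq_sym e).
have sub : nb g b :&: nb g z \subset [set a; w].
  apply/subsetP=> t; rewrite !inE => /andP[bt zt]; have tK := K_common hab bK zK bz bt zt.
  by have [->|ta] := eqVneq t a; rewrite // (one t) ?eqxx ?orbT.
by have := subset_leq_card sub; rewrite cards2 eq_sym wa; clear; lia.
Qed.

Variables (A B : {set V}).
Hypotheses (mA : closed_clique h A) (mB : closed_clique h B) (dj : forall w, w \in A -> w \notin B) (fewB : one_heavy h B).
Let dj' w : w \in B -> w \notin A. Proof. by apply: contraL; exact: dj. Qed.

Local Notation valid := (@valid V h A B).
Local Notation sep := (@sep V h A B).
Local Notation three_conns := (@three_conns V h A B).

(** Two heavy vertices in different connectors are adjacent in [h], so both lie in [A], where they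
    are heads, or both in [B], which has at most one heavy vertex. *)
Lemma far_cross d k k' x y : valid g k -> valid g k' -> sep g k k' -> x \in conn_vertices k -> y \in conn_vertices k' ->
  (x != head d k.1) || (y != head d k'.1) -> (x != last d k.1) || (y != last d k'.1) -> far x y.
Proof.
move=> vk vk' s xk yk nh nl; have [n1 n2 n3] := s d x y xk yk.
have [_ _ _ _ [kA _]] := vk; have [_ _ _ _ [kA' _]] := vk'.
split=> //.
  by apply/negP=> /n3[[e1 e2]|[e1 e2]]; [move: nh|move: nl]; rewrite e1 e2 !eqxx.
apply/negP=> /andP[hx hy]; have hx' := heavy_in_sub gh hx; have hy' := heavy_in_sub gh hy.
case: (n2 (heavy_in_adj sh ch clh hx' hy' n1)) => -[xX yX].
  by move: nh; rewrite (kA d x xk xX) (kA' d y yk yX) !eqxx.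
by case/eqP: n1; exact: fewB.
Qed.

Lemma val_T k : valid g k -> size k.1 = 2 -> exists a b c, [/\ k = ([:: a; b], [:: c]), a \in A, b \in B, g a b &
  [/\ c \in edge_clique h a b, c != a, c != b & 2 < #|edge_clique h a b|]].
Proof.
case: k => p [|c s] [ip _ hl e _] /= s2; first by rewrite /= s2 in e.
case: e => -> _ hc; case: p ip hl hc s2 => [|a [|b []]] // ip hl hc _; have [/= aA bB] := hl a.
have gab : g a b by move: (ipath_sorted ip); rewrite /= andbT.
have [ca cb] : h c a /\ h c b by split; apply: hc; rewrite !inE eqxx ?orbT.
have nca : c != a by apply: contraTneq ca => ->; rewrite hi.
have ncb : c != b by apply: contraTneq cb => ->; rewrite hi.
exists a, b, c; split=> //; rewrite inE ca cb !orbT; split=> //.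
apply/card_gt2P; exists a, b, c; split; first by rewrite !inE !eqxx ca cb !orbT.
by split; rewrite // 1?eq_sym // eq_sym (ab_neq (gh gab)).
Qed.

Lemma val_P k : valid g k -> size k.1 != 2 -> exists p m' m b, k = (rcons (rcons (rcons p m') m) b, [::]).
Proof.
case: k => p [|c s] [ip sz hl e _] /= s2; last by case: e => _ e _; rewrite e in s2.
rewrite /= in e; case/lastP: p e {ip sz hl s2} => // p b; case/lastP: p => // p m; case/lastP: p => // p m' _.
by exists p, m', m, b.
Qed.

Lemma path_end p m' m b : induced_path g (rcons (rcons (rcons p m') m) b) ->
  [/\ g m' m, g m b, m != b, m' != b /\ m' != m & ~~ g m' b].
Proof.
move=> ip; have e : rcons (rcons (rcons p m') m) b = p ++ [:: m'; m; b] by rewrite -!cats1 -!catA.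
rewrite e in ip; have := ipath_catr ip; rewrite /= /link /= !inE !negb_or !andbT -!andbA => /and5P[h1 h2 h3 h4 /andP[h5 h6]].
by split.
Qed.

Lemma A_B_gt2 k1 k2 k3 : three_conns g k1 k2 k3 -> 2 < #|A| /\ 2 < #|B|.
Proof.
move=> [[v1 v2 v3] [s12 s13 s23] _]; have [d _] : exists d : V, true by case: mA => /card_gt1P[d _]; exists d.
have [h1 l1 A1 B1] := val_in d v1; have [h2 l2 A2 B2] := val_in d v2; have [h3 l3 A3 B3] := val_in d v3.
have three X x y z : x \in X -> y \in X -> z \in X -> x != y -> x != z -> y != z -> 2 < #|X|.
  by move=> xX yX zX xy xz yz; apply/card_gt2P; exists x, y, z; split; split=> //; rewrite eq_sym.
by split; [apply: (three A _ _ _ A1 A2 A3)|apply: (three B _ _ _ B1 B2 B3)];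
  (have [? _ _] := s12 d _ _ h1 h2; have [? _ _] := s13 d _ _ h1 h3; have [? _ _] := s23 d _ _ h2 h3;
   have [? _ _] := s12 d _ _ l1 l2; have [? _ _] := s13 d _ _ l1 l3; have [? _ _] := s23 d _ _ l2 l3).
Qed.

(** Either [b] has two neighbours in the clique besides [a], which leaves a choice of pendant, or
    [pendant_dichotomy] reduces the clique to the triangle [a b c]. *)
Lemma two_or a b c : 2 < #|A| -> a \in A -> b \in B -> g a b -> c \in edge_clique h a b -> c != a -> c != b -> 2 < #|edge_clique h a b| ->
  ((forall z, z \in edge_clique h a b -> [\/ z = a, z = b | z = c]) /\ (g b c /\ g a c)) \/
  exists y y', [/\ y \in edge_clique h a b, y' \in edge_clique h a b, g b y /\ g b y', y != y' & (y != a /\ y != b) /\ (y' != a /\ y' != b)].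
Proof.
move=> cA aA bB gab cK ca cb K3; have hab := gh gab; have mK := mcK hab; have ab := ab_neq hab.
have ba : b != a by rewrite eq_sym.
have [y [yK ya yb by_]] := mc_nb ex sg mK K3 (bK a b) ba.
case: (pickP (fun y' => [&& y' \in edge_clique h a b, g b y', y' != y & y' != a])) => [y' /and4P[h1 h2 h3 h4]|no].
  right; exists y, y'; split=> //; first by rewrite eq_sym.
  by split=> //; split=> //; apply: contraTneq h2 => ->; rewrite gi.
left; have H : forall z, z \in edge_clique h a b -> [\/ z = a, z = b | z = y].
  apply: (pendant_dichotomy mA mB dj aA bB gab cA K3) => z zK za bz; apply/eqP/negPn/negP=> zy.
  by have := no z; rewrite zK bz zy za.
have ec : c = y by case: (H c cK) => e; rewrite e ?eqxx // in ca cb *.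
rewrite ec; split=> //; split=> //.
have [w [wK wb wa aw]] := mc_nb ex sg mK K3 (aK a b) ab.
by case: (H w wK) => e; rewrite e ?eqxx // in wa wb aw *.
Qed.

(** [z] lies outside the clique and is adjacent to at most one of two candidates. *)
Lemma pendant_avoiding a b c z : 2 < #|A| -> a \in A -> b \in B -> g a b -> c \in edge_clique h a b -> c != a -> c != b -> 2 < #|edge_clique h a b| ->
  z \notin edge_clique h a b -> exists y, [/\ y \in edge_clique h a b, g b y, y != a, y != b & y = c \/ (y != z /\ ~~ h y z)].
Proof.
move=> cA aA bB gab cK ca cb K3 zK; have ne y : y \in edge_clique h a b -> y != z by move=> yK; apply: contraNneq zK => <-.
case: (two_or cA aA bB gab cK ca cb K3) => [[_ [bc _]]|[y [y' [yK yK' [by_ by'] yy [[ya yb] [ya' yb']]]]]].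
  by exists c; split=> //; left.
case: (K_out (gh gab) zK yK yK' yy) => n; [exists y|exists y']; split=> //; right; split=> //; exact: ne.
Qed.

Lemma vs_notK a b c k z : valid g ([:: a; b], [:: c]) -> valid g k -> sep g ([:: a; b], [:: c]) k -> z \in conn_vertices k ->
  z \notin edge_clique h a b.
Proof.
move=> vt vk s zk; have [hA lB aA0 bB0] := val_in a vt; have [ip _ _ _ _] := vt.
have aA : a \in A by []. have bB : b \in B by [].
have hab : h a b by apply: gh; move: (ipath_sorted ip); rewrite /= andbT.
apply/negP=> zK; have [n1 n2 n3] := s a a z hA zk; rewrite /= in n1.
have hza : h a z by have [_ cK _] := mcK hab; apply: cK => //; exact: aK.
case: (n2 hza) => -[h1 h2]; last by have := dj aA; rewrite h1.
have zb : z != b by apply: contraTneq h2 => ->; exact: dj'.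
have za : z != a by rewrite eq_sym.
have [n4 _] := KA mA dj aA bB hab zK za h2 za.
by rewrite eqxx in n4.
Qed.

End Far.

Section Net.
Variables (V : finType) (g : rel V).
Implicit Types (u v w x y z d : V).

(** What c-heaviness for [Z_1], [B] or [N] gives on an induced net with centres [b1], [b2], [b3]
    when the clique [b1 p1] is removed. *)
Definition net_condition := forall b1 b2 b3 p1 p2 p3, g b1 b2 -> g b1 b3 -> g b2 b3 -> g b1 p1 -> g b2 p2 -> g b3 p3 ->
  nadj g p1 p2 -> nadj g p1 p3 -> nadj g p2 p3 -> nadj g p1 b2 -> nadj g p1 b3 -> nadj g p2 b1 -> nadj g p2 b3 ->
  nadj g p3 b1 -> nadj g p3 b2 -> [|| heavy_in g b2, heavy_in g b3, heavy_in g p2 | heavy_in g p3].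

(** What c-heaviness for [Z_2] or [W] gives on an induced wounded: the conjuncts come from removing
    the clique [t2 b1] and the triangle. *)
Definition wounded_condition := forall t1 t2 t3 a b1 b2, g t1 t2 -> g t1 t3 -> g t2 t3 -> g a t1 -> g t2 b1 -> g b1 b2 ->
  nadj g a t2 -> nadj g a t3 -> nadj g t2 b2 -> nadj g a b1 -> nadj g a b2 -> nadj g t1 b1 -> nadj g t1 b2 ->
  nadj g t3 b1 -> nadj g t3 b2 -> [|| heavy_in g a, heavy_in g t1 | heavy_in g t3] && (heavy_in g b1 || heavy_in g b2).

(** The condition at all three centres requires heavy vertices in two different branches, centre or
    pendant; but no two branches contain heavy vertices at the same time. *)
Lemma net_absurd : simple_rel g -> net_condition -> forall b1 b2 b3 p1 p2 p3, g b1 b2 -> g b1 b3 -> g b2 b3 -> g b1 p1 -> g b2 p2 -> g b3 p3 ->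
  far g p1 p2 -> far g p1 p3 -> far g p2 p3 -> far g p1 b2 -> far g p1 b3 -> far g p2 b1 -> far g p2 b3 ->
  far g p3 b1 -> far g p3 b2 -> ~~ (heavy_in g b1 && heavy_in g b2) -> ~~ (heavy_in g b1 && heavy_in g b3) -> ~~ (heavy_in g b2 && heavy_in g b3) -> False.
Proof.
move=> sg Phi b1 b2 b3 p1 p2 p3 b12 b13 b23 bp1 bp2 bp3 f1 f2 f3 f4 f5 f6 f7 f8 f9.
have [gs _] := sg; have n u v : far g u v -> nadj g u v by exact: far_nadj.
have := Phi b1 b2 b3 p1 p2 p3 b12 b13 b23 bp1 bp2 bp3 (n _ _ f1) (n _ _ f2) (n _ _ f3) (n _ _ f4) (n _ _ f5) (n _ _ f6)
  (n _ _ f7) (n _ _ f8) (n _ _ f9).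
have b21 : g b2 b1 by rewrite gs. have b31 : g b3 b1 by rewrite gs. have b32 : g b3 b2 by rewrite gs.
have := Phi b2 b1 b3 p2 p1 p3 b21 b23 b13 bp2 bp1 bp3 (nadjC sg (n _ _ f1)) (n _ _ f3) (n _ _ f2) (n _ _ f6) (n _ _ f7)
  (n _ _ f4) (n _ _ f5) (n _ _ f9) (n _ _ f8).
have := Phi b3 b1 b2 p3 p1 p2 b31 b32 b12 bp3 bp1 bp2 (nadjC sg (n _ _ f2)) (nadjC sg (n _ _ f3)) (n _ _ f1) (n _ _ f8)
  (n _ _ f9) (n _ _ f5) (n _ _ f4) (n _ _ f7) (n _ _ f6).
case: f1 => _ _; case: f2 => _ _; case: f3 => _ _; case: f4 => _ _; case: f5 => _ _.
case: f6 => _ _; case: f7 => _ _; case: f8 => _ _; case: f9 => _ _.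
by case: (heavy_in g b1); case: (heavy_in g b2); case: (heavy_in g b3); case: (heavy_in g p1); case: (heavy_in g p2); case: (heavy_in g p3).
Qed.

Lemma wounded_absurd : wounded_condition -> forall t1 t2 t3 a b1 b2, g t1 t2 -> g t1 t3 -> g t2 t3 -> g a t1 -> g t2 b1 -> g b1 b2 ->
  nadj g a t2 -> nadj g a t3 -> nadj g t2 b2 -> far g a b1 -> far g a b2 -> far g t1 b1 -> far g t1 b2 ->
  far g t3 b1 -> far g t3 b2 -> False.
Proof.
move=> Phi t1 t2 t3 a b1 b2 e1 e2 e3 e4 e5 e6 n1 n2 n3 f1 f2 f3 f4 f5 f6.
have n u v : far g u v -> nadj g u v by exact: far_nadj.
have := Phi t1 t2 t3 a b1 b2 e1 e2 e3 e4 e5 e6 n1 n2 n3 (n _ _ f1) (n _ _ f2) (n _ _ f3) (n _ _ f4) (n _ _ f5) (n _ _ f6).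
case: f1 => _ _; case: f2 => _ _; case: f3 => _ _; case: f4 => _ _; case: f5 => _ _; case: f6 => _ _.
by case: (heavy_in g a); case: (heavy_in g t1); case: (heavy_in g t3); case: (heavy_in g b1); case: (heavy_in g b2).
Qed.

Variable h : rel V.
Hypotheses (sg : simple_rel g) (cg : claw_heavy g) (ex : completes_to g h) (clh : closed h).
Let gs := sg.1.
Let gi := sg.2.
Let sh := completes_to_simple ex sg.
Let ch := completes_to_claw_heavy ex sg cg.
Let hs := sh.1.
Let hi := sh.2.
Let gh : subrel g h := completes_to_sub ex.
Variables (A B : {set V}).
Hypotheses (mA : closed_clique h A) (mB : closed_clique h B) (dj : forall w, w \in A -> w \notin B) (fewB : one_heavy h B).
Let dj' w : w \in B -> w \notin A. Proof. by apply: contraL; exact: dj. Qed.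
Implicit Type k : conn V.

Local Notation valid := (@valid V h A B).
Local Notation sep := (@sep V h A B).
Local Notation three_conns := (@three_conns V h A B).
Local Notation K a b := (edge_clique h a b).

Definition triangle_conn a b c := [/\ a \in A, b \in B, g a b & [/\ c \in K a b, c != a, c != b & 2 < #|K a b|]].

Lemma val_TT k : valid g k -> size k.1 = 2 -> exists a b c, k = ([:: a; b], [:: c]) /\ triangle_conn a b c.
Proof. by move=> vk s2; have [a [b [c [e h1 h2 h3 h4]]]] := val_T sg ex vk s2; exists a, b, c. Qed.

Lemma vs2 (a b c : V) : b \in conn_vertices ([:: a; b], [:: c]).
Proof. by rewrite !inE eqxx orbT. Qed.

Lemma KK_not a b c a' b' c' y : valid g ([:: a; b], [:: c]) -> triangle_conn a b c -> valid g ([:: a'; b'], [:: c']) ->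
  sep g ([:: a; b], [:: c]) ([:: a'; b'], [:: c']) -> triangle_conn a' b' c' -> y \in K a' b' -> y \notin K a b.
Proof.
move=> vt [aA bB gab _] vk s [aA' bB' gab' _] yK; have hab := gh gab; have hab' := gh gab'.
have a'n := vs_notK sg cg ex clh mA dj vt vk s (mem_head _ _).
apply/negP=> yK'; have ya' : y != a' by apply: contraNneq a'n => <-.
have aa' : a' != a by apply: contraNneq a'n => ->; exact: aK.
have [_ cK' _] := mcK sg cg ex clh hab'.
have ya : y != a.
  apply/negP=> /eqP e; rewrite e in yK ya'.
  by have [] := KA sg cg ex clh mA dj aA' bB' hab' yK ya' aA ya'; rewrite eqxx.
have [_ /negP] := KA sg cg ex clh mA dj aA bB hab yK' ya aA' aa'.
by apply; apply: cK' => //; exact: aK.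
Qed.

Let HF := @hfar V g h sg cg ex clh.
Let FC := @far_cross V g h sg cg ex clh A B fewB.

(** Candidates for the pendant vertex at the last vertex of [k]: a vertex of the connector outside
    [A], or any further vertex in the clique of a triangle connector. *)
Definition Pd k p := [\/ [/\ p \in conn_vertices k, p \notin A & forall d, p != last d k.1] |
  exists a b c, [/\ k = ([:: a; b], [:: c]), triangle_conn a b c, p \in K a b, p != a & p != b]].

Lemma inA_head k x d : valid g k -> x \in conn_vertices k -> x \notin A -> x != head d k.1.
Proof. by move=> vk xk; apply: contraNneq => ->; have [] := val_in d vk. Qed.

Lemma Pd1_far k k' p x : valid g k -> valid g k' -> sep g k k' -> p \in conn_vertices k -> p \notin A -> (forall d, p != last d k.1) ->
  x \in conn_vertices k' -> far g p x.
Proof.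
by move=> vk vk' s pk pA pl xk; apply: (FC (d := p) vk vk' s pk xk); rewrite ?pl // (inA_head p vk pk pA).
Qed.

Lemma Pd_far k k' p d : valid g k -> valid g k' -> sep g k k' -> Pd k p -> far g p (head d k'.1) /\ far g p (last d k'.1).
Proof.
move=> vk vk' s; have [h1 l1 A1 B1] := val_in d vk; have [h2 l2 A2 B2] := val_in d vk'.
case=> [[pk pA pl]|[a [b [c [ek [aA bB gab _] pK pa pb]]]]].
  by split; apply: (Pd1_far vk vk' s).
have [n1 _ _] := s d _ _ h1 h2; have [n2 _ _] := s d _ _ l1 l2; rewrite ek /= eq_sym in n1; rewrite ek /= eq_sym in n2.
have [q1 q2] := KA sg cg ex clh mA dj aA bB (gh gab) pK pa A2 n1.
have [q3 q4] := KB sg cg ex clh mA mB dj aA bB (gh gab) pK pb B2 n2.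
by split; exact: HF.
Qed.

Lemma path_m p m' m b : valid g (rcons (rcons (rcons p m') m) b, [::]) ->
  [/\ m \notin A, (p != [::]) -> m' \notin A, g m' m, g b m & [/\ m != b, m' != b, m' != m, ~~ g m' b & b \notin A]].
Proof.
move=> vk; have [ip _ hl _ [kA _]] := vk; rewrite /= in ip hl.
have [h1 h2 h3 [h4 h5] h6] := path_end ip.
have up := ipath_uniq ip; have [_ bB] := hl b; rewrite last_rcons in bB.
have mk : m \in conn_vertices (rcons (rcons (rcons p m') m) b, [::]) by rewrite /conn_vertices cats0 /= !(mem_rcons, inE) eqxx orbT.
have mk' : m' \in conn_vertices (rcons (rcons (rcons p m') m) b, [::]) by rewrite /conn_vertices cats0 /= !(mem_rcons, inE) eqxx !orbT.
split=> //; last by split=> //; exact: dj'.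
- by apply/negP=> /(kA m m mk) /= e; move: up; rewrite !rcons_uniq !(mem_rcons, inE) e; case: (p) => [|z p'] /=;
    rewrite ?eqxx ?inE ?eqxx ?orbT ?andbF //= => /and3P[].
- by move=> p0; apply/negP=> /(kA m m' mk') /= e; move: up p0; rewrite !rcons_uniq !(mem_rcons, inE) e; case: (p) => [|z p'] //=;
    rewrite ?inE ?eqxx ?orbT ?andbF //= andbF.
- by rewrite gs.
Qed.

Lemma Pd_path p m' m b : valid g (rcons (rcons (rcons p m') m) b, [::]) -> Pd (rcons (rcons (rcons p m') m) b, [::]) m.
Proof.
move=> vk; have [mA' _ _ _ [mb _ _ _ _]] := path_m vk; constructor 1; split=> //.
  by rewrite /conn_vertices cats0 /= !(mem_rcons, inE) eqxx orbT.
by move=> d; rewrite last_rcons.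
Qed.

Lemma TT_c a b c : valid g ([:: a; b], [:: c]) -> triangle_conn a b c -> [/\ c \in conn_vertices ([:: a; b], [:: c]), c \notin A, c \notin B &
  forall d, c != last d ([:: a; b], [:: c]).1].
Proof.
move=> vk [aA bB gab [cK ca cb _]].
have ck : c \in conn_vertices ([:: a; b], [:: c]) by rewrite !inE eqxx !orbT.
have [_ _ _ _ [kA kB]] := vk; split=> //.
  by apply/negP=> /(kA c c ck) /= e; rewrite e eqxx in ca.
by apply/negP=> /(kB c c ck) /= [e|[]//]; rewrite e eqxx in cb.
Qed.

(** For two triangle connectors [pendant_avoiding] is used twice, the second pendant avoiding the
    first. Where it returns the triangle vertex of the connector, the separation of the connectors
    takes over. *)
Lemma pendants_far k k' : 2 < #|A| -> valid g k -> valid g k' -> sep g k k' -> exists p p',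
  [/\ forall d, g (last d k.1) p, forall d, g (last d k'.1) p', Pd k p, Pd k' p' & far g p p'].
Proof.
move=> cA vk vk' s.
have pT a b c z : valid g ([:: a; b], [:: c]) -> triangle_conn a b c -> z \notin K a b ->
    exists y, [/\ g b y, Pd ([:: a; b], [:: c]) y, y \in K a b & y = c \/ (y != z /\ ~~ h y z)].
  move=> vt T zK; have [aA bB gab [cK ca cb K3]] := T.
  have [y [yK by_ ya yb H]] := pendant_avoiding sg cg ex clh mA mB dj cA aA bB gab cK ca cb K3 zK.
  by exists y; split=> //; constructor 2; exists a, b, c.
have PT p m' m b k2 : valid g (rcons (rcons (rcons p m') m) b, [::]) -> valid g k2 -> size k2.1 = 2 ->
    sep g (rcons (rcons (rcons p m') m) b, [::]) k2 -> exists q q',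
    [/\ g b q, forall d, g (last d k2.1) q', Pd (rcons (rcons (rcons p m') m) b, [::]) q, Pd k2 q' & far g q q'].
  move=> v1 v2 s2 s12; have [a2 [b2 [c2 [e2 T2]]]] := val_TT v2 s2; rewrite {k2}e2 in v2 s2 s12 *.
  have [mA' _ _ bm [mb _ _ _ _]] := path_m v1; have Pm := Pd_path v1.
  have mk : m \in conn_vertices (rcons (rcons (rcons p m') m) b, [::]) by rewrite /conn_vertices cats0 /= !(mem_rcons, inE) eqxx orbT.
  have s21 := sep_sym sh sg s12.
  have mK := vs_notK sg cg ex clh mA dj v2 v1 s21 mk.
  have [y [by_ Py yK H]] := pT _ _ _ m v2 T2 mK.
  exists m, y; split=> //; case: H => [e|[n1 n2]]; last by apply: farC => //; exact: HF.
  have [ck cA' _ _] := TT_c v2 T2; rewrite e; apply: (Pd1_far v1 v2 s12) => // d; by rewrite last_rcons.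
have [e1|n1] := eqVneq (size k.1) 2; last first.
  have [p [m' [m [b ek]]]] := val_P vk n1; rewrite {k}ek in vk s n1 *.
  have [e2|n2] := eqVneq (size k'.1) 2.
    have [q [q' [h1 h2 h3 h4 h5]]] := PT p m' m b k' vk vk' e2 s; exists q, q'; split=> // d; by rewrite last_rcons.
  have [p2 [m2' [m2 [b2 ek2]]]] := val_P vk' n2; rewrite {k'}ek2 in vk' s n2 *.
  have [mA1 _ _ bm1 [mb1 _ _ _ _]] := path_m vk; have [mA2 _ _ bm2 [mb2 _ _ _ _]] := path_m vk'.
  exists m, m2; split; try (by move=> d; rewrite last_rcons); try exact: Pd_path.
  apply: (Pd1_far vk vk' s) => //; first by rewrite /conn_vertices cats0 /= !(mem_rcons, inE) eqxx orbT.
    by move=> d; rewrite last_rcons.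
  by rewrite /conn_vertices cats0 /= !(mem_rcons, inE) eqxx orbT.
have [e2|n2] := eqVneq (size k'.1) 2; last first.
  have [p [m' [m [b ek]]]] := val_P vk' n2; rewrite {k'}ek in vk' s n2 *.
  have [q [q' [h1 h2 h3 h4 h5]]] := PT p m' m b k vk' vk e1 (sep_sym sh sg s).
  by exists q', q; split=> // [d|]; [rewrite last_rcons|exact: farC].
have [a [b [c [ek T]]]] := val_TT vk e1; have [a' [b' [c' [ek' T']]]] := val_TT vk' e2; rewrite {k}ek {k'}ek' in vk vk' s e1 e2 *.
have s' := sep_sym sh sg s.
have [ck cnA _ cl] := TT_c vk T; have [ck' cnA' _ cl'] := TT_c vk' T'.
have [y' [by' Py' yK' H']] := pT _ _ _ c vk' T' (vs_notK sg cg ex clh mA dj vk' vk s' ck).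
have [y [by_ Py yK H]] := pT _ _ _ y' vk T (KK_not vk T vk' s T' yK').
exists y, y'; split=> //; case: H => [->|[h1 h2]]; last exact: HF.
case: H' => [->|[h1 h2]]; first exact: (Pd1_far vk vk' s).
by apply: farC => //; exact: HF.
Qed.

(** The centres are the three last vertices. The head of a triangle connector, or the inner
    neighbour of the last vertex if all connectors are longer, is a pendant far from all candidates
    of the other two, so only the remaining two pendants must be matched. *)
Lemma net_no_conns k1 k2 k3 : net_condition -> three_conns g k1 k2 k3 -> False.
Proof.
move=> Phi S; have [cA _] := A_B_gt2 mA S.
suff body l1 l2 l3 p d : three_conns g l1 l2 l3 -> g (last d l1.1) p -> far g p (last d l2.1) -> far g p (last d l3.1) ->
    (forall q, Pd l2 q -> far g p q) -> (forall q, Pd l3 q -> far g p q) -> False.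
  have T1 l1 l2 l3 : three_conns g l1 l2 l3 -> size l1.1 = 2 -> False.
    move=> S'; have [[v1 v2 v3] [s12 s13 s23] _] := S' => e1.
    have [a [b [c [el T]]]] := val_TT v1 e1; rewrite {l1}el in v1 s12 s13 S' e1 *.
    have [aA bB gab [_ _ _ _]] := T.
    have ak : a \in conn_vertices ([:: a; b], [:: c]) by rewrite mem_head.
    have nab : a != b by apply: contraTneq gab => ->; rewrite gi.
    have fl l : valid g l -> sep g ([:: a; b], [:: c]) l -> far g a (last a l.1).
      move=> vl s; have [h2 l2' A2 B2] := val_in a vl.
      by apply: (FC (d := a) v1 vl s ak l2'); rewrite ?nab // (inA_head a vl l2' (dj' B2)) orbT.
    have fq l q : valid g l -> sep g ([:: a; b], [:: c]) l -> Pd l q -> far g a q.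
      by move=> vl s Pq; apply: farC => //; have [] := Pd_far a vl v1 (sep_sym sh sg s) Pq.
    apply: (body _ _ _ a a S') => //=; [by rewrite gs|exact: fl|exact: fl| |].
      by move=> q; exact: fq.
    by move=> q; exact: fq.
  have se : simple_rel h by [].
  have [e1|n1] := eqVneq (size k1.1) 2; first exact: T1 S e1.
  have [e2|n2] := eqVneq (size k2.1) 2; first exact: T1 (st_perm12 sh sg S) e2.
  have [e3|n3] := eqVneq (size k3.1) 2; first exact: T1 (st_perm12 sh sg (st_perm23 sh sg S)) e3.
  have [[v1 v2 v3] [s12 s13 s23] _] := S.
  have [p [m' [m [b ek]]]] := val_P v1 n1; rewrite {k1}ek in v1 s12 s13 S n1 *.
  have Pm := Pd_path v1; have [_ _ _ bm _] := path_m v1.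
  have fq l q : valid g l -> sep g (rcons (rcons (rcons p m') m) b, [::]) l -> size l.1 != 2 -> Pd l q -> far g m q.
    move=> vl s nl [[qk _ _]|[a' [b' [c' [el]]]]]; last by rewrite el in nl.
    case: Pm => [[mk mnA ml]|[a' [b' [c' [el]]]]]; first exact: (Pd1_far v1 vl s).
    by move: n1; rewrite el.
  apply: (body _ _ _ m m S); rewrite ?last_rcons //.
  - by have [] := Pd_far m v1 v2 s12 Pm.
  - by have [] := Pd_far m v1 v3 s13 Pm.
  - by move=> q; exact: fq.
  by move=> q; exact: fq.
move=> {k1 k2 k3}S gp f2 f3 F2 F3; have [[v1 v2 v3] [s12 s13 s23] [b12 b13 b23]] := S.
have [p2 [p3 [gp2 gp3 P2 P3 f23]]] := pendants_far cA v2 v3 s23.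
have [_ k1l _ B1] := val_in d v1; have [_ k2l _ B2] := val_in d v2; have [_ k3l _ B3] := val_in d v3.
have few u v : u \in B -> v \in B -> u != v -> ~~ (heavy_in g u && heavy_in g v).
  move=> uB vB; apply: contra => /andP[hu hw]; apply/eqP; apply: fewB => //; exact: heavy_in_sub gh _.
have [n12 _ _] := s12 d _ _ k1l k2l; have [n13 _ _] := s13 d _ _ k1l k3l; have [n23 _ _] := s23 d _ _ k2l k3l.
have s21 := sep_sym sh sg s12; have s31 := sep_sym sh sg s13; have s32 := sep_sym sh sg s23.
apply: (@net_absurd sg Phi (last d l1.1) (last d l2.1) (last d l3.1) p p2 p3) => //; try exact: few; try exact: F2; try exact: F3.
- by have [] := Pd_far d v2 v1 s21 P2.
- by have [] := Pd_far d v2 v3 s23 P2.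
- by have [] := Pd_far d v3 v1 s31 P3.
by have [] := Pd_far d v3 v2 s32 P3.
Qed.

(** The triangle is virtual: [a] and [b] have no common neighbour in the clique with respect to [g].
    The claws at [a] and [b] whose third leaves lie in [A] and [B] then force heavy pairs [b z] and
    [a y], and each contains a heavy vertex. *)
Lemma virtual_heavy a b c : 2 < #|A| -> 2 < #|B| -> triangle_conn a b c -> (forall y, y \in K a b -> g a y -> ~~ g b y) ->
  exists p q, [/\ p \in K a b, q \in K a b, p != q & heavy_in g p && heavy_in g q].
Proof.
move=> cA cB [aA bB gab [_ _ _ K3]] vt; have hab := gh gab; have mK := mcK sg cg ex clh hab; have ab := ab_neq sg ex hab.
have ba : b != a by rewrite eq_sym.
have [z [zK zb za az]] := mc_nb ex sg mK K3 (aK h a b) ab.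
have [y [yK ya yb by_]] := mc_nb ex sg mK K3 (bK h a b) ba.
have [e [eA eb ea ae]] := mc_nb ex sg mA cA aA ab.
have [f [fB fa fb bf]] := mc_nb ex sg mB cB bB ba.
have nbz : ~~ g b z by exact: vt.
have nay : ~~ g a y by apply: contraL by_; exact: vt.
have hpn u v : u != v -> ~~ h u v -> ore_pair g u v = false.
  move=> uv nh; apply/negP=> /and3P[_ _ d]; have := closed_nohp sh ch clh u v.
  by rewrite /ore_pair uv nh (leq_trans d) // leq_add // dg_sub.
have ng u v : ~~ h u v -> ~~ g u v by apply: contra; exact: gh.
have [be nbe] := KA sg cg ex clh mA dj aA bB hab (bK h a b) ba eA ea.
have [ze nze] := KA sg cg ex clh mA dj aA bB hab zK za eA ea.
have [af naf] := KB sg cg ex clh mA mB dj aA bB hab (aK h a b) ab fB fb.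
have [yf nyf] := KB sg cg ex clh mA mB dj aA bB hab yK yb fB fb.
have bz : b != z by rewrite eq_sym. have ay : a != y by rewrite eq_sym.
have gba : g b a by rewrite gs.
have := cg gab az ae bz be ze nbz (ng _ _ nbe) (ng _ _ nze); rewrite !(hpn _ e) // !orbF => /and3P[_ _ d1].
have := cg gba by_ bf ay af yf nay (ng _ _ naf) (ng _ _ nyf); rewrite !(hpn _ f) // !orbF => /and3P[_ _ d2].
have half u v : #|V| <= dg g u + dg g v -> heavy_in g u \/ heavy_in g v.
  by rewrite /heavy_in => d; case: (leqP #|V| (dg g u).*2) => l; [left|right; move: d l; clear; lia].
have zy : z != y by apply: contraNneq nay => <-.
have [aKi bKi] : a \in K a b /\ b \in K a b by rewrite aK bK.
case: (half _ _ d1) (half _ _ d2) => h1 [] h2.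
- by exists b, a; rewrite h1 h2.
- by exists b, y; rewrite h1 h2; split=> //; rewrite eq_sym.
- by exists z, a; rewrite h1 h2.
by exists z, y; rewrite h1 h2.
Qed.

(** Heavy vertices are adjacent in [h], so a heavy vertex in the second clique would have two
    neighbours in the first. *)
Lemma two_virtual a b c a' b' c' : 2 < #|A| -> 2 < #|B| -> valid g ([:: a; b], [:: c]) -> triangle_conn a b c -> valid g ([:: a'; b'], [:: c']) ->
  sep g ([:: a; b], [:: c]) ([:: a'; b'], [:: c']) -> triangle_conn a' b' c' ->
  (exists y, [/\ y \in K a b, g a y & g b y]) \/ (exists y, [/\ y \in K a' b', g a' y & g b' y]).
Proof.
move=> cA cB v T v' s T'.
have R a0 b0 : (exists y, [/\ y \in K a0 b0, g a0 y & g b0 y]) \/ (forall y, y \in K a0 b0 -> g a0 y -> ~~ g b0 y).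
  case: (pickP (fun y => [&& y \in K a0 b0, g a0 y & g b0 y])) => [y /and3P[]|no]; first by left; exists y.
  by right=> y yK ay; apply/negP=> by_; have := no y; rewrite yK ay by_.
case: (R a b) => [|vt]; first by left.
case: (R a' b') => [|vt']; first by right.
have [p [q [pK qK pq /andP[hvp hvq]]]] := virtual_heavy cA cB T vt.
have [r [_ [rK _ _ /andP[hr _]]]] := virtual_heavy cA cB T' vt'.
have rn := KK_not v T v' s T' rK; have [_ _ gab _] := T.
have adj x : x \in K a b -> heavy_in g x -> h x r.
  move=> xK hx; apply: (heavy_in_adj sh ch clh); [exact: heavy_in_sub gh hx|exact: heavy_in_sub gh hr|].
  by apply: contraNneq rn => <-.
by case: (K_out sg cg ex clh (gh gab) rn pK qK pq); rewrite adj.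
Qed.

(** With a path connector, the wounded consists of the three last vertices, the two vertices
    preceding one of them, and a pendant at another. With three triangle connectors, a real triangle
    [x1 y1 c] carries a vertex of [A] at [x1] and the path [y1 y t] into another connector; if
    neither of the other two offers such a [t], then [c] is the centre of a claw of [h]. *)
Lemma wounded_no_conns k1 k2 k3 : wounded_condition -> three_conns g k1 k2 k3 -> False.
Proof.
move=> Phi S; have [cA cB] := A_B_gt2 mA S.
have Pth l1 l2 l3 : three_conns g l1 l2 l3 -> size l1.1 != 2 -> False.
  move=> [[v1 v2 v3] [s12 s13 s23] [b12 b13 b23]] n1.
  have [p [m' [m [b ek]]]] := val_P v1 n1; rewrite {l1}ek in v1 s12 s13 n1 b12 b13 *.
  have [mnA m'nA gm bm [mb mb' mm' nmb bnA]] := path_m v1; set l1 := (_, _) in v1 s12 s13 n1 b12 b13.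
  have mk : m \in conn_vertices l1 by rewrite /conn_vertices cats0 /= !(mem_rcons, inE) eqxx orbT.
  have mk' : m' \in conn_vertices l1 by rewrite /conn_vertices cats0 /= !(mem_rcons, inE) eqxx !orbT.
  have ml d : last d l1.1 = b by rewrite last_rcons.
  have [k2h k2l A2 B2] := val_in b v2; have [k3h k3l A3' B3] := val_in b v3.
  move e2b : (last b l2.1) k2l B2 => b2 k2l B2; move e3b : (last b l3.1) k3l B3 => b3 k3l B3.
  have fm z x l : valid g l -> sep g l1 l -> x \in conn_vertices l -> x \notin A -> z \in conn_vertices l1 -> z != b -> far g x z.
    move=> vl s xl xA zl zb; apply: farC => //; apply: (FC (d := b) v1 vl s zl xl); first by rewrite (inA_head b vl xl xA) orbT.
    by rewrite ml zb.
  have s21 := sep_sym sh sg s12.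
  have gb12 : g b b2 by have := b12 b; rewrite ml e2b.
  have gb13 : g b b3 by have := b13 b; rewrite ml e3b.
  have gb23 : g b2 b3 by rewrite -e2b -e3b.
  suff [q [gq Pq fq fq']] : exists q, [/\ g b2 q, nadj g q b /\ nadj g q b3, far g q m & far g q m'].
    have mm : g m m' by rewrite gs.
    apply: (@wounded_absurd Phi b2 b b3 q m m') => //; try by rewrite gs.
    - by case: Pq.
    - by case: Pq.
    - by split; rewrite 1?eq_sym // gs.
    - by apply: (fm m b2 l2) => //; exact: dj'.
    - by apply: (fm m' b2 l2) => //; exact: dj'.
    - by apply: (fm m b3 l3) => //; exact: dj'.
    by apply: (fm m' b3 l3) => //; exact: dj'.
  have nad q : Pd l2 q -> nadj g q b /\ nadj g q b3.
    move=> Pq; have [_ f1] := Pd_far b v2 v1 s21 Pq; have [_ f2] := Pd_far b v2 v3 s23 Pq.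
    by rewrite ml in f1; rewrite e3b in f2; split; exact: far_nadj.
  have [e2|n2] := eqVneq (size l2.1) 2; last first.
    have [p2 [m2' [m2 [b2' ek2]]]] := val_P v2 n2.
    rewrite {l2}ek2 in v2 s12 s21 s23 n2 b12 b23 k2h k2l A2 e2b nad *.
    have [m2nA _ _ bm2 [mb2 _ _ _ _]] := path_m v2; have Pm := Pd_path v2.
    have m2k : m2 \in conn_vertices (rcons (rcons (rcons p2 m2') m2) b2', [::]) by rewrite /conn_vertices cats0 /= !(mem_rcons, inE) eqxx orbT.
    exists m2; rewrite -e2b last_rcons; split=> //; [exact: nad|exact: fm m m2 _ v2 s12 m2k m2nA mk mb|exact: fm m' m2 _ v2 s12 m2k m2nA mk' mb'].
  have [a2 [b2' [c2 [ek2 T2]]]] := val_TT v2 e2.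
  rewrite {l2}ek2 in v2 s12 s21 s23 b12 b23 k2h k2l A2 e2b nad e2 *; rewrite -e2b /=.
  have [aA bB gab [cK ca cb K3]] := T2.
  (* On three vertices [m'] is the head and lies in [A] like [a2], so [a2] serves as pendant only
     for longer paths. *)
  case: (eqVneq p [::]) => [p0|p0].
    have [y [yK by_ ya yb H]] := pendant_avoiding sg cg ex clh mA mB dj cA aA bB gab cK ca cb K3 (vs_notK sg cg ex clh mA dj v2 v1 s21 mk).
    have Py : Pd ([:: a2; b2'], [:: c2]) y by constructor 2; exists a2, b2', c2.
    exists y; split=> //; first exact: nad.
      case: H => [->|[h1 h2]]; last exact: HF.
      have [ck cnA _ _] := TT_c v2 T2; exact: fm m c2 _ v2 s12 ck cnA mk mb.
    have [f1 _] := Pd_far b v2 v1 s21 Py; by move: f1; rewrite /l1 p0.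
  have m'A := m'nA p0.
  have nab : a2 != b2' by apply: contraTneq gab => ->; rewrite gi.
  have ak : a2 \in conn_vertices ([:: a2; b2'], [:: c2]) by rewrite mem_head.
  have fa z l : valid g l -> sep g ([:: a2; b2'], [:: c2]) l -> z \in conn_vertices l -> z \notin A -> far g a2 z.
    move=> vl s zl zA; apply: (FC (d := a2) v2 vl s ak zl); last by rewrite nab.
    by rewrite (inA_head a2 vl zl zA) orbT.
  have bl : b \in conn_vertices l1 by rewrite /conn_vertices cats0 /= !(mem_rcons, inE) eqxx.
  exists a2; split; [by rewrite gs| |exact: fa m l1 v1 s21 mk mnA|exact: fa m' l1 v1 s21 mk' m'A].
  by split; apply: far_nadj; [exact: fa b l1 v1 s21 bl bnA|exact: fa b3 l3 v3 s23 k3l (dj' B3)].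
have [e1|n1] := eqVneq (size k1.1) 2; last exact: Pth S n1.
have [e2|n2] := eqVneq (size k2.1) 2; last exact: Pth (st_perm12 sh sg S) n2.
have [e3|n3] := eqVneq (size k3.1) 2; last exact: Pth (st_perm12 sh sg (st_perm23 sh sg S)) n3.
have [[v1 v2 v3] [s12 s13 s23] [b12 b13 b23]] := S.
have [a1 [b1 [c1 [ek1 T1]]]] := val_TT v1 e1; have [a2 [b2 [c2 [ek2 T2]]]] := val_TT v2 e2; have [a3 [b3 [c3 [ek3 T3]]]] := val_TT v3 e3.
rewrite {k1}ek1 {k2}ek2 {k3}ek3 in v1 v2 v3 s12 s13 s23 b12 b13 b23 S {e1 e2 e3}.
have Tw x1 y1 z1 x2 y2 z2 x3 y3 z3 : three_conns g ([:: x1; y1], [:: z1]) ([:: x2; y2], [:: z2]) ([:: x3; y3], [:: z3]) ->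
    triangle_conn x1 y1 z1 -> triangle_conn x2 y2 z2 -> triangle_conn x3 y3 z3 -> (exists y, [/\ y \in K x1 y1, g x1 y & g y1 y]) -> False.
  move=> {S v1 v2 v3 s12 s13 s23 b12 b13 b23 T1 T2 T3} [[v1 v2 v3] [s12 s13 s23] [b12 b13 b23]] T1 T2 T3 [c [cK ac bc]].
  have [A1 B1 g1 [zK1 za1 zb1 K1]] := T1; have hab1 := gh g1.
  have s21 := sep_sym sh sg s12; have s31 := sep_sym sh sg s13.
  have ca : c != x1 by apply: contraTneq ac => ->; rewrite gi.
  have cb : c != y1 by apply: contraTneq bc => ->; rewrite gi.
  have ba : y1 != x1 by rewrite eq_sym (ab_neq sg ex hab1).
  (* the pattern needs a pendant vertex of the second connector not adjacent to c *)
  have W x y z t : triangle_conn x y z -> valid g ([:: x; y], [:: z]) -> sep g ([:: x1; y1], [:: z1]) ([:: x; y], [:: z]) -> g y1 y ->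
      t \in K x y -> g y t -> t != x -> t != y -> t != c -> ~~ h t c -> False.
    move=> T v s gyy tK yt tx ty tc ntc; have [AA BB gg _] := T; have hab := gh gg.
    have [n1 _ _] := s x1 x1 x (mem_head _ _) (mem_head _ _).
    have [n2 _ _] := s x1 y1 y (vs2 _ _ _) (vs2 _ _ _).
    have [e [eA ex' ee xe]] : exists e, [/\ e \in A, e != x, e != x1 & g x1 e] := mc_nb ex sg mA cA A1 n1.
    have yx : y != x by rewrite eq_sym (ab_neq sg ex hab).
    have [f1 f2] := KA sg cg ex clh mA dj A1 B1 hab1 (bK h x1 y1) ba eA ee.
    have [f3 f4] := KA sg cg ex clh mA dj A1 B1 hab1 cK ca eA ee.
    have [f5 f6] := KB sg cg ex clh mA mB dj AA BB hab tK ty B1 n2.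
    have [f7 f8] := KA sg cg ex clh mA dj AA BB hab (bK h x y) yx eA ex'.
    have [f9 f10] := KA sg cg ex clh mA dj AA BB hab tK tx eA ex'.
    have [f11 f12] := KA sg cg ex clh mA dj AA BB hab (bK h x y) yx A1 n1.
    have [f13 f14] := KA sg cg ex clh mA dj AA BB hab tK tx A1 n1.
    have n2' : y != y1 by rewrite eq_sym.
    have [f15 f16] := KB sg cg ex clh mA mB dj A1 B1 hab1 cK cb BB n2'.
    have hf u w : u != w -> ~~ h u w -> far g u w by exact: HF.
    have hf' u w : u != w -> ~~ h u w -> far g w u by move=> *; apply: farC => //; exact: HF.
    apply: (@wounded_absurd Phi x1 y1 c e y t) => //; try exact: hf; try exact: hf'.
    - by rewrite gs.
    - by apply: far_nadj; exact: hf'.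
    - by apply: far_nadj; exact: hf'.
    by apply: far_nadj; exact: hf'.
  have cn2 : c \notin K x2 y2 by exact: (KK_not v2 T2 v1 s21 T1 cK).
  have cn3 : c \notin K x3 y3 by exact: (KK_not v3 T3 v1 s31 T1 cK).
  have [A2 B2 g2 [zK2 za2 zb2 K2]] := T2; have [A3' B3 g3 [zK3 za3 zb3 K3]] := T3.
  have [t2 [tK2 yt2 tx2 ty2 H2]] := pendant_avoiding sg cg ex clh mA mB dj cA A2 B2 g2 zK2 za2 zb2 K2 cn2.
  have [t3 [tK3 yt3 tx3 ty3 H3]] := pendant_avoiding sg cg ex clh mA mB dj cA A3' B3 g3 zK3 za3 zb3 K3 cn3.
  have q2 : ~ (t2 != c /\ ~~ h t2 c) by move=> [h1 h2]; apply: (W x2 y2 z2 t2) => //; exact: b12 c.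
  have q3 : ~ (t3 != c /\ ~~ h t3 c) by move=> [h1 h2]; apply: (W x3 y3 z3 t3) => //; exact: b13 c.
  case: H2 => [e2|/q2//]; case: H3 => [e3|/q3//]; rewrite {}e2 in q2 tK2; rewrite {}e3 in q3 tK3.
  have c2c : z2 != c by apply: contraNneq cn2 => <-. have c3c : z3 != c by apply: contraNneq cn3 => <-.
  have h2 : h c z2 by rewrite hs; apply/negPn/negP=> n; exact: q2.
  have h3 : h c z3 by rewrite hs; apply/negPn/negP=> n; exact: q3.
  have hcx : h c x1 by rewrite hs; exact: gh.
  have [ck2 cnA2 cnB2 _] := TT_c v2 T2; have [ck3 cnA3 cnB3 _] := TT_c v3 T3.
  have [n1 m1 _] := s12 c x1 z2 (mem_head _ _) ck2; have [n2 m2 _] := s13 c x1 z3 (mem_head _ _) ck3.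
  have [n3 m3 _] := s23 c z2 z3 ck2 ck3.
  have := closed_clawfree sh ch clh hcx h2 h3 n1 n2 n3.
  by case/or3P=> [/m1|/m2|/m3] [][]; rewrite ?(negbTE cnA2) ?(negbTE cnA3) ?(negbTE cnB2) ?(negbTE cnB3).
case: (two_virtual cA cB v1 T1 v2 s12 T2) => R; first exact: (Tw _ _ _ _ _ _ _ _ _ S T1 T2 T3 R).
exact: (Tw _ _ _ _ _ _ _ _ _ (st_perm12 sh sg S) T2 T1 T3 R).
Qed.

End Net.

(** * The case of Z_3: cliques reduced to triangles *)

Section Z3.
Variables (V : finType) (g : rel V).
Implicit Types (u v w x y z d e s t : V) (A B X K : {set V}).

(** The conjuncts come from removing the clique [t1 z1] and the triangle from an induced [Z_3]. *)
Definition Z3_condition := forall t1 t2 t3 z1 z2 z3, g t1 t2 -> g t1 t3 -> g t2 t3 -> g t1 z1 -> g z1 z2 -> g z2 z3 ->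
  nadj g t1 z2 -> nadj g t1 z3 -> nadj g z1 z3 -> nadj g t2 z1 -> nadj g t2 z2 -> nadj g t2 z3 ->
  nadj g t3 z1 -> nadj g t3 z2 -> nadj g t3 z3 -> (heavy_in g t2 || heavy_in g t3) && [|| heavy_in g z1, heavy_in g z2 | heavy_in g z3].

(** All pairs between the two places are far except [t3] and [z3], so these are the two heavy
    vertices. *)
Lemma Z3_two_heavy : Z3_condition -> forall t1 t2 t3 z1 z2 z3, g t1 t2 -> g t1 t3 -> g t2 t3 -> g t1 z1 -> g z1 z2 -> g z2 z3 ->
  nadj g t1 z2 -> nadj g t1 z3 -> nadj g z1 z3 -> far g t2 z1 -> far g t2 z2 -> far g t2 z3 ->
  far g t3 z1 -> far g t3 z2 -> nadj g t3 z3 -> heavy_in g t3 && heavy_in g z3.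
Proof.
move=> Phi t1 t2 t3 z1 z2 z3 e1 e2 e3 e4 e5 e6 n1 n2 n3 f1 f2 f3 f4 f5 n6.
have n u v : far g u v -> nadj g u v by exact: far_nadj.
have := Phi t1 t2 t3 z1 z2 z3 e1 e2 e3 e4 e5 e6 n1 n2 n3 (n _ _ f1) (n _ _ f2) (n _ _ f3) (n _ _ f4) (n _ _ f5) n6.
case: f1 => _ _; case: f2 => _ _; case: f3 => _ _; case: f4 => _ _; case: f5 => _ _.
by case: (heavy_in g t2); case: (heavy_in g t3); case: (heavy_in g z1); case: (heavy_in g z2); case: (heavy_in g z3).
Qed.

Lemma Z3_absurd : Z3_condition -> forall t1 t2 t3 z1 z2 z3, g t1 t2 -> g t1 t3 -> g t2 t3 -> g t1 z1 -> g z1 z2 -> g z2 z3 ->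
  nadj g t1 z2 -> nadj g t1 z3 -> nadj g z1 z3 -> far g t2 z1 -> far g t2 z2 -> far g t2 z3 ->
  far g t3 z1 -> far g t3 z2 -> far g t3 z3 -> False.
Proof.
move=> Phi t1 t2 t3 z1 z2 z3 e1 e2 e3 e4 e5 e6 n1 n2 n3 f1 f2 f3 f4 f5 f6.
have := Z3_two_heavy Phi e1 e2 e3 e4 e5 e6 n1 n2 n3 f1 f2 f3 f4 f5 (far_nadj f6).
by case: f6 => _ _ /negbTE ->.
Qed.

Variable h : rel V.
Hypotheses (sg : simple_rel g) (cg : claw_heavy g) (ex : completes_to g h) (clh : closed h) (Phi : Z3_condition).
Let gs := sg.1.
Let gi := sg.2.
Let sh := completes_to_simple ex sg.
Let ch := completes_to_claw_heavy ex sg cg.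
Let hs := sh.1.
Let hi := sh.2.
Let gh : subrel g h := completes_to_sub ex.
Let HF := @hfar V g h sg cg ex clh.
Let hpn u v : u != v -> ~~ h u v -> ore_pair g u v = false.
Proof.
move=> uv nh; apply/negP=> /and3P[_ _ d]; have := closed_nohp sh ch clh u v.
by rewrite /ore_pair uv nh (leq_trans d) // leq_add // dg_sub.
Qed.
Let ng u v : ~~ h u v -> ~~ g u v. Proof. by apply: contra; exact: gh. Qed.
Let gn u v : g u v -> u != v. Proof. by apply: contraTneq => ->; rewrite gi. Qed.

Local Notation K a b := (edge_clique h a b).

Ltac ff := solve [ assumption | apply: far_nadj; assumption | apply: (farC sg); assumption
  | apply: far_nadj; apply: (farC sg); assumption | rewrite gs; assumption | apply: (nadjC sg); assumption ].

Lemma KAf A B a b y w : closed_clique h A -> (forall w, w \in A -> w \notin B) -> a \in A -> b \in B -> g a b ->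
  y \in K a b -> y != a -> w \in A -> w != a -> far g y w.
Proof.
by move=> mA dj aA bB gab yK ya wA wa; have [] := KA sg cg ex clh mA dj aA bB (gh gab) yK ya wA wa; exact: HF.
Qed.

Lemma KBf A B a b y w : closed_clique h A -> closed_clique h B -> (forall w, w \in A -> w \notin B) -> a \in A -> b \in B -> g a b ->
  y \in K a b -> y != b -> w \in B -> w != b -> far g y w.
Proof.
by move=> mA mB dj aA bB gab yK ya wA wa; have [] := KB sg cg ex clh mA mB dj aA bB (gh gab) yK ya wA wa; exact: HF.
Qed.

(* Two nonadjacent neighbours s, s' of a that form a claw at a together with
   some b far from both have many common neighbours. *)
Lemma many_common_neighbours a b s s' (O : seq V) : g a b -> g a s -> g a s' -> s != s' -> ~~ g s s' ->
  s != b -> ~~ h s b -> s' != b -> ~~ h s' b -> uniq O ->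
  (forall o, o \in O -> far g s o /\ far g s' o) -> 2 + size O <= #|nb g s :&: nb g s'|.
Proof.
move=> ab as_ as' ss nss sb nsb s'b ns'b uO hO.
have := cg as_ as' ab ss sb s'b nss (ng nsb) (ng ns'b); rewrite (hpn sb nsb) (hpn s'b ns'b) !orbF => /and3P[_ _ d].
have := @ore_pair_common _ g s s' [set o in O] sg ss nss d; rewrite cardsE (card_uniqP uO); apply=> o.
by rewrite inE => /hO[[h1 h2 _] [h3 h4 _]]; rewrite !(eq_sym o).
Qed.

Lemma in_nb v w : (w \in nb g v) = g v w.
Proof. by rewrite inE. Qed.

Lemma pick_out (S : {set V}) (L : seq V) : size L < #|S| -> exists2 w, w \in S & w \notin L.
Proof.
move=> lt; case: (pickP (fun w => (w \in S) && (w \notin L))) => [w /andP[]|no]; first by exists w.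
have sub : {subset enum S <= L}.
  by move=> w; rewrite mem_enum => wS; have := no w; rewrite wS /= => /negbFE.
by have := uniq_leq_size (enum_uniq S) sub; rewrite -cardE leqNgt lt.
Qed.

(** Two candidates outside [L] are available, and [c] is adjacent to at most one of them. *)
Lemma pick_far a b (S : {set V}) (L : seq V) c : g a b -> (forall w, w \in S -> w \in K a b) -> (size L).+1 < #|S| -> c \notin K a b ->
  exists w, [/\ w \in S, w \notin L & far g w c].
Proof.
move=> gab sK lt cK; have [w wS wL] := pick_out (ltnW lt).
have ltw : size (w :: L) < #|S| by [].
have [w' wS' wL'] := pick_out ltw; move: wL'; rewrite in_cons negb_or => /andP[ww wL'].
have ne x : x \in S -> x != c by move/sK=> xK; apply: contraNneq cK => <-.
by case: (K_out sg cg ex clh (gh gab) cK (sK _ wS') (sK _ wS) ww) => n; [exists w'|exists w]; split=> //; apply: HF => //; exact: ne.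
Qed.

Section Half.
Variables (A B : {set V}) (a1 b1 c1 a2 b2 c2 a3 b3 : V) (X3 : seq V).
Hypotheses (mA : closed_clique h A) (mB : closed_clique h B) (dj : forall w, w \in A -> w \notin B)
  (T1 : triangle_conn g h A B a1 b1 c1) (T2 : triangle_conn g h A B a2 b2 c2) (a3A : a3 \in A) (b3B : b3 \in B)
  (a12 : a1 != a2) (b12 : b1 != b2) (a13 : a1 != a3) (a23 : a2 != a3) (b13 : b1 != b3) (b23 : b2 != b3)
  (g12 : g b1 b2) (g13 : g b1 b3) (g23 : g b2 b3)
  (c2K : c2 \notin K a1 b1) (b2K : b2 \notin K a1 b1) (c1K : c1 \notin K a2 b2) (b1K : b1 \notin K a2 b2)
  (X2 : size X3 <= 2) (Xg : forall x x', x \in X3 -> x' \in X3 -> x != x' -> g x x')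
  (Xb : forall e, e \in A -> e \notin X3 -> ~~ h e b3) (X1n : a1 \notin X3) (X2n : a2 \notin X3).

Lemma A_gt2 : 2 < #|A|.
Proof.
have [aA _ _ _] := T1; have [aA2 _ _ _] := T2.
by apply/card_gt2P; exists a1, a2, a3; split; split=> //; rewrite eq_sym.
Qed.

(** Adjacent [s] and [s'] would give a [Z_3] on the triangle [a1 s s'] with path [a1 b1 b2 y].
    Nonadjacent ones form a heavy pair by the claw at [a1], and [b1], [b2], [c1], [c2] raise the
    number of their common neighbours to six; a common neighbour [w] then gives a [Z_3] on
    [b1 b2 b3] with path [b1 a1 e w]. [X3] lists the vertices of [A] that may be adjacent to [b3]:
    it is [a3], or, with the roles of [A] and [B] exchanged, an end and an inner vertex of the third
    connector. *)
Lemma half1 s s' : s \in A -> s' \in A -> g a1 s -> g a1 s' -> s != a2 -> s' != a2 -> s = s'.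
Proof.
have [A1 B1 gab1 [cK1 ca1 cb1 K1]] := T1; have [A2 B2 gab2 [cK2 ca2 cb2 K2]] := T2.
have ab1 : a1 != b1 := gn gab1. have ab2 : a2 != b2 := gn gab2.
have ba1 : b1 != a1 by rewrite eq_sym. have ba2 : b2 != a2 by rewrite eq_sym.
have K1f y w := @KAf A B a1 b1 y w mA dj A1 B1 gab1. have K2f y w := @KAf A B a2 b2 y w mA dj A2 B2 gab2.
have bK1 := bK h a1 b1; have bK2 := bK h a2 b2.
have [y [yK ya yb by_]] := mc_nb ex sg (mcK sg cg ex clh (gh gab2)) K2 bK2 ba2.
have fy : far g y b1 by apply: (KBf mA mB dj A2 B2 gab2).
have fb2a1 : far g b2 a1 by exact: K2f. have fya1 : far g y a1 by exact: K2f.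
have indep t t' : t \in A -> t' \in A -> g a1 t -> g a1 t' -> t != a2 -> t' != a2 -> ~~ g t t'.
  move=> tA tA' at_ at' t2 t2'; apply/negP=> tt.
  have ta : t != a1 by rewrite eq_sym gn. have ta' : t' != a1 by rewrite eq_sym gn.
  have f1 : far g b1 t by exact: K1f. have f2 : far g b1 t' by exact: K1f.
  have f3 : far g b2 t by exact: K2f. have f4 : far g b2 t' by exact: K2f.
  have f5 : far g y t by exact: K2f. have f6 : far g y t' by exact: K2f.
  apply: (Z3_absurd Phi at_ at' tt gab1 g12 by_); ff.
move=> sA sA' as_ as' s2 s2'; apply/eqP/negPn/negP=> ss; have nss := indep s s' sA sA' as_ as' s2 s2'.
have sa : s != a1 by rewrite eq_sym gn. have sa' : s' != a1 by rewrite eq_sym gn.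
have [q1 q2] := KA sg cg ex clh mA dj A1 B1 (gh gab1) bK1 ba1 sA sa.
have [q3 q4] := KA sg cg ex clh mA dj A1 B1 (gh gab1) bK1 ba1 sA' sa'.
have uO : uniq [:: b1; b2; c1; c2].
  rewrite /= !inE !negb_or b12 (eq_sym b1 c1) cb1 (eq_sym b2 c2) cb2 !andbT /=.
  by apply/and3P; split; [apply: contraNneq c2K => <-|apply: contraNneq b2K => ->|apply: contraNneq c2K => <-].
have hO o : o \in [:: b1; b2; c1; c2] -> far g s o /\ far g s' o.
  by rewrite !inE => /or4P[]/eqP->; split; apply: (farC sg); first [exact: K1f|exact: K2f].
have := @many_common_neighbours a1 b1 s s' _ gab1 as_ as' ss nss _ _ _ _ uO hO; rewrite !(eq_sym _ b1) q1 q3 ![h _ b1]hs q2 q4 => /(_ isT isT isT isT) c6.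
have lt : size [:: a1, a2 & X3] < #|nb g s :&: nb g s'| by apply: leq_trans c6; rewrite /= !ltnS; apply: leq_trans X2 _.
have [w] := pick_out lt; rewrite !inE !negb_or => /andP[sw sw'] /and3P[wa1 wa2 wX].
have wA : w \in A by apply: (mc_in mA sA sA' ss); rewrite hs; exact: gh.
(* Vertices of [X3] are pairwise adjacent, so one of the nonadjacent [s] and [s'] is outside. *)
have [e [eA ea1 ea2 eX ew]] : exists e, [/\ e \in A, g a1 e, e != a2, e \notin X3 & g e w].
  case: (boolP (s \in X3)) => sX; last by exists s.
  by exists s'; split=> //; apply: contra nss => sX'; exact: Xg.
have ea : e != a1 by rewrite eq_sym gn.
have naw : nadj g a1 w.
  by split; rewrite 1?eq_sym //; apply: contraTN ew => aw; exact: indep.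
have dn z : z \in A -> z != b3 by move=> zA; apply: contraTneq b3B => <-; exact: dj.
have f1 : far g b1 e by exact: K1f. have f2 : far g b1 w by exact: K1f.
have f3 : far g b2 e by exact: K2f. have f4 : far g b2 w by exact: K2f.
have f5 : far g a1 b3 by apply: HF; [exact: dn|exact: Xb].
have f6 : far g e b3 by apply: HF; [exact: dn|exact: Xb].
have f7 : far g w b3 by apply: HF; [exact: dn|exact: Xb].
have gba : g b1 a1 by rewrite gs.
apply: (Z3_absurd Phi g12 g13 g23 gba ea1 ew); ff.
Qed.

End Half.

(** By [half1] each of [a1] and [a2] has at most one further neighbour in [A]; both have the same
    one, and [mc_pair] leaves no other vertex. *)
Lemma half A B a1 b1 c1 a2 b2 c2 a3 b3 (X3 : seq V) : closed_clique h A -> closed_clique h B -> (forall w, w \in A -> w \notin B) ->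
  triangle_conn g h A B a1 b1 c1 -> triangle_conn g h A B a2 b2 c2 -> a3 \in A -> b3 \in B ->
  [/\ a1 != a2, a1 != a3 & a2 != a3] -> [/\ b1 != b2, b1 != b3 & b2 != b3] ->
  [/\ g b1 b2, g b1 b3 & g b2 b3] ->
  [/\ c2 \notin K a1 b1, b2 \notin K a1 b1, c1 \notin K a2 b2 & b1 \notin K a2 b2] ->
  size X3 <= 2 -> (forall x x', x \in X3 -> x' \in X3 -> x != x' -> g x x') ->
  (forall e, e \in A -> e \notin X3 -> ~~ h e b3) -> a1 \notin X3 -> a2 \notin X3 ->
  (forall z, z \in A -> [\/ z = a1, z = a2 | z = a3]) /\ [/\ g a1 a2, g a1 a3 & g a2 a3].
Proof.
move=> mA mB dj T1 T2 a3A b3B [a12 a13 a23] [b12 b13 b23] [g12 g13 g23] [n1 n2 n3 n4] X2 Xg Xb X1n X2n.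
have cA := A_gt2 T1 T2 a3A a12 a13 a23.
have [A1 B1 gab1 [cK1 ca1 cb1 K1]] := T1; have [A2 B2 gab2 [cK2 ca2 cb2 K2]] := T2.
have a21 : a2 != a1 by rewrite eq_sym. have b21 : b2 != b1 by rewrite eq_sym.
have g21 : g b2 b1 by rewrite gs.
have U1 s s' := @half1 A B a1 b1 c1 a2 b2 c2 b3 X3 mA mB dj T1 T2 b3B a12 b12 g12 g13 g23 n1 n2 X2 Xg Xb X1n s s'.
have U2 s s' := @half1 A B a2 b2 c2 a1 b1 c1 b3 X3 mA mB dj T2 T1 b3B a21 b21 g21 g23 g13 n3 n4 X2 Xg Xb X2n s s'.
have [s [sA s2 s1 as_]] := mc_nb ex sg mA cA A1 a12.
have [s' [sA' s2' s1' as']] := mc_nb ex sg mA cA A2 a21.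
have [w [wA ws wa aw]] := mc_nb ex sg mA cA A1 (c := s) (gn as_).
have ew : w = a2.
  by apply/eqP/negPn/negP=> w2; case/eqP: ws; exact: U1.
rewrite {w wA ws wa}ew in aw.
have bK1 := bK h a1 b1; have ba1 : b1 != a1 by rewrite eq_sym gn.
have [q1 q2] := KA sg cg ex clh mA dj A1 B1 (gh gab1) bK1 ba1 sA s1.
have [q3 q4] := KA sg cg ex clh mA dj A1 B1 (gh gab1) bK1 ba1 A2 a21.
(* Nonadjacent [a2] and [s] would have three common neighbours, one of which contradicts [half1] at
   [a2]. *)
have a2s : g a2 s.
  rewrite gs; apply/negPn/negP=> n.
  have hO o : o \in [:: b1] -> far g s o /\ far g a2 o.
    by rewrite inE => /eqP->; split; apply: HF; rewrite 1?eq_sym // hs.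
  have := @many_common_neighbours a1 b1 s a2 [:: b1] gab1 as_ aw s2 n; rewrite !(eq_sym _ b1) ![h _ b1]hs q1 q2 q3 q4 => /(_ isT isT isT isT isT hO) c3.
  have lt : size [:: a1; s'] < #|nb g s :&: nb g a2| by [].
  have [t] := pick_out lt; rewrite !inE negb_or => /andP[three_conns at_] /andP[t1 ts].
  have tA : t \in A by apply: (mc_in mA sA A2 s2); rewrite hs; exact: gh.
  by case/eqP: ts; exact: U2.
have es : s' = s by exact: U2.
have H : forall z, z \in A -> [\/ z = a1, z = a2 | z = s].
  apply: (mc_pair ex sg mA A1 A2 s1 s2) => z zA az.
    by have [->|z2] := eqVneq z a2; [left|right; exact: U1].
  by have [->|z1] := eqVneq z a1; [left|right; exact: U2].
have e3 : a3 = s by case: (H a3 a3A) => e //; rewrite e eqxx in a13 a23.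
by rewrite e3.
Qed.

(** The scheme of [half1] inside the clique of [a1 b1]. Two adjacent neighbours of [a1] give a [Z_3]
    with path [a1 a2 b2 b3], two nonadjacent ones a [Z_3] on [a2 b2 y] with path [a2 a1 e w]. So
    [a1] has a single neighbour there besides [b1], and [pendant_dichotomy] applies with [A] and [B]
    exchanged. *)
Lemma K_exact A B a1 b1 c1 a2 b2 c2 a3 b3 y : closed_clique h A -> closed_clique h B -> (forall w, w \in A -> w \notin B) ->
  triangle_conn g h A B a1 b1 c1 -> triangle_conn g h A B a2 b2 c2 -> a3 \in A -> b3 \in B ->
  [/\ a1 != a2, a1 != a3 & a2 != a3] -> [/\ b1 != b2, b1 != b3 & b2 != b3] ->
  [/\ g b1 b2, g b1 b3 & g b2 b3] -> [/\ g a1 a2, g a1 a3 & g a2 a3] ->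
  ~~ h a1 b3 -> ~~ h a2 b3 -> y \in K a2 b2 -> g a2 y -> g b2 y -> y \notin K a1 b1 ->
  forall z, z \in K a1 b1 -> [\/ z = a1, z = b1 | z = c1].
Proof.
move=> mA mB dj T1 T2 a3A b3B [a12 a13 a23] [b12 b13 b23] [g12 g13 g23] [e12 e13 e23] nab13 nab23 yK ay by_ yn.
have [A1 B1 gab1 [cK1 ca1 cb1 K1]] := T1; have [A2 B2 gab2 [cK2 ca2 cb2 K2]] := T2.
have dj' w : w \in B -> w \notin A by apply: contraL; exact: dj.
have ab1 : a1 != b1 := gn gab1. have ab2 : a2 != b2 := gn gab2.
have ba1 : b1 != a1 by rewrite eq_sym. have ba2 : b2 != a2 by rewrite eq_sym.
have a21 : a2 != a1 by rewrite eq_sym. have b21 : b2 != b1 by rewrite eq_sym.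
have a31 : a3 != a1 by rewrite eq_sym. have b31 : b3 != b1 by rewrite eq_sym.
have K1A t w := @KAf A B a1 b1 t w mA dj A1 B1 gab1. have K2A t w := @KAf A B a2 b2 t w mA dj A2 B2 gab2.
have K1B t w := @KBf A B a1 b1 t w mA mB dj A1 B1 gab1. have K2B t w := @KBf A B a2 b2 t w mA mB dj A2 B2 gab2.
have aK1 := aK h a1 b1; have aK2 := aK h a2 b2; have bK1 := bK h a1 b1; have bK2 := bK h a2 b2.
have ya : y != a2 by rewrite eq_sym gn.
have dn u v : u \in A -> v \in B -> u != v by move=> uA vB; apply: contraTneq vB => <-; exact: dj.
have f1 : far g a1 b2 by exact: K1B. have f2 : far g a1 b3 by apply: HF => //; exact: dn.
have f3 : far g a2 b3 by apply: HF => //; exact: dn.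
have f4 : far g b2 a1 by exact: K2A. have f5 : far g y a1 by exact: K2A.
have indep t t' : t \in K a1 b1 -> t' \in K a1 b1 -> g a1 t -> g a1 t' -> t != b1 -> t' != b1 -> ~~ g t t'.
  move=> tK tK' at_ at' tb tb'; apply/negP=> tt.
  have ta : t != a1 by rewrite eq_sym gn. have ta' : t' != a1 by rewrite eq_sym gn.
  have p1 : far g t a2 by exact: K1A. have p2 : far g t' a2 by exact: K1A.
  have p3 : far g t b2 by exact: K1B. have p4 : far g t' b2 by exact: K1B.
  have p5 : far g t b3 by exact: K1B. have p6 : far g t' b3 by exact: K1B.
  apply: (Z3_absurd Phi at_ at' tt e12 gab2 g23); ff.
have uni s s' : s \in K a1 b1 -> s' \in K a1 b1 -> g a1 s -> g a1 s' -> s != b1 -> s' != b1 -> s = s'.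
  move=> sK sK' as_ as' sb sb'; apply/eqP/negPn/negP=> ss; have nss := indep s s' sK sK' as_ as' sb sb'.
  have sa : s != a1 by rewrite eq_sym gn. have sa' : s' != a1 by rewrite eq_sym gn.
  have [q1 q2] := KA sg cg ex clh mA dj A1 B1 (gh gab1) sK sa A2 a21.
  have [q3 q4] := KA sg cg ex clh mA dj A1 B1 (gh gab1) sK' sa' A2 a21.
  have uO : uniq [:: a2; a3; b2; b3].
    by rewrite /= !inE !negb_or a23 b23 !dn.
  have hO o : o \in [:: a2; a3; b2; b3] -> far g s o /\ far g s' o.
    by rewrite !inE => /or4P[]/eqP->; split; first [exact: K1A|exact: K1B].
  have c6 := many_common_neighbours e12 as_ as' ss nss q1 q2 q3 q4 uO hO.
  have sK0 w : w \in nb g s :&: nb g s' -> w \in K a1 b1.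
    by rewrite in_setI !in_nb => /andP[sw sw']; exact: (K_common sg cg ex clh (gh gab1) sK sK' ss sw sw').
  have [|w [wS]] := @pick_far a1 b1 (nb g s :&: nb g s') [:: a1; b1] y gab1 sK0 _ yn; first by apply: leq_trans c6.
  have wK := sK0 w wS; move: wS; rewrite in_setI !in_nb !inE negb_or => /andP[sw sw'] /andP[wa wb] fwy.
  have [e [eK ae eb ew fey]] : exists e, [/\ e \in K a1 b1, g a1 e, e != b1, g e w & far g e y].
    have ne x : x \in K a1 b1 -> x != y by move=> xK; apply: contraNneq yn => <-.
    case: (K_out sg cg ex clh (gh gab1) yn sK sK' ss) => n; [exists s|exists s']; split=> //; apply: HF => //; exact: ne.
  have ea : e != a1 by rewrite eq_sym gn.
  have naw : nadj g a1 w.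
    by split; rewrite 1?eq_sym //; apply: contraTN ew => aw; apply: indep.
  have e21 : g a2 a1 by rewrite gs.
  have p1 : far g e a2 by exact: K1A. have p2 : far g w a2 by exact: K1A.
  have p3 : far g e b2 by exact: K1B. have p4 : far g w b2 by exact: K1B.
  apply: (Z3_absurd Phi gab2 ay by_ e21 ae ew); ff.
have cB : 2 < #|B| by apply/card_gt2P; exists b1, b2, b3; split; split=> //; rewrite eq_sym.
have hba : h b1 a1 by rewrite hs; exact: gh.
have gba : g b1 a1 by rewrite gs.
have [w [wK wb wa aw]] := mc_nb ex sg (mcK sg cg ex clh (gh gab1)) K1 aK1 ab1.
have H : forall z, z \in K b1 a1 -> [\/ z = b1, z = a1 | z = w].
  apply: (pendant_dichotomy sg cg ex clh mB mA dj' B1 A1 gba cB); first by rewrite edge_cliqueC.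
  by move=> z; rewrite edge_cliqueC => zK zb az; exact: uni.
have ec : c1 = w by case: (H c1) => [|e|e|//]; [rewrite edge_cliqueC|rewrite e eqxx in cb1|rewrite e eqxx in ca1].
by move=> z; rewrite edge_cliqueC ec => /H[]; [constructor 2|constructor 1|constructor 3].
Qed.

(** The same scheme at the head of a path [a3 m3 b3]. Adjacent [s] and [m3] give a [Z_3] with path
    [a3 a1 b1 b2], nonadjacent ones a [Z_3] on [a1 b1 c1] with path [a1 a3 m3 w]. *)
Lemma P3_exact A B a1 b1 c1 a2 b2 a3 m3 b3 : closed_clique h A -> closed_clique h B -> (forall w, w \in A -> w \notin B) ->
  a1 \in A -> a2 \in A -> a3 \in A -> b1 \in B -> b2 \in B -> g a1 b1 -> g a2 b2 ->
  [/\ a1 != a2, a1 != a3 & a2 != a3] -> [/\ b1 != b2, b1 != b3 & b2 != b3] ->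
  g b1 b2 -> [/\ g a1 a2, g a1 a3 & g a2 a3] ->
  (forall z, z \in A -> [\/ z = a1, z = a2 | z = a3]) -> (forall z, z \in B -> [\/ z = b1, z = b2 | z = b3]) ->
  (forall z, z \in K a1 b1 -> [\/ z = a1, z = b1 | z = c1]) -> c1 \in K a1 b1 -> c1 != a1 -> g a1 c1 -> g b1 c1 ->
  (forall z, h b2 z -> z \in B \/ z \notin K a3 m3) ->
  g a3 m3 -> nadj g a3 b3 -> m3 \notin A ->
  [/\ far g m3 a1, far g m3 a2, far g m3 b1, far g m3 b2 & far g m3 c1] -> ~~ h m3 a1 -> m3 != a1 -> ~~ h m3 b1 -> ~~ h m3 b2 ->
  (forall z, h a3 z -> [\/ z = a1, z = a2 | z = m3]) /\ (forall z, z \in K a3 m3 -> z = a3 \/ z = m3).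
Proof.
move=> mA mB dj A1 A2 A3 B1 B2 gab1 gab2 [a12 a13 a23] [b12 b13 b23] g12 [e12 e13 e23] exA exB exK1 cK1 ca1 ac1 bc1 exK2.
move=> gam nab mA' [fm1 fm2 fm3 fm4 fm5] nm1 ma1 nmb1 nmb2.
have dj' w : w \in B -> w \notin A by apply: contraL; exact: dj.
have dn u v : u \in A -> v \in B -> u != v by move=> uA vB; apply: contraTneq vB => <-; exact: dj.
have mQ := mcK sg cg ex clh (gh gam); have aQ := aK h a3 m3; have mQ' := bK h a3 m3.
have [_ cQ _] := mQ; have [_ _ HA] := mA.
have am : a3 != m3 := gn gam. have ma : m3 != a3 by rewrite eq_sym.
have ne : A <> K a3 m3 by move=> e; rewrite -e in mQ'; rewrite mQ' in mA'.
have QA z : z \in K a3 m3 -> z != a3 -> z \notin A.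
  by move=> zQ za; apply/negP=> zA; apply: ne; apply: (mc_eq sh mA mQ A3 zA) => //; rewrite eq_sym.
have ba1 : b1 != a1 by rewrite eq_sym gn. have ba2 : b2 != a2 by rewrite eq_sym gn.
have a31 : a3 != a1 by rewrite eq_sym. have a32 : a3 != a2 by rewrite eq_sym.
have b21 : b2 != b1 by rewrite eq_sym.
have fQ z a : z \in K a3 m3 -> z != a3 -> a \in A -> a != a3 -> far g z a.
  move=> zQ za aA aa; apply: HF; first by apply: contraNneq (QA z zQ za) => ->.
  by apply/negP=> hza; case/eqP: aa; apply: (HA z) => //; [exact: QA|apply: cQ].
have fb1a3 : far g b1 a3 by apply: (KAf mA dj A1 B1 gab1) => //; exact: bK.
have fb2a3 : far g b2 a3 by apply: (KAf mA dj A2 B2 gab2) => //; exact: bK.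
have fb2a1 : far g b2 a1 by apply: (KAf mA dj A2 B2 gab2) => //; exact: bK.
have fca3 : far g c1 a3 by apply: (KAf mA dj A1 B1 gab1).
have [_ nca3] := KA sg cg ex clh mA dj A1 B1 (gh gab1) cK1 ca1 A3 a31.
have [_ nba3] := KA sg cg ex clh mA dj A1 B1 (gh gab1) (bK h a1 b1) ba1 A3 a31.
have [_ nba23] := KA sg cg ex clh mA dj A2 B2 (gh gab2) (bK h a2 b2) ba2 A3 a32.
have cQ1 : c1 \notin K a3 m3.
  apply/negP=> cQ1; case/negP: nca3; apply: cQ => //.
  by apply: contraNneq (ca1) => e; have [] := exA a3 A3; case/eqP: ca1; apply/eqP/negPn/negP=> _; move: fca3; rewrite e => -[]; rewrite eqxx.
have b1Q : b1 \notin K a3 m3.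
  by apply/negP=> b1Q; case/negP: nba3; apply: cQ => //; rewrite eq_sym dn.
have b2Q : b2 \notin K a3 m3.
  by apply/negP=> b2Q; case/negP: nba23; apply: cQ => //; rewrite eq_sym dn.
have neB1 : B <> K a1 b1 by move=> e; have := aK h a1 b1; rewrite -e => /(dn _ _ A1); rewrite eqxx.
have fb1 z : z \in K a3 m3 -> z != a3 -> z != b3 -> far g z b1.
  move=> zQ za zb; apply: HF; first by apply: contraNneq b1Q => <-.
  apply/negP; rewrite hs => bz; case: (mc_nb2 sh ch clh mB (mcK sg cg ex clh (gh gab1)) neB1 B1 (bK h a1 b1) bz).
    by move/exB=> [] e; rewrite e ?eqxx // in zb zQ bz; [rewrite hi in bz|rewrite zQ in b2Q].
  move/exK1=> [] e; rewrite e ?hi // in zQ bz za.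
    by have := QA a1 zQ za; rewrite A1.
  by rewrite zQ in cQ1.
have fb2 z : z \in K a3 m3 -> z != a3 -> z != b3 -> far g z b2.
  move=> zQ za zb; apply: HF; first by apply: contraNneq b2Q => <-.
  apply/negP; rewrite hs => bz; case: (exK2 z bz); last by rewrite zQ.
  by move/exB=> [] e; rewrite e ?eqxx // in zb zQ bz; [rewrite zQ in b1Q|rewrite hi in bz].
have mb3 : m3 != b3.
  by apply: contraTneq gam => ->; case: nab.
have ga3a1 : g a3 a1 by rewrite gs.
have gQ s : g a3 s -> s != a1 -> s != a2 -> [/\ s \in K a3 m3, s != a3 & s != b3].
  move=> as_ s1 s2; have sa : s != a3 by rewrite eq_sym gn.
  split=> //; last by apply: contraTneq as_ => ->; case: nab.
  case: (mc_nb2 sh ch clh mA mQ ne A3 aQ (gh as_)) => // /exA[] e; by rewrite e eqxx in s1 s2 sa.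
have indep s : g a3 s -> s != a1 -> s != a2 -> ~~ g s m3.
  move=> as_ s1 s2; have [sQ sa sb] := gQ s as_ s1 s2; apply/negP=> sm.
  have p1 : far g s a1 by exact: fQ. have p2 := fb1 s sQ sa sb; have p3 := fb2 s sQ sa sb.
  apply: (Z3_absurd Phi as_ gam sm ga3a1 gab1 g12); ff.
have uni s : g a3 s -> s != a1 -> s != a2 -> s = m3.
  move=> as_ s1 s2; have [sQ sa sb] := gQ s as_ s1 s2; apply/eqP/negPn/negP=> sm.
  have nsm := indep s as_ s1 s2.
  have [q1 q2] : s != a1 /\ ~~ h s a1.
    split=> //; apply/negP=> hsa; have sA := QA s sQ sa; case/eqP: a13; apply: (HA s) => //; exact: cQ.
  have uO : uniq [:: a1; a2; b1; b2] by rewrite /= !inE !negb_or a12 b12 !dn.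
  have hO o : o \in [:: a1; a2; b1; b2] -> far g s o /\ far g m3 o.
    by rewrite !inE => /or4P[]/eqP->; split=> //; first [exact: fQ|exact: fb1|exact: fb2].
  have c6 := many_common_neighbours ga3a1 as_ gam sm nsm q1 q2 ma1 nm1 uO hO.
  have sK0 w : w \in nb g s :&: nb g m3 -> w \in K a3 m3.
    by rewrite in_setI !in_nb => /andP[sw mw]; exact: (K_common sg cg ex clh (gh gam) sQ mQ' sm sw mw).
  have [|w [wS wL fwc]] := @pick_far a3 m3 (nb g s :&: nb g m3) [:: a3; b3] c1 gam sK0 _ cQ1; first by apply: leq_trans c6.
  have wQ := sK0 w wS; move: wS wL; rewrite in_setI !in_nb => /andP[sw mw].
  rewrite !inE negb_or => /andP[wa wb].
  have w1 : w != a1 by apply: contraTneq mw => ->; case: fm1.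
  have w2 : w != a2 by apply: contraTneq mw => ->; case: fm2.
  have naw : nadj g a3 w.
    by split; rewrite 1?eq_sym //; apply: contraTN mw => aw; rewrite gs; exact: indep.
  have p1 : far g w a1 by exact: fQ. have p2 := fb1 w wQ wa wb.
  apply: (Z3_absurd Phi gab1 ac1 bc1 e13 gam mw); ff.
have Q2 z : z \in K a3 m3 -> z = a3 \/ z = m3.
  have [c2 zQ|c3] := leqP #|K a3 m3| 2; last first.
    have [w [wQ wm wa aw]] := mc_nb ex sg mQ c3 aQ am.
    by case/eqP: wm; apply: uni => //; apply: contraNneq (QA w wQ wa) => ->.
  have [->|za] := eqVneq z a3; [by left|right; apply/eqP/negPn/negP=> zm].
  have : 2 < #|K a3 m3| by apply/card_gt2P; exists a3, m3, z; split; split=> //; rewrite eq_sym.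
  by rewrite ltnNge c2.
split=> // z az; case: (mc_nb2 sh ch clh mA mQ ne A3 aQ az).
  by move/exA=> [->|->|e]; [constructor 1|constructor 2|rewrite e hi in az].
by move/Q2=> [e|->]; [rewrite e hi in az|constructor 3].
Qed.

End Z3.

(** * The case of Z_3: excluding all combinations of connectors *)

Section Z3.
Variables (V : finType) (g h : rel V).
Hypotheses (sg : simple_rel g) (cg : claw_heavy g) (ex : completes_to g h) (clh : closed h) (Phi : Z3_condition g).
Variables (A B : {set V}).
Hypotheses (mA : closed_clique h A) (mB : closed_clique h B) (dj : forall w, w \in A -> w \notin B) (fewB : one_heavy h B).
Implicit Types (u v w x y z d e s t : V) (X K : {set V}) (k l : conn V).
Let gs := sg.1.
Let gi := sg.2.
Let sh := completes_to_simple ex sg.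
Let ch := completes_to_claw_heavy ex sg cg.
Let hs := sh.1.
Let hi := sh.2.
Let gh : subrel g h := completes_to_sub ex.
Let HF := @hfar V g h sg cg ex clh.
Let FC := @far_cross V g h sg cg ex clh A B fewB.
Let dj' w : w \in B -> w \notin A. Proof. by apply: contraL; exact: dj. Qed.
Let gn u v : g u v -> u != v. Proof. by apply: contraTneq => ->; rewrite gi. Qed.
Let dn u v : u \in A -> v \in B -> u != v.
Proof. by move=> uA vB; apply: contraTneq vB => <-; exact: dj. Qed.
Let K1A a b y w : a \in A -> b \in B -> g a b -> y \in edge_clique h a b -> y != a -> w \in A -> w != a -> far g y w.
Proof. by move=> aA bB gab; exact: (KAf sg cg ex clh mA dj aA bB gab). Qed.
Let K1B a b y w : a \in A -> b \in B -> g a b -> y \in edge_clique h a b -> y != b -> w \in B -> w != b -> far g y w.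
Proof. by move=> aA bB gab; exact: (KBf sg cg ex clh mA mB dj aA bB gab). Qed.

Local Notation valid := (@valid V h A B).
Local Notation sep := (@sep V h A B).
Local Notation three_conns := (@three_conns V h A B).
Local Notation K a b := (edge_clique h a b).
Local Notation TTflip := (@triangle_conn V g h B A).
Local Notation triangle_conn := (@triangle_conn V g h A B).

Ltac ff := solve [ assumption | apply: far_nadj; assumption | apply: (farC sg); assumption
  | apply: far_nadj; apply: (farC sg); assumption | rewrite gs; assumption | apply: (nadjC sg); assumption ].

Lemma far_mixed k k' x y : valid g k -> valid g k' -> sep g k k' -> x \in conn_vertices k -> y \in conn_vertices k' ->
  x \notin A \/ y \notin A -> (forall d, x != last d k.1) \/ (forall d, y != last d k'.1) -> far g x y.
Proof.
move=> vk vk' s xk yk nA nl; apply: (FC (d := x) vk vk' s xk yk).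
  by case: nA => n; [rewrite (inA_head x vk xk n)|rewrite (inA_head x vk' yk n) orbT].
by case: nl => ->; rewrite ?orbT.
Qed.

Lemma hc k k' x y : sep g k k' -> x \in conn_vertices k -> y \in conn_vertices k' -> x \notin A \/ y \notin A -> x \notin B \/ y \notin B ->
  x != y /\ ~~ h x y.
Proof.
move=> s xk yk nA nB; have [n1 n2 _] := s x x y xk yk; split=> //; apply/negP=> /n2[][h1 h2].
  by case: nA; rewrite ?h1 ?h2.
by case: nB; rewrite ?h1 ?h2.
Qed.

(** The three last vertices and the three vertices before one of them form a [Z_3]. *)
Lemma long_no k1 k2 k3 : three_conns g k1 k2 k3 -> 3 < size k1.1 -> False.
Proof.
move=> [[v1 v2 v3] [s12 s13 s23] [b12 b13 b23]] s4.
have n1 : size k1.1 != 2 by apply: contraTneq s4 => ->.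
have [p [m' [m [b ek]]]] := val_P v1 n1; rewrite {k1}ek in v1 s12 s13 n1 b12 b13 s4.
case/lastP: p v1 s12 s13 n1 b12 b13 s4 => [|p m''] v1 s12 s13 _ b12 b13 _ //.
have [mnA _ gm bm [mb mb' mm' nmb bnA]] := path_m sg dj v1.
have [ip _ _ _ _] := v1.
have e : rcons (rcons (rcons (rcons p m'') m') m) b = p ++ [:: m''; m'; m; b] by rewrite -!cats1 -!catA.
have ip' : induced_path g [:: m''; m'; m; b] by apply: (@ipath_catr _ _ p); rewrite -e.
have {ip'}[q1 q2 q3 q4] : [/\ g m' m'', nadj g m m'', nadj g b m'' & nadj g b m'].
  move: ip'; rewrite /= /link /= !inE !negb_or !andbT -!andbA => /and5P[h1 h2 h3 h4 /and5P[h5 h6 h7 _ /and3P[_ _ _]]].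
  by rewrite /nadj [g m' _]gs !(eq_sym m) !(eq_sym b) !(gs m) !(gs b) h2 h3 h4 h5 h6 mb' nmb.
set k1 := (_, _) in v1 s12 s13 b12 b13.
have mk : m \in conn_vertices k1 by rewrite /conn_vertices cats0 /= !(mem_rcons, inE) eqxx ?orbT.
have mk' : m' \in conn_vertices k1 by rewrite /conn_vertices cats0 /= !(mem_rcons, inE) eqxx ?orbT.
have mk'' : m'' \in conn_vertices k1 by rewrite /conn_vertices cats0 /= !(mem_rcons, inE) eqxx ?orbT.
have ml d : last d k1.1 = b by rewrite last_rcons.
have [_ k2l _ B2] := val_in b v2; have [_ k3l _ B3] := val_in b v3.
have := b12 b; have := b13 b; have := b23 b; rewrite !ml.
move: (last b k2.1) (last b k3.1) k2l B2 k3l B3 => b2 b3 k2l B2 k3l B3 g23 g13 g12.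
have mb'' : m'' != b by case: q3; rewrite eq_sym.
have F z x l : valid g l -> sep g k1 l -> x \in conn_vertices l -> x \in B -> z \in conn_vertices k1 -> z != b -> far g x z.
  move=> vl s xl xB zl zb; apply: (farC sg); apply: (far_mixed v1 vl s zl xl); first by right; exact: dj'.
  by left=> d; rewrite ml.
have mm : g m m' by rewrite gs.
apply: (Z3_absurd Phi g12 g13 g23 bm mm q1) => //.
- exact: (F m b2 k2). - exact: (F m' b2 k2). - exact: (F m'' b2 k2).
- exact: (F m b3 k3). - exact: (F m' b3 k3). exact: (F m'' b3 k3).
Qed.

Definition path3_conn a m b := [/\ a \in A, b \in B, g a m /\ g m b, nadj g a b &
  [/\ m \notin A, m != b & m \in B -> forall w, h b w -> w \in B]].

Lemma val_3 k : valid g k -> size k.1 = 3 -> exists a m b, k = ([:: a; m; b], [::]) /\ path3_conn a m b.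
Proof.
move=> vk s3; have n2 : size k.1 != 2 by rewrite s3.
have [p [m' [m [b ek]]]] := val_P vk n2; rewrite {k}ek in vk s3 n2 *.
case: p vk s3 {n2} => [|? ?] vk s3; last by move: s3; rewrite /= !size_rcons.
have [mnA _ gm bm [mb mb' mm' nmb bnA]] := path_m sg dj vk.
have [_ _ /(_ b)[/= aA bB] _ [_ kB]] := vk.
exists m', m, b; split=> //; split=> //; first by rewrite [g m b]gs.
split=> // mB'; have mk : m \in conn_vertices ([:: m'; m; b], [::]) by rewrite !inE eqxx orbT.
by case: (kB b m mk mB') => /= [e|[]//]; rewrite e eqxx in mb.
Qed.

(** If [m] lies in [B], so do all neighbours of [b]. Otherwise claw-freeness at [b] on [e], [m] and
    the last vertex of [l] joins [e] to [m], whose only neighbour in [A] is [a]. *)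
Lemma A_nb3 a m b l : valid g ([:: a; m; b], [::]) -> path3_conn a m b -> valid g l -> sep g ([:: a; m; b], [::]) l -> last_adjacent g ([:: a; m; b], [::]) l ->
  forall e, e \in A -> h b e -> e = a.
Proof.
move=> vk [aA bB [gam gmb] nab [mA' mb HB]] vl s bl e eA be.
case: (boolP (m \in B)) => mB'; first by have := dj eA; rewrite (HB mB' e be).
have [_ l1 _ B1] := val_in a vl; have gbb := bl a; rewrite /= in gbb.
have mk : m \in conn_vertices ([:: a; m; b], [::]) by rewrite !inE eqxx orbT.
have [q1 q2] := hc s mk l1 (or_introl mA') (or_introl mB').
have [_ _ HB'] := mB; have [_ _ HA] := mA.
have eb : e != last a l.1 := dn eA B1.
have neb : ~~ h e (last a l.1).
  apply/negP=> eb'; have := HB' e b (last a l.1) (dj eA) bB B1; rewrite hs be eb' => /(_ isT isT) eq.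
  by have := gn gbb; rewrite eq eqxx.
have em : e != m by apply: contraNneq mA' => <-.
have hbm : h b m by rewrite hs; exact: gh.
have := closed_clawfree sh ch clh be hbm (gh gbb) em eb q1.
rewrite (negbTE neb) (negbTE q2) !orbF => hem.
by apply: (HA m) => //; rewrite hs //; exact: gh.
Qed.

Lemma A_nb k l : valid g k -> size k.1 <= 3 -> valid g l -> sep g k l -> last_adjacent g k l ->
  forall d e, e \in A -> h (last d k.1) e -> e = head d k.1.
Proof.
move=> vk s3 vl s bl d e eA be; have [s2|s2] := eqVneq (size k.1) 2.
  have [a [b [c [ek [aA bB gab _]]]]] := val_TT sg ex vk s2; rewrite ek /= in be *.
  apply/eqP/negPn/negP=> ea; have ba : b != a by rewrite eq_sym gn.
  by have [_] := KA sg cg ex clh mA dj aA bB (gh gab) (bK h a b) ba eA ea; rewrite be.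
have s3' : size k.1 = 3 by have [_ sz _ _ _] := vk; move: sz s3 s2; clear; lia.
have [a [m [b [ek P]]]] := val_3 vk s3'; rewrite ek /= in vk s bl be *.
exact: (A_nb3 vk P vl s bl).
Qed.

(* With k1 on three vertices, the pattern b1; b3, b2; m1, a1, e is forced to end in e = a2. *)
Lemma two_paths1 k1 k2 k3 d : three_conns g k1 k2 k3 -> size k1.1 = 3 -> size k2.1 = 3 -> size k3.1 <= 3 -> heavy_in g (last d k2.1).
Proof.
move=> S s1 s2 s3; have [cA cB] := A_B_gt2 mA S.
have [[v1 v2 v3] [s12 s13 s23] [b12 b13 b23]] := S.
have s21 := sep_sym sh sg s12; have s31 := sep_sym sh sg s13; have b21 := bb_sym sg b12; have b31 := bb_sym sg b13.
have [a1 [m1 [b1 [ek1 P1]]]] := val_3 v1 s1; have [a2 [m2 [b2 [ek2 P2]]]] := val_3 v2 s2.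
have N3 : forall e, e \in A -> h (last d k3.1) e -> e = head d k3.1 by exact: (A_nb v3 s3 v1 s31 b31).
have [k3h k3l A3 B3] := val_in d v3; have g13 := b13 d; have g23 := b23 d.
clear S b31 s31 s1 s2; subst k1 k2; rewrite /= in g13 g23 *.
move: (last d k3.1) (head d k3.1) k3h k3l A3 B3 N3 g13 g23 => b3 a3 k3h k3l A3 B3 N3 g13 g23.
have [A1 B1 [gam1 gmb1] nab1 [mA1 mb1 HB1]] := P1; have [A2 B2 [gam2 gmb2] nab2 [mA2 mb2 HB2]] := P2.
have ak1 : a1 \in conn_vertices ([:: a1; m1; b1], [::]) by rewrite mem_head.
have mk1 : m1 \in conn_vertices ([:: a1; m1; b1], [::]) by rewrite !inE eqxx orbT.
have ak2 : a2 \in conn_vertices ([:: a2; m2; b2], [::]) by rewrite mem_head.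
have bk2 : b2 \in conn_vertices ([:: a2; m2; b2], [::]) by rewrite !inE eqxx !orbT.
have [a13 _ _] := s13 a1 a1 a3 ak1 k3h.
have [e [eA e3 e1 ae]] := mc_nb ex sg mA cA A1 a13.
have Nb1 := A_nb3 v1 P1 v2 s12 b12.
have Nb2 := A_nb3 v2 P2 v1 s21 b21.
have ab1 : a1 != b1 := dn A1 B1.
have f1 : far g b1 e by apply: HF; [rewrite eq_sym dn|apply/negP=> /(Nb1 e eA) E; rewrite E eqxx in e1].
have [_ _ HA] := mA.
have f2 : nadj g m1 e.
  split; first by apply: contraNneq mA1 => ->.
  apply/negP=> me; case/eqP: e1; apply: (HA m1) => //; first exact: gh.
  by rewrite hs; exact: gh.
have F x y l : valid g l -> sep g ([:: a1; m1; b1], [::]) l -> x \in conn_vertices l -> x \in B -> y \in conn_vertices ([:: a1; m1; b1], [::]) -> y != b1 -> far g x y.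
  move=> vl s xl xB yl yb; apply: (farC sg); apply: (far_mixed v1 vl s yl xl); [by right; exact: dj'|by left].
have p1 : far g b3 m1 by apply: (F _ _ k3). have p2 : far g b3 a1 by apply: (F _ _ k3).
have p3 : far g b2 m1 by apply: (F _ _ _ v2 s12). have p4 : far g b2 a1 by apply: (F _ _ _ v2 s12).
have p5 : far g b3 e by apply: HF; [rewrite eq_sym dn|apply/negP=> /(N3 e eA) E; rewrite E eqxx in e3].
have g12 : g b1 b2 := b12 d.
have g32 : g b3 b2 by rewrite gs.
have gbm : g b1 m1 by rewrite gs. have gma : g m1 a1 by rewrite gs.
have nba : nadj g b1 a1 by exact: (nadjC sg).
have [ee|ne] := eqVneq e a2.
  have nb2 : nadj g b2 e by rewrite ee; exact: (nadjC sg).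
  by case/andP: (Z3_two_heavy Phi g13 g12 g32 gbm gma ae nba (far_nadj f1) f2 p1 p2 p5 p3 p4 nb2).
have p6 : far g b2 e by apply: HF; [rewrite eq_sym dn|apply/negP=> /(Nb2 e eA) E; rewrite E eqxx in ne].
by case: (Z3_absurd Phi g13 g12 g32 gbm gma ae nba (far_nadj f1) f2 p1 p2 p5 p3 p4 p6).
Qed.

(** [two_paths1] and its mirror image make two vertices of [B] heavy. *)
Lemma two_paths k1 k2 k3 : three_conns g k1 k2 k3 -> size k1.1 = 3 -> size k2.1 = 3 -> size k3.1 <= 3 -> False.
Proof.
move=> S s1 s2 s3; have [[v1 v2 v3] [s12 _ _] _] := S.
have [d _] : exists d : V, true by case: mA => /card_gt1P[d _]; exists d.
have h2 := two_paths1 d S s1 s2 s3; have h1 := two_paths1 d (st_perm12 sh sg S) s2 s1 s3.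
have [_ l1 _ B1] := val_in d v1; have [_ l2 _ B2] := val_in d v2.
have [n _ _] := s12 d _ _ l1 l2; case/eqP: n; apply: fewB => //; exact: heavy_in_sub gh _.
Qed.

Definition real_triangle a b := exists y, [/\ y \in K a b, g a y & g b y].

(** The claws at both ends of a virtual triangle produce heavy pairs. Their common neighbours supply
    [y] and [z] in the clique of [a1 b1], both far from the vertex [c] of the real triangle, and
    [a2 b2 c] with the path [b2 b1 y z] is a [Z_3]. *)
Lemma virtual_no a1 b1 c1 a2 b2 c2 : 2 < #|A| -> 2 < #|B| -> valid g ([:: a1; b1], [:: c1]) -> triangle_conn a1 b1 c1 ->
  valid g ([:: a2; b2], [:: c2]) -> sep g ([:: a1; b1], [:: c1]) ([:: a2; b2], [:: c2]) -> triangle_conn a2 b2 c2 -> g b1 b2 ->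
  (forall y, y \in K a1 b1 -> g a1 y -> ~~ g b1 y) -> real_triangle a2 b2 -> False.
Proof.
move=> cA cB v1 T1 v2 s T2 g12 vt [c [cK ac bc]].
have cK1 := KK_not sg cg ex clh mA dj v1 T1 v2 s T2 cK.
have [A1 B1 gab1 [zK1 za1 zb1 K3]] := T1; have [A2 B2 gab2 _] := T2.
have mK := mcK sg cg ex clh (gh gab1).
have ab1 := gn gab1; have ba1 : b1 != a1 by rewrite eq_sym.
have [a12 _ _] := s a1 a1 a2 (mem_head _ _) (mem_head _ _).
have [b12 _ _] := s a1 b1 b2 (vs2 _ _ _) (vs2 _ _ _).
have a21 : a2 != a1 by rewrite eq_sym. have b21 : b2 != b1 by rewrite eq_sym.
have aK1 := aK h a1 b1; have bK1 := bK h a1 b1; have aK2 := aK h a2 b2; have bK2 := bK h a2 b2.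
have [e [eA eb ea ae]] := mc_nb ex sg mA cA A1 ab1.
have [z0 [zK0 zb0 za0 az0]] := mc_nb ex sg mK K3 aK1 ab1.
have nbz0 : ~~ g b1 z0 by exact: vt.
have bz0 : b1 != z0 by rewrite eq_sym.
have [q1 q2] := KA sg cg ex clh mA dj A1 B1 (gh gab1) bK1 ba1 eA ea.
have [q3 q4] := KA sg cg ex clh mA dj A1 B1 (gh gab1) zK0 za0 eA ea.
have hO o : o \in [:: a2] -> far g b1 o /\ far g z0 o.
  by rewrite inE => /eqP->; split; apply: (K1A A1 B1 gab1).
have c3 := many_common_neighbours sg cg ex clh ae gab1 az0 bz0 nbz0 q1 q2 q3 q4 (isT : uniq [:: a2]) hO.
have SK w : w \in nb g b1 :&: nb g z0 -> w \in K a1 b1.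
  by rewrite in_setI !in_nb => /andP[h1 h2]; exact: (K_common sg cg ex clh (gh gab1) bK1 zK0 bz0 h1 h2).
have [y [yS yL fyc]] := pick_far sg cg ex clh (L := [:: a1]) gab1 SK c3 cK1.
have yK := SK y yS; move: yS yL; rewrite in_setI !in_nb inE => /andP[by_ z0y] ya.
have yb : y != b1 by rewrite eq_sym gn.
have nay : ~~ g a1 y by apply: contraL by_; exact: vt.
have ay : a1 != y by rewrite eq_sym.
have gba1 : g b1 a1 by rewrite gs.
have [r1 r2] := KB sg cg ex clh mA mB dj A1 B1 (gh gab1) aK1 ab1 B2 b21.
have [r3 r4] := KB sg cg ex clh mA mB dj A1 B1 (gh gab1) yK yb B2 b21.
have hO' o : o \in [:: b2] -> far g a1 o /\ far g y o.
  by rewrite inE => /eqP->; split; exact: HF.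
have c3' := many_common_neighbours sg cg ex clh g12 gba1 by_ ay nay r1 r2 r3 r4 (isT : uniq [:: b2]) hO'.
have SK' w : w \in nb g a1 :&: nb g y -> w \in K a1 b1.
  by rewrite in_setI !in_nb => /andP[h1 h2]; exact: (K_common sg cg ex clh (gh gab1) aK1 yK ay h1 h2).
have [z [zS zL fzc]] := pick_far sg cg ex clh (L := [:: b1]) gab1 SK' c3' cK1.
have zK := SK' z zS; move: zS zL; rewrite in_setI !in_nb inE => /andP[az yz] zb.
have za : z != a1 by rewrite eq_sym gn.
have nbz : nadj g b1 z by split; [rewrite eq_sym|exact: vt].
have p1 : far g y b2 by exact: HF.
have p2 : far g z b2 by apply: (K1B A1 B1 gab1).
have p3 : far g b1 a2 by apply: (K1A A1 B1 gab1).
have p4 : far g y a2 by apply: (K1A A1 B1 gab1).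
have p5 : far g z a2 by apply: (K1A A1 B1 gab1).
have cb : c != b2 by rewrite eq_sym gn.
have p6 : far g c b1 by apply: (K1B A2 B2 gab2).
have gba2 : g b2 a2 by rewrite gs. have g21 : g b2 b1 by rewrite gs.
apply: (Z3_absurd Phi gba2 bc ac g21 by_ yz); ff.
Qed.

Lemma real_two a1 b1 c1 a2 b2 c2 : 2 < #|A| -> 2 < #|B| -> valid g ([:: a1; b1], [:: c1]) -> triangle_conn a1 b1 c1 ->
  valid g ([:: a2; b2], [:: c2]) -> sep g ([:: a1; b1], [:: c1]) ([:: a2; b2], [:: c2]) -> triangle_conn a2 b2 c2 -> g b1 b2 ->
  real_triangle a1 b1 /\ real_triangle a2 b2.
Proof.
move=> cA cB v1 T1 v2 s T2 g12; have s' := sep_sym sh sg s; have g21 : g b2 b1 by rewrite gs.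
have R a b : real_triangle a b \/ (forall y, y \in K a b -> g a y -> ~~ g b y).
  case: (pickP (fun y => [&& y \in K a b, g a y & g b y])) => [y /and3P[]|no]; first by left; exists y.
  by right=> y yK ay; apply/negP=> by_; have := no y; rewrite yK ay by_.
case: (two_virtual sg cg ex clh mA mB dj cA cB v1 T1 v2 s T2) => r.
  by split=> //; case: (R a2 b2) => // vt; case: (virtual_no cA cB v2 T2 v1 s' T1 g21 vt r).
by split=> //; case: (R a1 b1) => // vt; case: (virtual_no cA cB v1 T1 v2 s T2 g12 vt r).
Qed.

Lemma TT_swap a b c : triangle_conn a b c -> TTflip b a c.
Proof. by move=> [aA bB gab [h1 h2 h3 h4]]; split=> //; [rewrite gs|rewrite edge_cliqueC]. Qed.

Lemma TT_exact a b c : triangle_conn a b c -> real_triangle a b -> (forall z, z \in K a b -> [\/ z = a, z = b | z = c]) -> g a c /\ g b c.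
Proof.
move=> [aA bB gab _] [y [yK ay by_]] E; case: (E y yK) => e; rewrite e in ay by_ => //.
  by rewrite gi in ay.
by rewrite gi in by_.
Qed.

Lemma TT_out a b c w : triangle_conn a b c -> w \notin A -> w \notin B -> w \notin K a b -> [/\ far g w a, ~~ h w a, far g w b & ~~ h w b].
Proof.
move=> [aA bB gab _] wA wB wK; have mK := mcK sg cg ex clh (gh gab).
have neA : A <> K a b by move=> e; have := bK h a b; rewrite -e => bA; have := dj bA; rewrite bB.
have neB : B <> K a b by move=> e; have := aK h a b; rewrite -e => aB; have := dj aA; rewrite aB.
have na : ~~ h w a.
  apply/negP; rewrite hs => aw; case: (mc_nb2 sh ch clh mA mK neA aA (aK h a b) aw); [exact/negP|exact/negP].
have nb_ : ~~ h w b.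
  apply/negP; rewrite hs => bw; case: (mc_nb2 sh ch clh mB mK neB bB (bK h a b) bw); [exact/negP|exact/negP].
split=> //; apply: HF => //; [apply: contraNneq wA => -> //|apply: contraNneq wB => -> //].
Qed.

(** Otherwise the triangle [a2 b2 c2] with the path [b2 b1 c1 w] is a [Z_3]. *)
Lemma w_both a1 b1 c1 a2 b2 c2 w : triangle_conn a1 b1 c1 -> triangle_conn a2 b2 c2 -> a1 != a2 -> b1 != b2 -> g b1 b2 -> g b1 c1 -> g a2 c2 /\ g b2 c2 ->
  w \notin A -> w \notin B -> w \notin K a1 b1 -> w \notin K a2 b2 -> far g c1 c2 -> g c1 w -> h w c2.
Proof.
move=> T1 T2 a12 b12 g12 bc1 [ac2 bc2] wA wB wK1 wK2 fcc cw.
have [A1 B1 gab1 [cK1 ca1 cb1 K1]] := T1; have [A2 B2 gab2 [cK2 ca2 cb2 K2]] := T2.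
have [f1 _ f2 _] := TT_out T1 wA wB wK1; have [f3 _ f4 _] := TT_out T2 wA wB wK2.
have a21 : a2 != a1 by rewrite eq_sym. have b21 : b2 != b1 by rewrite eq_sym.
apply/negPn/negP=> n; have wc : w != c2 by apply: contraNneq wK2 => ->.
have f5 : far g w c2 by exact: HF.
have ba1 : b1 != a1 by rewrite eq_sym gn.
have p1 : far g c1 b2 by apply: (K1B A1 B1 gab1).
have p2 : far g b1 a2 by apply: (K1A A1 B1 gab1); rewrite ?bK.
have p3 : far g c1 a2 by apply: (K1A A1 B1 gab1).
have p4 : far g c2 b1 by apply: (K1B A2 B2 gab2).
have gba2 : g b2 a2 by rewrite gs. have g21 : g b2 b1 by rewrite gs.
apply: (Z3_absurd Phi gba2 bc2 ac2 g21 bc1 cw); ff.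
Qed.

Lemma exit (P : seq V) v p r : biconnected g [set: V] -> v \notin P -> p \in P -> r != v -> r != p ->
  exists w q, [/\ w \notin P, w != r, q \in P & g w q].
Proof.
move=> [_ bX] vP pP rv rp; have := bX r v p; rewrite !inE !(eq_sym _ r) rv rp => /(_ isT isT) /connectP[s].
elim: s v vP rv => [|y s IH] v vP rv /=; first by move=> _ e; rewrite e in pP; rewrite pP in vP.
case/andP=> /and3P[_ yr vy] ps lp; case: (boolP (y \in P)) => yP; first by exists v, y; split=> //; rewrite eq_sym.
by apply: (IH y yP _ ps lp); rewrite eq_sym; case/setD1P: yr.
Qed.

Hypotheses (n10 : 10 <= #|V|) (bg : biconnected g [set: V]) (nham : ~ ham_on h [set: V]).

(** Ten vertices are assumed, and three connectors of three vertices each account for nine. *)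
Lemma outside (P : seq V) : size P <= 9 -> exists v, v \notin P.
Proof.
move=> s9; have [|v _ vP] := @pick_out V [set: V] P; last by exists v.
by rewrite cardsT; apply: leq_ltn_trans s9 n10.
Qed.

Lemma st_TT_notK a1 b1 c1 a2 b2 c2 : valid g ([:: a1; b1], [:: c1]) -> valid g ([:: a2; b2], [:: c2]) ->
  sep g ([:: a1; b1], [:: c1]) ([:: a2; b2], [:: c2]) ->
  [/\ c2 \notin K a1 b1, b2 \notin K a1 b1, c1 \notin K a2 b2 & b1 \notin K a2 b2] /\ (a2 \notin K a1 b1 /\ a1 \notin K a2 b2).
Proof.
move=> v1 v2 s; have s' := sep_sym sh sg s.
have H1 z := vs_notK sg cg ex clh mA dj v1 v2 s (z := z); have H2 z := vs_notK sg cg ex clh mA dj v2 v1 s' (z := z).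
by split; split; first [apply: H1|apply: H2]; rewrite !inE eqxx ?orbT.
Qed.

(** All cliques reduce to the nine connector vertices, of which only [c1], [c2], [c3] can have
    neighbours outside. By [w_both] such a neighbour is adjacent to all three in [h], and so the
    centre of a claw. *)
Lemma TTT_no a1 b1 c1 a2 b2 c2 a3 b3 c3 : three_conns g ([:: a1; b1], [:: c1]) ([:: a2; b2], [:: c2]) ([:: a3; b3], [:: c3]) ->
  triangle_conn a1 b1 c1 -> triangle_conn a2 b2 c2 -> triangle_conn a3 b3 c3 -> False.
Proof.
move=> S T1 T2 T3; have [cA cB] := A_B_gt2 mA S; have [[v1 v2 v3] [s12 s13 s23] [b12 b13 b23]] := S.
have g12 : g b1 b2 := b12 a1. have g13 : g b1 b3 := b13 a1. have g23 : g b2 b3 := b23 a1.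
have [r1 r2] := real_two cA cB v1 T1 v2 s12 T2 g12; have [_ r3] := real_two cA cB v1 T1 v3 s13 T3 g13.
have [na12 _ _] := s12 a1 a1 a2 (mem_head _ _) (mem_head _ _).
have [na13 _ _] := s13 a1 a1 a3 (mem_head _ _) (mem_head _ _).
have [na23 _ _] := s23 a1 a2 a3 (mem_head _ _) (mem_head _ _).
have [nb12 _ _] := s12 a1 b1 b2 (vs2 _ _ _) (vs2 _ _ _).
have [nb13 _ _] := s13 a1 b1 b3 (vs2 _ _ _) (vs2 _ _ _).
have [nb23 _ _] := s23 a1 b2 b3 (vs2 _ _ _) (vs2 _ _ _).
have [A1 B1 gab1 [cK1 ca1 cb1 K1]] := T1; have [A2 B2 gab2 [cK2 ca2 cb2 K2]] := T2; have [A3' B3 gab3 [cK3 ca3 cb3 K3]] := T3.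
have [k12 [k12a k12b]] := st_TT_notK v1 v2 s12.
have [k1 k2 k3 k4] := k12.
have [k13 [k13a k13b]] := st_TT_notK v1 v3 s13; have [k23 [k23a k23b]] := st_TT_notK v2 v3 s23.
have b3K := bK h a3 b3; have a3K := aK h a3 b3.
have ba3 : b3 != a3 by rewrite eq_sym gn. have ab3 : a3 != b3 := gn gab3.
have XA e : e \in A -> e \notin [:: a3] -> ~~ h e b3.
  by rewrite inE => eA ea; have [_] := KA sg cg ex clh mA dj A3' B3 (gh gab3) b3K ba3 eA ea; rewrite hs.
have XB e : e \in B -> e \notin [:: b3] -> ~~ h e a3.
  by rewrite inE => eA ea; have [_] := KB sg cg ex clh mA mB dj A3' B3 (gh gab3) a3K ab3 eA ea; rewrite hs.
have one x : forall y y', y \in [:: x] -> y' \in [:: x] -> y != y' -> g y y'.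
  by move=> y y'; rewrite !inE => /eqP-> /eqP->; rewrite eqxx.
have nin x y : x != y -> x \notin [:: y] by rewrite inE.
have [exA GA] := half sg cg ex clh Phi mA mB dj T1 T2 A3' B3 (And3 na12 na13 na23) (And3 nb12 nb13 nb23) (And3 g12 g13 g23)
  k12 (isT : size [:: a3] <= 2) (one a3) XA (nin _ _ na13) (nin _ _ na23).
have k12' : [/\ c2 \notin K b1 a1, a2 \notin K b1 a1, c1 \notin K b2 a2 & a1 \notin K b2 a2] by rewrite !(edge_cliqueC h b1) !(edge_cliqueC h b2).
have [exB _] := half sg cg ex clh Phi mB mA dj' (TT_swap T1) (TT_swap T2) B3 A3' (And3 nb12 nb13 nb23) (And3 na12 na13 na23) GA
  k12' (isT : size [:: b3] <= 2) (one b3) XB (nin _ _ nb13) (nin _ _ nb23).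
have [ga12 ga13 ga23] := GA.
have nab x y z x' y' z' : triangle_conn x y z -> triangle_conn x' y' z' -> x' != x -> ~~ h x' y.
  move=> [xA yB gxy _] [xA' _ _ _] nx; have yx : y != x by rewrite eq_sym gn.
  by have [_] := KA sg cg ex clh mA dj xA yB (gh gxy) (bK h x y) yx xA' nx; rewrite hs.
have na21 : a2 != a1 by rewrite eq_sym. have na31 : a3 != a1 by rewrite eq_sym. have na32 : a3 != a2 by rewrite eq_sym.
have nb21 : b2 != b1 by rewrite eq_sym. have nb31 : b3 != b1 by rewrite eq_sym. have nb32 : b3 != b2 by rewrite eq_sym.
have g21 : g b2 b1 by rewrite gs. have g31 : g b3 b1 by rewrite gs. have g32 : g b3 b2 by rewrite gs.
have ga21 : g a2 a1 by rewrite gs. have ga31 : g a3 a1 by rewrite gs. have ga32 : g a3 a2 by rewrite gs.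
have s21 := sep_sym sh sg s12; have s31 := sep_sym sh sg s13.
have E1 : forall z, z \in K a1 b1 -> [\/ z = a1, z = b1 | z = c1].
  have [y [yK ay by_]] := r2; have yn := KK_not sg cg ex clh mA dj v1 T1 v2 s12 T2 yK.
  exact: (K_exact sg cg ex clh Phi mA mB dj T1 T2 A3' B3 (And3 na12 na13 na23) (And3 nb12 nb13 nb23) (And3 g12 g13 g23)
    (And3 ga12 ga13 ga23) (nab _ _ _ _ _ _ T3 T1 na13) (nab _ _ _ _ _ _ T3 T2 na23) yK ay by_ yn).
have E2 : forall z, z \in K a2 b2 -> [\/ z = a2, z = b2 | z = c2].
  have [y [yK ay by_]] := r1; have yn := KK_not sg cg ex clh mA dj v2 T2 v1 s21 T1 yK.
  exact: (K_exact sg cg ex clh Phi mA mB dj T2 T1 A3' B3 (And3 na21 na23 na13) (And3 nb21 nb23 nb13) (And3 g21 g23 g13)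
    (And3 ga21 ga23 ga13) (nab _ _ _ _ _ _ T3 T2 na23) (nab _ _ _ _ _ _ T3 T1 na13) yK ay by_ yn).
have E3 : forall z, z \in K a3 b3 -> [\/ z = a3, z = b3 | z = c3].
  have [y [yK ay by_]] := r1; have yn := KK_not sg cg ex clh mA dj v3 T3 v1 s31 T1 yK.
  exact: (K_exact sg cg ex clh Phi mA mB dj T3 T1 A2 B2 (And3 na31 na32 na12) (And3 nb31 nb32 nb12) (And3 g31 g32 g12)
    (And3 ga31 ga32 ga12) (nab _ _ _ _ _ _ T2 T3 na32) (nab _ _ _ _ _ _ T2 T1 na12) yK ay by_ yn).
pose P := [:: a1; b1; c1; a2; b2; c2; a3; b3; c3].
have sA z : z \in A -> z \in P by move/exA=> [] ->; rewrite !inE eqxx ?orbT.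
have sB z : z \in B -> z \in P by move/exB=> [] ->; rewrite !inE eqxx ?orbT.
have sK1 z : z \in K a1 b1 -> z \in P by move/E1=> [] ->; rewrite !inE eqxx ?orbT.
have sK2 z : z \in K a2 b2 -> z \in P by move/E2=> [] ->; rewrite !inE eqxx ?orbT.
have sK3 z : z \in K a3 b3 -> z \in P by move/E3=> [] ->; rewrite !inE eqxx ?orbT.
have no z (X : {set V}) : (forall t, t \in X -> t \in P) -> z \notin P -> z \notin X by move=> sX; apply: contra; exact: sX.
have [v vP] := outside (isT : size P <= 9).
have ra : b1 != a1 by rewrite eq_sym gn.
have rv : b1 != v by apply: contraNneq vP => <-; exact: sB.
have [w [q [wP _ qP wq]]] := exit bg vP (sA a1 A1) rv ra.
have [wA wB wK1 wK2 wK3] : [/\ w \notin A, w \notin B, w \notin K a1 b1, w \notin K a2 b2 & w \notin K a3 b3].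
  by split; apply: no => //.
have [ac1 bc1] := TT_exact T1 r1 E1; have [ac2 bc2] := TT_exact T2 r2 E2; have [ac3 bc3] := TT_exact T3 r3 E3.
have cc x y z x' y' z' : valid g ([:: x; y], [:: z]) -> triangle_conn x y z -> valid g ([:: x'; y'], [:: z']) -> triangle_conn x' y' z' ->
    sep g ([:: x; y], [:: z]) ([:: x'; y'], [:: z']) -> [/\ far g z z', z != z' & ~~ h z z'].
  move=> v0 T v0' T' s0; have [zk zA zB _] := TT_c v0 T; have [zk' _ _ _] := TT_c v0' T'.
  have [n1 n2] := hc s0 zk zk' (or_introl zA) (or_introl zB); split=> //; exact: HF.
have [f12 n12 h12] := cc _ _ _ _ _ _ v1 T1 v2 T2 s12; have [f13 n13 h13] := cc _ _ _ _ _ _ v1 T1 v3 T3 s13.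
have [f23 n23 h23] := cc _ _ _ _ _ _ v2 T2 v3 T3 s23.
have f21 := farC sg f12; have f31 := farC sg f13; have f32 := farC sg f23.
have fin : h w c1 -> h w c2 -> h w c3 -> False.
  by move=> w1 w2 w3; have := closed_clawfree sh ch clh w1 w2 w3 n12 n13 n23; rewrite (negbTE h12) (negbTE h13) (negbTE h23).
have nq x y z : triangle_conn x y z -> w \notin K x y -> q = x \/ q = y -> False.
  move=> T wK; have [_ o1 _ o2] := TT_out T wA wB wK; case=> e; rewrite e in wq; move: o1 o2; rewrite (gh wq) //.
have := qP; rewrite !inE => /orP[/eqP e|]; first by apply: (nq _ _ _ T1 wK1); left.
case/orP=> [/eqP e|]; first by apply: (nq _ _ _ T1 wK1); right.
case/orP=> [/eqP e|].
  rewrite e in wq; have cw : g c1 w by rewrite gs.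
  apply: fin; first exact: gh.
    exact: (w_both T1 T2 na12 nb12 g12 bc1 (conj ac2 bc2) wA wB wK1 wK2 f12 cw).
  exact: (w_both T1 T3 na13 nb13 g13 bc1 (conj ac3 bc3) wA wB wK1 wK3 f13 cw).
case/orP=> [/eqP e|]; first by apply: (nq _ _ _ T2 wK2); left.
case/orP=> [/eqP e|]; first by apply: (nq _ _ _ T2 wK2); right.
case/orP=> [/eqP e|].
  rewrite e in wq; have cw : g c2 w by rewrite gs.
  apply: fin; [|exact: gh|].
    exact: (w_both T2 T1 na21 nb21 g21 bc2 (conj ac1 bc1) wA wB wK2 wK1 f21 cw).
  exact: (w_both T2 T3 na23 nb23 g23 bc2 (conj ac3 bc3) wA wB wK2 wK3 f23 cw).
case/orP=> [/eqP e|]; first by apply: (nq _ _ _ T3 wK3); left.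
case/orP=> [/eqP e|/eqP e]; first by apply: (nq _ _ _ T3 wK3); right.
rewrite e in wq; have cw : g c3 w by rewrite gs.
apply: fin; [| |exact: gh].
  exact: (w_both T3 T1 na31 nb31 g31 bc3 (conj ac1 bc1) wA wB wK3 wK1 f31 cw).
exact: (w_both T3 T2 na32 nb32 g32 bc3 (conj ac2 bc2) wA wB wK3 wK2 f32 cw).
Qed.

(** The nine vertices can be left only at [c1] and [c2], and by [w_both] an outer neighbour is
    adjacent to both in [h]. Two such neighbours would be adjacent by the claw at [c1] and then
    force [c1] and [c2] to be adjacent; so there is one, the graph has ten vertices, and [H] is a
    Hamilton cycle. *)
Lemma TTP_no a1 b1 c1 a2 b2 c2 a3 m3 b3 : three_conns g ([:: a1; b1], [:: c1]) ([:: a2; b2], [:: c2]) ([:: a3; m3; b3], [::]) ->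
  triangle_conn a1 b1 c1 -> triangle_conn a2 b2 c2 -> path3_conn a3 m3 b3 -> False.
Proof.
move=> S T1 T2 P3; have [cA cB] := A_B_gt2 mA S; have [[v1 v2 v3] [s12 s13 s23] [b12 b13 b23]] := S.
have s21 := sep_sym sh sg s12; have s31 := sep_sym sh sg s13; have s32 := sep_sym sh sg s23.
have g12 : g b1 b2 := b12 a1. have g13 : g b1 b3 := b13 a1. have g23 : g b2 b3 := b23 a1.
have [r1 r2] := real_two cA cB v1 T1 v2 s12 T2 g12.
set l1 := ([:: a1; b1], [:: c1]) in S v1 s12 s13 b12 b13 s21 s31.
set l2 := ([:: a2; b2], [:: c2]) in S v2 s12 s23 b12 b23 s21 s32.
set l3 := ([:: a3; m3; b3], [::]) in S v3 s13 s23 b13 b23 s31 s32.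
have [ka1 kb1 kc1] : [/\ a1 \in conn_vertices l1, b1 \in conn_vertices l1 & c1 \in conn_vertices l1] by rewrite !inE !eqxx !orbT.
have [ka2 kb2 kc2] : [/\ a2 \in conn_vertices l2, b2 \in conn_vertices l2 & c2 \in conn_vertices l2] by rewrite !inE !eqxx !orbT.
have [ka3 km3 kb3] : [/\ a3 \in conn_vertices l3, m3 \in conn_vertices l3 & b3 \in conn_vertices l3] by rewrite !inE !eqxx !orbT.
have [na12 _ _] := s12 a1 a1 a2 ka1 ka2; have [na13 _ _] := s13 a1 a1 a3 ka1 ka3; have [na23 _ _] := s23 a1 a2 a3 ka2 ka3.
have [nb12 _ _] := s12 a1 b1 b2 kb1 kb2; have [nb13 _ _] := s13 a1 b1 b3 kb1 kb3; have [nb23 _ _] := s23 a1 b2 b3 kb2 kb3.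
have [A1 B1 gab1 [cK1 ca1 cb1 K1]] := T1; have [A2 B2 gab2 [cK2 ca2 cb2 K2]] := T2.
have [A3' B3 [gam gmb] nab [mnA mb HB]] := P3.
have [k12 _] := st_TT_notK v1 v2 s12.
have [k12a k12b] : a2 \notin K a1 b1 /\ a1 \notin K a2 b2 by have [_] := st_TT_notK v1 v2 s12.
have b31 := bb_sym sg b13.
have N3 := A_nb3 v3 P3 v1 s31 b31.
have [_ _ HA] := mA; have [_ _ HB'] := mB; have [_ cA' _] := mA.
have XA e : e \in A -> e \notin [:: a3] -> ~~ h e b3.
  by rewrite inE => eA ea; apply: contra ea; rewrite hs => /(N3 e eA) ->.
have [cnA1 cnB1] : c1 \notin A /\ c1 \notin B by have [] := TT_c v1 T1.
have [cnA2 cnB2] : c2 \notin A /\ c2 \notin B by have [] := TT_c v2 T2.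
have XB e : e \in B -> e \notin [:: b3; m3] -> ~~ h e a3.
  rewrite !inE negb_or => eB /andP[e3 em]; rewrite hs; apply/negP=> ae.
  have [a1m na1m] : a1 != m3 /\ ~~ h a1 m3 by apply: (hc s13 ka1 km3); [right|left; exact: dj].
  have ea1 : e != a1 by rewrite eq_sym dn.
  have nea1 : ~~ h e a1.
    by apply/negP=> h1; case/eqP: na13; apply: (HA e) => //; [exact: dj'|rewrite hs].
  have ha31 : h a3 a1 by apply: cA'; rewrite // eq_sym.
  have := closed_clawfree sh ch clh ae ha31 (gh gam) ea1 em a1m; rewrite (negbTE nea1) (negbTE na1m) orbF /= => hem.
  case: (boolP (m3 \in B)) => mB'.
    by case/eqP: em; apply: (HB' a3) => //; [exact: dj|exact: gh].
  by case/eqP: e3; apply: (HB' m3) => //; [rewrite hs|exact: gh].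
have one x : forall y y', y \in [:: x] -> y' \in [:: x] -> y != y' -> g y y'.
  by move=> y y'; rewrite !inE => /eqP-> /eqP->; rewrite eqxx.
have two x x' : g x x' -> forall y y', y \in [:: x; x'] -> y' \in [:: x; x'] -> y != y' -> g y y'.
  by move=> gx y y'; rewrite !inE => /orP[]/eqP-> /orP[]/eqP->; rewrite ?eqxx // gs.
have nin x y : x != y -> x \notin [:: y] by rewrite inE.
have [exA GA] := half sg cg ex clh Phi mA mB dj T1 T2 A3' B3 (And3 na12 na13 na23) (And3 nb12 nb13 nb23) (And3 g12 g13 g23)
  k12 (isT : size [:: a3] <= 2) (one a3) XA (nin _ _ na13) (nin _ _ na23).
have k12' : [/\ c2 \notin K b1 a1, a2 \notin K b1 a1, c1 \notin K b2 a2 & a1 \notin K b2 a2].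
  by rewrite !(edge_cliqueC h b1) !(edge_cliqueC h b2); case: k12 => *; split.
have [b1m _ _] := s13 a1 b1 m3 kb1 km3; have [b2m _ _] := s23 a1 b2 m3 kb2 km3.
have b1X : b1 \notin [:: b3; m3] by rewrite !inE negb_or nb13.
have b2X : b2 \notin [:: b3; m3] by rewrite !inE negb_or nb23.
have gbm : g b3 m3 by rewrite gs.
have [exB _] := half sg cg ex clh Phi mB mA dj' (TT_swap T1) (TT_swap T2) B3 A3' (And3 nb12 nb13 nb23) (And3 na12 na13 na23) GA
  k12' (isT : size [:: b3; m3] <= 2) (two _ _ gbm) XB b1X b2X.
have mnB : m3 \notin B by apply/negP=> /exB[] e; rewrite e eqxx in b1m b2m mb.
have [ga12 ga13 ga23] := GA.
have na21 : a2 != a1 by rewrite eq_sym. have nb21 : b2 != b1 by rewrite eq_sym.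
have g21 : g b2 b1 by rewrite gs. have ga21 : g a2 a1 by rewrite gs.
have nab13 : ~~ h a1 b3 by apply: XA => //; exact: nin. have nab23 : ~~ h a2 b3 by apply: XA => //; exact: nin.
have E1 : forall z, z \in K a1 b1 -> [\/ z = a1, z = b1 | z = c1].
  have [y [yK ay by_]] := r2; have yn := KK_not sg cg ex clh mA dj v1 T1 v2 s12 T2 yK.
  exact: (K_exact sg cg ex clh Phi mA mB dj T1 T2 A3' B3 (And3 na12 na13 na23) (And3 nb12 nb13 nb23) (And3 g12 g13 g23)
    (And3 ga12 ga13 ga23) nab13 nab23 yK ay by_ yn).
have E2 : forall z, z \in K a2 b2 -> [\/ z = a2, z = b2 | z = c2].
  have [y [yK ay by_]] := r1; have yn := KK_not sg cg ex clh mA dj v2 T2 v1 s21 T1 yK.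
  exact: (K_exact sg cg ex clh Phi mA mB dj T2 T1 A3' B3 (And3 na21 na23 na13) (And3 nb21 nb23 nb13) (And3 g21 g23 g13)
    (And3 ga21 ga23 ga13) nab23 nab13 yK ay by_ yn).
have [ac1 bc1] := TT_exact T1 r1 E1; have [ac2 bc2] := TT_exact T2 r2 E2.
have M l x : sep g l3 l -> x \in conn_vertices l -> [/\ far g m3 x, ~~ h m3 x & m3 != x].
  by move=> s xl; have [n1 n2] := hc s km3 xl (or_introl mnA) (or_introl mnB); split=> //; exact: HF.
have [ma1 ha1 na1] := M _ _ s31 ka1; have [mb1 hb1 _] := M _ _ s31 kb1; have [mc1 hc1 nc1] := M _ _ s31 kc1.
have [ma2 ha2 na2] := M _ _ s32 ka2; have [mb2 hb2 nb2'] := M _ _ s32 kb2; have [mc2 hc2 nc2] := M _ _ s32 kc2.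
have nQ u : m3 != u -> ~~ h m3 u -> (u \notin K a3 m3) /\ (u \notin K b3 m3).
  move=> n1 n2; split; apply/negP=> uQ.
    by have [_ cQ _] := mcK sg cg ex clh (gh gam); case/negP: n2; apply: cQ => //; exact: bK.
  by have [_ cQ _] := mcK sg cg ex clh (gh gbm); case/negP: n2; apply: cQ => //; exact: bK.
have hab1 := gh gab1; have hab2 := gh gab2.
have mK2 := mcK sg cg ex clh hab2.
have neA2 : A <> K a2 b2 by move=> e; have := bK h a2 b2; rewrite -e => bA; have := dj bA; rewrite B2.
have neB2 : B <> K a2 b2 by move=> e; have := aK h a2 b2; rewrite -e => aB; have := dj A2; rewrite aB.
have X2 z : h b2 z -> z \in B \/ z \notin K a3 m3.
  move=> bz; case: (mc_nb2 sh ch clh mB mK2 neB2 B2 (bK h a2 b2) bz) => [|/E2[]->]; [by left| | |]; right.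
  - by have [] := nQ a2 na2 ha2.
  - by have [] := nQ b2 nb2' hb2.
  by have [] := nQ c2 nc2 hc2.
have Y2 z : h a2 z -> z \in A \/ z \notin K b3 m3.
  move=> bz; case: (mc_nb2 sh ch clh mA mK2 neA2 A2 (aK h a2 b2) bz) => [|/E2[]->]; [by left| | |]; right.
  - by have [] := nQ a2 na2 ha2.
  - by have [] := nQ b2 nb2' hb2.
  by have [] := nQ c2 nc2 hc2.
have [Na3 Q1] := P3_exact sg cg ex clh Phi mA mB dj A1 A2 A3' B1 B2 gab1 gab2 (And3 na12 na13 na23) (And3 nb12 nb13 nb23) g12
  (And3 ga12 ga13 ga23) exA exB E1 cK1 ca1 ac1 bc1 X2 gam nab mnA (And5 ma1 ma2 mb1 mb2 mc1) ha1 na1 hb1 hb2.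
have E1' : forall z, z \in K b1 a1 -> [\/ z = b1, z = a1 | z = c1].
  by move=> z; rewrite edge_cliqueC => /E1[]; [constructor 2|constructor 1|constructor 3].
have cK1' : c1 \in K b1 a1 by rewrite edge_cliqueC.
have gba1 : g b1 a1 by rewrite gs. have gba2 : g b2 a2 by rewrite gs.
have nba : nadj g b3 a3 by exact: nadjC.
have m3b1 : m3 != b1 by rewrite eq_sym.
have [Nb3 Q2] := P3_exact sg cg ex clh Phi mB mA dj' B1 B2 B3 A1 A2 gba1 gba2 (And3 nb12 nb13 nb23) (And3 na12 na13 na23) ga12
  (And3 g12 g13 g23) exB exA E1' cK1' cb1 bc1 ac1 Y2 gbm nba mnB (And5 mb1 mb2 ma1 ma2 mc1) hb1 m3b1 ha1 ha2.
have am : a3 != m3 := gn gam. have ab3 : a3 != b3 := dn A3' B3.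
have Nm3 z : h m3 z -> z = a3 \/ z = b3.
  move=> mz; have neQ : K a3 m3 <> K b3 m3.
    move=> e; have := aK h a3 m3; rewrite e => /Q2[] e'; [by rewrite e' eqxx in ab3|by rewrite e' eqxx in am].
  case: (mc_nb2 sh ch clh (mcK sg cg ex clh (gh gam)) (mcK sg cg ex clh (gh gbm)) neQ (bK h a3 m3) (bK h b3 m3) mz).
    by move/Q1=> [|e]; [left|rewrite e hi in mz].
  by move/Q2=> [|e]; [right|rewrite e hi in mz].
pose P := [:: a1; b1; c1; a2; b2; c2; a3; m3; b3].
have sA z : z \in A -> z \in P by move/exA=> [] ->; rewrite !inE eqxx ?orbT.
have sB z : z \in B -> z \in P by move/exB=> [] ->; rewrite !inE eqxx ?orbT.
have sK1 z : z \in K a1 b1 -> z \in P by move/E1=> [] ->; rewrite !inE eqxx ?orbT.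
have sK2 z : z \in K a2 b2 -> z \in P by move/E2=> [] ->; rewrite !inE eqxx ?orbT.
have no z (X : {set V}) : (forall t, t \in X -> t \in P) -> z \notin P -> z \notin X by move=> sX; apply: contra; exact: sX.
have fcc : [/\ far g c1 c2, c1 != c2 & ~~ h c1 c2].
  by have [n1 n2] := hc s12 kc1 kc2 (or_introl cnA1) (or_introl cnB1); split=> //; exact: HF.
have [f12 n12 h12] := fcc; have f21 := farC sg f12.
have att w q : w \notin P -> q \in P -> g w q -> h w c1 /\ h w c2.
  move=> wP qP wq; have wA : w \notin A by exact: no. have wB : w \notin B by exact: no.
  have wK1 : w \notin K a1 b1 by exact: no. have wK2 : w \notin K a2 b2 by exact: no.
  have nq x y z : triangle_conn x y z -> w \notin K x y -> q = x \/ q = y -> False.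
    move=> T wK; have [_ o1 _ o2] := TT_out T wA wB wK; case=> e; rewrite e in wq; move: o1 o2; rewrite (gh wq) //.
  have qw : h q w by rewrite hs; exact: gh.
  have nP x : x \in P -> w = x -> False by move=> xP e; rewrite e xP in wP.
  have := qP; rewrite !inE => /orP[/eqP e|]; first by case: (nq _ _ _ T1 wK1); left.
  case/orP=> [/eqP e|]; first by case: (nq _ _ _ T1 wK1); right.
  case/orP=> [/eqP e|].
    rewrite e in wq; split; first exact: gh.
    have cw : g c1 w by rewrite gs.
    exact: (w_both T1 T2 na12 nb12 g12 bc1 (conj ac2 bc2) wA wB wK1 wK2 f12 cw).
  case/orP=> [/eqP e|]; first by case: (nq _ _ _ T2 wK2); left.
  case/orP=> [/eqP e|]; first by case: (nq _ _ _ T2 wK2); right.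
  case/orP=> [/eqP e|].
    rewrite e in wq; split; last exact: gh.
    have cw : g c2 w by rewrite gs.
    exact: (w_both T2 T1 na21 nb21 g21 bc2 (conj ac1 bc1) wA wB wK2 wK1 f21 cw).
  move=> p; exfalso; move: p => /or3P[]/eqP e; rewrite e in qw.
  - by case: (Na3 w qw); apply: nP; rewrite !inE eqxx ?orbT.
  - by case: (Nm3 w qw); apply: nP; rewrite !inE eqxx ?orbT.
  by case: (Nb3 w qw); apply: nP; rewrite !inE eqxx ?orbT.
have [v vP] := outside (isT : size P <= 9).
have ra : b1 != a1 by rewrite eq_sym gn.
have rv : b1 != v by apply: contraNneq vP => <-; exact: sB.
have [w [q [wP _ qP wq]]] := exit bg vP (sA a1 A1) rv ra.
have [wc1 wc2] := att w q wP qP wq.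
have all z : z \in P \/ z = w.
  case: (boolP (z \in P)) => zP; [by left|right; apply/eqP/negPn/negP=> zw].
  have wz : w != z by rewrite eq_sym. have wa1 : w != a1 by apply: contraNneq wP => ->; exact: sA.
  have [w' [q' [wP' ww' qP' wq']]] := exit bg zP (sA a1 A1) wz wa1.
  have [wc1' wc2'] := att w' q' wP' qP' wq'.
  have c1w : h c1 w by rewrite hs. have c1w' : h c1 w' by rewrite hs.
  have hca : h c1 a1 by rewrite hs; exact: gh.
  have nK u : u \notin P -> [/\ a1 != u & ~~ h a1 u].
    move=> uP; have uA : u \notin A by exact: no. have uB : u \notin B by exact: no. have uK : u \notin K a1 b1 by exact: no.
    have [_ o _ _] := TT_out T1 uA uB uK; split; [by apply: contraNneq uA => <-|by rewrite hs].
  have [o1 o2] := nK w wP; have [o3 o4] := nK w' wP'.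
  have w'w : w != w' by rewrite eq_sym.
  have := closed_clawfree sh ch clh hca c1w c1w' o1 o3 w'w; rewrite (negbTE o2) (negbTE o4) /= => hww.
  by have := closed_diamondfree sh ch clh wc1 hww wc2 c1w' wc2' n12; rewrite (negbTE h12).
apply: nham; pose H := [:: a3; m3; b3; b1; a1; c1; w; c2; b2; a2].
have sH z : z \in H.
  by case: (all z) => [|->]; rewrite /H !inE ?eqxx ?orbT //; do !(case: (z == _); rewrite ?orbT //).
exists H; split=> //; last by move=> z; rewrite sH inE.
rewrite /ucycle; apply/andP; split; last first.
  (* [H] has ten entries and contains all of at least ten vertices, so none is repeated. *)
  apply: (@leq_size_uniq _ (enum V)); [exact: enum_uniq|by move=> z _; exact: sH|by rewrite -cardE].
have h1 := gh gam; have h2 := gh gmb; have h3 : h b3 b1 by rewrite hs; exact: gh.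
have h4 : h b1 a1 by exact: gh. have h5 := gh ac1. have h6 : h c1 w by rewrite hs.
have h7 : h c2 b2 by rewrite hs; exact: gh. have h8 : h b2 a2 by exact: gh. have h9 := gh ga23.
by rewrite /= h1 h2 h3 h4 h5 h6 wc2 h7 h8 h9.
Qed.

Lemma Z3_no_conns k1 k2 k3 : three_conns g k1 k2 k3 -> False.
Proof.
have L l1 l2 l3 : three_conns g l1 l2 l3 -> size l1.1 <= 3 by move=> S; case: leqP => // /(long_no S).
move=> S; have S2 := st_perm12 sh sg S; have S3 := st_perm12 sh sg (st_perm23 sh sg S).
have c1 := L _ _ _ S; have c2 := L _ _ _ S2; have c3 := L _ _ _ S3.
have sz l : valid g l -> size l.1 <= 3 -> size l.1 = 2 \/ size l.1 = 3.
  by move=> [_ h1 _ _ _] h2; move: h1 h2; clear; lia.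
have [[v1 v2 v3] _ _] := S.
have main l1 l2 l3 : three_conns g l1 l2 l3 -> size l1.1 = 2 -> size l2.1 = 2 -> size l3.1 <= 3 -> False.
  move=> S' e1 e2 e3; have [[w1 w2 w3] _ _] := S'.
  have [a1 [b1 [d1 [q1 T1]]]] := val_TT sg ex w1 e1; have [a2 [b2 [d2 [q2 T2]]]] := val_TT sg ex w2 e2.
  case: (sz l3 w3 e3) => e3'.
    have [a3 [b3 [d3 [q3 T3]]]] := val_TT sg ex w3 e3'.
    by rewrite q1 q2 q3 in S'; exact: (TTT_no S' T1 T2 T3).
  have [a3 [m3 [b3 [q3 T3]]]] := val_3 w3 e3'.
  by rewrite q1 q2 q3 in S'; exact: (TTP_no S' T1 T2 T3).
case: (sz k1 v1 c1) => e1; case: (sz k2 v2 c2) => e2.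
- exact: main S e1 e2 c3.
- case: (sz k3 v3 c3) => e3; first exact: main (st_perm23 sh sg S) e1 e3 c2.
  exact: two_paths (st_perm12 sh sg (st_perm23 sh sg (st_perm12 sh sg S))) e3 e2 c1.
- case: (sz k3 v3 c3) => e3; first exact: main (st_perm23 sh sg S2) e2 e3 c1.
  exact: two_paths (st_perm23 sh sg S) e1 e3 c2.
exact: two_paths S e1 e2 c3.
Qed.

End Z3.

(** * Induced copies of S *)

Section Glue.
Variables (V : finType) (g : rel V).
Hypotheses (sg : simple_rel g) (cg : claw_heavy g) (bg : biconnected g [set: V]).

(** The common frame of the three patterns. When [orient] selects [A], the connectors are reversed,
    so that the selected clique always plays the part of [B]. *)
Lemma ham_or_st :
  (forall h (A B : {set V}) k1 k2 k3, completes_to g h -> closed h -> closed_clique h A -> closed_clique h B -> (forall w, w \in A -> w \notin B) ->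
    one_heavy h B -> ~ ham_on h [set: V] -> three_conns h A B g k1 k2 k3 -> False) -> ham_on g [set: V].
Proof.
move=> H; apply: ham_on_NNE => nham.
have [h ex clh] := closure_ex sg.
have sh := completes_to_simple ex sg; have ch := completes_to_claw_heavy ex sg cg.
have nh : ~ ham_on h [set: V] by move=> /(completes_to_ham ex sg cg).
case: (closed_ham_or_good sh ch clh (bic_sub (completes_to_sub ex) bg)) => // -[A [B [k1 [k2 [k3 [mA mB dj0 v s0]]]]]].
have dj w : w \in A -> w \notin B by apply: dj0; rewrite inE.
have s : [/\ conn_sep h k1 k2, conn_sep h k1 k3 & conn_sep h k2 k3] by case: s0.
have dj' w : w \in B -> w \notin A by apply: contraL; exact: dj.
case: (orient sh ch clh mA mB dj) => -[cB fB].
  have := st_init sh mA mB dj v s.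
  by case/(carry sh ch clh mA mB dj cB ex sg cg)=> [l1 [l2 [l3]]]; exact: H nh.
have [v1 v2 v3] := v; have [s1 s2 s3] := s.
have v' := And3 (cvalid_rev sh v1) (cvalid_rev sh v2) (cvalid_rev sh v3).
have s' := And3 (csep_rev sh s1) (csep_rev sh s2) (csep_rev sh s3).
have := st_init sh mB mA dj' v' s'.
by case/(carry sh ch clh mB mA dj' cB ex sg cg)=> [l1 [l2 [l3]]]; exact: H nh.
Qed.

Lemma net_ham : net_condition g -> ham_on g [set: V].
Proof.
move=> Phi; apply: ham_or_st => h A B k1 k2 k3 ex clh mA mB dj fB nh.
exact: (net_no_conns sg cg ex clh mA mB dj fB).
Qed.

Lemma wounded_ham : wounded_condition g -> ham_on g [set: V].
Proof.
move=> Phi; apply: ham_or_st => h A B k1 k2 k3 ex clh mA mB dj fB nh.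
exact: (wounded_no_conns sg cg ex clh mA mB dj fB).
Qed.

Lemma Z3_ham : 10 <= #|V| -> Z3_condition g -> ham_on g [set: V].
Proof.
move=> n10 Phi; apply: ham_or_st => h A B k1 k2 k3 ex clh mA mB dj fB nh.
exact: (Z3_no_conns sg cg ex clh Phi mA mB dj fB n10 bg nh).
Qed.

End Glue.

Section Sgraph.
Variable G : sgraph.

Lemma sgraph_sgr : simple_rel (@edge G).
Proof. by split; [exact: edge_sym|exact: edge_irrefl]. Qed.

Lemma kconnected_bic : kconnected G 2 -> biconnected (@edge G) [set: G].
Proof.
case=> cG con; split; first by rewrite cardsT.
move=> r u v; rewrite !inE !andbT => ur vr.
have := con [set r]; rewrite cards1 => /(_ isT u v); rewrite !inE ur vr => /(_ isT isT).
by apply: connect_sub => a b /=; rewrite !inE -andbA => /and3P[h1 h2 h3]; apply: connect1; rewrite /inX /= !inE h1 h2.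
Qed.

End Sgraph.

(** Concrete graphs are handled through a numbering and a decidable relation on [nat], which turns
    statements about them into computations. *)
Definition code (S : sgraph) (s : seq nat) (E : rel nat) := exists phi : S -> nat,
  [/\ injective phi, forall x, phi x \in s, forall i, i \in s -> exists x, phi x = i &
      forall x y, edge x y = E (phi x) (phi y)].

Definition lrel (l : seq (nat * nat)) : rel nat := fun i j =>
  has (fun p => eqn p.1 i && eqn p.2 j || eqn p.1 j && eqn p.2 i) l.

Lemma lrel_sym l : symmetric (lrel l).
Proof. by move=> i j; apply: eq_has => p; rewrite orbC. Qed.

(** Closure of the first entry of [s] under adjacency inside [s]; [size s] rounds reach every vertex
    connected to it. *)
Definition reach (E : rel nat) (s : seq nat) :=
  iter (size s) (fun t => [seq x <- s | (x \in t) || has (E x) t]) (take 1 s).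

Lemma reach_ind (E : rel nat) s (P : nat -> Prop) : P (head 0 s) ->
  (forall x y, x \in s -> y \in s -> P y -> E x y -> P x) -> forall x, x \in reach E s -> P x.
Proof.
move=> P0 IH; rewrite /reach.
suff H n : forall x, x \in iter n (fun t => [seq x <- s | (x \in t) || has (E x) t]) (take 1 s) -> x \in s /\ P x by move=> x /H[].
elim: n => [|n IHn] x /=.
  by case: s P0 {IH} => // a s P0; rewrite take_cons take0 inE => /eqP->; rewrite mem_head.
rewrite mem_filter => /andP[/orP[/IHn//|/hasP[y /IHn[ys Py] xy]] xs].
by split=> //; exact: IH xy.
Qed.

Section CHeavy.
Variables (S G : sgraph) (n : nat) (E : rel nat).

(* C is a maximal clique of the graph on 0, ..., n-1 and D a component of its complement. *)
Definition isolates (C D : seq nat) := [&&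
  all (fun i => (i < n) && all (fun j => (i == j) || E i j) C) C,
  all (fun i => (i \in C) || has (fun j => ~~ E i j) C) (iota 0 n),
  all (fun i => [&& i < n, i \notin C, i \in reach E D & all (fun j => E i j ==> ((j \in C) || (j \in D))) (iota 0 n)]) D,
  uniq D & 1 < size D].

(** With [fits], says that [v] lists an induced copy of the coded graph, entry [i] being vertex [i];
    it unfolds to a conjunction over all pairs. *)
Fixpoint fit1 (x : G) i j (v : seq G) : Prop :=
  if v is y :: v' then (if E i j then is_true (edge x y) else nadj edge x y) /\ fit1 x i j.+1 v' else True.
Fixpoint fits i (v : seq G) : Prop :=
  if v is x :: v' then fit1 x i i.+1 v' /\ fits i.+1 v' else True.

Lemma fitsP i v x0 : fits i v -> forall a b, a < b -> b < size v ->
  nth x0 v a != nth x0 v b /\ edge (nth x0 v a) (nth x0 v b) = E (i + a) (i + b).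
Proof.
elim: v i => // x v IH i [f1 f2] [|a] [|b] //= lt lt'; last first.
  by have [-> ->] := IH _ f2 a b lt lt'; rewrite !addSnnS.
rewrite addn0 addnS -addSn; clear IH f2 lt; move: i.+1 lt' f1 => j.
elim: v j b => // y v IH j [|b] lt /= [e f1]; last by rewrite addnS -addSn; exact: IH.
rewrite addn0; case: (E i j) e => [e|[n1 n2]]; last by rewrite (negbTE n2).
by rewrite e; split=> //; apply: contraTneq e => ->; rewrite edge_irrefl.
Qed.

Hypotheses (Es : symmetric E) (Ei : irreflexive E).

Lemma fits_eq v x0 : fits 0 v -> forall i j, i < size v -> j < size v ->
  edge (nth x0 v i) (nth x0 v j) = E i j /\ (nth x0 v i == nth x0 v j) = (i == j).
Proof.
move=> ft i j li lj; case: (ltngtP i j) => [lt|lt|->].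
- by have [n1 e] := fitsP x0 ft lt lj; rewrite e (negbTE n1).
- by have [n1 e] := fitsP x0 ft lt li; rewrite edge_sym e eq_sym (negbTE n1) Es.
by rewrite edge_irrefl Ei eqxx.
Qed.

Lemma fits_iso v : code S (iota 0 n) E -> size v = n -> fits 0 v -> isomorphic (induced [set z in v]) S.
Proof.
move=> [phi [pI pin psur pE]] sz ft.
have pn x : phi x < n by have := pin x; rewrite mem_iota.
have [x0 _|S0] := pickP (mem v); last first.
  have v0 : v = [::] by case: (v) S0 => // a s /(_ a); rewrite /= mem_head.
  have n0 : n = 0 by rewrite -sz v0.
  have nv (z : induced [set z in v]) : False by case: z => z; rewrite v0 inE.
  have ns (x : S) : False by have := pn x; rewrite n0.
  by exists (fun z => False_rect _ (nv z)); split=> [|z]; [exists (fun x => False_rect _ (ns x)) => z; [case: (nv z)|case: (ns z)]|case: (nv z)].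
pose f := nth x0 v; rewrite -sz in pn; have ff := fits_eq x0 ft.
have gA (x : S) : f (phi x) \in [set z in v] by rewrite inE mem_nth.
pose q (x : S) : induced [set z in v] := Sub (f (phi x)) (gA x).
have qI : injective q.
  move=> x y /(congr1 sval) /= /eqP; have [_ ->] := ff _ _ (pn x) (pn y).
  by move/eqP; exact: pI.
have qS z : exists x, q x = z.
  case: z => z zA; have := zA; rewrite inE => /(nthP x0)[i li e].
  have [|x ex] := psur i; first by rewrite mem_iota /= add0n -sz.
  by exists x; apply/val_inj; rewrite /= -e -ex.
have [r qr rq] : bijective q.
  apply: inj_card_bij => //; rewrite -(card_codom qI); apply: subset_leq_card.
  by apply/subsetP=> z _; have [x <-] := qS z; exact: codom_f.
exists r; split; first by exists q.
move=> a b; rewrite -[a in RHS]rq -[b in RHS]rq pE.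
by have [e _] := ff _ _ (pn (r a)) (pn (r b)); rewrite -e.
Qed.

(** Along the copy [v] the lists [C] and [D] become a maximal clique and a component, so c-heaviness
    is applied by evaluating [isolates]. *)
Lemma c_heavy_fits C D v x0 : code S (iota 0 n) E -> c_heavy S G -> isolates C D -> size v = n -> fits 0 v ->
  exists2 i, i \in D & heavy (nth x0 v i).
Proof.
move=> cS cH /and5P[/allP h1 /allP h2 /allP h3 uD sD] sz ft.
pose f i := nth x0 v i.
have ff i j : i < n -> j < n -> edge (f i) (f j) = E i j /\ (f i == f j) = (i == j).
  by rewrite -sz; exact: fits_eq.
pose A := [set z in v].
have fA i : i < n -> f i \in A by rewrite -sz inE => li; exact: mem_nth.
have AP z : z \in A -> exists2 i, i < n & z = f i.
  by rewrite inE => /(nthP x0)[i]; rewrite sz => li <-; exists i.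
have isoA : isomorphic (induced A) S by exact: fits_iso.
have lC i : i \in C -> i < n by move/h1=> /andP[].
have lD i : i \in D -> i < n by move/h3=> /and4P[].
pose C' := [set z in [seq f i | i <- C]]; pose D' := [set z in [seq f i | i <- D]].
have inC i : i < n -> (f i \in C') = (i \in C).
  move=> li; rewrite inE; apply/mapP/idP => [[j jC /eqP e]|iC]; last by exists i.
  by have [_ e'] := ff _ _ li (lC _ jC); rewrite e' in e; rewrite (eqP e).
have inD i : i < n -> (f i \in D') = (i \in D).
  move=> li; rewrite inE; apply/mapP/idP => [[j jD /eqP e]|iD]; last by exists i.
  by have [_ e'] := ff _ _ li (lD _ jD); rewrite e' in e; rewrite (eqP e).
have CA : C' \subset A by apply/subsetP=> z; rewrite inE => /mapP[i /lC iC ->]; exact: fA.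
have DA : D' \subset A by apply/subsetP=> z; rewrite inE => /mapP[i /lD iC ->]; exact: fA.
have cC : clique C'.
  apply/forall_inP=> y; rewrite inE => /mapP[i iC ->]; apply/forall_inP=> z; rewrite inE => /mapP[j jC ->].
  have [-> ->] := ff _ _ (lC _ iC) (lC _ jC); have /andP[_ /allP/(_ j jC)] := h1 i iC.
  by case: eqP => //=.
have mC : maximal_clique_of A C'.
  apply/maxsetP; split; first by rewrite CA.
  move=> X /andP[XA cX] sub; apply/eqP; rewrite eqEsubset sub andbT; apply/subsetP=> z zX.
  have [i li e] := AP z (subsetP XA z zX); rewrite e inC //.
  case: (boolP (i \in C)) => // iC; have : i \in iota 0 n by rewrite mem_iota.
  case/h2/orP=> [/(negP iC)//|] /hasP[j jC /negP[]]; have lj := lC j jC; have [e1 e2] := ff _ _ li lj.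
  rewrite -e1 -e; have /forall_inP/(_ z zX)/forall_inP/(_ (f j)) := cX.
  rewrite (subsetP sub) ?inC // => /(_ isT)/implyP; apply; rewrite e e2.
  by apply: contraNneq iC => ->.
have nDC i : i \in D -> i \notin C by move/h3=> /and4P[].
have D0 : head 0 D \in D by case: (D) sD => // a l _; exact: mem_head.
have ADP z : z \in A :\: C' -> exists i, [/\ i < n, i \notin C & z = f i].
  by rewrite in_setD => /andP[nz /AP[i li e]]; exists i; rewrite -inC // -e.
have ADI i : i < n -> i \notin C -> f i \in A :\: C' by move=> li iC; rewrite in_setD inC // iC fA.
have DD : D' \in components (A :\: C').
  apply/imsetP; exists (f (head 0 D)); first by apply: ADI; [exact: lD|exact: nDC].
  apply/setP=> z; rewrite [RHS]inE; apply/idP/andP.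
    rewrite inE => /mapP[i iD ->]; split; first by apply: ADI; [exact: lD|exact: nDC].
    have /and4P[_ _ ir _] := h3 i iD; apply: (reach_ind (P := fun i => connect_in _ _ (f i)) _ _ ir); first exact: connect0.
    move=> x y xD yD c xy; apply: connect_trans c _; apply: connect1 => /=.
    rewrite !ADI ?nDC ?lD //=; have [-> _] := ff _ _ (lD _ yD) (lD _ xD); by rewrite Es.
  case=> zA c; suff cl : fingraph.closed [rel u v in A :\: C' | edge u v] D'.
    by have /= <- := closed_connect cl c; rewrite inD ?lD.
  have step a b : a < n -> b < n -> b \notin C -> E a b -> a \in D -> b \in D.
    move=> la lb bC ab aD; have /and4P[_ _ _ /allP/(_ b)] := h3 a aD.
    by rewrite mem_iota ab (negbTE bC) => /(_ lb).
  move=> a b /andP[/andP[/ADP[i [li iC ->]] /ADP[j [lj jC ->]]]]; have [-> _] := ff _ _ li lj => ij.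
  by rewrite !inD //; apply/idP/idP; apply: step => //; rewrite Es.
have c1 : 1 < #|D'|.
  have uf : uniq [seq f i | i <- D].
    rewrite map_inj_in_uniq // => i j iD jD /eqP.
    by have [_ ->] := ff _ _ (lD _ iD) (lD _ jD) => /eqP.
  by rewrite cardsE (card_uniqP uf) size_map.
have [z zD hz] := cH A isoA C' mC D' DD c1.
by move: zD hz; rewrite inE => /mapP[i iD ->] hz; exists i.
Qed.
End CHeavy.

Lemma code_eqE S s (E E' : rel nat) : code S s E -> all (fun i => all (fun j => E i j == E' i j) s) s -> code S s E'.
Proof.
move=> [phi [pI pin ps pE]] /allP h; exists phi; split=> // x y.
by rewrite pE; have /allP/(_ _ (pin y))/eqP := h _ (pin x).
Qed.

Lemma code_path n : code (path_graph n) (iota 0 n) consecutive.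
Proof.
exists (@nat_of_ord n); split=> //; first exact: val_inj.
- by move=> x; rewrite mem_iota /=.
- by move=> i; rewrite mem_iota /= => li; exists (Ordinal li).
Qed.

(* The vertices of [gen_net i j k] are numbered along the three paths, one after the other. *)
Definition net_off i j t := nth 0 [:: 0; i.+1; i + j + 2] t.
Definition net_tag i j a := if a <= i then 0 else if a <= i + j + 1 then 1 else 2.
Definition net_rel i j : rel nat := fun a b =>
  if net_tag i j a == net_tag i j b then consecutive a b
  else (a == net_off i j (net_tag i j a)) && (b == net_off i j (net_tag i j b)).

Lemma code_net i j k : code (gen_net i j k) (iota 0 (i + j + k + 3)) (net_rel i j).
Proof.
pose phi (x : gen_net i j k) := net_off i j (tag x) + tagged x.
have pt x : net_tag i j (phi x) = tag x /\ phi x < i + j + k + 3.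
  rewrite /phi /net_tag; case: x => [[[|[|[|//]]] lt] [a]] /=; rewrite /net_length (tnth_nth 0) /= => la; move: la; clear.
  - by rewrite /net_off /= add0n ltnS => la; rewrite la; lia.
  - rewrite /net_off /= ltnS => la; have -> : (i.+1 + a <= i) = false by lia.
    have -> : i.+1 + a <= i + j + 1 by lia.
    by lia.
  rewrite /net_off /= ltnS => la; have -> : (i + j + 2 + a <= i) = false by lia.
  have -> : (i + j + 2 + a <= i + j + 1) = false by lia.
  by lia.
exists phi; split.
- move=> x y e; have: tag x = tag y.
    by apply: val_inj => /=; have [<- _] := pt x; have [<- _] := pt y; rewrite e.
  case: x y e => [t a] [u b] e /= tu; subst u; congr (existT _ _ _); apply: val_inj.
  exact: (@addnI (net_off i j t)).
- by move=> x; rewrite mem_iota; have [_ ->] := pt x.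
- move=> a; rewrite mem_iota /= add0n => la.
  have mk t b (lt : t < 3) (lb : b < (net_length i j k (Ordinal lt)).+1) : phi (existT _ (Ordinal lt) (Ordinal lb)) = net_off i j t + b by [].
  have L t (lt : t < 3) : net_length i j k (Ordinal lt) = nth 0 [:: i; j; k] t by rewrite /net_length (tnth_nth 0).
  case: (leqP a i) => l1; [|case: (leqP a (i + j + 1)) => l2].
  + have lb : a < (net_length i j k (Ordinal (isT : 0 < 3))).+1 by rewrite L.
    by eexists; apply: etrans (mk _ _ _ lb) _.
  + have lb : a - i.+1 < (net_length i j k (Ordinal (isT : 1 < 3))).+1 by rewrite L /=; move: l1 l2; clear; lia.
    eexists; apply: etrans (mk _ _ _ lb) _; rewrite /net_off /=; move: l1; clear; lia.
  have lb : a - (i + j + 2) < (net_length i j k (Ordinal (isT : 2 < 3))).+1 by rewrite L /=; move: la l1 l2; clear; lia.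
  eexists; apply: etrans (mk _ _ _ lb) _; rewrite /net_off /=; move: l2; clear; lia.
move=> x y; rewrite /net_rel; have [-> _] := pt x; have [-> _] := pt y.
rewrite /= /net_edge -val_eqE; case: eqP => [e|_].
  by rewrite /phi /consecutive e -!addnS !eqn_add2l.
have E p q : (p + q == p) = (q == 0) by rewrite -{2}[p]addn0 eqn_add2l.
by rewrite /phi !E.
Qed.

Lemma code_iso S T s E : isomorphic S T -> code T s E -> code S s E.
Proof.
move=> [f [[g fK gK] fE]] [phi [pI pin ps pE]]; exists (phi \o f); split=> //=.
- exact: inj_comp pI (can_inj fK).
- move=> i /ps[x <-]; exists (g x); by rewrite gK.
by move=> x y; rewrite -pE fE.
Qed.

Definition path_edges k := [seq (i, i.+1) | i <- iota 0 k.-1].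
Definition Z1_edges := [:: (0,1); (0,2); (0,3); (2,3)].
Definition Z2_edges := [:: (0,1); (1,2); (0,3); (0,4); (3,4)].
Definition Z3_edges := [:: (0,1); (1,2); (2,3); (0,4); (0,5); (4,5)].
Definition bull_edges := [:: (0,1); (2,3); (0,2); (0,4); (2,4)].
Definition net_edges := [:: (0,1); (2,3); (4,5); (0,2); (0,4); (2,4)].
Definition wounded_edges := [:: (0,1); (2,3); (3,4); (0,2); (0,5); (2,5)].

Ltac net_code := apply: (code_eqE (code_net _ _ _)); vm_compute; reflexivity.
Lemma code_P4 : code (path_graph 4) (iota 0 4) (lrel (path_edges 4)).
Proof. by apply: (code_eqE (code_path _)). Qed.
Lemma code_P5 : code (path_graph 5) (iota 0 5) (lrel (path_edges 5)).
Proof. by apply: (code_eqE (code_path _)). Qed.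
Lemma code_P6 : code (path_graph 6) (iota 0 6) (lrel (path_edges 6)).
Proof. by apply: (code_eqE (code_path _)). Qed.
Lemma code_Z1 : code (Z_graph 1) (iota 0 4) (lrel Z1_edges). Proof. net_code. Qed.
Lemma code_Z2 : code (Z_graph 2) (iota 0 5) (lrel Z2_edges). Proof. net_code. Qed.
Lemma code_Z3 : code (Z_graph 3) (iota 0 6) (lrel Z3_edges). Proof. net_code. Qed.
Lemma code_B : code bull (iota 0 5) (lrel bull_edges). Proof. net_code. Qed.
Lemma code_N : code net (iota 0 6) (lrel net_edges). Proof. net_code. Qed.
Lemma code_W : code wounded (iota 0 6) (lrel wounded_edges). Proof. net_code. Qed.

Definition simple_list (l : seq (nat * nat)) := all (fun p => p.1 != p.2) l.
Lemma lrel_irr l : simple_list l -> irreflexive (lrel l).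
Proof.
move=> /allP h i; apply/negbTE/hasPn=> p /h; apply: contra => /orP[] /andP[/eqnP-> /eqnP->] //.
Qed.

(** * What c-heaviness yields for each of the nine graphs *)

Section Phi.
Variables (S G : sgraph).
Hypothesis cH : c_heavy S G.
Notation g := (@edge G).

Let gs : symmetric g := @edge_sym G.
Let nC u v : nadj g u v -> nadj g v u.
Proof. by case=> n1 n2; split; rewrite 1?eq_sym // gs. Qed.

Lemma fits_heavy n l C D v x0 : code S (iota 0 n) (lrel l) -> simple_list l -> isolates n (lrel l) C D -> size v = n ->
  fits (lrel l) 0 v -> has (fun i => heavy_in g (nth x0 v i)) D.
Proof.
move=> c sl ic sz ft; have [i iD hi] := c_heavy_fits (lrel_sym l) (lrel_irr sl) x0 c cH ic sz ft.
by apply/hasP; exists i.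
Qed.

Ltac heavies := rewrite /=; repeat match goal with |- context [heavy_in g ?x] => case: (heavy_in g x) end.
Ltac fit := rewrite /=; repeat match goal with |- _ /\ _ => split | |- True => exact: I end; first [assumption | by rewrite gs | apply: nC; assumption].

(** In each of the three paths the clique on the third and fourth vertices isolates the first
    two. *)
Lemma P_heavy : isomorphic S (path_graph 4) \/ isomorphic S (path_graph 5) \/ isomorphic S (path_graph 6) ->
  forall v1 v2 v3 v4 v5 v6, induced_path g [:: v1; v2; v3; v4; v5; v6] -> heavy_in g v1 || heavy_in g v2.
Proof.
move=> iso v1 v2 v3 v4 v5 v6; rewrite /= /link /= !inE !negb_or -!andbA => ip.
have nad u v : u != v -> ~~ g u v -> nadj g u v by [].
repeat (case/andP: ip; let H := fresh in intros H ip).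
have [n13 n14 n15 n16] : [/\ nadj g v1 v3, nadj g v1 v4, nadj g v1 v5 & nadj g v1 v6] by split.
have [n24 n25 n26] : [/\ nadj g v2 v4, nadj g v2 v5 & nadj g v2 v6] by split.
have [n35 n36 n46] : [/\ nadj g v3 v5, nadj g v3 v6 & nadj g v4 v6] by split.
case: iso => [i|[i|i]].
- have F : fits (lrel (path_edges 4)) 0 [:: v1; v2; v3; v4] by fit.
  have := fits_heavy v1 (v := [:: v1; v2; v3; v4]) (C := [:: 2; 3]) (D := [:: 0; 1]) (code_iso i code_P4) isT isT erefl F.
  by heavies.
- have F : fits (lrel (path_edges 5)) 0 [:: v1; v2; v3; v4; v5] by fit.
  have := fits_heavy v1 (v := [:: v1; v2; v3; v4; v5]) (C := [:: 2; 3]) (D := [:: 0; 1]) (code_iso i code_P5) isT isT erefl F.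
  by heavies.
have F : fits (lrel (path_edges 6)) 0 [:: v1; v2; v3; v4; v5; v6] by fit.
  have := fits_heavy v1 (v := [:: v1; v2; v3; v4; v5; v6]) (C := [:: 2; 3]) (D := [:: 0; 1]) (code_iso i code_P6) isT isT erefl F.
  by heavies.
Qed.

(** [Z_1] and [B] arise from the net by dropping pendants other than [p1], so the clique [b1 p1]
    serves all three. *)
Lemma net_heavy : isomorphic S (Z_graph 1) \/ isomorphic S bull \/ isomorphic S net -> net_condition g.
Proof.
move=> iso b1 b2 b3 p1 p2 p3; move=> *.
case: iso => [i|[i|i]].
- have F : fits (lrel Z1_edges) 0 [:: b1; p1; b2; b3] by fit.
  have := fits_heavy b1 (v := [:: b1; p1; b2; b3]) (C := [:: 0; 1]) (D := [:: 2; 3]) (code_iso i code_Z1) isT isT erefl F.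
  by heavies.
- have F : fits (lrel bull_edges) 0 [:: b1; p1; b2; p2; b3] by fit.
  have := fits_heavy b1 (v := [:: b1; p1; b2; p2; b3]) (C := [:: 0; 1]) (D := [:: 2; 3; 4]) (code_iso i code_B) isT isT erefl F.
  by heavies.
have F : fits (lrel net_edges) 0 [:: b1; p1; b2; p2; b3; p3] by fit.
  have := fits_heavy b1 (v := [:: b1; p1; b2; p2; b3; p3]) (C := [:: 0; 1]) (D := [:: 2; 3; 4; 5]) (code_iso i code_N) isT isT erefl F.
  by heavies.
Qed.

(** [Z_2] arises from the wounded by dropping [a]. *)
Lemma wounded_heavy : isomorphic S (Z_graph 2) \/ isomorphic S wounded -> wounded_condition g.
Proof.
move=> iso t1 t2 t3 a b1 b2; move=> *; apply/andP.
case: iso => [i|i]; split.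
- have F : fits (lrel Z2_edges) 0 [:: t2; b1; b2; t1; t3] by fit.
  have := fits_heavy t1 (v := [:: t2; b1; b2; t1; t3]) (C := [:: 0; 1]) (D := [:: 3; 4]) (code_iso i code_Z2) isT isT erefl F.
  by heavies.
- have F : fits (lrel Z2_edges) 0 [:: t2; b1; b2; t1; t3] by fit.
  have := fits_heavy t1 (v := [:: t2; b1; b2; t1; t3]) (C := [:: 0; 3; 4]) (D := [:: 1; 2]) (code_iso i code_Z2) isT isT erefl F.
  by heavies.
- have F : fits (lrel wounded_edges) 0 [:: t1; a; t2; b1; b2; t3] by fit.
  have := fits_heavy t1 (v := [:: t1; a; t2; b1; b2; t3]) (C := [:: 2; 3]) (D := [:: 0; 1; 5]) (code_iso i code_W) isT isT erefl F.
  by heavies.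
have F : fits (lrel wounded_edges) 0 [:: t1; a; t2; b1; b2; t3] by fit.
  have := fits_heavy t1 (v := [:: t1; a; t2; b1; b2; t3]) (C := [:: 0; 2; 5]) (D := [:: 3; 4]) (code_iso i code_W) isT isT erefl F.
  by heavies.
Qed.

Lemma Z3_heavy : isomorphic S (Z_graph 3) -> Z3_condition g.
Proof.
move=> i t1 t2 t3 z1 z2 z3; move=> *; apply/andP; split.
- have F : fits (lrel Z3_edges) 0 [:: t1; z1; z2; z3; t2; t3] by fit.
  have := fits_heavy t1 (v := [:: t1; z1; z2; z3; t2; t3]) (C := [:: 0; 1]) (D := [:: 4; 5]) (code_iso i code_Z3) isT isT erefl F.
  by heavies.
have F : fits (lrel Z3_edges) 0 [:: t1; z1; z2; z3; t2; t3] by fit.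
  have := fits_heavy t1 (v := [:: t1; z1; z2; z3; t2; t3]) (C := [:: 0; 4; 5]) (D := [:: 1; 2; 3]) (code_iso i code_Z3) isT isT erefl F.
  by heavies.
Qed.

End Phi.

Definition claw_edges := [:: (0,1); (0,2); (0,3)].
Lemma code_claw : code claw (iota 0 4) (lrel claw_edges).
Proof.
exists (fun x : claw => match x with inl _ => 0 | inr i => i.+1 end); split.
- by move=> [x|x] [y|y] //= => [_|[/val_inj->]//]; rewrite (ord1 x) (ord1 y).
- by move=> [x|[[|[|[|]]]]].
- move=> [|i]; first by exists (inl ord0).
  by rewrite mem_iota /= add0n ltnS => li; exists (inr (Ordinal li)).
by move=> [x|[[|[|[|//]]]] ?] [y|[[|[|[|//]]]] ?].
Qed.

Lemma claw_o_heavy_coh (G : sgraph) : claw_o_heavy G -> claw_heavy (@edge G).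
Proof.
move=> cl c u v w cu cv cw uv uw vw nuv nuw nvw.
have ft : fits (lrel claw_edges) 0 [:: c; u; v; w] by rewrite /=; do !split.
have [x [y [xA yA]]] := cl _ (fits_iso (lrel_sym _) (@lrel_irr claw_edges isT) code_claw (v := [:: c; u; v; w]) erefl ft).
have gs := @edge_sym G.
rewrite !inE in xA yA; have -> : heavy_pair x y = ore_pair (@edge G) x y by [].
have h0 (z : G) : ore_pair edge z z = false by rewrite /ore_pair eqxx.
have hc z : edge c z -> ore_pair edge c z = false /\ ore_pair edge z c = false.
  by move=> cz; rewrite /ore_pair [edge z c]gs cz /= !andbF.
have [c1 c2] := hc _ cu; have [c3 c4] := hc _ cv; have [c5 c6] := hc _ cw.
have C (a b : G) : ore_pair edge a b = ore_pair edge b a by exact: ore_pairC.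
by case/or4P: xA => /eqP->; case/or4P: yA => /eqP->; rewrite ?h0 ?c1 ?c2 ?c3 ?c4 ?c5 ?c6 // ?(C v u) ?(C w u) ?(C w v) => H; rewrite H ?orbT.
Qed.

Lemma sufficiency (S G : sgraph) :
  (isomorphic S (path_graph 4) \/ isomorphic S (path_graph 5) \/
   isomorphic S (path_graph 6) \/
   isomorphic S (Z_graph 1) \/ isomorphic S (Z_graph 2) \/
   isomorphic S (Z_graph 3) \/
   isomorphic S bull \/ isomorphic S net \/ isomorphic S wounded) ->
   kconnected G 2 -> claw_o_heavy G -> 10 <= #|G| -> c_heavy S G -> hamiltonian G.
Proof.
move=> iso k2 cl n10 cH.
have sg := sgraph_sgr G; have cg := claw_o_heavy_coh cl; have bg := kconnected_bic k2.
have hP H := P6_ham sg cg bg (P_heavy cH H).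
have hN H := net_ham sg cg bg (net_heavy cH H).
have hW H := wounded_ham sg cg bg (wounded_heavy cH H).
have hZ H := Z3_ham sg cg bg n10 (Z3_heavy cH H).
case: iso => [i|[i|[i|[i|[i|[i|[i|[i|i]]]]]]]].
- by apply: hP; left.
- by apply: hP; right; left.
- by apply: hP; right; right.
- by apply: hN; left.
- by apply: hW; left.
- exact: hZ.
- by apply: hN; right; left.
- by apply: hN; right; right.
by apply: hW; right.
Qed.

(** * Common induced subgraphs of three graphs *)

(* [has] with a conditional instead of [||], so that [vm_compute] stops at the first witness. *)
Fixpoint lazy_has (p : nat -> bool) (s : seq nat) :=
  if s is x :: s' then if p x then true else lazy_has p s' else false.
Lemma lazy_hasE p s : lazy_has p s = has p s.
Proof. by elim: s => //= x s ->; case: (p x). Qed.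

Definition fit_pair (E F : rel nat) x y (p : nat * nat) :=
  if eqn x p.1 == eqn y p.2 then E x p.1 == F y p.2 else false.

Fixpoint embeds (E F : rel nat) (t : seq nat) (done : seq (nat * nat)) (s : seq nat) :=
  if s is x :: s' then
    lazy_has (fun y => if all (fit_pair E F x y) done then embeds E F t ((x, y) :: done) s' else false) t
  else true.

Definition fit_all (E F : rel nat) (l : seq (nat * nat)) :=
  forall p q, p \in l -> q \in l -> (p.1 == q.1) = (p.2 == q.2) /\ E p.1 q.1 = F p.2 q.2.

Lemma embeds_sound E F t s : symmetric E -> symmetric F -> irreflexive E -> irreflexive F -> embeds E F t [::] s ->
  exists l, [/\ fit_all E F l, forall p, p \in l -> p.2 \in t & forall i, i \in s -> exists j, (i, j) \in l].
Proof.
move=> Es Fs Ei Fi.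
suff H s2 done : embeds E F t done s2 -> fit_all E F done -> (forall p, p \in done -> p.2 \in t) ->
    exists l, [/\ fit_all E F l, forall p, p \in l -> p.2 \in t, {subset done <= l} & forall i, i \in s2 -> exists j, (i, j) \in l].
  by move=> /H[] // l [h1 h2 _ h4]; exists l.
elim: s2 done => [d0 _ h1 h2|x s2 IH d0]; first by exists d0; split.
rewrite [embeds _ _ _ _ _]/=.
rewrite lazy_hasE => /hasP[y yt]; case: ifP => // /allP ok em fd td.
have [||l [h1 h2 h3 h4]] := IH _ em.
- have F1 p : p \in d0 -> (x == p.1) = (y == p.2) /\ E x p.1 = F y p.2.
    move/ok; rewrite /fit_pair -[eqn x _]/(x == _) -[eqn y _]/(y == _); by case: ifP => // /eqP-> /eqP->.
  move=> p q; rewrite !inE => /orP[/eqP->|pd] /orP[/eqP->|qd] /=.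
  + by rewrite !eqxx Ei Fi.
  + exact: F1.
  + by rewrite eq_sym [RHS in _ = RHS /\ _]eq_sym Es Fs; exact: F1.
  exact: fd.
- by move=> p; rewrite inE => /orP[/eqP->|/td].
exists l; split=> // [p pd|i]; first by apply: h3; rewrite inE pd orbT.
by rewrite inE => /orP[/eqP->|/h4//]; exists y; apply: h3; exact: mem_head.
Qed.

(** The computed set is also checked to be closed under adjacency, so [disconnectedP] relies on this
    check and not on how [reach] computes it. *)
Definition disconnected (E : rel nat) (s : seq nat) := let t := reach E s in
  (all (fun x => all (fun y => E x y ==> (y \in t)) s) t) && ~~ all (mem t) s.

Definition adj (T : seq (seq bool)) i j := nth false (nth [::] T i) j.
Definition table l := [seq [seq lrel l i j | j <- iota 0 10] | i <- iota 0 10].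

Fixpoint fit_list (E F : rel nat) x y (s v : seq nat) :=
  if s is i :: s' then if v is j :: v' then if fit_pair E F x y (i, j) then fit_list E F x y s' v' else false else false
  else true.
Definition extend (E F : rel nat) s x (e : seq (seq nat)) :=
  flatten [seq [seq y :: v | y <- iota 0 10 & fit_list E F x y s v] | v <- e].

(* Backtracking over the subsets s of rest, together with all the embeddings of s
   in F and in F', listed by their values on s. *)
Fixpoint all_common (ok : seq nat -> bool) (E F F' : rel nat) rest s e e' :=
  if e is [::] then true else if e' is [::] then true else
  if rest is x :: rest' then
    if all_common ok E F F' rest' s e e' then
      all_common ok E F F' rest' (x :: s) (extend E F s x e) (extend E F' s x e')
    else false
  else ok s.

Lemma extend_in E F f s x e : [seq f i | i <- s] \in e -> f x < 10 ->
  (forall i, i \in s -> E x i = F (f x) (f i) /\ (x == i) = (f x == f i)) -> [seq f i | i <- x :: s] \in extend E F s x e.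
Proof.
move=> se fx H; apply/flattenP; exists [seq y :: [seq f i | i <- s] | y <- iota 0 10 & fit_list E F x y s [seq f i | i <- s]].
  by apply/mapP; exists [seq f i | i <- s].
apply/mapP; exists (f x) => //; rewrite mem_filter mem_iota fx andbT.
elim: s H {se} => //= i s IH H; have [|h1 h2] := H i; first exact: mem_head.
rewrite /fit_pair /= -[eqn x i]/(x == i) -[eqn _ _]/(f x == f i) h1 h2 !eqxx; apply: IH => j js.
by apply: H; rewrite inE js orbT.
Qed.

(** The branch of the search that takes exactly the entries of [u] keeps the values of [f] and [f']
    in its two lists. Entries are pushed in front, hence [rev u]. *)
Lemma all_commonP ok E F F' f f' rest s e e' u : all_common ok E F F' rest s e e' -> subseq u rest ->
  [seq f i | i <- s] \in e -> [seq f' i | i <- s] \in e' ->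
  (forall i, i \in rev u ++ s -> f i < 10 /\ f' i < 10) ->
  (forall i j, i \in rev u ++ s -> j \in rev u ++ s -> E i j = F (f i) (f j) /\ (i == j) = (f i == f j)) ->
  (forall i j, i \in rev u ++ s -> j \in rev u ++ s -> E i j = F' (f' i) (f' j) /\ (i == j) = (f' i == f' j)) ->
  ok (rev u ++ s).
Proof.
elim: rest s e e' u => [|x rest IH] s [|e0 e] [|e0' e'] // u; first by move=> /= ? /eqP->.
rewrite /all_common -/all_common; case: ifP => // a1 a2; case: u => [|y u] sub se se' H1 H2 H3.
  exact: IH a1 (sub0seq _) se se' H1 H2 H3.
move: sub => /=; case: eqP => [e1|_] sub; last exact: IH a1 sub se se' H1 H2 H3.
subst y; rewrite rev_cons cat_rcons in H1 H2 H3 *.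
have xs : x \in rev u ++ x :: s by rewrite mem_cat mem_head orbT.
have ss i : i \in s -> i \in rev u ++ x :: s by rewrite mem_cat inE => ->; rewrite !orbT.
have [fx fx'] := H1 _ xs.
apply: (IH _ _ _ _ a2 sub _ _ H1 H2 H3); apply: extend_in => // i /ss; by auto.
Qed.

(* Chosen by computer search, with common connected induced subgraphs of order
   at least 3 only P_3, C_3 and the nine graphs. *)
Definition G1 := [:: (0,1);(0,2);(0,4);(0,6);(0,7);(1,3);(1,5);(1,6);(1,7);(2,3);(2,4);(2,8);(3,5);(3,8);(4,5);(4,9);(5,9);(6,7)].
Definition G2 := [:: (0,1);(0,3);(0,6);(0,9);(1,2);(2,5);(2,8);(3,4);(3,6);(3,9);(4,5);(5,8);(6,7);(6,9);(7,8)].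
Definition G3 := [:: (0,1);(0,2);(0,4);(0,6);(1,3);(1,4);(1,9);(2,3);(2,5);(2,6);(3,5);(3,9);(6,7);(7,8);(8,9)].

Definition nine := [:: (4, path_edges 4); (5, path_edges 5); (6, path_edges 6); (4, Z1_edges); (5, Z2_edges); (6, Z3_edges); (5, bull_edges); (6, net_edges); (6, wounded_edges)].

(** Adjacency is tabulated once, because [lrel] scans the edge list at every test. *)
Definition G1_table := Eval vm_compute in table G1.
Definition G2_table := Eval vm_compute in table G2.
Definition G3_table := Eval vm_compute in table G3.

(** Subsets of at most three vertices are accepted here; [order_gt3] deals with them. *)
Definition common_ok (s : seq nat) :=
  if size s <= 3 then true else
  if disconnected (lrel G1) s then true else
  has (fun p => if size s == p.1 then embeds (lrel G1) (lrel p.2) (iota 0 p.1) [::] s else false) nine.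

Lemma common_check : all_common common_ok (adj G1_table) (adj G2_table) (adj G3_table) (iota 0 10) [::] [:: [::]] [:: [::]].
Proof. vm_compute. reflexivity. Qed.

Lemma code_card S s E : code S s E -> uniq s -> #|S| = size s.
Proof.
move=> [phi [pI pin ps _]] us; rewrite cardE -(size_map phi); apply: perm_size; apply: uniq_perm => //.
  by rewrite map_inj_uniq ?enum_uniq.
move=> i; apply/mapP/idP => [[x _ ->]//|/ps[x <-]]; by exists x; rewrite ?mem_enum.
Qed.

Lemma code_embeds_iso S T s t E F : symmetric E -> symmetric F -> irreflexive E -> irreflexive F ->
  code S s E -> code T t F -> uniq s -> uniq t -> size s = size t -> embeds E F t [::] s -> isomorphic S T.
Proof.
move=> Es Fs Ei Fi cS cT us ut three_conns em.
have cST : #|T| <= #|S| by rewrite (code_card cS us) (code_card cT ut) three_conns.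
have [l [fl lt ls]] := embeds_sound Es Fs Ei Fi em.
have [phi [pI pin ps pE]] := cS; have [psi [qI qin qs qE]] := cT.
have /fin_all_exists[f fP] : forall x : S, exists y : T, (phi x, psi y) \in l.
  move=> x; have [j jl] := ls _ (pin x); have /= jt := lt _ jl.
  by have [y ey] := qs j jt; exists y; rewrite ey.
have fE x y : (phi x == phi y) = (psi (f x) == psi (f y)) /\ E (phi x) (phi y) = F (psi (f x)) (psi (f y)).
  exact: fl (fP x) (fP y).
exists f; split; last by move=> x y; rewrite qE pE; have [_ ->] := fE x y.
apply: inj_card_bij => // x y e; apply: pI; apply/eqP; have [-> _] := fE x y; by rewrite e.
Qed.

Lemma disconnectedP S s E : symmetric E -> code S s E -> disconnected E s -> ~ connected [set: S].
Proof.
move=> Es [phi [pI pin ps pE]]; rewrite /disconnected /=.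
have hr : s != [::] -> head 0 s \in reach E s.
  case: s {pin ps} => // a s _; rewrite /reach; elim: (size _) => [|n IH]; first by rewrite take_cons mem_head.
  by rewrite iterS mem_filter IH mem_head.
move: (reach E s) hr => t hr /andP[/allP cl /allPn[j js jt]] con.
have s0 : s != [::] by apply: contraTneq js => ->.
have [x ex] : exists x, phi x = head 0 s by apply: ps; case: (s) s0 => // a l _; exact: mem_head.
have [y ey] := ps j js; have c := con x y (in_setT _) (in_setT _).
have three_conns u v : edge u v -> phi u \in t -> phi v \in t.
  rewrite pE => uv ut; have /allP/(_ (phi v) (pin v)) := cl _ ut; by rewrite uv.
have := closed_connect (a := [pred u | phi u \in t]) _ c; rewrite !inE ex hr // ey => H.
case/negP: jt; apply/esym/H => u v /andP[_ uv]; rewrite !inE.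
apply/idP/idP; apply: three_conns => //; by rewrite edge_sym.
Qed.

Lemma connected_neighbour (S : sgraph) (x : S) : connected [set: S] -> 1 < #|S| -> exists y, edge x y.
Proof.
move=> con; rewrite -cardsT => /card_gt1P[a [b [_ _ ab]]].
have [y xy] : exists y, x != y.
  by have [e|n] := eqVneq x a; [exists b; rewrite e|exists a].
have /connectP[[|z p] /= pp e] := con x y (in_setT _) (in_setT _); first by rewrite e eqxx in xy.
by case/andP: pp => /andP[_ xz] _; exists z.
Qed.

(* No component survives the removal of an edge from a connected graph on three vertices. *)
Lemma c_heavy_order3 (S G : sgraph) : connected [set: S] -> #|S| = 3 -> c_heavy S G.
Proof.
move=> con c3 A [f [[fi fK iK] fE]] C /maxsetP[/andP[CA _] mC] D /imsetP[x0 _ eD] D1; exfalso.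
have cA : #|A| = 3.
  by rewrite -c3 -(bij_eq_card (f := f)) ?card_sig; [apply: eq_card|exists fi].
have sD : D \subset A :\: C by rewrite eD; apply/subsetP=> z; rewrite inE => /andP[].
(* [D] takes two of the three vertices, so at most one is left for [C]; by connectedness that vertex
   has a neighbour, which contradicts maximality. *)
have C1 : #|C| <= 1.
  have := subset_leq_card sD; have := cardsID C A; rewrite (setIidPr CA) cA; move: D1; clear; lia.
have [z zA Cz] : exists2 z, z \in A & C \subset [set z].
  have [C0|[z zC]] := set_0Vmem C.
    have /card_gt0P[z zA] : 0 < #|A| by rewrite cA.
    by exists z; rewrite // C0 sub0set.
  exists z; first exact: (subsetP CA).
  by apply/subsetP=> y yC; rewrite inE; apply/eqP; move/card_le1_eqP: C1; exact.
have [|y xy] := connected_neighbour (f (Sub z zA)) con; first by rewrite c3.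
pose w := val (fi y); have wA : w \in A by exact: valP.
have zw : edge z w by move: xy; rewrite -[y]iK fE.
have := mC [set z; w] _ _; rewrite subUset !sub1set zA wA => E2.
have : #|[set z; w]| = 2 by rewrite cards2; case: eqP zw => // ->; rewrite edge_irrefl.
rewrite E2 => [e| |]; first by rewrite e in C1.
- apply/forall_inP=> a; rewrite !inE => /orP[]/eqP->; apply/forall_inP=> b; rewrite !inE => /orP[]/eqP->; rewrite ?eqxx ?zw ?implybT //.
  by rewrite edge_sym zw implybT.
by apply: subset_trans Cz _; rewrite sub1set !inE eqxx.
Qed.

Lemma connect_in_sym (G : sgraph) (A : {set G}) u v : connect_in A u v = connect_in A v u.
Proof.
by apply: sym_connect_sym => a b /=; rewrite edge_sym; case: (a \in _); case: (b \in _).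
Qed.

(** * Graphs on ten vertices and their decidable properties *)

Section Counterexample.
Variables (l : seq (nat * nat)) (sl : simple_list l).

Let ledge : rel 'I_10 := fun i j => lrel l i j.
Definition lgraph : sgraph := @SGraph _ ledge (fun i j => lrel_sym l i j) (fun i => lrel_irr sl i).

(** The value [r = 10] deletes nothing and covers the connectedness of the whole graph. *)
Definition no_cut_vertex := all (fun r => let s := [seq i <- iota 0 10 | i != r] in all (mem (reach (lrel l) s)) s) (iota 0 11).
Definition claw_free := all (fun c => let s := [seq i <- iota 0 10 | lrel l c i] in
  all (fun u => all (fun v => all (fun w => [|| u == v, u == w, v == w, lrel l u v, lrel l u w | lrel l v w]) s) s) s) (iota 0 10).
(** Depth-first search for [n] further vertices after [x] that avoid [used] and return to vertex
    [0]. *)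
Fixpoint extends_to_cycle n x used :=
  if n is n'.+1 then lazy_has (fun y => if lrel l x y then if y \in used then false else extends_to_cycle n' y (y :: used) else false) (iota 0 10)
  else lrel l x 0.

Lemma lgraph_2con : no_cut_vertex -> kconnected lgraph 2.
Proof.
move=> /allP nc; split; first by rewrite card_ord.
move=> X cX u v; rewrite !inE => uX vX.
have [r [rl sX Xs]] : exists r, [/\ r \in iota 0 11, forall i : lgraph, i \notin X -> val i != r & forall i : lgraph, val i != r -> i \notin X].
  have [X0|[x xX]] := set_0Vmem X.
    by exists 10; split=> // i _; rewrite ?X0 ?inE // ltn_eqF //; exact: ltn_ord.
  have eX : X = [set x].
    apply/eqP; rewrite eq_sym eqEcard sub1set xX cards1 /=; by move: cX; rewrite ltnS.
  exists (val x); split=> [|i|i]; rewrite ?eX ?in_set1 //.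
  by rewrite mem_iota add0n; apply: leq_trans (ltn_ord x) _.
set s := [seq i <- iota 0 10 | i != r].
have ms (i : lgraph) : i \notin X -> val i \in s by move=> iX; rewrite mem_filter mem_iota sX //= ltn_ord.
have key (a b : lgraph) : val b = head 0 s -> a \notin X -> connect_in (~: X) b a.
  move=> eb aX; have /allP/(_ _ (ms a aX)) := nc r rl.
  pose P i := forall a : lgraph, val a = i -> connect_in (~: X) b a.
  move=> ar; apply: (@reach_ind (lrel l) s P _ _ _ ar) => //.
    by move=> c ec; have -> : c = b by [apply: val_inj; rewrite eb]; exact: connect0.
  move=> x y xs ys Py xy c ec; have yl : y < 10 by move: ys; rewrite mem_filter mem_iota => /andP[].
  apply: connect_trans (Py (Ordinal yl) erefl) _; apply: connect1; rewrite /= !inE !Xs /=.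
  - by rewrite /edge /= /ledge /= ec lrel_sym.
  - by rewrite ec; move: xs; rewrite mem_filter => /andP[].
  by move: ys; rewrite mem_filter => /andP[].
have hs : head 0 s \in s by have := ms u uX; case: (s) => // a q _; exact: mem_head.
have hl : head 0 s < 10 by move: hs; rewrite mem_filter mem_iota => /andP[].
apply: (@connect_trans _ _ (Ordinal hl)); last exact: key.
by rewrite -[connect _ _ _]/(connect_in (~: X) u (Ordinal hl)) connect_in_sym; exact: key.
Qed.

Lemma lgraph_claw : claw_free -> claw_o_heavy lgraph.
Proof.
move=> /allP cf A [f [[fi fK iK] fE]]; exfalso.
pose p (x : claw) : nat := val (val (fi x)).
have pE x y : lrel l (p x) (p y) = edge x y by rewrite -[x in RHS]iK -[y in RHS]iK fE.
have pI x y : p x = p y -> x = y by move=> e; apply: (can_inj iK); do 2 apply: val_inj.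
have pl x : p x \in iota 0 10 by rewrite mem_iota ltn_ord.
pose q i : claw := inr i.
have ql i : p (q i) \in [seq j <- iota 0 10 | lrel l (p (inl ord0)) j] by rewrite mem_filter pl pE.
have := cf _ (pl (inl ord0)) => /allP/(_ _ (ql ord0))/allP/(_ _ (ql (inord 1)))/allP/(_ _ (ql (inord 2))).
have n i j : (p (q i) == p (q j)) = (i == j).
  by apply/eqP/eqP=> [/pI[]|->].
by rewrite !n !pE -!val_eqE /= !inordK.
Qed.

Lemma lgraph_nonham : ~~ extends_to_cycle 9 0 [:: 0] -> ~ hamiltonian lgraph.
Proof.
move=> /negP nc [s [sz /andP[cs us] es]]; apply: nc.
have /rot_to[i s' er] : (ord0 : lgraph) \in s by rewrite es inE.
have {us} us : uniq (ord0 :: s') by rewrite -er rot_uniq.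
have pp : path edge (ord0 : lgraph) (rcons s' ord0).
  by have : cycle edge (ord0 :: s' : seq lgraph) by rewrite -er rot_cycle.
have ss : size s' = 9.
  have : size (ord0 :: s') = 10 by rewrite -(card_uniqP us) -[RHS](card_ord 10); apply: eq_card => z; rewrite -er mem_rot es inE.
  by case.
move: us ss pp; rewrite cons_uniq; clear er es sz cs.
suff H n (x : lgraph) (used : seq nat) : size s' = n -> path edge x (rcons s' ord0) -> uniq s' ->
    all (fun y : lgraph => val y \notin used) s' -> extends_to_cycle n (val x) used.
  move=> /andP[n0 us] ss pp; apply: (H 9 (ord0 : lgraph) [:: 0] ss pp us); apply/allP=> y ys; rewrite inE.
  by apply: contra n0 => /eqP e; have <- : y = ord0 by exact: val_inj.
elim: s' n x used => [|y s' IH] [|n] x used //; first by move=> _ /andP[].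
move=> [sn] /andP[xy pp] /andP[ny us] /andP[yu au]; rewrite [extends_to_cycle _ _ _]/extends_to_cycle -/extends_to_cycle lazy_hasE; apply/hasP; exists (val y); first by rewrite mem_iota ltn_ord.
rewrite (negbTE yu) [lrel l _ _]xy; apply: IH => //.
apply/allP=> z zs; rewrite inE negb_or (allP au) // andbT.
by apply: contraNneq ny => /val_inj <-.
Qed.

End Counterexample.

(** An induced copy of [S] is a finite function with a decidable property, so its existence can be
    decided; without a copy c-heaviness holds vacuously. *)
Lemma embeds_of_not_c_heavy (S G : sgraph) : ~ c_heavy S G ->
  exists f : S -> G, injective f /\ forall x y, edge (f x) (f y) = edge x y.
Proof.
move=> nG.
have [/existsP[f /andP[/injectiveP fI /forallP fE]]|/existsPn no] := boolP [exists f : {ffun S -> G},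
    injectiveb f && [forall x, [forall y, edge (f x) (f y) == edge x y]]].
  by exists f; split=> // x y; have /forallP/(_ y)/eqP := fE x.
case: nG => A [f [[fi fK iK] fE]]; exfalso.
have := no [ffun x => val (fi x)]; case/negP; apply/andP; split.
  apply/injectiveP=> x y; rewrite !ffunE => /val_inj; exact: (can_inj iK).
by apply/forallP=> x; apply/forallP=> y; rewrite !ffunE -{2}[x]iK -{2}[y]iK fE.
Qed.

Lemma checks1 : no_cut_vertex G1 && (claw_free G1 && ~~ extends_to_cycle G1 9 0 [:: 0]).
Proof. vm_compute. reflexivity. Qed.
Lemma checks2 : no_cut_vertex G2 && (claw_free G2 && ~~ extends_to_cycle G2 9 0 [:: 0]).
Proof. vm_compute. reflexivity. Qed.
Lemma checks3 : no_cut_vertex G3 && (claw_free G3 && ~~ extends_to_cycle G3 9 0 [:: 0]).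
Proof. vm_compute. reflexivity. Qed.

Lemma tableE l T : T = table l -> forall i j, i < 10 -> j < 10 -> adj T i j = lrel l i j.
Proof.
by move=> -> i j li lj; rewrite /adj /table (nth_map 0) ?size_iota // (nth_map 0) ?size_iota // !nth_iota.
Qed.

(** * Necessity: S embeds into all three graphs *)

Section Necessity.
Variable S : sgraph.
Hypotheses (con : connected [set: S]) (c3 : 3 <= #|S|).
Hypothesis main : forall G : sgraph, kconnected G 2 -> claw_o_heavy G -> 10 <= #|G| -> c_heavy S G -> hamiltonian G.

Lemma not_c_heavy l (sl : simple_list l) : no_cut_vertex l && (claw_free l && ~~ extends_to_cycle l 9 0 [:: 0]) ->
  ~ c_heavy S (lgraph sl).
Proof.
case/andP=> k /andP[cf nh] cH; apply: (lgraph_nonham nh (sl := sl)).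
have c10 : 10 <= #|lgraph sl| by rewrite card_ord.
exact: main (@lgraph_2con l sl k) (@lgraph_claw l sl cf) c10 cH.
Qed.

(** By [c_heavy_order3] a connected [S] on three vertices would make the nonhamiltonian [G1]
    hamiltonian. *)
Lemma order_gt3 : 3 < #|S|.
Proof.
rewrite ltn_neqAle c3 andbT; apply/eqP=> e.
by apply: (@not_c_heavy G1 isT checks1); apply: c_heavy_order3.
Qed.

Lemma embeds_in l (sl : simple_list l) : no_cut_vertex l && (claw_free l && ~~ extends_to_cycle l 9 0 [:: 0]) ->
  exists p : S -> nat, [/\ injective p, forall x, p x < 10 & forall x y, edge x y = lrel l (p x) (p y)].
Proof.
move/(not_c_heavy (sl := sl))/embeds_of_not_c_heavy=> [f [fI fE]].
exists (fun x => val (f x)); split.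
- exact: inj_comp val_inj fI.
- by move=> x; exact: ltn_ord.
by move=> x y; rewrite -fE.
Qed.

Lemma necessity : isomorphic S (path_graph 4) \/ isomorphic S (path_graph 5) \/
   isomorphic S (path_graph 6) \/
   isomorphic S (Z_graph 1) \/ isomorphic S (Z_graph 2) \/
   isomorphic S (Z_graph 3) \/
   isomorphic S bull \/ isomorphic S net \/ isomorphic S wounded.
Proof.
have [p1 [I1 L1 H1]] := embeds_in (isT : simple_list G1) checks1.
have [p2 [I2 L2 H2]] := embeds_in (isT : simple_list G2) checks2.
have [p3 [I3 L3 H3]] := embeds_in (isT : simple_list G3) checks3.
(* The image of [S] in [G1] in increasing order, a subsequence of [iota 0 10] as the search
   enumerates them. *)
pose u := [seq i <- iota 0 10 | i \in codom p1].
have uP i : reflect (exists x, p1 x = i) (i \in u).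
  apply: (iffP idP) => [|[x <-]]; first by rewrite mem_filter => /andP[/codomP[x ->] _]; exists x.
  by rewrite mem_filter codom_f mem_iota L1.
have cu : code S (rev u) (lrel G1).
  exists p1; split=> // [x|i]; first by rewrite mem_rev; apply/uP; exists x.
  by rewrite mem_rev => /uP.
have uur : uniq (rev u) by rewrite rev_uniq filter_uniq ?iota_uniq.
(* The embedding [p] read on the labels of [G1]; the default [0] does not occur for labels in
   [u]. *)
pose f (p : S -> nat) i := if [pick x | p1 x == i] is Some x then p x else 0.
have fE p x : f p (p1 x) = p x.
  by rewrite /f; case: pickP => [y /eqP/I1->//|/(_ x)]; rewrite eqxx.
have t1 := @tableE G1 G1_table erefl; have t2 := @tableE G2 G2_table erefl; have t3 := @tableE G3 G3_table erefl.
have ok : common_ok (rev u).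
  rewrite -[rev u]cats0; apply: (all_commonP (f := f p2) (f' := f p3) common_check); rewrite ?inE ?cats0 //.
  - exact: filter_subseq.
  - by move=> i; rewrite mem_rev => /uP[x <-]; rewrite !fE.
  - move=> i j; rewrite !mem_rev => /uP[x <-] /uP[y <-]; rewrite !fE t1 // t2 // -H1 -H2.
    by rewrite (inj_eq I1) (inj_eq I2).
  move=> i j; rewrite !mem_rev => /uP[x <-] /uP[y <-]; rewrite !fE t1 // t3 // -H1 -H3.
  by rewrite (inj_eq I1) (inj_eq I3).
move: ok; rewrite /common_ok -(code_card cu uur) leqNgt order_gt3 [~~ true]/=.
case: ifP => [/(disconnectedP (lrel_sym _) cu)//|_].
have iso T n l : simple_list l -> code T (iota 0 n) (lrel l) -> #|S| == n -> embeds (lrel G1) (lrel l) (iota 0 n) [::] (rev u) -> isomorphic S T.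
  move=> sl cT /eqP en; apply: (code_embeds_iso _ _ _ _ cu cT) => //; try exact: lrel_sym; try exact: lrel_irr.
    exact: iota_uniq.
  by rewrite size_iota -en (code_card cu uur).
case/hasP=> -[n l]; rewrite !inE /= => D; case: ifP => // en em.
move: D; rewrite !xpair_eqE.
case/orP=> [/andP[/eqP e1 /eqP e2]|]; first by subst; left; exact: iso code_P4 en em.
case/orP=> [/andP[/eqP e1 /eqP e2]|]; first by subst; right; left; exact: iso code_P5 en em.
case/orP=> [/andP[/eqP e1 /eqP e2]|]; first by subst; do 2 right; left; exact: iso code_P6 en em.
case/orP=> [/andP[/eqP e1 /eqP e2]|]; first by subst; do 3 right; left; exact: iso code_Z1 en em.
case/orP=> [/andP[/eqP e1 /eqP e2]|]; first by subst; do 4 right; left; exact: iso code_Z2 en em.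
case/orP=> [/andP[/eqP e1 /eqP e2]|]; first by subst; do 5 right; left; exact: iso code_Z3 en em.
case/orP=> [/andP[/eqP e1 /eqP e2]|]; first by subst; do 6 right; left; exact: iso code_B en em.
case/orP=> [/andP[/eqP e1 /eqP e2]|]; first by subst; do 7 right; left; exact: iso code_N en em.
by case/andP=> /eqP e1 /eqP e2; subst; do 8 right; exact: iso code_W en em.
Qed.

End Necessity.

Theorem theorem6 (S : sgraph) (S_connected : connected [set: S])
    (S_order : 3 <= #|S|) :
  (forall G : sgraph,
     kconnected G 2 -> claw_o_heavy G -> 10 <= #|G| -> c_heavy S G ->
     hamiltonian G)
  <->
  (isomorphic S (path_graph 4) \/ isomorphic S (path_graph 5) \/
   isomorphic S (path_graph 6) \/
   isomorphic S (Z_graph 1) \/ isomorphic S (Z_graph 2) \/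
   isomorphic S (Z_graph 3) \/
   isomorphic S bull \/ isomorphic S net \/ isomorphic S wounded).
Proof.
split; first exact: necessity.
by move=> iso G; exact: sufficiency.
Qed.
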